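(* Let $\bar g$ be a Riemannian metric on $S^2$ of constant curvature $1$ and let $\bar\mu$ be the area form associated to $\bar g$ and a given orientation of $S^2$. For all $s\ge 0$, there exist sequences of Riemannian metrics $(g_n)$ and $1$-forms $(\beta_n)$ on $S^2$ and of positive numbers $(k_n)$ (depending on $s$) with the property that $$g_n\xrightarrow{\,C^\infty\,}\bar g,\qquad \beta_n\xrightarrow{\,C^\infty\,}0,\qquad k_n\longrightarrow 0,$$ and such that the double cover of the level $H_{g_n}^{-1}(k_n)\subset (T^*S^2,\omega_{s\bar\mu+d\beta_n})$ is strictly contactomorphic to $E_{\alpha_n}$, where $(\alpha_n)\subset(0,1)$ is a sequence of irrational numbers converging to $0$. In particular, $\Phi^{g_n,\,s\bar\mu+d\beta_n}$ has exactly two periodic orbits with energy $k_n$.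
   Context: Let $\lambda$ be the canonical $1$-form on $T^*S^2$ and $\pi:T^*S^2\to S^2$ the bundle projection. For a $2$-form $\sigma$ on $S^2$ put $\omega_\sigma:=d\lambda-\pi^*\sigma$, a symplectic form on $T^*S^2$. For a smooth function $H$ on an open subset of $T^*S^2$, the Hamiltonian vector field $X_{H,\sigma}$ is defined by $\imath_{X_{H,\sigma}}\omega_\sigma=-dH$, and $\Phi^{H,\sigma}$ denotes its flow. For a Riemannian metric $g$ on $S^2$, $H_g(q,p):=\frac12|p|_q^2$ is the kinetic energy, where $|\cdot|_q$ is the norm on $T^*_qS^2$ induced by $g$; the flow $\Phi^{g,\sigma}:=\Phi^{H_g,\sigma}$ is called the magnetic flow of $(g,\sigma)$. A periodic orbit has energy $k$ if it lies in $H_g^{-1}(k)$. For $\alpha\in(-1,1)$, $$E_\alpha:=\Big\{(z_1,z_2)\in\mathbb C^2\ \Big|\ (1+\alpha)\tfrac{|z_1|^2}{2}+(1-\alpha)\tfrac{|z_2|^2}{2}=1\Big\}\subset(\mathbb C^2,d\lambda_{\mathbb C^2})$$ is the standard ellipsoid, where $\lambda_{\mathbb C^2}$ is the standard Liouville form on $\mathbb C^2$; $E_\alpha$ carries the contact form $\lambda_{\mathbb C^2}|_{E_\alpha}$. A level of $H_g$ at positive energy is diffeomorphic to $\mathbb{RP}^3$, and its double cover is the connected one (diffeomorphic to $S^3$), endowed with the lift of a contact form on the level that is a primitive of the restriction of the symplectic form. Strictly contactomorphic means that there is a diffeomorphism pulling back one contact form to the other.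
   Formalization: ''Strictly contactomorphic to E_{α_n}'' is proved up to a positive constant factor (depending on n) multiplying the standard contact form on E_{α_n}; without it the contact volumes cannot match, e.g. for s = 0 they tend to 0 on the level but not on the ellipsoid. *)

(* Defs.v *)
From mathcomp Require Import all_boot all_order all_algebra.
From mathcomp Require Import all_classical all_reals all_analysis.

Set Implicit Arguments.
Unset Strict Implicit.
Unset Printing Implicit Defensive.

Import Order.TTheory GRing.Theory Num.Theory.
Import numFieldNormedType.Exports.

Local Open Scope classical_set_scope.
Local Open Scope ring_scope.

(* Conventions.  S^2 is the unit sphere of R^3 = 'rV[R]_3.  A covector at q is
   the restriction to T_q S^2 of v |-> dot p v for a unique p orthogonal to q,
   so that T^*S^2 is the set of pairs (q, p) with |q| = 1 and dot q p = 0.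
   All the manifolds are embedded, and maps and forms on them are functions on
   the ambient space of which only the values on the manifold, and at vectors
   tangent to it, are relevant. *)

Section Calculus.
Context {R : realType}.

Fixpoint iter_derive (V W : normedModType R) (vs : seq V) (f : V -> W) : V -> W :=
  if vs is v :: vs' then iter_derive vs' (fun x => 'D_v f x) else f.

(* For a finite-dimensional V and an open U, this is C^oo on U: each iterated
   directional derivative is differentiable, hence continuous. *)
Definition smooth_on (V W : normedModType R) (U : set V) (f : V -> W) :=
  forall vs x, U x -> differentiable (iter_derive vs f) x.

(* The compact-open C^oo topology *)
Definition cvg_Cinfty (V W : normedModType R) (f : nat -> V -> W) (f0 : V -> W) :=
  forall (K : set V) (vs : seq V) (e : R), compact K -> 0 < e ->
    \forall n \near \oo, forall x, K x -> `|iter_derive vs (f n) x - iter_derive vs f0 x| < e.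

End Calculus.

Section Submanifolds.
Context {R : realType}.
Implicit Types V W : normedModType R.

Definition smooth_in V W (X : set V) (f : V -> W) :=
  forall x, X x -> exists (U : set V) (F : V -> W),
    [/\ open U, U x, smooth_on U F & forall y, U y -> X y -> F y = f y].

Definition diffeo V W (X : set V) (Y : set W) (f : V -> W) :=
  [/\ smooth_in X f, f @` X = Y
    & exists2 h : W -> V, smooth_in Y h & forall x, X x -> h (f x) = x].

Definition curve_at V (X : set V) (x : V) (c : R -> V) (v : V) :=
  [/\ c 0 = x, \forall t \near (0 : R), X (c t) & is_derive (0 : R) 1 c v].

Definition tangent V (X : set V) (x v : V) := exists c, curve_at X x c v.

(* The differential at x of a map f defined on X: it sends the velocity of c to
   the velocity of f \o c. *)
Definition mdiff V W (X : set V) (f : V -> W) (x v : V) : W :=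
  get [set w | exists2 c, curve_at X x c v & is_derive (0 : R) 1 (f \o c) w].

Definition pullback V W (X : set V) (f : V -> W) (eta : W -> W -> R) : V -> V -> R :=
  fun x v => eta (f x) (mdiff X f x v).

(* A is a smooth 1-form on a neighbourhood of x in the ambient space, which
   restricts to the 1-form eta on X. *)
Definition form_extension V (X : set V) (eta : V -> V -> R) (x : V)
    (A : V -> V -> R) :=
  exists U : set V,
    [/\ open U, U x, forall v, smooth_on U (A ^~ v), forall y, scalar (A y)
      & forall y v, U y -> X y -> tangent X y v -> A y v = eta y v].

Definition smooth_form V (X : set V) (eta : V -> V -> R) :=
  forall x, X x -> exists A, form_extension X eta x A.

(* The exterior derivative at x of a 1-form on X, computed on any extension, as
   d commutes with restriction; u and v are tangent to X at x. *)
Definition extd V (X : set V) (eta : V -> V -> R) (x u v : V) : R :=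
  get [set r | exists2 A, form_extension X eta x A
                        & r = 'D_u (A ^~ v) x - 'D_v (A ^~ u) x].

(* The last clause is eta /\ d eta <> 0; X is meant to be 3-dimensional. *)
Definition contact_form V (X : set V) (eta : V -> V -> R) :=
  smooth_form X eta /\
  forall x, X x -> exists u v w,
    [/\ tangent X x u, tangent X x v, tangent X x w
      & eta x u * extd X eta x v w + eta x v * extd X eta x w u
        + eta x w * extd X eta x u v != 0].

Definition primitive_on V (X : set V) (omega : V -> V -> V -> R)
    (eta : V -> V -> R) :=
  forall x u v, X x -> tangent X x u -> tangent X x v ->
    extd X eta x u v = omega x u v.

Definition double_cover V W (M : set V) (Y : set W) (p : V -> W) :=
  [/\ connected M, smooth_in M p, p @` M `<=` Y
    & forall y, Y y -> exists (O : set W) (O1 O2 : set V),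
       [/\ [/\ open O, O y, open O1 & open O2],
           M `&` p @^-1` O = M `&` (O1 `|` O2), M `&` (O1 `&` O2) = set0,
           diffeo (M `&` O1) (Y `&` O) p & diffeo (M `&` O2) (Y `&` O) p]].

Definition strictly_contactomorphic V W (X : set V) (eta : V -> V -> R)
    (Y : set W) (zeta : W -> W -> R) :=
  exists2 f : V -> W, diffeo X Y f &
    forall x v, X x -> tangent X x v -> pullback X f zeta x v = eta x v.

End Submanifolds.

Section Sphere.
Context {R : realType}.
Local Notation E3 := 'rV[R]_3.

(* The norm of the library on matrices is the sup norm, hence this. *)
Definition dot n (u v : 'rV[R]_n) : R := \sum_i u 0 i * v 0 i.

Definition sphere : set E3 := [set q | dot q q = 1].

(* Inverse stereographic projections from the two poles; they form an atlas. *)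
Definition stereo (c : bool) (x : 'rV[R]_2) : E3 :=
  (1 + dot x x)^-1 *:
  \row_i [:: 2 * x 0 0; 2 * x 0 1; (-1) ^+ c * (dot x x - 1)]`_i.

Definition frame (c : bool) (x : 'rV[R]_2) (i : 'I_2) : E3 :=
  'D_(delta_mx 0 i) (stereo c) x.

(* Symmetric 2-tensors and 1-forms on S^2 are given by a matrix, respectively a
   covector, at each q; only their values on T_q S^2 are relevant. *)
Definition bil (G : 'M[R]_3) (u v : E3) : R := (u *m G *m v^T) 0 0.

Definition metric_coord (g : E3 -> 'M[R]_3) (c : bool) (x : 'rV[R]_2) : 'M[R]_2 :=
  \matrix_(i, j) bil (g (stereo c x)) (frame c x i) (frame c x j).

Definition form_coord (b : E3 -> E3) (c : bool) (x : 'rV[R]_2) : 'rV[R]_2 :=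
  \row_i dot (b (stereo c x)) (frame c x i).

Definition riemannian_metric (g : E3 -> 'M[R]_3) :=
  [/\ forall c, smooth_on setT (metric_coord g c),
      forall q u v, sphere q -> tangent sphere q u -> tangent sphere q v ->
        bil (g q) u v = bil (g q) v u
    & forall q v, sphere q -> tangent sphere q v -> v != 0 -> 0 < bil (g q) v v].

Definition one_form (b : E3 -> E3) := forall c, smooth_on setT (form_coord b c).

Definition cvg_metric (g : nat -> E3 -> 'M[R]_3) (g0 : E3 -> 'M[R]_3) :=
  forall c, cvg_Cinfty (fun n => metric_coord (g n) c) (metric_coord g0 c).

Definition cvg_one_form (b : nat -> E3 -> E3) (b0 : E3 -> E3) :=
  forall c, cvg_Cinfty (fun n => form_coord (b n) c) (form_coord b0 c).

Definition partial (i : 'I_2) (f : 'rV[R]_2 -> R) (x : 'rV[R]_2) : R :=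
  'D_(delta_mx 0 i) f x.

(* christoffel h k i j is Gamma^k_ij *)
Definition christoffel (h : 'rV[R]_2 -> 'M[R]_2) (k i j : 'I_2) (x : 'rV[R]_2) : R :=
  2^-1 * \sum_l invmx (h x) k l *
    (partial i (fun y => h y j l) x + partial j (fun y => h y i l) x
     - partial l (fun y => h y i j) x).

(* riemann h l k i j is the l-th component of R(d_i, d_j) d_k, for
   R(X, Y) = [nabla_X, nabla_Y] - nabla_[X, Y] *)
Definition riemann (h : 'rV[R]_2 -> 'M[R]_2) (l k i j : 'I_2) (x : 'rV[R]_2) : R :=
  partial i (christoffel h l j k) x - partial j (christoffel h l i k) x
  + \sum_m (christoffel h l i m x * christoffel h m j k x
            - christoffel h l j m x * christoffel h m i k x).

Definition gauss_curvature (h : 'rV[R]_2 -> 'M[R]_2) (x : 'rV[R]_2) : R :=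
  (\sum_l h x 0 l * riemann h l 1 0 1 x) / \det (h x).

Definition constant_curvature (K : R) (g : E3 -> 'M[R]_3) :=
  forall c x, gauss_curvature (metric_coord g c) x = K.

(* The orientation o = false makes (u, v) a positive basis of T_q S^2 when
   (q, u, v) is a positive basis of R^3; o = true is the opposite one. *)
Definition area_form (g : E3 -> 'M[R]_3) (o : bool) (q u v : E3) : R :=
  (-1) ^+ o * Num.sg (\det (\matrix_(i < 3) [:: q; u; v]`_i)) *
  Num.sqrt (bil (g q) u u * bil (g q) v v - bil (g q) u v ^+ 2).

End Sphere.

Section MagneticFlow.
Context {R : realType}.
Local Notation E3 := 'rV[R]_3.
Local Notation E6 := ('rV[R]_3 * 'rV[R]_3)%type.

Definition cotangent : set E6 := [set x | sphere x.1 /\ dot x.1 x.2 = 0].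

Definition canonical_form (x v : E6) : R := dot x.2 v.1.

(* omega_sigma = d lambda - pi^* sigma *)
Definition twisted_form (sigma : E3 -> E3 -> E3 -> R) (x u v : E6) : R :=
  extd cotangent canonical_form x u v - sigma x.1 u.1 v.1.

Definition conorm (g : E3 -> 'M[R]_3) (q p : E3) : R :=
  sup [set dot p v | v in [set v | tangent sphere q v /\ bil (g q) v v <= 1]].

Definition kinetic (g : E3 -> 'M[R]_3) (x : E6) : R := 2^-1 * conorm g x.1 x.2 ^+ 2.

Definition level (H : E6 -> R) (k : R) : set E6 := [set x | cotangent x /\ H x = k].

Definition hamiltonian_vector (H : E6 -> R) (sigma : E3 -> E3 -> E3 -> R) (x X : E6) :=
  tangent cotangent x X /\
  forall w, tangent cotangent x w ->
    twisted_form sigma x X w = - mdiff cotangent H x w.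

Definition flow_line (H : E6 -> R) (sigma : E3 -> E3 -> E3 -> R) (c : R -> E6) :=
  forall t : R, cotangent (c t) /\
    exists2 X, hamiltonian_vector H sigma (c t) X & is_derive t 1 c X.

(* Orbits are identified with their images.  For k > 0 the level consists of
   regular points of kinetic g, so that no orbit is constant. *)
Definition periodic_orbit (g : E3 -> 'M[R]_3) (sigma : E3 -> E3 -> E3 -> R)
    (k : R) (O : set E6) :=
  O `<=` level (kinetic g) k /\
  exists c T, [/\ 0 < T, flow_line (kinetic g) sigma c,
                  forall t, c (t + T) = c t & range c = O].

(* (1-form b on S^2) |-> s mu + d b *)
Definition magnetic_form (s : R) (mu : E3 -> E3 -> E3 -> R) (b : E3 -> E3)
    (q u v : E3) : R :=
  s * mu q u v + extd sphere (fun y w => dot (b y) w) q u v.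

(* C^2 is R^4 with coordinates (Re z1, Im z1, Re z2, Im z2). *)
Definition ellipsoid (a : R) : set 'rV[R]_4 :=
  [set z | (1 + a) * ((z 0 0 ^+ 2 + z 0 1 ^+ 2) / 2)
           + (1 - a) * ((z 0 2 ^+ 2 + z 0 3 ^+ 2) / 2) = 1].

Definition liouville (z v : 'rV[R]_4) : R :=
  2^-1 * (z 0 0 * v 0 1 - z 0 1 * v 0 0 + z 0 2 * v 0 3 - z 0 3 * v 0 2).

(* The double cover (M, p) of Y, endowed with the lift of a contact form tau
   that is a primitive on Y of omega, is strictly contactomorphic to the
   ellipsoid with the contact form r * liouville for some r > 0, that is, to
   the ellipsoid up to homothety.  The factor r is needed: the volume of
   tau /\ d tau on the double cover of a level of energy k_n -> 0 tends to
   (4 pi s)^2, whereas the volume of liouville /\ d liouville on the ellipsoid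
   a_n -> 0 tends to (2 pi)^2, so that r tends to 2 s (and to 0 if s = 0). *)
Definition double_cover_is_ellipsoid (Y : set E6) (omega : E6 -> E6 -> E6 -> R)
    (a : R) :=
  exists tau : E6 -> E6 -> R,
    [/\ contact_form Y tau, primitive_on Y omega tau
      & exists (N : nat) (M : set 'rV[R]_N) (p : 'rV[R]_N -> E6) (r : R),
         [/\ double_cover M Y p, 0 < r
           & strictly_contactomorphic M (pullback M p tau)
               (ellipsoid a) (fun z v => r * liouville z v)]].

End MagneticFlow.

(* Main.v *)
(* A metric of curvature 1 on S^2 is the pullback of the round one by a diffeomorphism Phi: the system
   d_i f = f_i, d_i f_j = Gamma^k_ij f_k - h_ij f is flat, its solutions develop S^2 locally onto the
   round sphere, and the developing map, extended to a homogeneous map of R^3 minus 0, is bijective: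
   the end point of the lift of the arc from Phi x to v is a locally constant function of x, on the
   connected complement of a fibre, that retracts onto the fibre of v.

   On the round sphere, |p|^2 + s^2 is the square of the norm j of the moment map J = q x p + s q of
   the rotations.  For c = s + t the function j + alpha J_3 generates a flow with the dynamics of an
   ellipsoid: a quaternionic frame of R^3, quadratic in z in C^2 = R^4, gives a double cover
   z |-> (q, p) of the nonzero covectors with j = c |z|^2 / 2 and J_3 = c (|z_1|^2 - |z_2|^2) / 2, which
   pulls back p dq + s (solid angle form) to 2 c times the Liouville form.  Now j + alpha J_3 = c is the
   level (c^2 - s^2) / 2 of the kinetic energy of a Randers-type metric g = lam (gbar + ...), up to a
   translation of p by a 1-form beta on the sphere, since
   j^2 - (c - alpha J_3)^2 is a quadratic polynomial in p.  As alpha << t << 1, both perturbations tend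
   to 0, and the Hamiltonian flow on the level rotates z_1^2 and z_2^2 with angular velocities in ratio
   (1 + alpha) / (1 - alpha), so that for irrational alpha only the two circles z_1 = 0 and z_2 = 0
   close up. *)
Require Import Defs.
From mathcomp Require Import all_boot all_order all_algebra.
From mathcomp Require Import all_classical all_reals all_analysis.
From mathcomp Require Import ring lra.
From HB Require Import structures.
Set Implicit Arguments.
Unset Strict Implicit.
Unset Printing Implicit Defensive.
Import Order.TTheory GRing.Theory Num.Theory.
Import numFieldNormedType.Exports.
Local Open Scope classical_set_scope.
Local Open Scope ring_scope.

(** * Smooth functions *)

(** The metric is known only through its curvature, whereas everything about the flow is an explicit
    computation on the round sphere; the diffeomorphism between them is a map of R^3 minus 0,
    homogeneous of degree one, so that all derivatives are ambient and Jacobians are square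
    matrices. Moreover [mdiff] and [extd] choose among curves and local extensions; smooth local
    retractions onto the sphere, T^*S^2 and the level make these choices immaterial, and the double
    cover itself supplies the last two.

    Completing the square in the quadratic polynomial yields at once the metric and the translation
    beta. Its conformal factor is normalised so that the energy minus its value on the level is j +
    alpha J_3 - c times a positive function: on the level the two Hamiltonian vector fields are then
    positive multiples of each other, which preserves the set of closed orbits though not their
    speed. The condition s (1 + alpha) < c keeps the level away from p = 0, where the solid angle
    form is singular. *)

Section DifferentialExtras.
Context {R : realType}.
Implicit Types V W Z : normedModType R.

Lemma diff_eps V W (f : V -> W) (x : V) (L : {linear V -> W}) : continuous L ->
  (forall e, 0 < e -> \forall h \near (0 : V), `|f (h + x) - f x - L h| <= e * `|h|) ->
  is_diff x f L.
Proof.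
move=> cL H.
have E : f \o shift x = cst (f x) + L +o_ (0 : V) id.
  apply/eqaddoP => e /H; apply: filterS => h /=.
  by rewrite opprD addrA.
have dE : 'd f x = L :> (V -> W) by exact: diff_unique.
by split=> //; apply/diff_locallyP; rewrite dE.
Qed.

Lemma differentiable_eps V W (f : V -> W) (x : V) : differentiable f x ->
  forall e, 0 < e -> \forall h \near (0 : V), `|f (h + x) - f x - 'd f x h| <= e * `|h|.
Proof.
move=> /diff_locallyP[_ /eqaddoP H] e /H; apply: filterS => h /=.
by rewrite opprD addrA.
Qed.

Lemma near_eq_is_diff V W (f g : V -> W) x :
  (\forall y \near x, f y = g y) -> differentiable f x -> is_diff x g ('d f x).
Proof.
move=> fg df; apply: diff_eps; first exact: diff_continuous.
move=> e e0; have fgx : f x = g x by exact: nbhs_singleton fg.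
have fg0 : \forall h \near (0 : V), f (h + x) = g (h + x).
  by move: fg; rewrite (near_shift 0) /=; apply: filterS => h /=; rewrite subr0.
by apply: filterS2 fg0 (differentiable_eps df e0) => h <-; rewrite fgx.
Qed.

Lemma near_eq_differentiable V W (f g : V -> W) x :
  (\forall y \near x, f y = g y) -> differentiable f x -> differentiable g x.
Proof. by move=> fg df; have := near_eq_is_diff fg df; case. Qed.

Definition lincont V W (L : V -> W) := linear L /\ continuous L.

Lemma lincont_diff V W (L : V -> W) : lincont L -> forall x, is_diff x L L.
Proof.
move=> [linL cL] x.
pose L' : {linear V -> W} := HB.pack L (GRing.isLinear.Build R V W _ L linL).
have dL : differentiable L' x by apply: linear_differentiable; exact: cL.
split; first exact: dL.
by have := diff_lin x (f := L') cL.
Qed.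

Lemma derive_lincont V W (L : V -> W) (x v : V) : lincont L -> 'D_v L x = L v.
Proof.
move=> /lincont_diff/(_ x) dL; rewrite deriveE; last by case: dL.
by rewrite (@diff_val _ _ _ _ _ _ _ dL).
Qed.

Lemma derive_comp V W Z (f : V -> W) (g : W -> Z) (x v : V) :
  differentiable f x -> differentiable g (f x) ->
  'D_v (g \o f) x = 'D_('D_v f x) g (f x).
Proof.
move=> df dg; rewrite !deriveE //; last exact: differentiable_comp.
by rewrite diff_comp.
Qed.

Lemma differentiable_lincont V W (L : V -> W) x : lincont L -> differentiable L x.
Proof. by move=> /lincont_diff/(_ x); case. Qed.

Lemma deriveZv V W (f : V -> W) x (k : R) v : differentiable f x ->
  'D_(k *: v) f x = k *: 'D_v f x.
Proof. by move=> df; rewrite !deriveE // linearZ. Qed.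

Lemma derive_sumv V W (f : V -> W) x n (v : 'I_n -> V) : differentiable f x ->
  'D_(\sum_i v i) f x = \sum_i 'D_(v i) f x.
Proof.
move=> df; rewrite deriveE // linear_sum.
by apply: eq_bigr => i _; rewrite deriveE.
Qed.

(** Finite dimension in the form of a spanning family with continuous linear coordinates: product
    and chain rules for maps into matrix spaces and their products then reduce to scalar ones. *)
Definition findim V := exists n (e : 'I_n -> V) (l : 'I_n -> V -> R),
  (forall i, lincont (l i)) /\ forall v, v = \sum_i l i v *: e i.

Lemma lincontZ V W (L : V -> W) k v : lincont L -> L (k *: v) = k *: L v.
Proof.
by move=> /lincont_diff/(_ 0) dL; rewrite -(@diff_val _ _ _ _ _ _ _ dL) linearZ.
Qed.

Lemma lincont_coord m n i j : lincont (fun M : 'M[R]_(m, n) => M i j).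
Proof. by split; [move=> a u v; rewrite !mxE | exact: coord_continuous]. Qed.

Lemma lincont_fst V W : lincont (@fst V W).
Proof. by split=> // x; exact: cvg_fst. Qed.

Lemma lincont_snd V W : lincont (@snd V W).
Proof. by split=> // x; exact: cvg_snd. Qed.

Lemma lincont_comp V W Z (f : V -> W) (g : W -> Z) :
  lincont f -> lincont g -> lincont (g \o f).
Proof.
move=> [lf cf] [lg cg]; split; first by move=> a u v /=; rewrite lf lg.
by move=> x; apply: continuous_comp; [exact: cf | exact: cg].
Qed.

Lemma findimR : findim R.
Proof.
exists 1%N, (fun=> 1), (fun=> id); split; first by move=> _; split=> // x; exact: cvg_id.
by move=> v; rewrite big_ord1 /GRing.scale /= mulr1.
Qed.

Lemma findim_mx m n : findim 'M[R]_(m, n).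
Proof.
pose p (i : 'I_#|{: 'I_m * 'I_n}|) := enum_val i.
exists _, (fun i => delta_mx (p i).1 (p i).2), (fun i (M : 'M[R]_(m, n)) => M (p i).1 (p i).2).
split; first by move=> i; exact: lincont_coord.
move=> M; rewrite {1}(matrix_sum_delta M) pair_bigA /=.
by rewrite (reindex p) //=; exact/onW_bij/enum_val_bij.
Qed.

Lemma findim_prod V W : findim V -> findim W -> findim (V * W)%type.
Proof.
move=> [n [e [l [lc le]]]] [m [e' [l' [lc' le']]]].
exists (n + m)%N, (fun i => match fintype.split i with inl j => (e j, 0) | inr k => (0, e' k) end),
  (fun i => match fintype.split i with inl j => l j \o fst | inr k => l' k \o snd end).
split.
  move=> i; case: (fintype.split i) => j; apply: lincont_comp => //.
    exact: lincont_fst.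
  exact: lincont_snd.
move=> [v w]; rewrite big_split_ord /=.
under eq_bigr do rewrite -/(unsplit (inl _)) unsplitK.
under [X in _ + X]eq_bigr do rewrite -/(unsplit (inr _)) unsplitK.
apply/pair_equal_spec; split.
  rewrite /= !raddf_sum /= [X in _ + X]big1 ?addr0; last by move=> i _; rewrite /= scaler0.
  exact: le.
rewrite /= !raddf_sum /= [X in X + _]big1 ?add0r; last by move=> i _; rewrite /= scaler0.
exact: le'.
Qed.

End DifferentialExtras.

#[global] Hint Resolve findimR findim_mx : core.
#[global] Hint Extern 0 (findim _) => (by repeat first [exact: findimR | exact: findim_mx | apply: findim_prod]) : core.

#[global] Opaque derive diff.

Section Ck.
Context {R : realType}.
Implicit Types V W Z : normedModType R.

(** [smooth_on] quantifies over lists of directions of one fixed map, which gives no induction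
    hypothesis for products and composites. The order k does: every rule is proved by induction on
    it, and [smooth_onP] returns to smoothness. *)
Fixpoint Ck (k : nat) V W (U : set V) (f : V -> W) : Prop :=
  (forall x, U x -> differentiable f x) /\
  if k is k'.+1 then forall v, Ck k' U ('D_v f) else True.

Lemma CkI k V W (U : set V) (f : V -> W) :
  (forall x, U x -> differentiable f x) ->
  (forall k' v, k = k'.+1 -> Ck k' U ('D_v f)) -> Ck k U f.
Proof. by case: k => [|k] df d; split; [exact: df| |exact: df|move=> v; exact: d]. Qed.

Lemma Ck_diff k V W (U : set V) (f : V -> W) x : Ck k U f -> U x -> differentiable f x.
Proof. by case: k => [|k] [df _]; exact: df. Qed.

Lemma Ck_der k V W (U : set V) (f : V -> W) v : Ck k.+1 U f -> Ck k U ('D_v f).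
Proof. by case=> _; apply. Qed.

Lemma Ck_le k V W (U : set V) (f : V -> W) : Ck k.+1 U f -> Ck k U f.
Proof.
elim: k f => [|k IH] f cf; apply: CkI; try by move=> x; exact: Ck_diff cf.
  by [].
by move=> _ v [<-]; apply/IH/Ck_der.
Qed.

Lemma open_near_eq V W (U : set V) (f g : V -> W) x : open U -> U x ->
  (forall y, U y -> f y = g y) -> \forall y \near x, f y = g y.
Proof.
move=> oU Ux fg; have : nbhs x U by exact: open_nbhs_nbhs.
by apply: filterS => y; exact: fg.
Qed.

Lemma Ck_eq k V W (U : set V) (f g : V -> W) : open U ->
  (forall y, U y -> f y = g y) -> Ck k U f -> Ck k U g.
Proof.
move=> oU; elim: k f g => [|k IH] f g fg cf; apply: CkI;
  try by move=> x Ux; apply: near_eq_differentiable (Ck_diff cf Ux); exact: open_near_eq fg.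
  by [].
move=> _ v [<-]; apply: IH (Ck_der v cf) => y Uy; apply: near_eq_derive.
exact: open_near_eq fg.
Qed.

Lemma smooth_onP V W (U : set V) (f : V -> W) : smooth_on U f <-> forall k, Ck k U f.
Proof.
split.
  move=> sf k; elim: k f sf => [|k IH] f sf; apply: CkI; try exact: (sf [::]).
    by [].
  by move=> _ v [<-]; apply: IH => vs; exact: (sf (v :: vs)).
move=> cf vs; elim: vs f cf => [|v vs IH] f cf /=.
  by move=> x; apply: Ck_diff (cf 0%N).
by apply: IH => k; exact: Ck_der.
Qed.

Lemma Ck_cst k V W (U : set V) (c : W) : Ck k U (cst c : V -> W).
Proof.
elim: k c => [|k IH] c; apply: CkI; try by move=> x _; exact: differentiable_cst.
  by [].
move=> _ v [<-]; have -> : 'D_v (cst c : V -> W) = cst 0 by apply/funext => x; rewrite derive_cst.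
exact: IH.
Qed.

Lemma Ck_lincont k V W (U : set V) (L : V -> W) : lincont L -> Ck k U L.
Proof.
move=> lL; apply: CkI => [x _|k' v _]; first exact: differentiable_lincont.
have -> : 'D_v L = cst (L v) by apply/funext => x; rewrite derive_lincont.
exact: Ck_cst.
Qed.

Lemma Ck_lincomp k V W Z (U : set V) (f : V -> W) (L : W -> Z) : open U -> lincont L ->
  Ck k U f -> Ck k U (L \o f).
Proof.
move=> oU lL; elim: k f => [|k IH] f cf; apply: CkI;
  try by move=> x Ux; apply: differentiable_comp; [exact: Ck_diff cf Ux | exact: differentiable_lincont].
  by [].
move=> _ v [<-]; apply: Ck_eq (IH _ (Ck_der v cf)) => // x Ux /=.
rewrite derive_comp; [|exact: Ck_diff cf Ux|exact: differentiable_lincont].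
by rewrite (derive_lincont _ _ lL).
Qed.

Lemma CkD k V W (U : set V) (f g : V -> W) : open U ->
  Ck k U f -> Ck k U g -> Ck k U (f + g).
Proof.
move=> oU; elim: k f g => [|k IH] f g cf cg; apply: CkI;
  try by move=> x Ux; apply: differentiableD; [exact: Ck_diff cf Ux | exact: Ck_diff cg Ux].
  by [].
move=> _ v [<-]; apply: Ck_eq (IH _ _ (Ck_der v cf) (Ck_der v cg)) => // x Ux.
by rewrite deriveD; [|exact: diff_derivable (Ck_diff cf Ux)|exact: diff_derivable (Ck_diff cg Ux)].
Qed.

Lemma CkN k V W (U : set V) (f : V -> W) : open U -> Ck k U f -> Ck k U (- f).
Proof.
move=> oU; elim: k f => [|k IH] f cf; apply: CkI;
  try by move=> x Ux; apply: differentiableN; exact: Ck_diff cf Ux.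
  by [].
move=> _ v [<-]; apply: Ck_eq (IH _ (Ck_der v cf)) => // x Ux.
by rewrite deriveN; [|exact: diff_derivable (Ck_diff cf Ux)].
Qed.

Lemma Ck_sum k V W (U : set V) n (f : 'I_n -> V -> W) : open U ->
  (forall i, Ck k U (f i)) -> Ck k U (fun x => \sum_i f i x).
Proof.
move=> oU; elim: n f => [|n IH] f cf.
  have -> : (fun x => \sum_i f i x) = cst 0 by apply/funext => x; rewrite big_ord0.
  exact: Ck_cst.
have -> : (fun x => \sum_i f i x) = (fun x => \sum_i f (widen_ord (leqnSn n) i) x) + f ord_max.
  by apply/funext => x; rewrite big_ord_recr.
by apply: CkD => //; exact: IH.
Qed.

Lemma CkM k V (U : set V) (f g : V -> R) : open U ->
  Ck k U f -> Ck k U g -> Ck k U (f * g).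
Proof.
move=> oU; elim: k f g => [|k IH] f g cf cg; apply: CkI;
  try by move=> x Ux; apply: differentiableM; [exact: Ck_diff cf Ux | exact: Ck_diff cg Ux].
  by [].
move=> _ v [<-].
have E : forall x, U x -> (f * 'D_v g + g * 'D_v f) x = 'D_v (f * g) x.
  by move=> x Ux; rewrite deriveM; [|exact: diff_derivable (Ck_diff cf Ux)|exact: diff_derivable (Ck_diff cg Ux)].
apply: Ck_eq E _ => //.
by apply: CkD => //; apply: IH; [exact: Ck_le|exact: Ck_der|exact: Ck_le|exact: Ck_der].
Qed.

Lemma CkZl k V W (U : set V) (f : V -> R) (w : W) : open U ->
  Ck k U f -> Ck k U (fun x => f x *: w).
Proof.
move=> oU; apply: (Ck_lincomp (L := fun r : R => r *: w)) => //; split.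
  by move=> a u v /=; rewrite scalerDl scalerA.
exact: scalel_continuous.
Qed.

Lemma Ck_coord k V W (U : set V) (f : V -> W) n (e : 'I_n -> W) (l : 'I_n -> W -> R) :
  open U -> (forall v, v = \sum_i l i v *: e i) ->
  (forall i, Ck k U (l i \o f)) -> Ck k U f.
Proof.
move=> oU eE cf.
apply: (@Ck_eq _ _ _ _ (fun x => \sum_i (l i \o f) x *: e i)) => //.
by apply: Ck_sum => // i; exact: CkZl.
Qed.

Lemma CkZ k V W (U : set V) (f : V -> R) (g : V -> W) : findim W -> open U ->
  Ck k U f -> Ck k U g -> Ck k U (fun x => f x *: g x).
Proof.
move=> [n [e [l [lc le]]]] oU cf cg; apply: (Ck_coord oU le) => i.
apply: (@Ck_eq _ _ _ _ (f * (l i \o g))) => //.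
  by move=> x _ /=; rewrite (lincontZ _ _ (lc i)).
by apply: CkM => //; exact: Ck_lincomp.
Qed.

(** The chain rule in coordinates of the middle space, D_v (g o f) = sum_i l_i(D_v f) (D_{e_i} g) o
    f, expresses the derivative by products and composites of one order less. *)
Lemma Ck_comp k V W Z (U : set V) (U' : set W) (f : V -> W) (g : W -> Z) :
  findim W -> findim Z -> open U -> open U' -> (forall x, U x -> U' (f x)) ->
  Ck k U f -> Ck k U' g -> Ck k U (g \o f).
Proof.
move=> fW fZ oU oU' fU; elim: k f g fU => [|k IH] f g fU cf cg; apply: CkI;
  try by move=> x Ux; apply: differentiable_comp; [exact: Ck_diff cf Ux | exact: Ck_diff cg (fU _ Ux)].
  by [].
move=> _ v [<-]; case: (fW) => n [e [l [lc le]]].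
apply: (@Ck_eq _ _ _ _ (fun x => \sum_i (l i \o 'D_v f) x *: ('D_(e i) g \o f) x)) => //.
  move=> x Ux /=; have dg := Ck_diff cg (fU _ Ux).
  rewrite derive_comp; [|exact: Ck_diff cf Ux|exact: dg].
  rewrite [in RHS](le ('D_v f x)) derive_sumv //.
  by apply: eq_bigr => i _; rewrite deriveZv.
apply: Ck_sum => // i; apply: CkZ => //.
  by apply: Ck_lincomp => //; exact: Ck_der.
by apply: IH => //; [exact: Ck_le|exact: Ck_der].
Qed.

Lemma Ck_pair k V W Z (U : set V) (f : V -> W) (g : V -> Z) : open U ->
  Ck k U f -> Ck k U g -> Ck k U (fun x => (f x, g x)).
Proof.
move=> oU cf cg.
have lW : lincont (fun w : W => (w, 0 : Z)).
  split; first by move=> a u v; apply/pair_equal_spec; rewrite /= scaler0 addr0.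
  by move=> x; apply: cvg_pair => /=; [exact: cvg_id|exact: cvg_cst].
have lZ : lincont (fun z : Z => (0 : W, z)).
  split; first by move=> a u v; apply/pair_equal_spec; rewrite /= scaler0 addr0.
  by move=> x; apply: cvg_pair => /=; [exact: cvg_cst|exact: cvg_id].
have -> : (fun x => (f x, g x)) = ((fun w => (w, 0)) \o f) + ((fun z => (0, z)) \o g).
  by apply/funext => x; apply/pair_equal_spec; rewrite /= addr0 add0r.
by apply: CkD => //; exact: Ck_lincomp.
Qed.

Lemma Ck_mx k V m n (U : set V) (f : V -> 'M[R]_(m, n)) : open U ->
  (forall i j, Ck k U (fun x => f x i j)) -> Ck k U f.
Proof.
move=> oU cf; pose p (i : 'I_#|{: 'I_m * 'I_n}|) := enum_val i.
apply: (@Ck_coord _ _ _ _ _ _ (fun i => delta_mx (p i).1 (p i).2)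
   (fun i (M : 'M[R]_(m, n)) => M (p i).1 (p i).2) oU).
  move=> M; rewrite {1}(matrix_sum_delta M) pair_bigA /=.
  by rewrite (reindex p) //=; exact/onW_bij/enum_val_bij.
by move=> i; exact: cf.
Qed.

(** The derivative is a polynomial in the function itself, so the induction on the order feeds on
    its own hypothesis. *)
Lemma Ck_inv k (U : set R) : open U -> (forall x, U x -> x != 0) -> Ck k U (@GRing.inv R).
Proof.
move=> oU U0; elim: k => [|k IH]; apply: CkI;
  try by move=> x /U0 x0; exact: differentiable_Rinv.
  by [].
move=> _ v [<-]; apply: (@Ck_eq _ _ _ _ (cst (- v) * (@GRing.inv R * @GRing.inv R))) => //.
  move=> x Ux; have x0 := U0 _ Ux.
  rewrite deriveE ?diff_Rinv //; last exact: differentiable_Rinv.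
  by rewrite /= !fctE /cst expr2 invfM /GRing.scale /=; ring.
by apply: CkM => //; [exact: Ck_cst|exact: CkM].
Qed.

Lemma Ck_sqrt k (U : set R) : open U -> (forall x, U x -> 0 < x) -> Ck k U (@Num.sqrt R).
Proof.
move=> oU U0.
have ds x : U x -> differentiable (@Num.sqrt R) x.
  by move=> /U0 x0; apply/derivable1_diffP; case: (is_derive1_sqrt x0).
have sq0 x : U x -> (Num.sqrt x) != 0 by move=> /U0; rewrite -sqrtr_gt0 => /lt0r_neq0.
elim: k => [|k IH]; apply: CkI; try exact: ds.
  by [].
move=> _ v [<-]; apply: (@Ck_eq _ _ _ _ (cst (v / 2) * (@GRing.inv R \o @Num.sqrt R))) => //.
  move=> x Ux; have x0 := U0 _ Ux.
  rewrite -[v in RHS]mulr1 (deriveZv _ _ (ds _ Ux)) (@derive_val _ _ _ _ _ _ _ (is_derive1_sqrt x0)).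
  by rewrite /= !fctE /GRing.scale /= invfM mulrA.
apply: CkM => //; first exact: Ck_cst.
pose U' : set R := [set x | x != 0].
have oU' : open U' by exact: open_neq.
apply: (@Ck_comp _ _ _ _ _ U') => //; apply: Ck_inv => // x.
Qed.

End Ck.

Section Smooth.
Context {R : realType}.
Implicit Types V W Z : normedModType R.

Lemma sm_diff V W (U : set V) (f : V -> W) x : smooth_on U f -> U x -> differentiable f x.
Proof. by move=> sf; exact: (sf [::]). Qed.

Lemma sm_der V W (U : set V) (f : V -> W) v : smooth_on U f -> smooth_on U ('D_v f).
Proof. by move=> sf vs; exact: (sf (v :: vs)). Qed.

Lemma sm_derx V W (U : set V) (f : V -> W) v : smooth_on U f -> smooth_on U (fun x => 'D_v f x).
Proof. exact: sm_der. Qed.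

Lemma sm_subset V W (U U' : set V) (f : V -> W) : U' `<=` U -> smooth_on U f -> smooth_on U' f.
Proof. by move=> sU sf vs x /sU; exact: sf. Qed.

Lemma sm_eq V W (U : set V) (f g : V -> W) : open U ->
  (forall y, U y -> f y = g y) -> smooth_on U f -> smooth_on U g.
Proof. by move=> oU fg /smooth_onP sf; apply/smooth_onP => k; exact: Ck_eq (sf k). Qed.

Lemma sm_cst V W (U : set V) (c : W) : smooth_on U (fun _ : V => c).
Proof. by apply/smooth_onP => k; exact: Ck_cst. Qed.

Lemma sm_lin V W (U : set V) (L : V -> W) : lincont L -> smooth_on U L.
Proof. by move=> lL; apply/smooth_onP => k; exact: Ck_lincont. Qed.

Lemma sm_id V (U : set V) : smooth_on U (fun x : V => x).
Proof. by apply: sm_lin; split => // x; exact: cvg_id. Qed.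

Lemma sm_lincomp V W Z (U : set V) (L : W -> Z) (f : V -> W) : open U -> lincont L ->
  smooth_on U f -> smooth_on U (fun x => L (f x)).
Proof. by move=> oU lL /smooth_onP sf; apply/smooth_onP => k; exact: Ck_lincomp. Qed.

Lemma smD V W (U : set V) (f g : V -> W) : open U ->
  smooth_on U f -> smooth_on U g -> smooth_on U (fun x => f x + g x).
Proof. by move=> oU /smooth_onP sf /smooth_onP sg; apply/smooth_onP => k; exact: CkD. Qed.

Lemma smN V W (U : set V) (f : V -> W) : open U ->
  smooth_on U f -> smooth_on U (fun x => - f x).
Proof. by move=> oU /smooth_onP sf; apply/smooth_onP => k; exact: CkN. Qed.

Lemma smB V W (U : set V) (f g : V -> W) : open U ->
  smooth_on U f -> smooth_on U g -> smooth_on U (fun x => f x - g x).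
Proof. by move=> oU sf sg; apply: smD => //; exact: smN. Qed.

Lemma smM V (U : set V) (f g : V -> R) : open U ->
  smooth_on U f -> smooth_on U g -> smooth_on U (fun x => f x * g x).
Proof. by move=> oU /smooth_onP sf /smooth_onP sg; apply/smooth_onP => k; exact: CkM. Qed.

Lemma smX V (U : set V) (f : V -> R) n : open U ->
  smooth_on U f -> smooth_on U (fun x => f x ^+ n).
Proof.
move=> oU sf; elim: n => [|n IH]; first exact: sm_cst.
have -> : (fun x => f x ^+ n.+1) = (fun x => f x * f x ^+ n) by apply/funext => x; rewrite exprS.
exact: smM.
Qed.

Lemma sm_sum V W (U : set V) n (f : 'I_n -> V -> W) : open U ->
  (forall i, smooth_on U (f i)) -> smooth_on U (fun x => \sum_i f i x).
Proof.
by move=> oU sf; apply/smooth_onP => k; apply: Ck_sum => // i; move: k; apply/smooth_onP.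
Qed.

Lemma smZ V W (U : set V) (f : V -> R) (g : V -> W) : findim W -> open U ->
  smooth_on U f -> smooth_on U g -> smooth_on U (fun x => f x *: g x).
Proof. by move=> fW oU /smooth_onP sf /smooth_onP sg; apply/smooth_onP => k; exact: CkZ. Qed.

Lemma sm_comp V W Z (U : set V) (U' : set W) (g : W -> Z) (f : V -> W) :
  findim W -> findim Z -> open U -> open U' -> (forall x, U x -> U' (f x)) ->
  smooth_on U f -> smooth_on U' g -> smooth_on U (fun x => g (f x)).
Proof.
move=> fW fZ oU oU' fU /smooth_onP sf /smooth_onP sg; apply/smooth_onP => k.
exact: (Ck_comp fW fZ oU oU' fU).
Qed.

Lemma smV V (U : set V) (f : V -> R) : open U -> (forall x, U x -> f x != 0) ->
  smooth_on U f -> smooth_on U (fun x => (f x)^-1).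
Proof.
move=> oU f0 sf; have oU' : open [set x : R | x != 0] by exact: open_neq.
apply: (@sm_comp _ _ _ U [set x : R | x != 0] (@GRing.inv R)) => //.
by apply/smooth_onP => k; exact: Ck_inv.
Qed.

Lemma sm_sqrt V (U : set V) (f : V -> R) : open U -> (forall x, U x -> 0 < f x) ->
  smooth_on U f -> smooth_on U (fun x => Num.sqrt (f x)).
Proof.
move=> oU f0 sf; have oU' : open [set x : R | 0 < x] by exact: open_gt.
apply: (@sm_comp _ _ _ U [set x : R | 0 < x] (@Num.sqrt R)) => //.
by apply/smooth_onP => k; exact: Ck_sqrt.
Qed.

Lemma sm_pair V W Z (U : set V) (f : V -> W) (g : V -> Z) : open U ->
  smooth_on U f -> smooth_on U g -> smooth_on U (fun x => (f x, g x)).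
Proof. by move=> oU /smooth_onP sf /smooth_onP sg; apply/smooth_onP => k; exact: Ck_pair. Qed.

Lemma sm_mx V m n (U : set V) (f : V -> 'M[R]_(m, n)) : open U ->
  (forall i j, smooth_on U (fun x => f x i j)) -> smooth_on U f.
Proof.
by move=> oU sf; apply/smooth_onP => k; apply: Ck_mx => // i j; move: (sf i j) => /smooth_onP.
Qed.

Lemma sm_coord V m n (U : set V) (f : V -> 'M[R]_(m, n)) i j : open U ->
  smooth_on U f -> smooth_on U (fun x => f x i j).
Proof. by move=> oU; apply: (sm_lincomp oU (lincont_coord i j)). Qed.

Lemma sm_fst V W Z (U : set V) (f : V -> W * Z) : open U ->
  smooth_on U f -> smooth_on U (fun x => (f x).1).
Proof. by move=> oU; apply: sm_lincomp => //; exact: lincont_fst. Qed.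

Lemma sm_snd V W Z (U : set V) (f : V -> W * Z) : open U ->
  smooth_on U f -> smooth_on U (fun x => (f x).2).
Proof. by move=> oU; apply: sm_lincomp => //; exact: lincont_snd. Qed.

Lemma sm_mulmx V m n p (U : set V) (f : V -> 'M[R]_(m, n)) (g : V -> 'M[R]_(n, p)) : open U ->
  smooth_on U f -> smooth_on U g -> smooth_on U (fun x => f x *m g x).
Proof.
move=> oU sf sg; apply: sm_mx => // i j.
have -> : (fun x => (f x *m g x) i j) = (fun x => \sum_k f x i k * g x k j).
  by apply/funext => x; rewrite mxE.
by apply: sm_sum => // k; apply: smM => //; exact: sm_coord.
Qed.

Lemma sm_tr V m n (U : set V) (f : V -> 'M[R]_(m, n)) : open U ->
  smooth_on U f -> smooth_on U (fun x => (f x)^T).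
Proof.
move=> oU sf; apply: sm_mx => // i j.
have -> : (fun x => (f x)^T i j) = (fun x => f x j i) by apply/funext => x; rewrite mxE.
exact: sm_coord.
Qed.

Lemma sm_dot V n (U : set V) (f g : V -> 'rV[R]_n) : open U ->
  smooth_on U f -> smooth_on U g -> smooth_on U (fun x => dot (f x) (g x)).
Proof.
move=> oU sf sg; apply: sm_sum => // k; apply: smM => //; exact: sm_coord.
Qed.

Lemma sm_continuous V W (U : set V) (f : V -> W) x : smooth_on U f -> U x -> {for x, continuous f}.
Proof. by move=> sf Ux; apply: differentiable_continuous; exact: sm_diff sf Ux. Qed.

Lemma is_derive_line V W (f : V -> W) (x v : V) (t : R) : differentiable f (x + t *: v) ->
  is_derive t 1 (fun s : R => f (x + s *: v)) ('D_v f (x + t *: v)).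
Proof.
move=> df; pose l (s : R) := x + s *: v.
have dl : is_diff t l (fun s => s *: v).
  have := @is_diffD _ _ _ (cst x) (fun s : R => s *: v) 0 (fun s => s *: v) t
    (is_diff_cst x t) (is_diff_scalel t v).
  by rewrite add0r.
have dfl : differentiable f (l t) by [].
have dl' : differentiable l t by case: dl.
have dfl' : differentiable (f \o l) t by exact: differentiable_comp.
split; first exact: diff_derivable.
rewrite -/(f \o l) deriveE // diff_comp // /= deriveE // -/(l t).
by rewrite (@diff_val _ _ _ _ _ _ _ dl) scale1r.
Qed.

Lemma MVT0 (f df : R -> R) (t : R) : 0 < t ->
  (forall s, 0 <= s <= t -> is_derive s 1 f (df s)) ->
  exists2 c, 0 < c < t & f t - f 0 = df c * t.
Proof.
move=> t0 dfE.
have cf : {within `[0, t], continuous f}.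
  by apply: derivable_within_continuous => s; rewrite in_itv /= => /dfE [].
have [|c] := @MVT _ f df 0 t t0 _ cf.
  by move=> s; rewrite in_itv /= => /andP[s0 st]; apply: dfE; rewrite !ltW.
by rewrite in_itv /= subr0 => ct E; exists c.
Qed.

(** The mean value theorem is applied along u to the increment in the direction v, and then along v
    to the derivative in the direction u. *)
Lemma second_difference V (U : set V) (f : V -> R) x u v (t : R) : 0 < t ->
  smooth_on U f -> (forall a b : R, 0 <= a <= t -> 0 <= b <= t -> U (x + a *: u + b *: v)) ->
  exists a b : R, [/\ 0 <= a <= t, 0 <= b <= t &
    f (x + t *: u + t *: v) - f (x + t *: u) - (f (x + t *: v) - f x) =
    'D_v ('D_u f) (x + a *: u + b *: v) * t * t].
Proof.
move=> t0 sf Uab.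
have tt : 0 <= t <= t by rewrite lexx ltW.
have t00 : 0 <= (0 : R) <= t by rewrite lexx ltW.
pose phi s := f (x + t *: v + s *: u) - f (x + s *: u).
have dphi s : 0 <= s <= t ->
    is_derive s 1 phi ('D_u f (x + t *: v + s *: u) - 'D_u f (x + s *: u)).
  move=> st; apply: is_deriveB; apply: is_derive_line; apply: sm_diff sf _.
    by rewrite -addrA (addrC (t *: v)) addrA; exact: Uab.
  by have := Uab _ _ st t00; rewrite scale0r addr0.
have [a /andP[a0 at_] phiE] := MVT0 t0 dphi.
have at' : 0 <= a <= t by rewrite !ltW.
pose psi s := 'D_u f (x + a *: u + s *: v).
have dpsi s : 0 <= s <= t -> is_derive s 1 psi ('D_v ('D_u f) (x + a *: u + s *: v)).
  by move=> st; apply: is_derive_line; apply: sm_diff (sm_der _ sf) _; exact: Uab.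
have [b /andP[b0 bt] psiE] := MVT0 t0 dpsi.
exists a, b; split; rewrite ?ltW //.
move: phiE psiE; rewrite /phi /psi !scale0r !addr0 => E1 E2.
rewrite -(addrA x) (addrC (a *: u)) addrA in E2.
by rewrite -E2 -E1 -(addrA x (t *: u)) (addrC (t *: u)) addrA; ring.
Qed.

Lemma separated_values V (U : set V) (A B : V -> R) x : nbhs x U ->
  {for x, continuous A} -> {for x, continuous B} -> A x != B x ->
  exists2 r, 0 < r & forall y z, `|x - y| < r -> `|x - z| < r -> U y /\ A y != B z.
Proof.
move=> nU /cvgrPdist_lt cA /cvgrPdist_lt cB neq.
pose e : R := `|A x - B x| / 2.
have e0 : 0 < e by apply: divr_gt0; rewrite // normr_gt0 subr_eq0.
have H : \forall y \near x, U y /\ (`|A x - A y| < e /\ `|B x - B y| < e).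
  by apply: filterI nU (filterI _ _); [exact: cA|exact: cB].
move/nbhs_normP : H => [r /= r0 rP]; exists r => // y z xy xz.
have [Uy [hA _]] := rP y xy; have [_ [_ hB]] := rP z xz.
split=> //; apply/eqP => E.
have : `|A x - B x| < e + e.
  have -> : A x - B x = (A x - A y) - (B x - B z) by rewrite E; ring.
  by apply: le_lt_trans (ler_normB _ _) _; exact: ltrD.
by rewrite /e -splitr ltxx.
Qed.

(** If the mixed derivatives differed at x, continuity would keep any nearby value of one apart from
    any nearby value of the other; but the second difference, symmetric in u and v, is t^2 times a
    nearby value of each. *)
Lemma schwarz_scalar V (U : set V) (f : V -> R) x u v : open U -> U x ->
  smooth_on U f -> 'D_v ('D_u f) x = 'D_u ('D_v f) x.
Proof.
move=> oU Ux sf; have nU : nbhs x U by exact: open_nbhs_nbhs.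
apply/eqP; apply/negPn/negP => neq.
have cA : {for x, continuous ('D_v ('D_u f))}.
  by apply: sm_continuous (sm_der _ (sm_der _ sf)) Ux.
have cB : {for x, continuous ('D_u ('D_v f))}.
  by apply: sm_continuous (sm_der _ (sm_der _ sf)) Ux.
have [r r0 rP] := separated_values nU cA cB neq; clear nU cA cB neq.
pose t : R := r / (`|u| + `|v| + 1) / 2.
have uv0 : 0 < `|u| + `|v| + 1 by rewrite ltr_wpDl // addr_ge0.
have t0 : 0 < t by rewrite !divr_gt0.
have near_x (a b : R) : 0 <= a <= t -> 0 <= b <= t -> `|x - (x + a *: u + b *: v)| < r.
  move=> /andP[a0 at_] /andP[b0 bt]; rewrite -addrA opprD addrA subrr add0r normrN.
  apply: le_lt_trans (ler_normD _ _) _; rewrite !normrZ !ger0_norm //.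
  apply: (@le_lt_trans _ _ (t * (`|u| + `|v|))).
    by rewrite mulrDr lerD // ler_wpM2r.
  apply: (@lt_le_trans _ _ (t * (`|u| + `|v| + 1))).
    by rewrite ltr_pM2l // ltrDl.
  rewrite /t mulrAC divfK ?gt_eqF // ler_pdivrMr //; nra.
have Uab (a b : R) : 0 <= a <= t -> 0 <= b <= t -> U (x + a *: u + b *: v).
  by move=> at_ bt; case: (rP _ _ (near_x _ _ at_ bt) (near_x _ _ at_ bt)).
have Uab' (a b : R) : 0 <= a <= t -> 0 <= b <= t -> U (x + a *: v + b *: u).
  by move=> at_ bt; rewrite -addrA (addrC (a *: v)) addrA; exact: Uab.
have [a [b [at_ bt E1]]] := second_difference t0 sf Uab.
have [a' [b' [at' bt' E2]]] := second_difference t0 sf Uab'.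
have [_ /eqP] := rP _ _ (near_x _ _ at_ bt) (near_x _ _ bt' at'); apply.
move: E1 E2; rewrite (addrAC x (a' *: v)) (addrAC x (t *: v)).
move: ('D_v _ _) ('D_u _ _) => A B E1 E2.
apply: (mulIf (lt0r_neq0 t0)); apply: (mulIf (lt0r_neq0 t0)).
by rewrite -E1 -E2; ring.
Qed.

Lemma schwarz V W (U : set V) (f : V -> W) x u v : findim W -> open U -> U x ->
  smooth_on U f -> 'D_v ('D_u f) x = 'D_u ('D_v f) x.
Proof.
move=> [n [e [l [lc le]]]] oU Ux sf.
have D2 i w w' : l i ('D_w ('D_w' f) x) = 'D_w ('D_w' (l i \o f)) x.
  have dd : differentiable ('D_w' f) x by exact: sm_diff (sm_der _ sf) Ux.
  have dl y : differentiable (l i) y by exact: differentiable_lincont.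
  have -> : 'D_w ('D_w' (l i \o f)) x = 'D_w (l i \o 'D_w' f) x.
    apply: near_eq_derive; apply: open_near_eq oU Ux _ => y Uy.
    by rewrite derive_comp //; [rewrite (derive_lincont _ _ (lc i)) | exact: sm_diff sf Uy].
  by rewrite derive_comp // (derive_lincont _ _ (lc i)).
rewrite (le ('D_v ('D_u f) x)) (le ('D_u ('D_v f) x)); apply: eq_bigr => i _.
by rewrite !D2 (schwarz_scalar _ _ oU Ux) //; exact: sm_lincomp.
Qed.

(** When the derivative is a smooth function of the point and of the value, order k for f gives
    order k for the derivative, hence order k + 1 for f. This serves for solutions of flat systems
    and for inverse maps. *)
Lemma sm_bootstrap V W (U : set V) (f : V -> W) : findim V -> findim W -> open U ->
  (forall x, U x -> differentiable f x) ->
  (forall v, exists N (G : V * W -> W), [/\ open N, smooth_on N G,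
    forall x, U x -> N (x, f x) & forall x, U x -> 'D_v f x = G (x, f x)]) ->
  smooth_on U f.
Proof.
move=> fV fW oU df H; apply/smooth_onP; elim=> [|k IH].
  by split.
apply: CkI => // _ v [<-]; have [N [G [oN sG fN dE]]] := H v.
apply: (@Ck_eq _ _ _ _ _ (G \o (fun x => (x, f x)))) => //.
  by move=> x Ux; rewrite dE.
apply: (@Ck_comp _ _ _ _ _ _ N) => //.
  by apply: Ck_pair => //; apply: Ck_lincont; split => // x; exact: cvg_id.
by move/smooth_onP: sG.
Qed.

End Smooth.

(** * Linear differential equations and flat systems *)

Section LinearODE.
Context {R : realType}.
Notation mu := (@lebesgue_measure R).

Lemma is_derive_cont (f : R -> R) (t df : R) : is_derive t 1 f df -> {for t, continuous f}.
Proof. by move=> [d _]; apply: differentiable_continuous; exact/derivable1_diffP. Qed.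

Lemma antideriv (f : R -> R) (b : R) : 0 < b -> continuous f ->
  exists2 F : R -> R, F 0 = 0 & forall t : R, `|t| < b -> is_derive t 1 F (f t).
Proof.
move=> b0 cf; pose F (x : R) : R := (\int[mu]_(t in `[(- b)%R, x]) (f t))%R.
have iF : mu.-integrable `[- b, b] (EFin \o f).
  apply: continuous_compact_integrable; first exact: segment_compact.
  exact: continuous_subspaceT.
have dF (t : R) : `|t| < b -> is_derive t 1 F (f t).
  rewrite ltr_norml => /andP[bt tb].
  have [d dE] := @continuous_FTC1_closed R f (- b) t b tb iF bt (cf t).
  by apply: DeriveDef; [exact: d|rewrite -derive1E; exact: dE].
exists (F - cst (F 0)); first by rewrite !fctE /cst subrr.
move=> t tb; have dt := dF t tb; rewrite -[f t]subr0; exact: is_deriveB.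
Qed.

Definition clamp (b t : R) : R := Num.max (- b) (Num.min b t).

Lemma clamp_continuous b : continuous (clamp b).
Proof.
have -> : clamp b = (fun=> - b) \max ((fun=> b) \min id) by apply/funext.
move=> t; apply: continuous_max; first exact: cvg_cst.
by apply: continuous_min; [exact: cvg_cst|exact: cvg_id].
Qed.

Lemma clamp_id b t : `|t| <= b -> clamp b t = t.
Proof. by rewrite ler_norml => /andP[h1 h2]; rewrite /clamp min_r // max_r. Qed.

Lemma clamp_norm b t : 0 <= b -> `|clamp b t| <= b.
Proof.
move=> b0; rewrite /clamp ler_norml le_max lexx /= ge_max ge_min lexx /=.
by rewrite (le_trans _ b0) // oppr_le0.
Qed.

(* Bielecki's weighted norm: the weight expR (k * t) makes integration a contraction. *)
Lemma weighted_bound (F f : R -> R) (b k K : R) : 0 < k -> 0 <= K -> F 0 = 0 ->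
  (forall t : R, 0 <= t <= b -> is_derive t 1 F (f t)) ->
  (forall t : R, 0 <= t <= b -> `|f t| <= K * expR (k * t)) ->
  forall t : R, 0 <= t <= b -> `|F t| <= K / k * expR (k * t).
Proof.
move=> k0 K0 F0 dF bf t /andP[t0 tb].
have H (s : R) : s = 1 \/ s = -1 -> s * F t <= K / k * expR (k * t).
  move=> s1; have [->|t0'] := eqVneq t 0.
    by rewrite F0 mulr0 mulr_ge0 ?expR_ge0 // divr_ge0 // ltW.
  have {t0'}t0 : 0 < t by rewrite lt_def t0'.
  pose g (x : R) := K / k * expR (k * x) - s * F x.
  have dg x : 0 <= x <= t -> is_derive x 1 g (K * expR (k * x) - s * f x).
    move=> /andP[x0 xt].
    have dFx := dF x; rewrite x0 (le_trans xt tb) in dFx; have {}dFx := dFx isT.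
    have dk : is_derive x 1 (fun y => k * y) k.
      by have := @is_deriveZ _ _ _ (@id R) k x 1 1 (is_derive_id x 1); rewrite /GRing.scale /= mulr1.
    have de := @is_derive1_comp R expR (fun y => k * y) x _ _ (is_derive_expR _) dk.
    have E : K * expR (k * x) - s * f x = (K / k) *: (k *: expR (k * x)) - s *: f x.
      by rewrite /GRing.scale /=; field; rewrite gt_eqF.
    rewrite E; apply: is_deriveB; apply: is_deriveZ.
    by move: de; rewrite /GRing.scale /= mulrC.
  have [c /andP[c0 ct] gE] := MVT0 t0 dg.
  have ct' : 0 <= c <= b by rewrite ltW //= (le_trans (ltW ct)).
  have h1 := bf c ct'.
  have h2 : s * f c <= K * expR (k * c).
    apply: le_trans h1; case: s1 => ->; first by rewrite mul1r ler_norm.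
    by rewrite mulN1r -normrN ler_norm.
  have : 0 <= g t - g 0 by rewrite gE mulr_ge0 ?subr_ge0 // ltW.
  rewrite /g F0 !mulr0 subr0 expR0 mulr1 => h3.
  have h4 : 0 <= K / k by rewrite divr_ge0 // ltW.
  lra.
rewrite ler_norml; apply/andP; split.
  by have := H (-1) (or_intror erefl); rewrite mulN1r; lra.
by have := H 1 (or_introl erefl); rewrite mul1r.
Qed.

Lemma weighted_bound_sym (F f : R -> R) (b k K : R) : 0 < k -> 0 <= K -> F 0 = 0 ->
  (forall t : R, `|t| <= b -> is_derive t 1 F (f t)) ->
  (forall t : R, `|t| <= b -> `|f t| <= K * expR (k * `|t|)) ->
  forall t : R, `|t| <= b -> `|F t| <= K / k * expR (k * `|t|).
Proof.
move=> k0 K0 F0 dF bf t tb; have [t0|t0] := lerP 0 t.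
  rewrite (ger0_norm t0) in tb *.
  apply: (@weighted_bound F f b k K k0 K0 F0) => [s /andP[s0 sb]|s /andP[s0 sb]|]; last by apply/andP.
    by apply: dF; rewrite ger0_norm.
  by rewrite -{2}(ger0_norm s0); apply: bf; rewrite ger0_norm.
rewrite (ltr0_norm t0) in tb *.
have := @weighted_bound (F \o -%R) (fun s => - f (- s)) b k K k0 K0.
rewrite /= oppr0 => /(_ F0) H; have := H _ _ (- t); rewrite /= opprK; apply.
- move=> s /andP[s0 sb].
  have d : is_derive (- s) 1 F (f (- s)) by apply: dF; rewrite normrN ger0_norm.
  have := @is_derive1_comp R F -%R s _ _ d (is_deriveNid s 1).
  by rewrite /GRing.scale /= mulrN1.
- move=> s /andP[s0 sb]; have sn : `|- s| = s by rewrite normrN ger0_norm.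
  by rewrite normrN; have := bf (- s); rewrite sn; apply.
- by rewrite oppr_ge0 ltW.
Qed.

Lemma bounded_on_segment (f : R -> R) (b : R) : continuous f ->
  exists2 M, 0 <= M & forall t : R, `|t| <= b -> `|f t| <= M.
Proof.
move=> cf; have [b0|b0] := ltrP b 0.
  by exists 0 => // t tb; have := le_lt_trans tb b0; rewrite normr_lt0.
have bb : - b <= b by lra.
have [c _ cM] := EVT_max bb (continuous_subspaceT (f := fun t => `|f t|)
  (fun t => continuous_comp (cf t) (@norm_continuous _ _ (f t)))).
exists `|f c| => // t tb; apply: cM; rewrite in_itv /=.
by rewrite ler_norml in tb.
Qed.

Lemma lt_pow2 (C e : R) : 0 < e -> exists k : nat, C / 2 ^+ k < e.
Proof.
move=> e0; set k := (Num.truncn (`|C| / e)).+1; exists k.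
rewrite ltr_pdivrMr ?exprn_gt0 // mulrC -ltr_pdivrMr //.
apply: (@le_lt_trans _ _ (`|C| / e)).
  by rewrite ler_pM2r ?invr_gt0 // ler_norm.
apply: (@lt_le_trans _ _ k%:R); first exact: Num.Theory.truncnS_gt.
by rewrite -natrX ler_nat ltnW // ltn_expl.
Qed.

(** The intervals [u_k - 2 C / 2^k, u_k + 2 C / 2^k] are nested; the limit is the supremum of their
    left end points. *)
Lemma geometric_limit (u : nat -> R) (C : R) :
  (forall k, `|u k.+1 - u k| <= C / 2 ^+ k) ->
  exists l, forall k, `|l - u k| <= 2 * C / 2 ^+ k.
Proof.
move=> uC; pose c k : R := C / 2 ^+ k.
have cS k : c k = 2 * c k.+1 by rewrite /c exprS; field; rewrite gt_eqF ?exprn_gt0.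
have h k : c k >= 0 by apply: le_trans (uC k).
have mono k p : u k - 2 * c k <= u (k + p)%N - 2 * c (k + p)%N /\
    u (k + p)%N + 2 * c (k + p)%N <= u k + 2 * c k.
  elim: p => [|p [IH1 IH2]]; first by rewrite addn0.
  rewrite addnS; have := uC (k + p)%N; rewrite -/(c _) ler_norml => /andP[].
  have := cS (k + p)%N; lra.
have vw k j : u k - 2 * c k <= u j + 2 * c j.
  have [kj|jk] := leqP k j.
    by have [] := mono k (j - k)%N; rewrite subnKC //; have := h j; lra.
  by have [] := mono j (k - j)%N; rewrite subnKC ?(ltnW jk) //; have := h k; lra.
pose A : set R := [set u k - 2 * c k | k in [set: nat]].
have A0 : A !=set0 by exists (u 0%N - 2 * c 0%N), 0%N.
have ub j : ubound A (u j + 2 * c j) by move=> _ [k _ <-]; exact: vw.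
exists (sup A) => k; rewrite -mulrA -/(c k) ler_norml; apply/andP; split.
  have : u k - 2 * c k <= sup A by apply: sup_upper_bound; [split=> //; exists (u 0%N + 2 * c 0%N); exact: ub|exists k].
  lra.
have : sup A <= u k + 2 * c k by apply: ge_sup => //; exact: ub.
lra.
Qed.

Lemma uniform_limit_continuous (u : nat -> R -> R) (f : R -> R) (C : R) :
  (forall k, continuous (u k)) -> (forall k t, `|f t - u k t| <= C / 2 ^+ k) ->
  continuous f.
Proof.
move=> cu fu t; apply/cvgrPdist_lt => e e0.
have e3 : 0 < e / 3 by rewrite divr_gt0.
have [k kC] := lt_pow2 C e3.
have /cvgrPdist_lt/(_ _ e3) := cu k t; apply: filterS => s h.
have h1 := le_lt_trans (fu k t) kC; have h2 := le_lt_trans (fu k s) kC.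
move: h h1 h2; rewrite !ltr_norml => /andP[? ?] /andP[? ?] /andP[? ?].
by apply/andP; split; lra.
Qed.

Lemma sum_continuous n (f : 'I_n -> R -> R) : (forall i, continuous (f i)) ->
  continuous (fun t => \sum_i f i t).
Proof.
move=> cf t; elim: n f cf => [|n IH] f cf.
  by under eq_fun do rewrite big_ord0; exact: cvg_cst.
by under eq_fun do rewrite big_ord_recr; apply: cvgD; [exact: IH|exact: cf].
Qed.

Lemma mulmx_continuous d e p (A : R -> 'M[R]_(d, e)) (B : R -> 'M[R]_(e, p)) :
  (forall i j, continuous (fun t => A t i j)) -> (forall i j, continuous (fun t => B t i j)) ->
  forall i j, continuous (fun t => (A t *m B t) i j).
Proof.
move=> cA cB i j; under eq_fun do rewrite mxE.
by apply: sum_continuous => k t; apply: cvgM; [exact: cA|exact: cB].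
Qed.

Lemma mulmx_entry_bound d e p (A : 'M[R]_(d, e)) (B : 'M[R]_(e, p)) (a b : R) i j :
  (forall i j, `|A i j| <= a) -> (forall i j, `|B i j| <= b) -> `|(A *m B) i j| <= e%:R * (a * b).
Proof.
move=> Aa Bb; rewrite mxE; apply: le_trans (ler_norm_sum _ _ _) _.
apply: (@le_trans _ _ (\sum_(k < e) a * b)).
  by apply: ler_sum => k _; rewrite normrM; apply: ler_pM.
by rewrite sumr_const card_ord -[leLHS]mulr_natl.
Qed.

(** An integration operator for Picard iteration. Primitives are taken on a larger interval and
    evaluated at the clamped argument, so that every iterate is continuous on the whole line and
    determined by its values on [-b, b]. The last two clauses are the contraction estimates in the
    weighted norm. *)
Lemma exists_integrator (b : R) : 0 < b -> exists P : (R -> R) -> R -> R,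
  [/\ forall f, continuous f -> continuous (P f) /\ P f 0 = 0,
  forall f (t : R), continuous f -> `|t| < b -> is_derive t 1 (P f) (f t),
  forall f t, P f t = P f (clamp b t),
  forall f k K, continuous f -> 0 < k -> 0 <= K ->
     (forall t : R, `|t| <= b -> `|f t| <= K * expR (k * `|t|)) ->
     forall t : R, `|t| <= b -> `|P f t| <= K / k * expR (k * `|t|) &
  forall f g k K, continuous f -> continuous g -> 0 < k -> 0 <= K ->
     (forall t : R, `|t| <= b -> `|f t - g t| <= K * expR (k * `|t|)) ->
     forall t : R, `|t| <= b -> `|P f t - P g t| <= K / k * expR (k * `|t|)].
Proof.
move=> b0; have b1 : 0 < b + 1 by rewrite ltr_wpDl // ltW.
have /choice[Q QP] : forall f : R -> R, exists F : R -> R, continuous f ->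
    F 0 = 0 /\ forall t : R, `|t| < b + 1 -> is_derive t 1 F (f t).
  move=> f; have [cf|ncf] := pselect (continuous f); last by exists f => /ncf.
  by have [F F0 dF] := antideriv b1 cf; exists F.
have bb (t : R) : `|t| <= b -> `|t| < b + 1 by move=> h; apply: le_lt_trans h _; rewrite ltrDl.
exists (fun f t => Q f (clamp b t)); split.
- move=> f cf; have [F0 dF] := QP f cf; split; last by rewrite clamp_id // normr0 ltW.
  move=> t; apply: (@continuous_comp _ _ _ (clamp b) (Q f) t); first exact: clamp_continuous.
  by apply: is_derive_cont (dF _ _); apply/bb/clamp_norm/ltW.
- move=> f t cf tb; have [F0 dF] := QP f cf.
  apply: (@near_eq_is_derive _ _ _ (Q f)); last by apply/dF/bb/ltW.
  have : \forall s \near t, `|s| < b.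
    have /cvgrPdist_lt/(_ (b - `|t|)) := @norm_continuous _ R t.
    rewrite subr_gt0 => /(_ tb); apply: filterS => s; rewrite ltr_norml => /andP[h1 _]; lra.
  by apply: filterS => s sb; rewrite clamp_id // ltW.
- by move=> f t; rewrite (clamp_id (clamp_norm t (ltW b0))).
- move=> f k K cf k0 K0 fK t tb; rewrite clamp_id //.
  have [F0 dF] := QP f cf.
  by apply: (weighted_bound_sym k0 K0 F0 _ fK) => // s sb; apply/dF/bb.
move=> f g k K cf cg k0 K0 fg t tb; rewrite clamp_id //.
have [F0 dF] := QP f cf; have [G0 dG] := QP g cg.
apply: (@weighted_bound_sym (fun t => Q f t - Q g t) (fun t => f t - g t) b) => //.
  by rewrite F0 G0 subrr.
by move=> s sb; apply: is_deriveB; [apply: dF|apply: dG]; exact: bb.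
Qed.

(** Picard iteration. With the weight exp (k |t|) a step contracts by d be / k <= 1/2, where be
    bounds the entries of B, so the iterates converge geometrically on the whole of [-b, b] at
    once. *)
Theorem linear_ode d (B : R -> 'M[R]_d) (M0 : 'M[R]_d) (b : R) : 0 < b ->
  (forall i j, continuous (fun t => B t i j)) ->
  exists2 M : R -> 'M[R]_d, M 0 = M0 &
    forall (t : R) i j, `|t| < b -> is_derive t 1 (fun s => M s i j) ((M t *m B t) i j).
Proof.
move=> b0 cB; have [P [Pc Pd Pclamp Pbound Pdiff]] := exists_integrator b0.
pose step (M : R -> 'M[R]_d) t := \matrix_(i, j) (M0 i j + P (fun s => (M s *m B s) i j) t).
pose m k := iter k step (fun=> M0).
have mS k t i j : m k.+1 t i j = M0 i j + P (fun s => (m k s *m B s) i j) t by rewrite /m /= mxE.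
have m0 t : m 0%N t = M0 by [].
clearbody m.
have mc k i j : continuous (fun t => m k t i j).
  elim: k i j => [|k IH] i j; first by under eq_fun do rewrite m0; move=> t; exact: cvg_cst.
  under eq_fun do rewrite mS.
  move=> t; apply: cvgD; first exact: cvg_cst.
  by have [+ _] := Pc _ (mulmx_continuous IH cB (i := i) (j := j)); apply.
have mBc k i j := mulmx_continuous (mc k) cB (i := i) (j := j).
have [be be0 Bb] : exists2 be, 0 <= be & forall (t : R) i j, `|t| <= b -> `|B t i j| <= be.
  have /choice[c cP] : forall p : 'I_d * 'I_d, exists c, 0 <= c /\ forall t : R, `|t| <= b -> `|B t p.1 p.2| <= c.
    by move=> p; have [c c0 h] := bounded_on_segment b (cB p.1 p.2); exists c.
  exists (\sum_p c p); first by apply: sumr_ge0 => p _; case: (cP p).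
  move=> t i j tb; apply: le_trans (proj2 (cP (i, j)) t tb) _.
  rewrite (bigD1 (i, j)) //= lerDl; apply: sumr_ge0 => p _; by case: (cP p).
pose k := 2 * (d%:R * be) + 1.
have dbe : 0 <= d%:R * be by rewrite mulr_ge0.
have k0 : 0 < k by rewrite /k; lra.
have kbe : d%:R * be / k <= 2^-1 by rewrite ler_pdivrMr // /k; lra.
pose S := \sum_i \sum_j `|M0 i j|.
have S0 : 0 <= S by apply: sumr_ge0 => i _; apply: sumr_ge0.
have MS i j : `|M0 i j| <= S.
  rewrite /S (bigD1 i) //= (bigD1 j) //= -addrA lerDl addr_ge0 //.
    by apply: sumr_ge0.
  by apply: sumr_ge0 => i' _; apply: sumr_ge0.
pose C := d%:R * (S * be) / k.
have C0 : 0 <= C.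
  by apply: divr_ge0; [apply: mulr_ge0 => //; exact: mulr_ge0|exact: ltW].
have e1 (t : R) : 1 <= expR (k * `|t|) by rewrite -expR0 ler_expR mulr_ge0 // ltW.
have delta n i j (t : R) : `|t| <= b -> `|m n.+1 t i j - m n t i j| <= C / 2 ^+ n * expR (k * `|t|).
  elim: n i j t => [|n IH] i j t tb.
    rewrite mS (m0 t) addrC addKr expr0 divr1.
    apply: (@Pbound _ k (d%:R * (S * be)) (mBc 0%N i j) k0) => //.
      by rewrite mulr_ge0 // mulr_ge0.
    move=> s sb; apply: le_trans (_ : d%:R * (S * be) <= _).
      by rewrite m0; apply: mulmx_entry_bound => // i' j'; exact: Bb.
    by rewrite ler_peMr // mulr_ge0 // mulr_ge0.
  rewrite !mS opprD addrACA subrr add0r.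
  apply: le_trans (@Pdiff _ _ k (d%:R * (C / 2 ^+ n * be)) (mBc n.+1 i j) (mBc n i j) k0 _ _ t tb) _.
  - by rewrite mulr_ge0 // mulr_ge0 // divr_ge0 // exprn_ge0.
  - move=> s sb.
    have -> : (m n.+1 s *m B s) i j - (m n s *m B s) i j = ((m n.+1 s - m n s) *m B s) i j.
      by rewrite mulmxBl !mxE.
    apply: le_trans (_ : d%:R * ((C / 2 ^+ n * expR (k * `|s|)) * be) <= _).
      apply: mulmx_entry_bound => i' j'; last exact: Bb.
      by rewrite !mxE; exact: IH.
    by rewrite le_eqVlt; apply/orP; left; apply/eqP; ring.
  rewrite ler_pM2r ?expR_gt0 //.
  have -> : d%:R * (C / 2 ^+ n * be) / k = C / 2 ^+ n * (d%:R * be / k) by ring.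
  have -> : C / 2 ^+ n.+1 = C / 2 ^+ n * 2^-1 by rewrite exprS invfM; ring.
  by rewrite ler_wpM2l // divr_ge0 // exprn_ge0.
pose C1 := C * expR (k * b).
have delta' n i j (t : R) : `|m n.+1 t i j - m n t i j| <= C1 / 2 ^+ n.
  have mcl p : m p t i j = m p (clamp b t) i j by case: p => [|p]; rewrite ?m0 // !mS Pclamp.
  rewrite !mcl; have cb := clamp_norm t (ltW b0).
  apply: le_trans (delta n i j _ cb) _.
  rewrite /C1 mulrAC ler_wpM2r // ?invr_ge0 ?exprn_ge0 // ler_wpM2l // ler_expR.
  by rewrite ler_wpM2l // ltW.
have C10 : 0 <= C1 by rewrite mulr_ge0 // expR_ge0.
have p2 n : 0 <= 2 * C1 / 2 ^+ n by apply: divr_ge0; [exact: mulr_ge0|exact: exprn_ge0].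
have /choice[M0' M0P] : forall p : R * 'I_d * 'I_d, exists l, forall n,
    `|l - m n p.1.1 p.1.2 p.2| <= 2 * C1 / 2 ^+ n.
  by move=> p; apply: geometric_limit => n; exact: delta'.
pose M t := \matrix_(i, j) M0' (t, i, j).
have ML n t i j : `|M t i j - m n t i j| <= 2 * C1 / 2 ^+ n.
  by rewrite mxE; exact: (M0P (t, i, j)).
clearbody M.
have Mc i j : continuous (fun t => M t i j).
  by apply: (@uniform_limit_continuous (fun n t => m n t i j) _ (2 * C1)) => n; [exact: mc|move=> t; exact: ML].
have MBc i j := mulmx_continuous Mc cB (i := i) (j := j).
(* The limit satisfies the integral equation up to K / 2^n for every n, by comparison with the
   iterates of ranks n + 1 and n on the two sides. *)
have fixed (t : R) i j : `|t| <= b -> M t i j = M0 i j + P (fun s => (M s *m B s) i j) t.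
  move=> tb; apply/eqP; rewrite -subr_eq0 -normr_le0; apply/ler_addgt0Pr => e e0; rewrite add0r.
  pose K := 2 * C1 + d%:R * (2 * C1 * be) / k * expR (k * `|t|).
  have [n nK] := lt_pow2 K e0; apply: le_trans (ltW nK).
  have -> : M t i j - (M0 i j + P (fun s => (M s *m B s) i j) t) =
     (M t i j - m n.+1 t i j) - (P (fun s => (M s *m B s) i j) t - P (fun s => (m n s *m B s) i j) t).
    by rewrite mS; ring.
  apply: le_trans (ler_normB _ _) _; rewrite /K mulrDl; apply: lerD.
    apply: le_trans (ML _ _ _ _) _; apply: ler_wpM2l; first by apply: mulr_ge0.
    by rewrite lef_pV2 ?posrE ?exprn_gt0 // exprS ler_peMl ?exprn_ge0 // ler1n.
  apply: le_trans (@Pdiff _ _ k (d%:R * (2 * C1 / 2 ^+ n * be)) (MBc i j) (mBc n i j) k0 _ _ t tb) _.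
  - by apply: mulr_ge0 => //; exact: mulr_ge0.
  - move=> s sb.
    have -> : (M s *m B s) i j - (m n s *m B s) i j = ((M s - m n s) *m B s) i j.
      by rewrite mulmxBl !mxE.
    apply: le_trans (_ : d%:R * ((2 * C1 / 2 ^+ n) * be) <= _).
      apply: mulmx_entry_bound => i' j'; last exact: Bb.
      by rewrite !mxE; exact: ML.
    by rewrite ler_peMr //; apply: mulr_ge0 => //; exact: mulr_ge0.
  by rewrite le_eqVlt; apply/orP; left; apply/eqP; ring.
exists M.
  by apply/matrixP => i j; rewrite fixed ?normr0 ?ltW // (proj2 (Pc _ (MBc i j))) addr0.
move=> t i j tb; have dP := Pd _ t (MBc i j) tb.
apply: (@near_eq_is_derive _ _ _ (fun s => M0 i j + P (fun s => (M s *m B s) i j) s)); last first.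
  by rewrite -[(M t *m B t) i j]add0r; exact: is_deriveD.
have : \forall s \near t, `|s| < b.
  have /cvgrPdist_lt/(_ (b - `|t|)) := @norm_continuous _ R t.
  rewrite subr_gt0 => /(_ tb); apply: filterS => s; rewrite ltr_norml => /andP[h1 _]; lra.
by apply: filterS => s sb; rewrite fixed // ltW.
Qed.

(** The sum E of the squares satisfies E' <= k E + n e^2 with n the cardinal and k = 2 L n + 1:
    Cauchy-Schwarz gives the first term of k, and 2 |y_j| e <= y_j^2 + e^2 the second. Hence (E + n
    e^2) exp (- k t) does not increase. *)
Lemma gronwall (I : finType) (y dy : I -> R -> R) (L e : R) : 0 <= L -> 0 <= e ->
  (forall i (t : R), 0 <= t <= 1 -> is_derive t 1 (y i) (dy i t)) ->
  (forall i, y i 0 = 0) ->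
  (forall i (t : R), 0 <= t <= 1 -> `|dy i t| <= L * (\sum_k `|y k t|) + e) ->
  forall i (t : R), 0 <= t <= 1 -> (y i t) ^+ 2 <= #|I|%:R * e ^+ 2 * expR (2 * L * #|I|%:R + 1).
Proof.
move=> L0 e0 dyE y0 dyL i t /andP[t0 t1].
pose n : R := #|I|%:R; pose k := 2 * L * n + 1.
have n0 : 0 <= n by [].
have k1 : 1 <= k by rewrite /k lerDr !mulr_ge0.
pose E s := \sum_j y j s ^+ 2.
have E0 s : 0 <= E s by apply: sumr_ge0 => j _; exact: sqr_ge0.
have yE s : y i s ^+ 2 <= E s.
  by rewrite /E (bigD1 i) //= lerDl; apply: sumr_ge0 => j _; exact: sqr_ge0.
have cauchy s : (\sum_j `|y j s|) ^+ 2 <= n * E s.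
  rewrite expr2 mulr_suml.
  apply: (@le_trans _ _ (\sum_j \sum_l (y j s ^+ 2 + y l s ^+ 2) / 2)).
    apply: ler_sum => j _; rewrite mulr_sumr; apply: ler_sum => l _.
    rewrite -(real_normK (num_real (y j s))) -(real_normK (num_real (y l s))).
    by have := sqr_ge0 (`|y j s| - `|y l s|); rewrite sqrrB; lra.
  under eq_bigr do rewrite -mulr_suml big_split /= sumr_const.
  rewrite -mulr_suml big_split /= sumr_const sumrMnl.
  have -> : #|(xpredT : pred I)| = #|I| by exact: eq_card.
  rewrite -[_ *+ _]mulr_natl -/n -/(E s).
  by have -> : (n * E s + n * E s) / 2 = n * E s by field.
pose g s := (E s + n * e ^+ 2) * expR (- (k * s)).
pose dE s := \sum_j 2 * y j s * dy j s.
have dEb s : 0 <= s <= 1 -> dE s <= k * E s + n * e ^+ 2.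
  move=> s01; have h : dE s <= \sum_j (2 * L * (`|y j s| * \sum_l `|y l s|) + (y j s ^+ 2 + e ^+ 2)).
    apply: ler_sum => j _; apply: le_trans (ler_norm _) _; rewrite !normrM (ger0_norm (ler0n _ 2)).
    have h1 := dyL j s s01; have h2 := normr_ge0 (y j s).
    have h3 : `|y j s| * `|dy j s| <= `|y j s| * (L * (\sum_k `|y k s|) + e) by rewrite ler_wpM2l.
    have h4 := sqr_ge0 (`|y j s| - e); rewrite sqrrB real_normK ?num_real // in h4.
    rewrite -mulrA; apply: (@le_trans _ _ (2 * (`|y j s| * (L * (\sum_k `|y k s|) + e)))).
      by rewrite ler_pM2l.
    set A := \sum_k _ in h3 *; nra.
  apply: le_trans h _; rewrite big_split /= -mulr_sumr -mulr_suml -expr2 big_split /= sumr_const -/(E s).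
  rewrite -[e ^+ 2 *+ _]mulr_natl -/n /k.
  have := cauchy s; have : 0 <= 2 * L by lra.
  move=> l0 /(ler_wpM2l l0); nra.
have dg (s : R) : 0 <= s <= 1 -> is_derive s 1 g ((dE s - k * (E s + n * e ^+ 2)) * expR (- (k * s))).
  move=> s01.
  have d1 : is_derive s 1 E (dE s).
    have EE : E = \sum_(j < #|I|) (fun s => y (enum_val j) s ^+ 2).
      apply/funext => x; rewrite /E fct_sumE (reindex (@enum_val _ I)) //=; exact/onW_bij/enum_val_bij.
    have dEE : dE s = \sum_(j < #|I|) 2 * y (enum_val j) s * dy (enum_val j) s.
      rewrite /dE (reindex (@enum_val _ I)) //=; exact/onW_bij/enum_val_bij.
    rewrite EE dEE; apply: is_derive_sum => j.
    have := @is_deriveX _ _ (y (enum_val j)) 2 s 1 _ (dyE _ s s01).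
    by rewrite /GRing.scale /= expr1.
  have d2 : is_derive s 1 (fun x => expR (- (k * x))) (- k * expR (- (k * s))).
    have dk : is_derive s 1 (fun y => - (k * y)) (- k).
      have -> : (fun y => - (k * y)) = - k \*: id by apply/funext => x; rewrite /= -mulNr.
      by rewrite -[X in is_derive _ _ _ X]mulr1; exact: is_deriveZ.
    have := @is_derive1_comp R expR (fun y => - (k * y)) s _ _ (is_derive_expR _) dk.
    by rewrite /GRing.scale /= mulrC.
  have d3 : is_derive s 1 (fun x => E x + n * e ^+ 2) (dE s).
    by rewrite -[dE s]addr0; apply: is_deriveD.
  have := @is_deriveM _ _ _ _ s 1 _ _ d3 d2; rewrite /GRing.scale /=.
  by move=> h; rewrite [X in is_derive _ _ _ X](_ : _ = (E s + n * e ^+ 2) * (- k * expR (- (k * s))) + expR (- (k * s)) * dE s) //; ring.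
have gt : g t <= g 0.
  have [->//|tn0] := eqVneq t 0; have {}t0 : 0 < t by rewrite lt_def tn0.
  have [c /andP[c0 ct] gE] : exists2 c, 0 < c < t &
      g t - g 0 = ((dE c - k * (E c + n * e ^+ 2)) * expR (- (k * c))) * t.
    by apply: MVT0 => // s /andP[s0 st]; apply: dg; rewrite s0 (le_trans st).
  rewrite -subr_le0 gE -mulrA mulr_le0_ge0 ?mulr_ge0 ?expR_ge0 ?(ltW t0) //.
  have := dEb c; rewrite (ltW c0) (le_trans (ltW ct) t1) => /(_ isT).
  have : 0 <= n * e ^+ 2 by rewrite mulr_ge0 ?sqr_ge0.
  nra.
have E00 : E 0 = 0 by rewrite /E big1 // => j _; rewrite y0 expr0n.
move: gt; rewrite /g E00 add0r mulr0 oppr0 expR0 mulr1 expRN => gt.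
have ne : 0 <= n * e ^+ 2 by rewrite mulr_ge0 ?sqr_ge0.
have h : E t + n * e ^+ 2 <= n * e ^+ 2 * expR (k * t) by rewrite -ler_pdivrMr ?expR_gt0.
apply: le_trans (yE t) _; apply: le_trans (_ : _ <= n * e ^+ 2 * expR (k * t)) _; first lra.
by rewrite ler_wpM2l // ler_expR -/k ler_piMr // (le_trans ler01).
Qed.

End LinearODE.

(** * Uniform Taylor estimates on compact sets *)

Section Taylor.
Context {R : realType}.

Lemma bounded_on_compact (T : topologicalType) (f : T -> R) (K : set T) : compact K ->
  (forall x, K x -> {for x, continuous f}) ->
  exists2 C, 0 <= C & forall x, K x -> `|f x| <= C.
Proof.
move=> cK cf; have [K0|/set0P[x0 Kx0]] := eqVneq K set0.
  by exists 0 => // x; rewrite K0.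
have [|c _ cM] := @compact_EVT_max _ _ (fun x => `|f x|) K (ex_intro _ x0 Kx0) cK.
  apply: continuous_in_subspaceT => x /set_mem Kx.
  by apply: (@continuous_comp _ _ _ f Num.norm); [exact: cf|exact: norm_continuous].
by exists `|f c| => // x Kx; apply: cM; exact/mem_set.
Qed.

Lemma compact_ball n (rho : R) : compact [set x : 'rV[R]_n | `|x| <= rho].
Proof.
apply: bounded_closed_compact.
  exists rho; split; first exact: num_real.
  by move=> M rM x /= xr; exact: le_trans xr (ltW rM).
have -> : [set x : 'rV[R]_n | `|x| <= rho] = closed_ball_ Num.norm 0 rho.
  by apply/funext => x; rewrite /closed_ball_ /= sub0r normrN.
exact: closed_closed_ball_.
Qed.

Lemma ler_rV_norm n (x : 'rV[R]_n) i : `|x 0 i| <= `|x|.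
Proof.
rewrite [leRHS]/Num.norm /= mx_normrE.
exact: (le_bigmax _ (fun ij => `|x ij.1 ij.2|) (0, i)).
Qed.

Lemma mx_norm_le m n (A : 'M[R]_(m, n)) (c : R) : 0 <= c -> (forall i j, `|A i j| <= c) -> `|A| <= c.
Proof.
move=> c0 h; rewrite [leLHS]/Num.norm /= mx_normrE.
by apply: bigmax_le => // -[i j] _; exact: h.
Qed.

Lemma derive_coord n (W : normedModType R) (f : 'rV[R]_n -> W) x w : differentiable f x ->
  'D_w f x = \sum_i w 0 i *: 'D_(delta_mx 0 i) f x.
Proof.
move=> df; rewrite {1}(row_sum_delta w) derive_sumv //.
by apply: eq_bigr => i _; rewrite deriveZv.
Qed.

(** All three estimates come from the mean value theorem on the segment from z to z + w, so only
    this segment has to lie in K. *)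
Lemma taylor2 n (U K : set 'rV[R]_n) (f : 'rV[R]_n -> R) : open U -> compact K -> K `<=` U ->
  smooth_on U f -> exists2 C, 0 <= C & forall z w,
  (forall s : R, 0 <= s <= 1 -> K (z + s *: w)) ->
  [/\ `|f z| <= C, `|f (z + w) - f z| <= C * `|w|
    & `|f (z + w) - f z - 'D_w f z| <= C * `|w| ^+ 2].
Proof.
move=> oU cK KU sf.
have bd (g : 'rV[R]_n -> R) : smooth_on U g -> exists2 C, 0 <= C & forall x, K x -> `|g x| <= C.
  by move=> sg; apply: bounded_on_compact => // x /KU; exact: sm_continuous sg.
have [C0 C00 fC0] := bd f sf.
have /choice[C1 C1P] : forall i, exists C, 0 <= C /\ forall x, K x -> `|'D_(delta_mx 0 i) f x| <= C.
  by move=> i; have [C c0 h] := bd _ (sm_der (delta_mx 0 i) sf); exists C.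
have /choice[C2 C2P] : forall p : 'I_n * 'I_n, exists C, 0 <= C /\ forall x, K x ->
    `|'D_(delta_mx 0 p.1) ('D_(delta_mx 0 p.2) f) x| <= C.
  move=> p; have [C c0 h] := bd _ (sm_der (delta_mx 0 p.1) (sm_der (delta_mx 0 p.2) sf)).
  by exists C.
pose S1 := \sum_i C1 i; pose S2 := \sum_i \sum_j C2 (i, j).
have S10 : 0 <= S1 by apply: sumr_ge0 => i _; case: (C1P i).
have S20 : 0 <= S2 by apply: sumr_ge0 => i _; apply: sumr_ge0 => j _; case: (C2P (i, j)).
have d1 x w : K x -> `|'D_w f x| <= S1 * `|w|.
  move=> Kx; rewrite derive_coord; last exact: sm_diff sf (KU _ Kx).
  apply: le_trans (ler_norm_sum _ _ _) _; rewrite mulr_suml; apply: ler_sum => i _.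
  by rewrite normrM mulrC; apply: ler_pM => //; [case: (C1P i) => _; apply|exact: ler_rV_norm].
have d2 x w : K x -> `|'D_w ('D_w f) x| <= S2 * `|w| ^+ 2.
  move=> Kx; rewrite derive_coord; last exact: sm_diff (sm_der _ sf) (KU _ Kx).
  apply: le_trans (ler_norm_sum _ _ _) _; rewrite mulr_suml; apply: ler_sum => i _.
  have -> : 'D_(delta_mx 0 i) ('D_w f) x = \sum_j w 0 j *: 'D_(delta_mx 0 i) ('D_(delta_mx 0 j) f) x.
    have dj j : derivable ('D_(delta_mx 0 j) f) x (delta_mx 0 i).
      exact: diff_derivable (sm_diff (sm_der _ sf) (KU _ Kx)).
    rewrite (@near_eq_derive _ _ _ _ (\sum_j w 0 j \*: 'D_(delta_mx 0 j) f)).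
      by rewrite derive_sum => [|j]; [apply: eq_bigr => j _; rewrite deriveZ|exact: derivableZ].
    apply: open_near_eq oU (KU _ Kx) _ => y Uy.
    by rewrite derive_coord ?fct_sumE //; exact: sm_diff sf Uy.
  rewrite normrM expr2 mulrCA; apply: ler_pM => //; first exact: ler_rV_norm.
  apply: le_trans (ler_norm_sum _ _ _) _; rewrite mulr_suml; apply: ler_sum => j _.
  rewrite normrM mulrC; apply: ler_pM => //; last exact: ler_rV_norm.
  by case: (C2P (i, j)) => _; apply.
exists (C0 + S1 + S2); first by rewrite !addr_ge0.
move=> z w Kzw.
have Kz : K z by have := Kzw 0; rewrite scale0r addr0; apply; rewrite lexx ler01.
have w0 := normr_ge0 w; have w20 := exprn_ge0 2 w0.
have line (s : R) : 0 <= s <= 1 -> is_derive s 1 (fun s : R => f (z + s *: w)) ('D_w f (z + s *: w)).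
  by move=> s01; apply: is_derive_line; exact: sm_diff sf (KU _ (Kzw _ s01)).
split.
- by have := fC0 _ Kz; lra.
- have [c /andP[c0 c1]] := MVT0 ltr01 line.
  rewrite scale0r addr0 scale1r mulr1 => ->.
  have Kc : K (z + c *: w) by apply: Kzw; rewrite !ltW.
  by have := d1 _ w Kc; nra.
- pose phi (s : R) := f (z + s *: w) - s * 'D_w f z.
  have dphi (s : R) : 0 <= s <= 1 -> is_derive s 1 phi ('D_w f (z + s *: w) - 'D_w f z).
    move=> s01; apply: is_deriveB; first exact: line.
    have := @is_deriveM _ _ (@id R) (cst ('D_w f z)) s 1 1 0 (is_derive_id s 1) (is_derive_cst _ _ _).
    by rewrite /GRing.scale /= mulr0 add0r mulr1.
  have [c /andP[c0 c1]] := MVT0 ltr01 dphi.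
  rewrite /phi scale0r addr0 scale1r mulr1 mul0r mul1r subr0 => E.
  have -> : f (z + w) - f z - 'D_w f z = f (z + w) - 'D_w f z - f z by ring.
  rewrite E.
  have line2 (s : R) : 0 <= s <= c ->
      is_derive s 1 (fun s : R => 'D_w f (z + s *: w)) ('D_w ('D_w f) (z + s *: w)).
    move=> /andP[s0 sc]; apply: (is_derive_line (f := 'D_w f)).
    by apply: sm_diff (sm_der _ sf) (KU _ (Kzw _ _)); rewrite s0 (le_trans sc) ?ltW.
  have [c' /andP[c'0 c'c]] := MVT0 c0 line2.
  rewrite scale0r addr0 => ->.
  have Kc' : K (z + c' *: w) by apply: Kzw; rewrite !ltW // (lt_trans c'c).
  have h := d2 _ w Kc'; rewrite normrM (gtr0_norm c0).
  apply: (@le_trans _ _ (S2 * `|w| ^+ 2 * 1)).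
    by apply: ler_pM => //; rewrite ltW.
  by rewrite mulr1 ler_wpM2r // lerDr addr_ge0.
Qed.

Lemma sum_le_card n (f : 'I_n -> R) c : (forall i, f i <= c) -> \sum_i f i <= n%:R * c.
Proof.
move=> fc; apply: (@le_trans _ _ (\sum_(i < n) c)); first exact: ler_sum.
by rewrite sumr_const card_ord -[leLHS]mulr_natl.
Qed.

Lemma fin_bound (I : finType) (P : I -> R -> Prop) :
  (forall i, exists2 C, 0 <= C & P i C) -> (forall i C C', P i C -> C <= C' -> P i C') ->
  exists2 C, 0 <= C & forall i, P i C.
Proof.
move=> H mono; have /choice[c cP] : forall i, exists C, 0 <= C /\ P i C.
  by move=> i; have [C C0 PC] := H i; exists C.
exists (\sum_i c i); first by apply: sumr_ge0 => i _; case: (cP i).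
move=> i; apply: mono (proj2 (cP i)) _; rewrite (bigD1 i) //= lerDl.
by apply: sumr_ge0 => j _; case: (cP j).
Qed.

Lemma derive_entry (V : normedModType R) m n (F : V -> 'M[R]_(m, n)) x v i j : differentiable F x ->
  ('D_v F x) i j = 'D_v (fun y => F y i j) x.
Proof.
move=> dF; have lc := lincont_coord (R := R) (i : 'I_m) (j : 'I_n).
have := @derive_comp _ _ _ _ F (fun M : 'M[R]_(m, n) => M i j) x v dF (differentiable_lincont _ lc).
by rewrite (derive_lincont _ _ lc).
Qed.

Lemma is_derive_mulmx m n p (P : R -> 'M[R]_(m, n)) (Q : R -> 'M[R]_(n, p))
  (P' : 'M[R]_(m, n)) (Q' : 'M[R]_(n, p)) (t : R) :
  (forall i j, is_derive t 1 (fun s => P s i j) (P' i j)) ->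
  (forall i j, is_derive t 1 (fun s => Q s i j) (Q' i j)) ->
  forall i j, is_derive t 1 (fun s => (P s *m Q s) i j) ((P' *m Q t + P t *m Q') i j).
Proof.
move=> dP dQ i j.
have -> : (fun s => (P s *m Q s) i j) = \sum_k (fun s => P s i k * Q s k j).
  by apply/funext => s; rewrite fct_sumE mxE.
have -> : (P' *m Q t + P t *m Q') i j = \sum_k (P' i k * Q t k j + P t i k * Q' k j).
  by rewrite !mxE -big_split.
apply: is_derive_sum => k.
have := @is_deriveM _ _ (fun s => P s i k) (fun s => Q s k j) t 1 _ _ (dP i k) (dQ k j).
by rewrite /GRing.scale /= addrC (mulrC (Q t k j)).
Qed.

Lemma bounded_derivable (f df : R -> R) : (forall t : R, 0 <= t <= 1 -> is_derive t 1 f (df t)) ->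
  exists2 C, 0 <= C & forall t : R, 0 <= t <= 1 -> `|f t| <= C.
Proof.
move=> dfE; have [|C C0 h] := @bounded_on_compact _ f `[0, 1] (@segment_compact _ _ _).
  by move=> t; rewrite /= in_itv /= => /dfE /is_derive_cont.
by exists C => // t t01; apply: h; rewrite /= in_itv.
Qed.

End Taylor.

(** * Integrability of flat linear systems *)

Section FlatSystem.
Context {R : realType} {n d : nat}.
Variable A : 'I_n -> 'rV[R]_n -> 'M[R]_d.

Definition conn (w x : 'rV[R]_n) : 'M[R]_d := \sum_i w 0 i *: A i x.

(** The integrability condition of the system D_i M = M A_i: multiplied by M on the left, the two
    sides are the second derivatives of a solution in the two orders. *)
Definition flat := forall x i j,
  'D_(delta_mx 0 j) (A i) x + A j x *m A i x = 'D_(delta_mx 0 i) (A j) x + A i x *m A j x.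

Hypothesis sA : forall i, smooth_on setT (A i).

Lemma conn_lin x a u v : conn (a *: u + v) x = a *: conn u x + conn v x.
Proof.
rewrite /conn scaler_sumr -big_split; apply: eq_bigr => i _ /=.
by rewrite !mxE scalerDl scalerA.
Qed.

Lemma connD x u v : conn (u + v) x = conn u x + conn v x.
Proof. by have := conn_lin x 1 u v; rewrite !scale1r. Qed.

Lemma sm_conn w : smooth_on setT (conn w).
Proof.
apply: sm_sum => [|i]; first exact: openT.
by apply: smZ => //; [exact: openT|exact: sm_cst].
Qed.

Lemma derive_conn v w x : 'D_v (conn w) x =
  \sum_i \sum_j (w 0 i * v 0 j) *: 'D_(delta_mx 0 j) (A i) x.
Proof.
have dA i : differentiable (A i) x by exact: sm_diff (sA i) _.
have -> : conn w = \sum_i w 0 i \*: A i by apply/funext => y; rewrite fct_sumE.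
rewrite derive_sum => [|i]; last exact/derivableZ/diff_derivable.
apply: eq_bigr => i _; rewrite deriveZ; last exact: diff_derivable.
rewrite derive_coord // scaler_sumr; apply: eq_bigr => j _.
by rewrite scalerA.
Qed.

Lemma flat_conn v w x : flat -> 'D_v (conn w) x + conn v x *m conn w x =
  'D_w (conn v) x + conn w x *m conn v x.
Proof.
move=> fA; rewrite !derive_conn [X in _ = X + _]exchange_big /=.
have E u u' : conn u x *m conn u' x = \sum_i \sum_j (u' 0 i * u 0 j) *: (A j x *m A i x).
  rewrite /conn mulmx_suml; under eq_bigr do rewrite mulmx_sumr.
  rewrite exchange_big /=; apply: eq_bigr => i _; apply: eq_bigr => j _.
  by rewrite -scalemxAl -scalemxAr scalerA mulrC.
rewrite !E [X in _ = _ + X]exchange_big /= -[LHS]big_split -[RHS]big_split; apply: eq_bigr => i _ /=.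
rewrite -[LHS]big_split -[RHS]big_split; apply: eq_bigr => j _ /=.
rewrite mulrC; exact: etrans (esym (scalerDr _ _ _)) (etrans (congr1 _ (fA _ _ _)) (scalerDr _ _ _)).
Qed.

Section RadialSolution.
Variables (x0 : 'rV[R]_n) (m : 'rV[R]_n -> R -> 'M[R]_d).
Variable M0 : 'M[R]_d.
Hypothesis m_init : forall v, m v 0 = M0.
Hypothesis m_ode : forall v (t : R) a b, `|t| < 2 ->
  is_derive t 1 (fun s => m v s a b) ((m v t *m conn v (x0 + t *: v)) a b).

(** [m v] solves the system along the ray in the direction v. [D] is the error of its expected
    first-order expansion at v, and [Rm] is the source, of order |w|^2, that remains in the equation
    of [D]. *)
Let D v w (t : R) : 'M[R]_d := m (v + w) t - m v t - t *: (m v t *m conn w (x0 + t *: v)).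
Let Rm v w (t : R) : 'M[R]_d := let y := x0 + t *: (v + w) in let z := x0 + t *: v in
  (conn v y - conn v z - t *: 'D_w (conn v) z) + (conn w y - conn w z)
  + t *: (conn w z *m (conn v y - conn v z)) + t *: (conn w z *m conn w y).

(** Differentiating the term m_v A_w produces D_v A_w + A_v A_w, which flatness exchanges for D_w
    A_v + A_w A_v; the terms of first order in w then cancel. *)
Lemma radial_defect_ode v w (t : R) a b : flat -> `|t| < 2 ->
  is_derive t 1 (fun s => D v w s a b)
    ((D v w t *m conn (v + w) (x0 + t *: (v + w)) + m v t *m Rm v w t) a b).
Proof.
move=> fA t2; set y := x0 + t *: (v + w); set z := x0 + t *: v.
have dq i j : is_derive t 1 (fun s => conn w (x0 + s *: v) i j) (('D_v (conn w) z) i j).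
  have sc : smooth_on setT (fun y => conn w y i j) by apply: sm_coord; [exact: openT|exact: sm_conn].
  rewrite derive_entry; last exact: sm_diff (sm_conn w) _.
  by apply: is_derive_line; exact: sm_diff sc _.
have dm := is_derive_mulmx (fun i j => m_ode v i j t2) dq.
set X := (_ *m _ + _) in dm.
have dtm : is_derive t 1 (fun s => s * (m v s *m conn w (x0 + s *: v)) a b)
    ((m v t *m conn w z) a b + t * X a b).
  have := @is_deriveM _ _ (@id R) (fun s => (m v s *m conn w (x0 + s *: v)) a b) t 1 _ _
    (is_derive_id t 1) (dm a b).
  by rewrite /GRing.scale /= mulr1 addrC.
have dD : is_derive t 1 (fun s => D v w s a b)
    ((m (v + w) t *m conn (v + w) y) a b - (m v t *m conn v z) a b
     - ((m v t *m conn w z) a b + t * X a b)).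
  have -> : (fun s => D v w s a b) = (fun s => m (v + w) s a b - m v s a b
     - s * (m v s *m conn w (x0 + s *: v)) a b).
    apply/funext => s; rewrite /D; move: (_ *m _) => X0; by rewrite !mxE.
  exact: (is_deriveB (is_deriveB (m_ode (v + w) a b t2) (m_ode v a b t2)) dtm).
suff -> : (D v w t *m conn (v + w) y + m v t *m Rm v w t) a b =
   (m (v + w) t *m conn (v + w) y) a b - (m v t *m conn v z) a b
     - ((m v t *m conn w z) a b + t * X a b) by [].
have := flat_conn v w z fA.
rewrite /D /Rm -/y -/z /X connD -/z.
move: (conn v y) (conn w y) (conn v z) (conn w z) ('D_v (conn w) z) ('D_w (conn v) z) => P Q p q dv dw.
move: (m (v + w) t) (m v t) => a' m' /(congr1 (fun Z => m' *m Z)).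
rewrite !(mulmxDr, mulmxDl, mulmxBl, mulmxBr, mulNmx, mulmxN, =^~ scalemxAl, =^~ scalemxAr, mulmxA).
move: (m' *m q *m P) (m' *m q *m Q) (m' *m q *m p) (m' *m p *m q) (m' *m dv) (m' *m dw).
move: (m' *m P) (m' *m Q) (m' *m p) (m' *m q) (a' *m P) (a' *m Q).
move=> h1 h2 h3 h4 h5 h6 h7 h8 h9 h10 h11 h12 /matrixP/(_ a b).
rewrite !mxE => h.
have -> : h11 a b = h12 a b + h9 a b - h10 a b by lra.
by ring.
Qed.

(** Taylor estimates bound the source [Rm] by a multiple of |w|^2 uniformly along the segment, and
    Gronwall's inequality transfers the bound to the defect at time 1. *)
Lemma radial_defect v : flat -> exists2 C, 0 <= C & forall w, `|w| <= 1 -> forall a b,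
  `|(m (v + w) 1 - m v 1 - m v 1 *m conn w (x0 + v)) a b| <= C * `|w| ^+ 2.
Proof.
move=> fA; pose K := [set x : 'rV[R]_n | `|x| <= `|x0| + `|v| + 2].
have cK : compact K by exact: compact_ball.
pose T (f : 'rV[R]_n -> R) C := forall z w, (forall s : R, 0 <= s <= 1 -> K (z + s *: w)) ->
  [/\ `|f z| <= C, `|f (z + w) - f z| <= C * `|w|
    & `|f (z + w) - f z - 'D_w f z| <= C * `|w| ^+ 2].
have Tmono f C C' : T f C -> C <= C' -> T f C'.
  move=> TC CC z w Kz; have [h1 h2 h3] := TC z w Kz; split.
  - exact: le_trans CC.
  - by apply: le_trans h2 _; rewrite ler_wpM2r.
  - by apply: le_trans h3 _; rewrite ler_wpM2r // exprn_ge0.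
have Tex f : smooth_on setT f -> exists2 C, 0 <= C & T f C.
  by move=> sf; apply: taylor2 sf => //; exact: openT.
have [c c0 cP] : exists2 c, 0 <= c & forall p : 'I_n * 'I_d * 'I_d, T (fun x => A p.1.1 x p.1.2 p.2) c.
  apply: fin_bound => [p|p]; last exact: Tmono.
  by apply: Tex; apply: sm_coord; [exact: openT|exact: sA].
have [cv cv0 cvP] : exists2 c, 0 <= c & forall p : 'I_d * 'I_d, T (fun x => conn v x p.1 p.2) c.
  apply: fin_bound => [p|p]; last exact: Tmono.
  by apply: Tex; apply: sm_coord; [exact: openT|exact: sm_conn].
have [mu mu0 muP] : exists2 mu, 0 <= mu & forall p : 'I_d * 'I_d, forall t : R, 0 <= t <= 1 -> `|m v t p.1 p.2| <= mu.
  apply: fin_bound => [p|p C C' h CC t t01]; last exact: le_trans (h t t01) CC.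
  apply: bounded_derivable => t /andP[t0 t1]; apply: m_ode.
  by rewrite ger0_norm // (le_lt_trans t1) // ltr1n.
pose N := n%:R * c; have N0 : 0 <= N by rewrite mulr_ge0.
pose L := cv + N.
pose E := d%:R * (mu * (cv + N + d%:R * (N * cv) + d%:R * (N * N))).
have dd0 : 0 <= d%:R :> R by [].
have E0 : 0 <= E by rewrite /E; apply: mulr_ge0 => //; apply: mulr_ge0 => //; rewrite !addr_ge0 // !mulr_ge0.
pose G : R := #|{: 'I_d * 'I_d}|%:R * expR (2 * L * #|{: 'I_d * 'I_d}|%:R + 1).
exists (Num.sqrt G * E); first by rewrite mulr_ge0 // sqrtr_ge0.
move=> w w1 a b.
have w0 := normr_ge0 w; have w20 := exprn_ge0 2 w0.
have Kt (t s : R) : 0 <= t <= 1 -> 0 <= s <= 1 -> K (x0 + t *: v + s *: (t *: w)).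
  move=> /andP[t0 t1] /andP[s0 s1]; rewrite /K /=.
  apply: le_trans (ler_normD _ _) _; apply: lerD.
    apply: le_trans (ler_normD _ _) _; rewrite lerD2l normrZ ger0_norm //.
    by rewrite ler_piMl.
  rewrite !normrZ !ger0_norm //; apply: (@le_trans _ _ 1); last by rewrite ler1n.
  by apply: mulr_ile1 => //; [exact: mulr_ge0|exact: mulr_ile1].
have Kt1 (t s : R) : 0 <= t <= 1 -> 0 <= s <= 1 -> K (x0 + t *: v + t *: w + s *: 0).
  by move=> t01 s01; rewrite scaler0 addr0 -[t *: w]scale1r; apply: Kt => //; rewrite ler01 lexx.
have tw (t : R) : 0 <= t <= 1 -> `|t *: w| <= `|w|.
  by move=> /andP[t0 t1]; rewrite normrZ ger0_norm // ler_piMl.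
have tw2 (t : R) : 0 <= t <= 1 -> `|t *: w| ^+ 2 <= `|w| ^+ 2.
  by move=> t01; rewrite ler_sqr ?nnegrE //; exact: tw.
have cw0 (t : R) i j : 0 <= t <= 1 -> `|conn w (x0 + t *: v) i j| <= N * `|w|.
  move=> t01; rewrite /conn summxE; apply: le_trans (ler_norm_sum _ _ _) _.
  rewrite /N -mulrA; apply: sum_le_card => k.
  rewrite mxE normrM mulrC; apply: ler_pM => //; last exact: ler_rV_norm.
  by have [] := cP (k, i, j) (x0 + t *: v) (t *: w) (fun s => Kt t s t01).
have cw1 (t : R) i j : 0 <= t <= 1 -> `|conn w (x0 + t *: v + t *: w) i j| <= N * `|w|.
  move=> t01; rewrite /conn summxE; apply: le_trans (ler_norm_sum _ _ _) _.
  rewrite /N -mulrA; apply: sum_le_card => k.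
  rewrite mxE normrM mulrC; apply: ler_pM => //; last exact: ler_rV_norm.
  by have [] := cP (k, i, j) (x0 + t *: v + t *: w) 0 (fun s => Kt1 t s t01).
have cwd (t : R) i j : 0 <= t <= 1 ->
    `|(conn w (x0 + t *: v + t *: w) - conn w (x0 + t *: v)) i j| <= N * `|w| ^+ 2.
  move=> t01; rewrite /conn -sumrB summxE; apply: le_trans (ler_norm_sum _ _ _) _.
  rewrite /N -mulrA; apply: sum_le_card => k.
  rewrite -scalerBr 3!mxE normrM expr2 mulrA mulrC; apply: ler_pM => //; last exact: ler_rV_norm.
  have [_ h _] := cP (k, i, j) (x0 + t *: v) (t *: w) (fun s => Kt t s t01).
  by apply: le_trans h _; rewrite ler_wpM2l // tw.
have cv1 (t : R) i j : 0 <= t <= 1 -> `|conn v (x0 + t *: v + t *: w) i j| <= cv.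
  by move=> t01; have [] := cvP (i, j) (x0 + t *: v + t *: w) 0 (fun s => Kt1 t s t01).
have cvd (t : R) i j : 0 <= t <= 1 ->
    `|(conn v (x0 + t *: v + t *: w) - conn v (x0 + t *: v)) i j| <= cv * `|w|.
  move=> t01; have [_ h _] := cvP (i, j) (x0 + t *: v) (t *: w) (fun s => Kt t s t01).
  by rewrite 2!mxE; apply: le_trans h _; rewrite ler_wpM2l // tw.
have cvdd (t : R) i j : 0 <= t <= 1 ->
    `|(conn v (x0 + t *: v + t *: w) - conn v (x0 + t *: v) - t *: 'D_w (conn v) (x0 + t *: v)) i j| <= cv * `|w| ^+ 2.
  move=> t01; have [_ _ h] := cvP (i, j) (x0 + t *: v) (t *: w) (fun s => Kt t s t01).
  have dc : differentiable (conn v) (x0 + t *: v) by exact: sm_diff (sm_conn v) _.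
  rewrite -deriveZv // 4!mxE [X in _ - X]derive_entry //; apply: le_trans h _.
  by rewrite ler_wpM2l // tw2.
have RmE (t : R) i j : 0 <= t <= 1 ->
    `|Rm v w t i j| <= (cv + N + d%:R * (N * cv) + d%:R * (N * N)) * `|w| ^+ 2.
  move=> t01; have /andP[t0 t1] := t01.
  have tb (x : R) : `|t * x| <= `|x| by rewrite normrM ger0_norm // ler_piMl.
  rewrite /Rm [_ *: (v + w)]scalerDr (addrA x0) !mulrDl 3!mxE.
  apply: le_trans (ler_normD _ _) _; apply: lerD; last first.
    rewrite mxE; apply: le_trans (tb _) _.
    have -> : d%:R * (N * N) * `|w| ^+ 2 = d%:R * ((N * `|w|) * (N * `|w|)) by ring.
    by apply: mulmx_entry_bound => k l; [exact: cw0|exact: cw1].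
  apply: le_trans (ler_normD _ _) _; apply: lerD; last first.
    rewrite mxE; apply: le_trans (tb _) _.
    have -> : d%:R * (N * cv) * `|w| ^+ 2 = d%:R * ((N * `|w|) * (cv * `|w|)) by ring.
    by apply: mulmx_entry_bound => k l; [exact: cw0|exact: cvd].
  by apply: le_trans (ler_normD _ _) _; apply: lerD; [exact: cvdd|exact: cwd].
pose e := E * `|w| ^+ 2; have e0 : 0 <= e by rewrite mulr_ge0.
have L0 : 0 <= L by rewrite addr_ge0.
have := @gronwall _ _ (fun p t => D v w t p.1 p.2) (fun p t =>
  (D v w t *m conn (v + w) (x0 + t *: (v + w)) + m v t *m Rm v w t) p.1 p.2) L e L0 e0 _ _ _ (a, b) 1.
rewrite /= ler01 lexx => h; rewrite -mulrA -/e.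
have <- : D v w 1 = m (v + w) 1 - m v 1 - m v 1 *m conn w (x0 + v) by rewrite /D !scale1r.
rewrite -ler_sqr ?nnegrE //; last by rewrite mulr_ge0 // sqrtr_ge0.
rewrite exprMn sqr_sqrtr; last by rewrite mulr_ge0 // expR_ge0.
rewrite real_normK ?num_real // mulrAC; apply: h => //.
- move=> p t /andP[t0 t1]; apply: radial_defect_ode => //.
  by rewrite ger0_norm // (le_lt_trans t1) // ltr1n.
- by move=> p; rewrite /D scale0r subr0 !m_init subrr mxE.
- move=> [i j] t t01 /=; rewrite mxE; apply: le_trans (ler_normD _ _) _; apply: lerD; last first.
    rewrite /e /E -mulrA -mulrA; apply: mulmx_entry_bound => k l; last exact: RmE.
    exact: muP (k, l) t t01.
  rewrite mxE; apply: le_trans (ler_norm_sum _ _ _) _.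
  apply: (@le_trans _ _ (L * \sum_k `|D v w t i k|)).
    rewrite mulr_sumr; apply: ler_sum => k _; rewrite normrM mulrC; apply: ler_pM => //.
    rewrite connD mxE scalerDr addrA; apply: le_trans (ler_normD _ _) _.
    apply: lerD; first exact: cv1.
    by apply: le_trans (cw1 _ _ _ t01) _; rewrite ler_piMr.
  have -> : \sum_p `|D v w t p.1 p.2| = \sum_i' \sum_k `|D v w t i' k| by rewrite pair_bigA.
  rewrite ler_wpM2l // [leRHS](bigD1 i) //= lerDl.
  by apply: sumr_ge0 => l _; apply: sumr_ge0.
Qed.

End RadialSolution.

(** The value at x is obtained from the linear equation along the segment from x0. The quadratic
    bound on the radial defect is its differentiability at x, and the equation itself then gives
    smoothness. *)
Theorem flat_solution (x0 : 'rV[R]_n) (M0 : 'M[R]_d) : flat ->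
  exists M, [/\ M x0 = M0, smooth_on setT M & forall x v, 'D_v M x = M x *m conn v x].
Proof.
move=> fA; have /choice[m mP] : forall v : 'rV[R]_n, exists m : R -> 'M[R]_d, m 0 = M0 /\
    forall (t : R) a b, `|t| < 2 -> is_derive t 1 (fun s => m s a b) ((m t *m conn v (x0 + t *: v)) a b).
  (* The time interval (-2, 2) has all of [0, 1] in its interior. *)
  move=> v; have [|m m0 mE] := @linear_ode _ d (fun t => conn v (x0 + t *: v)) M0 2 (ltr0n _ 2).
    move=> i j t; have sc : smooth_on setT (fun y => conn v y i j).
      by apply: sm_coord; [exact: openT|exact: sm_conn].
    have := @is_derive_line _ _ _ (fun y => conn v y i j) x0 v t (sm_diff sc I).
    exact: is_derive_cont.
  by exists m.
have m0 v : m v 0 = M0 by case: (mP v).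
have mE v (t : R) a b : `|t| < 2 -> is_derive t 1 (fun s => m v s a b) ((m v t *m conn v (x0 + t *: v)) a b).
  by case: (mP v) => _; apply.
pose M x := m (x - x0) 1.
have dM x : is_diff x M (fun w => M x *m conn w x).
  pose L w := M x *m conn w x.
  have linL : linear L by move=> a u v; rewrite /L conn_lin mulmxDr scalemxAr.
  pose L' : {linear 'rV[R]_n -> 'M[R]_d} := HB.pack L (GRing.isLinear.Build R _ _ _ L linL).
  have cL : continuous L'.
    have -> : (L' : _ -> _) = (fun w => \sum_i w 0 i *: (M x *m A i x)).
      apply/funext => w; rewrite /= /L /conn mulmx_sumr.
      by apply: eq_bigr => i _; rewrite scalemxAr.
    have : smooth_on setT (fun w : 'rV[R]_n => \sum_i w 0 i *: (M x *m A i x)).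
      apply: sm_sum => [|i]; first exact: openT.
      apply: smZ => //; [exact: openT| |exact: sm_cst].
      by apply: sm_coord; [exact: openT|exact: sm_id].
    by move=> h y; exact: sm_continuous h _.
  have [C C0 hC] := radial_defect m0 mE (x - x0) fA.
  apply: (@diff_eps _ _ _ M x L' cL) => e e0.
  have [d' d'0 d'P] : exists2 d' : R, 0 < d' & d' <= 1 /\ C * d' <= e.
    exists (Num.min 1 (e / (C + 1))); first by rewrite lt_min ltr01 divr_gt0 // ltr_wpDl.
    split; first by rewrite ge_min lexx.
    have C1 : 0 < C + 1 by rewrite ltr_wpDl.
    apply: (@le_trans _ _ (C * (e / (C + 1)))); first by rewrite ler_wpM2l // ge_min lexx orbT.
    rewrite mulrA ler_pdivrMr // mulrC ler_pM2l // lerDl.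
    exact: ler01.
  have /nbhs_normP : nbhs_ball_ (ball_ Num.norm) (0 : 'rV[R]_n) (fun h => `|M (h + x) - M x - L' h| <= e * `|h|).
    exists d' => //= h; rewrite /ball_ /= sub0r normrN => hd.
    have h1 : `|h| <= 1 by apply: le_trans (ltW hd) _; case: d'P.
    have h2 : C * `|h| <= e by apply: le_trans (_ : C * d' <= _); [rewrite ler_wpM2l // ltW|case: d'P].
    apply: (@le_trans _ _ (C * `|h| ^+ 2)); last by rewrite expr2 mulrA ler_wpM2r.
    apply: mx_norm_le; first by rewrite mulr_ge0 // exprn_ge0.
    move=> i j; have := hC h h1 i j.
    have E1 : x0 + (x - x0) = x by rewrite addrC subrK.
    have E2 : x - x0 + h = h + x - x0 by rewrite addrAC (addrC x).
    by rewrite E1 E2.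
  by [].
have dME x v : 'D_v M x = M x *m conn v x.
  have d1 := dM x; have d2 : differentiable M x by case: d1.
  by rewrite deriveE // (@diff_val _ _ _ _ _ _ _ d1).
exists M; split => //.
(* In the direction 0 the equation has zero right-hand side, so its solution stays at [M0]. *)
- rewrite /M subrr; apply/matrixP => a b; apply/eqP; rewrite -subr_eq0 -sqrf_eq0.
  have c0 x : conn 0 x = 0 by rewrite /conn big1 // => i _; rewrite mxE scale0r.
  have := @gronwall _ _ (fun (p : 'I_d * 'I_d) t => m 0 t p.1 p.2 - M0 p.1 p.2) (fun p t => 0) 0 0
    (lexx 0) (lexx 0) _ _ _ (a, b) 1.
  rewrite /= ler01 lexx expr0n /= mulr0 mul0r => h; rewrite eq_le sqr_ge0 andbT; apply: h => //.
  + move=> p t /andP[t0 t1]; have t2 : `|t| < 2 by rewrite ger0_norm // (le_lt_trans t1) // ltr1n.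
    have := is_deriveB (mE 0 t p.1 p.2 t2) (is_derive_cst (M0 p.1 p.2) t 1).
    by rewrite c0 mulmx0 mxE subr0.
  + by move=> p; rewrite m0 subrr.
  + by move=> p t _; rewrite normr0 mul0r addr0.
- apply: sm_bootstrap => //; first exact: openT.
  move=> v; exists setT, (fun p : 'rV[R]_n * 'M[R]_d => p.2 *m conn v p.1); split => //; first exact: openT.
  have sid : smooth_on setT (fun p : 'rV[R]_n * 'M[R]_d => p) by exact: sm_id.
  apply: sm_mulmx; [exact: openT|by apply: sm_snd => //; exact: openT|].
  apply: (@sm_comp _ _ _ _ setT setT (conn v)) => //; try exact: openT.
    by apply: sm_fst => //; exact: openT.
  exact: sm_conn.
Qed.

End FlatSystem.

Section Small.
Context {R : realType}.

Lemma ord2P (P : 'I_2 -> Prop) : P 0 -> P 1 -> forall i, P i.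
Proof.
move=> P0 P1 [[|[|//]] lti].
  by rewrite (_ : Ordinal lti = 0) //; exact: val_inj.
by rewrite (_ : Ordinal lti = 1) //; exact: val_inj.
Qed.

Lemma ord3P (P : 'I_3 -> Prop) : P 0 -> P 1 -> P 2 -> forall i, P i.
Proof.
move=> P0 P1 P2 [[|[|[|//]]] lti].
- by rewrite (_ : Ordinal lti = 0) //; exact: val_inj.
- by rewrite (_ : Ordinal lti = 1) //; exact: val_inj.
- by rewrite (_ : Ordinal lti = 2) //; exact: val_inj.
Qed.

Lemma sum2 (V : nmodType) (F : 'I_2 -> V) : \sum_i F i = F 0 + F 1.
Proof.
by rewrite !big_ord_recl big_ord0 addr0; congr (F _ + F _); exact: val_inj.
Qed.

Lemma sum3 (V : nmodType) (F : 'I_3 -> V) : \sum_i F i = F 0 + F 1 + F 2.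
Proof.
rewrite !big_ord_recl big_ord0 addr0 addrA.
by congr (F _ + F _ + F _); exact: val_inj.
Qed.

Definition mx3 (a b c d e f g h k : R) : 'M[R]_3 :=
  \matrix_(i, j) (nth [::] [:: [:: a; b; c]; [:: d; e; f]; [:: g; h; k]] i)`_j.

Lemma mx3E (M : 'M[R]_3) : M = mx3 (M 0 0) (M 0 1) (M 0 2) (M 1 0) (M 1 1) (M 1 2) (M 2 0) (M 2 1) (M 2 2).
Proof. by apply/matrixP; elim/ord3P; elim/ord3P; rewrite mxE. Qed.

Lemma mx3_mul a b c d e f g h k a' b' c' d' e' f' g' h' k' :
  mx3 a b c d e f g h k *m mx3 a' b' c' d' e' f' g' h' k' =
  mx3 (a * a' + b * d' + c * g') (a * b' + b * e' + c * h') (a * c' + b * f' + c * k')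
      (d * a' + e * d' + f * g') (d * b' + e * e' + f * h') (d * c' + e * f' + f * k')
      (g * a' + h * d' + k * g') (g * b' + h * e' + k * h') (g * c' + h * f' + k * k').
Proof. by apply/matrixP; elim/ord3P; elim/ord3P; rewrite !mxE sum3 !mxE. Qed.

Lemma mx3_add a b c d e f g h k a' b' c' d' e' f' g' h' k' :
  mx3 a b c d e f g h k + mx3 a' b' c' d' e' f' g' h' k' =
  mx3 (a + a') (b + b') (c + c') (d + d') (e + e') (f + f') (g + g') (h + h') (k + k').
Proof. by apply/matrixP; elim/ord3P; elim/ord3P; rewrite !mxE. Qed.

Lemma mx3_tr a b c d e f g h k : (mx3 a b c d e f g h k)^T = mx3 a d g b e h c f k.
Proof. by apply/matrixP; elim/ord3P; elim/ord3P; rewrite !mxE. Qed.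

Lemma smooth_mx3 (V : normedModType R) (U : set V) (a b c d e f g h k : V -> R) : open U ->
  smooth_on U a -> smooth_on U b -> smooth_on U c -> smooth_on U d -> smooth_on U e ->
  smooth_on U f -> smooth_on U g -> smooth_on U h -> smooth_on U k ->
  smooth_on U (fun x => mx3 (a x) (b x) (c x) (d x) (e x) (f x) (g x) (h x) (k x)).
Proof.
move=> oU *; apply: sm_mx => // i j.
by under eq_fun do rewrite mxE; move: i j; elim/ord3P; elim/ord3P.
Qed.

Lemma derive_mx3 (V : normedModType R) (U : set V) (a b c d e f g h k : V -> R) x v :
  open U -> U x ->
  smooth_on U a -> smooth_on U b -> smooth_on U c -> smooth_on U d -> smooth_on U e ->
  smooth_on U f -> smooth_on U g -> smooth_on U h -> smooth_on U k ->
  'D_v (fun x => mx3 (a x) (b x) (c x) (d x) (e x) (f x) (g x) (h x) (k x)) x =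
  mx3 ('D_v a x) ('D_v b x) ('D_v c x) ('D_v d x) ('D_v e x) ('D_v f x) ('D_v g x) ('D_v h x) ('D_v k x).
Proof.
move=> oU Ux *; rewrite {1}(mx3E ('D_v _ x)).
have dM : differentiable (fun x => mx3 (a x) (b x) (c x) (d x) (e x) (f x) (g x) (h x) (k x)) x.
  by apply: sm_diff Ux; exact: smooth_mx3.
by rewrite !(derive_entry _ _ _ dM); congr mx3; congr ('D_v _ x); apply/funext => y; rewrite mxE.
Qed.

End Small.

Section Rules.
Context {R : realType} {V : normedModType R}.
Implicit Types (f g : V -> R) (x v : V).

Lemma derD (W : normedModType R) (f g : V -> W) x v : differentiable f x -> differentiable g x ->
  'D_v (fun y => f y + g y) x = 'D_v f x + 'D_v g x.
Proof. by move=> df dg; rewrite -deriveD //; exact: diff_derivable. Qed.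

Lemma derN (W : normedModType R) (f : V -> W) x v : differentiable f x ->
  'D_v (fun y => - f y) x = - 'D_v f x.
Proof. by move=> df; rewrite -deriveN //; exact: diff_derivable. Qed.

Lemma derB (W : normedModType R) (f g : V -> W) x v : differentiable f x -> differentiable g x ->
  'D_v (fun y => f y - g y) x = 'D_v f x - 'D_v g x.
Proof. by move=> df dg; rewrite -deriveB //; exact: diff_derivable. Qed.

Lemma derM f g x v : differentiable f x -> differentiable g x ->
  'D_v (fun y => f y * g y) x = 'D_v f x * g x + f x * 'D_v g x.
Proof.
move=> df dg; have := @deriveM _ _ f g x v (diff_derivable df) (diff_derivable dg).
by rewrite /GRing.scale /= => ->; rewrite addrC mulrC.
Qed.

Lemma derX f n x v : differentiable f x ->
  'D_v (fun y => f y ^+ n.+1) x = n.+1%:R * f x ^+ n * 'D_v f x.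
Proof.
move=> df; elim: n => [|n IH]; first by rewrite expr0 mulr1 mul1r; congr ('D_v _ x); apply/funext => y; rewrite expr1.
have -> : (fun y => f y ^+ n.+2) = (fun y => f y * f y ^+ n.+1) by apply/funext => y; rewrite exprS.
rewrite derM ?IH; [|exact: df|].
  by rewrite exprS [n.+2%:R]mulrS; ring.
elim: n.+1 => [|m IHm]; first by under eq_fun do rewrite expr0; exact: differentiable_cst.
have -> : (fun y => f y ^+ m.+1) = f * (fun y => f y ^+ m) by apply/funext => y; rewrite exprS.
exact: differentiableM.
Qed.

Lemma derV f x v : differentiable f x -> f x != 0 ->
  'D_v (fun y => (f y)^-1) x = - 'D_v f x / f x ^+ 2.
Proof.
move=> df f0; have := @deriveV _ _ f x v f0 (diff_derivable df).
by rewrite /GRing.scale /= => ->; rewrite mulNr mulNr mulrC.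
Qed.

Lemma derZ (W : normedModType R) (f : V -> R) (g : V -> W) x v :
  differentiable f x -> differentiable g x -> findim W ->
  'D_v (fun y => f y *: g y) x = 'D_v f x *: g x + f x *: 'D_v g x.
Proof.
move=> df dg [n [e [l [lc le]]]].
have -> : (fun y => f y *: g y) = \sum_i (fun y => (f y * l i (g y)) *: e i).
  apply/funext => y; rewrite fct_sumE {1}(le (g y)) scaler_sumr.
  by apply: eq_bigr => i _; rewrite scalerA.
have dlg i : differentiable (l i \o g) x.
  by apply: differentiable_comp => //; exact: differentiable_lincont.
have lz i : lincont (fun r : R => r *: e i).
  by split; [move=> a u w; rewrite /= scalerDl scalerA|exact: scalel_continuous].
have dm i : differentiable (fun y => f y * l i (g y)) x by apply: differentiableM => //; exact: dlg.
have dz i : differentiable (fun y => (f y * l i (g y)) *: e i) x.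
  exact: differentiable_comp (dm i) (differentiable_lincont _ (lz i)).
rewrite derive_sum => [|i]; last exact: diff_derivable.
rewrite (le (g x)) [in X in _ + X](le ('D_v g x)) !scaler_sumr -big_split; apply: eq_bigr => i _ /=.
have := @derive_comp _ _ _ _ (fun y => f y * l i (g y)) (fun r : R => r *: e i) x v (dm i)
  (differentiable_lincont _ (lz i)).
rewrite (derive_lincont _ _ (lz i)) => ->.
rewrite (derM _ df (dlg i)) (derive_comp _ dg (differentiable_lincont _ (lc i))).
by rewrite (derive_lincont _ _ (lc i)) scalerDl !scalerA.
Qed.

Lemma der_cst (W : normedModType R) (c : W) x v : 'D_v (fun _ : V => c) x = 0.
Proof. exact: derive_cst. Qed.

End Rules.

(** * The developing map of a metric of curvature 1 *)

Section Christoffel.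
Context {R : realType}.

(** The hypothesis is the equality of the mixed second derivatives of h_ij, written out by metric
    compatibility; the conclusion is the antisymmetry of the curvature with its index lowered. Free
    variables in place of derivatives leave a polynomial identity to [ring]. *)
Lemma antisym_algebra (hi0 hi1 hj0 hj1 h00 h01 h11 A B C D E F
  gi00 gi01 gi10 gi11 gj00 gj01 gj10 gj11 a b c d e f g k : R) :
  ((hi0 * A + hi1 * B + (h00 * gi00 + h01 * gi10)) * gj01 + hi0 * a
   + ((hi0 * C + hi1 * D + (h01 * gi00 + h11 * gi10)) * gj11 + hi1 * b))
  + ((hj0 * A + hj1 * B + (h00 * gj00 + h01 * gj10)) * gi01 + hj0 * c
   + ((hj0 * C + hj1 * D + (h01 * gj00 + h11 * gj10)) * gi11 + hj1 * d)) =
  ((hi0 * C + hi1 * D + (h00 * gi01 + h01 * gi11)) * gj00 + hi0 * e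
   + ((hi0 * E + hi1 * F + (h01 * gi01 + h11 * gi11)) * gj10 + hi1 * f))
  + ((hj0 * C + hj1 * D + (h00 * gj01 + h01 * gj11)) * gi00 + hj0 * g
   + ((hj0 * E + hj1 * F + (h01 * gj01 + h11 * gj11)) * gi10 + hj1 * k)) ->
  (hi0 * (a - e + (A * gj01 - C * gj00 + (C * gj11 - E * gj10)))
   + hi1 * (b - f + (B * gj01 - D * gj00 + (D * gj11 - F * gj10))))
  + (hj0 * (c - g + (A * gi01 - C * gi00 + (C * gi11 - E * gi10)))
   + hj1 * (d - k + (B * gi01 - D * gi00 + (D * gi11 - F * gi10)))) = 0.
Proof. by move/eqP; rewrite -subr_eq0 => /eqP <-; ring. Qed.

Lemma curvature_algebra (h00 h01 h11 d R00 R01 R10 R11 : R) :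
  d = h00 * h11 - h01 * h01 -> d != 0 -> h00 * R01 + h01 * R11 = d ->
  h01 * R00 + h11 * R10 + d = 0 ->
  (h00 * R00 + h01 * R10) + (h00 * R00 + h01 * R10) = 0 ->
  (h01 * R01 + h11 * R11) + (h01 * R01 + h11 * R11) = 0 ->
  [/\ R00 = h01, R01 = h11, R10 = - h00 & R11 = - h01].
Proof.
move=> dE dn0 e1 e2 e3 e4.
have e3' : h00 * R00 + h01 * R10 = 0 by lra.
have e4' : h01 * R01 + h11 * R11 = 0 by lra.
have e2' : h01 * R00 + h11 * R10 = - d by lra.
split; apply: (mulfI dn0).
- have -> : d * R00 = h11 * (h00 * R00 + h01 * R10) - h01 * (h01 * R00 + h11 * R10) by rewrite dE; ring.
  by rewrite e3' e2'; ring.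
- have -> : d * R01 = h11 * (h00 * R01 + h01 * R11) - h01 * (h01 * R01 + h11 * R11) by rewrite dE; ring.
  by rewrite e1 e4'; ring.
- have -> : d * R10 = h00 * (h01 * R00 + h11 * R10) - h01 * (h00 * R00 + h01 * R10) by rewrite dE; ring.
  by rewrite e3' e2'; ring.
- have -> : d * R11 = h00 * (h01 * R01 + h11 * R11) - h01 * (h00 * R01 + h01 * R11) by rewrite dE; ring.
  by rewrite e1 e4'; ring.
Qed.

Lemma flat_algebra (h00 h01 h11 A B C D E F a0 a1 b0 b1 e0 e1 f0 f1 p1 p2 p3 p4 : R) :
  a0 - e0 + (A * C - C * A + (C * D - E * B)) = h01 ->
  a1 - e1 + (A * E - C * C + (C * F - E * D)) = h11 ->
  b0 - f0 + (B * C - D * A + (D * D - F * B)) = - h00 ->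
  b1 - f1 + (B * E - D * C + (D * F - F * D)) = - h01 ->
  p1 = (h00 * C + h01 * D) + (h00 * C + h01 * D) ->
  p2 = (h00 * E + h01 * F) + (h01 * C + h11 * D) ->
  p3 = (h01 * A + h11 * B) + (h00 * C + h01 * D) ->
  p4 = (h01 * C + h11 * D) + (h01 * C + h11 * D) ->
  mx3 0 (- p1) (- p2) 0 e0 e1 0 f0 f1
    + mx3 0 (- h01) (- h11) 0 C E 1 D F *m mx3 0 (- h00) (- h01) 1 A C 0 B D =
  mx3 0 (- p3) (- p4) 0 a0 a1 0 b0 b1
    + mx3 0 (- h00) (- h01) 1 A C 0 B D *m mx3 0 (- h01) (- h11) 0 C E 1 D F.
Proof.
move=> r1 r2 r3 r4 -> -> -> ->; rewrite !mx3_mul !mx3_add.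
congr mx3; try ring.
- have -> : a0 = h01 + e0 - (A * C - C * A + (C * D - E * B)) by lra.
  ring.
- have -> : a1 = h11 + e1 - (A * E - C * C + (C * F - E * D)) by lra.
  ring.
- have -> : b0 = - h00 + f0 - (B * C - D * A + (D * D - F * B)) by lra.
  ring.
- have -> : b1 = - h01 + f1 - (B * E - D * C + (D * F - F * D)) by lra.
  ring.
Qed.

Variable h : 'rV[R]_2 -> 'M[R]_2.
Hypothesis sh : smooth_on setT h.
Hypothesis hsym : forall x i j, h x i j = h x j i.
Hypothesis hpos : forall x, 0 < h x 0 0 /\ 0 < h x 0 0 * h x 1 1 - h x 0 1 * h x 1 0.
Local Notation "'G' k i j" := (christoffel h k i j) (at level 10, k, i, j at next level).
Local Notation hh i j := (fun y => h y i j).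

Let oT : open [set: 'rV[R]_2]. Proof. exact: openT. Qed.

Lemma det2 (M : 'M[R]_2) : \det M = M 0 0 * M 1 1 - M 0 1 * M 1 0.
Proof.
by rewrite (expand_det_row _ 0) sum2 /cofactor !det_mx11 !mxE /= expr0 expr1 mul1r mulN1r mulrN;
   congr (_ * M _ _ - _ * M _ _); exact: val_inj.
Qed.

Lemma metric_unit x : h x \in unitmx.
Proof. by rewrite unitmxE unitfE det2 lt0r_neq0 //; case: (hpos x). Qed.

Lemma sm_entry i j : smooth_on setT (hh i j).
Proof. exact: sm_coord. Qed.

Lemma invmx2 x : invmx (h x) = \matrix_(i, j)
  ((h x 0 0 * h x 1 1 - h x 0 1 * h x 1 0)^-1 *
   (nth [::] [:: [:: h x 1 1; - h x 0 1]; [:: - h x 1 0; h x 0 0]] i)`_j).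
Proof.
set N := \matrix_(i, j) _; have d0 : h x 0 0 * h x 1 1 - h x 0 1 * h x 1 0 != 0.
  by rewrite lt0r_neq0 //; case: (hpos x).
have hN : h x *m N = 1%:M.
  by apply/matrixP; elim/ord2P; elim/ord2P; rewrite !mxE sum2 !mxE /=; field.
by rewrite -[LHS]mulmx1 -hN mulKmx // metric_unit.
Qed.

Lemma sm_christoffel k i j : smooth_on setT (G k i j).
Proof.
have sp a b c : smooth_on setT (partial a (hh b c)) by apply: sm_derx; exact: sm_entry.
apply: smM => //; first exact: sm_cst.
apply: sm_sum => // l; apply: smM => //.
  under eq_fun do rewrite invmx2 mxE.
  apply: smM => //.
    apply: smV => //; first by move=> x _; rewrite lt0r_neq0 //; case: (hpos x).
    by apply: smB => //; apply: smM => //; exact: sm_entry.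
  by move: k l; elim/ord2P; elim/ord2P => /=; try (apply: smN => //); exact: sm_entry.
by apply: smB => //; apply: smD.
Qed.

Lemma christoffel_sym k i j : G k i j = G k j i.
Proof.
apply/funext => x.
have E l : partial l (hh i j) x = partial l (hh j i) x.
  by congr (partial l _ x); apply/funext => y; rewrite hsym.
rewrite /christoffel; congr (_ * _); apply: eq_bigr => l _.
by rewrite (E l) (addrC (partial i (hh j l) x)).
Qed.

Lemma lower_christoffel i a j x : \sum_l h x i l * G l a j x =
  2^-1 * (partial a (hh j i) x + partial j (hh a i) x - partial i (hh a j) x).
Proof.
rewrite /christoffel; under eq_bigr do rewrite mulrCA mulr_sumr.
rewrite -mulr_sumr exchange_big /=; congr (_ * _).
under eq_bigr do under eq_bigr do rewrite mulrA.
under eq_bigr do rewrite -mulr_suml.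
have E k : \sum_l h x i l * invmx (h x) l k = (i == k)%:R.
  by have /matrixP/(_ i k) := mulmxV (metric_unit x); rewrite !mxE.
by under eq_bigr do rewrite E; rewrite (bigD1 i) //= eqxx mul1r big1 ?addr0 // => k /negbTE;
   rewrite eq_sym => ->; rewrite mul0r.
Qed.

Lemma metric_compat a i j x : partial a (hh i j) x =
  (h x i 0 * G 0 a j x + h x i 1 * G 1 a j x) + (h x j 0 * G 0 a i x + h x j 1 * G 1 a i x).
Proof.
rewrite -(sum2 (fun l => h x i l * G l a j x)) -(sum2 (fun l => h x j l * G l a i x)).
rewrite !lower_christoffel.
have E b c d : partial b (hh c d) x = partial b (hh d c) x.
  by congr (partial b _ x); apply/funext => y; rewrite hsym.
by rewrite (E a j i) (E i a j) (E j a i); field.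
Qed.

Lemma derive_metric_compat a b i j x : partial b (partial a (hh i j)) x =
  (partial b (hh i 0) x * G 0 a j x + h x i 0 * partial b (G 0 a j) x
   + (partial b (hh i 1) x * G 1 a j x + h x i 1 * partial b (G 1 a j) x))
  + (partial b (hh j 0) x * G 0 a i x + h x j 0 * partial b (G 0 a i) x
   + (partial b (hh j 1) x * G 1 a i x + h x j 1 * partial b (G 1 a i) x)).
Proof.
rewrite {1}/partial (_ : partial a _ = (fun x =>
  (h x i 0 * G 0 a j x + h x i 1 * G 1 a j x) + (h x j 0 * G 0 a i x + h x j 1 * G 1 a i x))); last first.
  by apply/funext => y; exact: metric_compat.
have dG k c d : differentiable (G k c d) x by exact: sm_diff (sm_christoffel k c d) I.
have dh c d : differentiable (hh c d) x by exact: sm_diff (sm_entry c d) I.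
have dp c d k e f : differentiable (fun y => h y c d * G k e f y) x by exact: differentiableM.
rewrite derD; [|exact: differentiableD|exact: differentiableD].
rewrite (derD _ (dp i 0 0 a j) (dp i 1 1 a j)) (derD _ (dp j 0 0 a i) (dp j 1 1 a i)).
by rewrite !(derM _ (dh _ _) (dG _ _ _)).
Qed.

Lemma riemann_antisym i j x :
  (h x i 0 * riemann h 0 j 0 1 x + h x i 1 * riemann h 1 j 0 1 x) +
  (h x j 0 * riemann h 0 i 0 1 x + h x j 1 * riemann h 1 i 0 1 x) = 0.
Proof.
have sw : partial 0 (partial 1 (hh i j)) x = partial 1 (partial 0 (hh i j)) x.
  by apply: (schwarz _ _ _ oT) => //; exact: sm_entry.
move: sw; rewrite !derive_metric_compat !metric_compat /riemann !sum2.
rewrite !(christoffel_sym _ 1 0) (hsym x 1 0).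
exact: antisym_algebra.
Qed.

Hypothesis hcurv : forall x, gauss_curvature h x = 1.

(** This is R(X, Y) Z = <Y, Z> X - <X, Z> Y. In dimension two the endomorphism R(d_0, d_1), skew for
    h, is determined by one number, which the Gauss curvature fixes. *)
Lemma riemann_curv1 x :
  [/\ riemann h 0 0 0 1 x = h x 0 1, riemann h 0 1 0 1 x = h x 1 1,
      riemann h 1 0 0 1 x = - h x 0 0 & riemann h 1 1 0 1 x = - h x 0 1].
Proof.
have [h0 d0] := hpos x.
have R01 : h x 0 0 * riemann h 0 1 0 1 x + h x 0 1 * riemann h 1 1 0 1 x =
    h x 0 0 * h x 1 1 - h x 0 1 * h x 1 0.
  have := hcurv x; rewrite /gauss_curvature sum2 det2 => E.
  by rewrite -[RHS]mul1r -E divfK // lt0r_neq0.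
have R10 := riemann_antisym 1 0 x; rewrite R01 in R10.
have R00 := riemann_antisym 0 0 x.
have R11 := riemann_antisym 1 1 x.
move: R01 R10 R00 R11 d0; rewrite (hsym x 1 0) => R01 R10 R00 R11 d0.
exact: (curvature_algebra erefl (lt0r_neq0 d0) R01 R10 R00 R11).
Qed.

(** It multiplies on the right the rows (f, f_0, f_1), one for each coordinate f of a map to R^3:
    the first column encodes d_i f = f_i, the other two the Hessian equation. *)
Definition hess_conn (i : 'I_2) (x : 'rV[R]_2) : 'M[R]_3 :=
  mx3 0 (- h x i 0) (- h x i 1)
      (i == 0)%:R (G 0 i 0 x) (G 0 i 1 x)
      (i == 1)%:R (G 1 i 0 x) (G 1 i 1 x).

Lemma sm_hess_conn i : smooth_on setT (hess_conn i).
Proof.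
by apply: smooth_mx3 => //; try exact: sm_cst; try exact: sm_christoffel;
   apply: smN => //; exact: sm_entry.
Qed.

Lemma derive_hess_conn i j x : 'D_(delta_mx 0 j) (hess_conn i) x =
  mx3 0 (- partial j (hh i 0) x) (- partial j (hh i 1) x)
      0 (partial j (G 0 i 0) x) (partial j (G 0 i 1) x)
      0 (partial j (G 1 i 0) x) (partial j (G 1 i 1) x).
Proof.
have dh c d : differentiable (hh c d) x by exact: sm_diff (sm_entry c d) I.
rewrite (derive_mx3 _ oT) //; try exact: sm_cst; try exact: sm_christoffel;
  try (apply: smN => //; exact: sm_entry).
by rewrite !der_cst !derN.
Qed.

(** Flatness in the first row is metric compatibility, in the first column the symmetry of the
    metric and of the Christoffel symbols, and in the remaining block the value 1 of the
    curvature. *)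
Lemma hess_conn_flat : flat hess_conn.
Proof.
have H x : 'D_(delta_mx 0 1) (hess_conn 0) x + hess_conn 1 x *m hess_conn 0 x =
    'D_(delta_mx 0 0) (hess_conn 1) x + hess_conn 0 x *m hess_conn 1 x.
  have [] := riemann_curv1 x; rewrite /riemann !sum2 => r1 r2 r3 r4.
  have p1 := metric_compat 1 0 0 x; have p2 := metric_compat 1 0 1 x.
  have p3 := metric_compat 0 1 0 x; have p4 := metric_compat 0 1 1 x.
  move: r1 r2 r3 r4 p1 p2 p3 p4; rewrite !derive_hess_conn /hess_conn /=.
  rewrite !(christoffel_sym _ 1 0) (hsym x 1 0) => r1 r2 r3 r4 p1 p2 p3 p4.
  exact: (flat_algebra r1 r2 r3 r4 p1 p2 p3 p4).
move=> x i j; move: i j; elim/ord2P; elim/ord2P; [reflexivity|exact: H|exact/esym/H|reflexivity].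
Qed.

End Christoffel.

Section Columns.
Context {R : realType}.

Definition cols (u v w : 'rV[R]_3) : 'M[R]_3 :=
  mx3 (u 0 0) (v 0 0) (w 0 0) (u 0 1) (v 0 1) (w 0 1) (u 0 2) (v 0 2) (w 0 2).

Lemma mx3_congr (a b c d e f g h k a' b' c' d' e' f' g' h' k' : R) :
  a = a' -> b = b' -> c = c' -> d = d' -> e = e' -> f = f' -> g = g' -> h = h' -> k = k' ->
  mx3 a b c d e f g h k = mx3 a' b' c' d' e' f' g' h' k'.
Proof. by move=> -> -> -> -> -> -> -> -> ->. Qed.

Lemma dot3 (u v : 'rV[R]_3) : dot u v = u 0 0 * v 0 0 + u 0 1 * v 0 1 + u 0 2 * v 0 2.
Proof. exact: sum3. Qed.

Lemma cols_gram u v w u' v' w' : (cols u v w)^T *m cols u' v' w' =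
  mx3 (dot u u') (dot u v') (dot u w') (dot v u') (dot v v') (dot v w') (dot w u') (dot w v') (dot w w').
Proof. by rewrite mx3_tr mx3_mul !dot3. Qed.

Lemma cols_inj u v w u' v' w' : cols u v w = cols u' v' w' -> [/\ u = u', v = v' & w = w'].
Proof.
move=> /matrixP E; split; apply/rowP; elim/ord3P.
- by have := E 0 0; rewrite !mxE.
- by have := E 1 0; rewrite !mxE.
- by have := E 2 0; rewrite !mxE.
- by have := E 0 1; rewrite !mxE.
- by have := E 1 1; rewrite !mxE.
- by have := E 2 1; rewrite !mxE.
- by have := E 0 2; rewrite !mxE.
- by have := E 1 2; rewrite !mxE.
- by have := E 2 2; rewrite !mxE.
Qed.

Lemma det_mx3 (a b c d e f g h k : R) : \det (mx3 a b c d e f g h k) =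
  a * (e * k - f * h) - b * (d * k - f * g) + c * (d * h - e * g).
Proof.
rewrite (expand_det_row _ 0) sum3 /cofactor !det2 !mxE /=; ring.
Qed.

Lemma derive_dot (V : normedModType R) n (f g : V -> 'rV[R]_n) x v :
  differentiable f x -> differentiable g x ->
  'D_v (fun y => dot (f y) (g y)) x = dot ('D_v f x) (g x) + dot (f x) ('D_v g x).
Proof.
move=> df dg; have dfi i : differentiable (fun y => f y 0 i) x.
  exact: differentiable_comp df (differentiable_lincont _ (lincont_coord 0 i)).
have dgi i : differentiable (fun y => g y 0 i) x.
  exact: differentiable_comp dg (differentiable_lincont _ (lincont_coord 0 i)).
have -> : (fun y => dot (f y) (g y)) = \sum_i (fun y => f y 0 i * g y 0 i).
  by apply/funext => y; rewrite fct_sumE.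
rewrite derive_sum => [|i]; last by apply: diff_derivable; exact: differentiableM.
rewrite /dot -big_split; apply: eq_bigr => i _ /=.
by rewrite (derM _ (dfi i) (dgi i)) !derive_entry.
Qed.

Lemma derive_cols (V : normedModType R) (U : set V) (u v w : V -> 'rV[R]_3) x z : open U -> U x ->
  smooth_on U u -> smooth_on U v -> smooth_on U w ->
  'D_z (fun y => cols (u y) (v y) (w y)) x = cols ('D_z u x) ('D_z v x) ('D_z w x).
Proof.
move=> oU Ux su sv sw; rewrite (derive_mx3 _ oU Ux); try exact: sm_coord.
exact: (mx3_congr (esym (derive_entry z 0 0 (sm_diff su Ux)))
  (esym (derive_entry z 0 0 (sm_diff sv Ux)))
  (esym (derive_entry z 0 0 (sm_diff sw Ux)))
  (esym (derive_entry z 0 1 (sm_diff su Ux)))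
  (esym (derive_entry z 0 1 (sm_diff sv Ux)))
  (esym (derive_entry z 0 1 (sm_diff sw Ux)))
  (esym (derive_entry z 0 2 (sm_diff su Ux)))
  (esym (derive_entry z 0 2 (sm_diff sv Ux)))
  (esym (derive_entry z 0 2 (sm_diff sw Ux)))).
Qed.

Lemma dotC n (u v : 'rV[R]_n) : dot u v = dot v u.
Proof. by apply: eq_bigr => i _; rewrite mulrC. Qed.

(** Gronwall's inequality without source. It serves with P = 0 to compare two jets along a segment,
    and with P the transpose of Q to propagate a Gram matrix. *)
Lemma sylvester_unique d (X P Q : R -> 'M[R]_d) (c : R) : 0 <= c ->
  (forall (t : R) i j, 0 <= t <= 1 ->
     is_derive t 1 (fun s => X s i j) ((P t *m X t + X t *m Q t) i j)) ->
  (forall (t : R) i j, 0 <= t <= 1 -> `|P t i j| <= c /\ `|Q t i j| <= c) ->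
  X 0 = 0 -> X 1 = 0.
Proof.
move=> c0 dX PQ X0; apply/matrixP => a b; rewrite mxE.
apply/eqP; rewrite -sqrf_eq0 eq_le sqr_ge0 andbT.
have := @gronwall _ _ (fun (p : 'I_d * 'I_d) t => X t p.1 p.2)
  (fun p t => (P t *m X t + X t *m Q t) p.1 p.2) (2 * c) 0 (mulr_ge0 (ler0n _ 2) c0) (lexx 0) _ _ _ (a, b) 1.
rewrite /= ler01 lexx expr0n /= mulr0 mul0r; apply => //.
- by move=> p; rewrite X0 mxE.
move=> [i j] t t01 /=; rewrite addr0 mxE; apply: le_trans (ler_normD _ _) _.
have -> : \sum_p `|X t p.1 p.2| = \sum_i' \sum_k `|X t i' k| by rewrite pair_bigA.
set S := \sum_i' _; have -> : 2 * c * S = c * S + c * S by ring.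
apply: lerD.
- rewrite mxE; apply: le_trans (ler_norm_sum _ _ _) _.
  rewrite /S mulr_sumr; apply: ler_sum => k _; rewrite normrM; apply: ler_pM => //.
    by case: (PQ t i k t01).
  by rewrite (bigD1 j) //= lerDl; apply: sumr_ge0.
- rewrite mxE; apply: le_trans (ler_norm_sum _ _ _) _.
  apply: (@le_trans _ _ (c * \sum_k `|X t i k|)).
    rewrite mulr_sumr; apply: ler_sum => k _; rewrite normrM mulrC; apply: ler_pM => //.
    by case: (PQ t k j t01).
  rewrite ler_wpM2l // /S [leRHS](bigD1 i) //= lerDl.
  by apply: sumr_ge0 => l _; apply: sumr_ge0.
Qed.

Lemma lower_algebra (h00 h01 h10 h11 a0 a1 u w G00 G01 G10 G11 : R) :
  mx3 1 0 0 0 h00 h01 0 h10 h11 *m mx3 0 a0 a1 u G00 G01 w G10 G11 =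
  mx3 0 a0 a1 (h00 * u + h01 * w) (h00 * G00 + h01 * G10) (h00 * G01 + h01 * G11)
      (h10 * u + h11 * w) (h10 * G00 + h11 * G10) (h10 * G01 + h11 * G11).
Proof. by rewrite mx3_mul; congr mx3; ring. Qed.

Lemma compat_algebra (h00 h01 h11 a0 a1 u w G00 G01 G10 G11 p00 p01 p10 p11 : R) :
  p00 = h00 * G00 + h01 * G10 + (h00 * G00 + h01 * G10) ->
  p01 = h00 * G01 + h01 * G11 + (h01 * G00 + h11 * G10) ->
  p10 = h01 * G00 + h11 * G10 + (h00 * G01 + h01 * G11) ->
  p11 = h01 * G01 + h11 * G11 + (h01 * G01 + h11 * G11) ->
  a0 = h00 * u + h01 * w -> a1 = h01 * u + h11 * w ->
  mx3 0 0 0 0 p00 p01 0 p10 p11 =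
  (mx3 0 (- a0) (- a1) u G00 G01 w G10 G11)^T *m mx3 1 0 0 0 h00 h01 0 h01 h11
  + mx3 1 0 0 0 h00 h01 0 h01 h11 *m mx3 0 (- a0) (- a1) u G00 G01 w G10 G11.
Proof. by move=> -> -> -> -> -> ->; rewrite mx3_tr !mx3_mul mx3_add; congr mx3; ring. Qed.

Lemma koszul_algebra (p1 p2 p3 ijk ikj jik jki kij kji : R) :
  p1 = ijk + ikj -> p2 = jik + jki -> p3 = kij + kji ->
  kij = ikj -> kji = jki -> jik = ijk -> ijk = 2^-1 * (p1 + p2 - p3).
Proof. by move=> -> -> -> -> -> ->; field. Qed.

End Columns.

(** * Local isometries into the unit sphere as solutions of a flat system *)

Section Developing.
Context {R : realType}.
Variable h : 'rV[R]_2 -> 'M[R]_2.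
Hypothesis sh : smooth_on setT h.
Hypothesis hsym : forall x i j, h x i j = h x j i.
Hypothesis hpos : forall x, 0 < h x 0 0 /\ 0 < h x 0 0 * h x 1 1 - h x 0 1 * h x 1 0.
Local Notation e_ i := (delta_mx 0 i : 'rV[R]_2).
Local Notation G := (christoffel h).
Local Notation A := (hess_conn h).
Let oT : open [set: 'rV[R]_2]. Proof. exact: openT. Qed.

Definition jet (Phi : 'rV[R]_2 -> 'rV[R]_3) (x : 'rV[R]_2) : 'M[R]_3 :=
  cols (Phi x) ('D_(e_ 0) Phi x) ('D_(e_ 1) Phi x).

(** The Gram matrix that the columns Phi, D_0 Phi, D_1 Phi of [jet] must have, since a unit vector
    is orthogonal to its derivatives. *)
Definition ext_metric (x : 'rV[R]_2) : 'M[R]_3 :=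
  mx3 1 0 0 0 (h x 0 0) (h x 0 1) 0 (h x 1 0) (h x 1 1).

Definition local_isometry (U : set 'rV[R]_2) (Phi : 'rV[R]_2 -> 'rV[R]_3) :=
  [/\ smooth_on U Phi, forall x, U x -> dot (Phi x) (Phi x) = 1
    & forall x i j, U x -> dot ('D_(e_ i) Phi x) ('D_(e_ j) Phi x) = h x i j].

Lemma ext_metric_unit x : ext_metric x \in unitmx.
Proof.
rewrite unitmxE unitfE det_mx3 !mul0r !mul1r !subr0 addr0.
by rewrite lt0r_neq0 //; case: (hpos x).
Qed.

Lemma lower_hess_conn i x : ext_metric x *m A i x =
  mx3 0 (- h x i 0) (- h x i 1)
      (h x 0 i) (2^-1 * (partial i (fun y => h y 0 0) x + partial 0 (fun y => h y i 0) x - partial 0 (fun y => h y i 0) x))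
                (2^-1 * (partial i (fun y => h y 1 0) x + partial 1 (fun y => h y i 0) x - partial 0 (fun y => h y i 1) x))
      (h x 1 i) (2^-1 * (partial i (fun y => h y 0 1) x + partial 0 (fun y => h y i 1) x - partial 1 (fun y => h y i 0) x))
                (2^-1 * (partial i (fun y => h y 1 1) x + partial 1 (fun y => h y i 1) x - partial 1 (fun y => h y i 1) x)).
Proof.
have l j k : h x j 0 * G 0 i k x + h x j 1 * G 1 i k x =
    2^-1 * (partial i (fun y => h y k j) x + partial k (fun y => h y i j) x - partial j (fun y => h y i k) x).
  by rewrite -(lower_christoffel hpos) sum2.
have e j : h x j 0 * (i == 0)%:R + h x j 1 * (i == 1)%:R = h x j i.
  by move: i {l}; elim/ord2P; rewrite /= ?mulr1 ?mulr0 ?addr0 ?add0r.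
by rewrite [LHS]lower_algebra !l !e.
Qed.

Lemma ext_metric_compat i x : 'D_(e_ i) ext_metric x =
  (A i x)^T *m ext_metric x + ext_metric x *m A i x.
Proof.
have sc j k : smooth_on setT (fun y => h y j k) by exact: sm_entry.
rewrite (derive_mx3 _ oT) //; try exact: sm_cst.
have m j k := metric_compat hsym hpos i j k x.
have e j : h x i j = h x 0 j * (i == 0)%:R + h x 1 j * (i == 1)%:R.
  by move: i {m}; elim/ord2P; rewrite /= ?mulr1 ?mulr0 ?addr0 ?add0r.
have m00 := m 0 0; have m01 := m 0 1; have m10 := m 1 0; have m11 := m 1 1.
have e0 := e 0; have e1 := e 1.
move: m00 m01 m10 m11 e0 e1; rewrite !der_cst /hess_conn /ext_metric (hsym x 1 0) => m00 m01 m10 m11 e0 e1.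
exact: (compat_algebra m00 m01 m10 m11 e0 e1).
Qed.

Lemma conn_e (B : 'I_2 -> 'rV[R]_2 -> 'M[R]_3) i x : conn B (e_ i) x = B i x.
Proof.
rewrite /conn (bigD1 i) //= mxE !eqxx scale1r big1 ?addr0 // => j ji.
by rewrite mxE eqxx (negbTE ji) scale0r.
Qed.

Lemma conn_bounded (B : 'I_2 -> 'rV[R]_2 -> 'M[R]_3) p v : (forall i, smooth_on setT (B i)) ->
  exists2 c, 0 <= c & forall (t : R) i j, 0 <= t <= 1 -> `|conn B v (p + t *: v) i j| <= c.
Proof.
move=> sB; have [c c0 cP] : exists2 c, 0 <= c & forall q : 'I_3 * 'I_3, forall t : R, 0 <= t <= 1 -> `|conn B v (p + t *: v) q.1 q.2| <= c.
  apply: fin_bound => [q|q C C' hC CC t t01]; last exact: le_trans (hC t t01) CC.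
  have sc : smooth_on setT (fun y => conn B v y q.1 q.2) by apply: sm_coord => //; exact: sm_conn.
  apply: bounded_derivable => t _; apply: (is_derive_line (f := fun y => conn B v y q.1 q.2)).
  exact: sm_diff sc I.
by exists c => // t i j; exact: (cP (i, j)).
Qed.

Lemma sm_jet U Phi : open U -> smooth_on U Phi -> smooth_on U (jet Phi).
Proof.
move=> oU sP; apply: (smooth_mx3 oU); apply: (sm_coord _ _ oU); first [exact: sP|exact: sm_der sP].
Qed.

(** The second derivatives of Phi have inner products - h_ij with Phi and, by Koszul's formula, the
    Christoffel symbols of the first kind with the D_k Phi. As the jet is invertible, these inner
    products determine them. *)
Lemma gauss_formula U Phi x v : open U -> U x -> local_isometry U Phi ->
  'D_v (jet Phi) x = jet Phi x *m conn A v x.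
Proof.
move=> oU Ux [sP P1 Ph].
have sd i : smooth_on U ('D_(e_ i) Phi) by exact: sm_der.
have sj : smooth_on U (jet Phi) by exact: sm_jet.
have dP y : U y -> differentiable Phi y by exact: sm_diff sP.
have dd i y : U y -> differentiable ('D_(e_ i) Phi) y by exact: sm_diff (sd i).
have near (f : 'rV[R]_2 -> R) g i : (forall y, U y -> f y = g y) -> 'D_(e_ i) f x = 'D_(e_ i) g x.
  by move=> fg; apply: near_eq_derive; exact: open_near_eq fg.
have o1 i y : U y -> dot (Phi y) ('D_(e_ i) Phi y) = 0.
  move=> Uy; have : 'D_(e_ i) (fun z => dot (Phi z) (Phi z)) y = 0.
    rewrite (@near_eq_derive _ _ _ _ (fun _ : 'rV[R]_2 => 1 : R)) ?der_cst //.
    exact: open_near_eq P1.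
  by rewrite (derive_dot _ (dP _ Uy) (dP _ Uy)) (dotC (Phi y)); lra.
have o2 i j : dot (Phi x) ('D_(e_ i) ('D_(e_ j) Phi) x) = - h x i j.
  have := near _ _ i (o1 j); rewrite der_cst (derive_dot _ (dP _ Ux) (dd j _ Ux)) (Ph x i j Ux).
  lra.
pose S i j k := dot ('D_(e_ k) Phi x) ('D_(e_ i) ('D_(e_ j) Phi) x).
have Ssym i j k : S i j k = S j i k.
  by apply: (congr1 (dot _)); exact: schwarz _ _ _ oU Ux sP.
have Sh i j k : partial k (fun y => h y i j) x = S k i j + S k j i.
  rewrite /partial -(near _ _ k (fun y => Ph y i j)) (derive_dot _ (dd i _ Ux) (dd j _ Ux)).
  by rewrite dotC.
have o3 i j k : S i j k = 2^-1 * (partial i (fun y => h y j k) x + partial j (fun y => h y i k) x - partial k (fun y => h y i j) x).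
  exact: (koszul_algebra (Sh j k i) (Sh i k j) (Sh i j k) (Ssym k i j) (Ssym k j i) (Ssym j i k)).
have o1' i : dot ('D_(e_ i) Phi x) (Phi x) = 0 by rewrite dotC; exact: o1.
have key i : 'D_(e_ i) (jet Phi) x = jet Phi x *m A i x.
  have jE : 'D_(e_ i) (jet Phi) x = cols ('D_(e_ i) Phi x) ('D_(e_ i) ('D_(e_ 0) Phi) x) ('D_(e_ i) ('D_(e_ 1) Phi) x).
    exact: (derive_cols _ oU Ux sP (sd 0) (sd 1)).
  have NN : (jet Phi x)^T *m jet Phi x = ext_metric x.
    rewrite /jet cols_gram /ext_metric.
    exact: (mx3_congr (P1 x Ux) (o1 0 x Ux) (o1 1 x Ux) (o1' 0) (Ph x 0 0 Ux) (Ph x 0 1 Ux)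
      (o1' 1) (Ph x 1 0 Ux) (Ph x 1 1 Ux)).
  have N'N : (jet Phi x)^T *m 'D_(e_ i) (jet Phi) x = ext_metric x *m A i x.
    rewrite jE /jet cols_gram lower_hess_conn.
    exact: (mx3_congr (o1 i x Ux) (o2 i 0) (o2 i 1) (Ph x 0 i Ux) (o3 i 0 0) (o3 i 1 0)
      (Ph x 1 i Ux) (o3 i 0 1) (o3 i 1 1)).
  have u : (jet Phi x)^T \in unitmx.
    by have := ext_metric_unit x; rewrite -NN unitmx_mul => /andP[].
  by rewrite -[LHS](mulKmx u) N'N -NN -!mulmxA mulKmx.
have dj : differentiable (jet Phi) x by exact: sm_diff sj Ux.
rewrite derive_coord // /conn mulmx_sumr; apply: eq_bigr => i _.
by rewrite key scalemxAr.
Qed.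

(** Both jets solve the linear equation of [gauss_formula] along the segment, with the same initial
    value. *)
Lemma isometry_unique U Phi Phi' p v : open U -> local_isometry U Phi -> local_isometry U Phi' ->
  (forall t : R, 0 <= t <= 1 -> U (p + t *: v)) -> jet Phi p = jet Phi' p ->
  jet Phi (p + v) = jet Phi' (p + v).
Proof.
move=> oU iP iP' Ut jp; have sj Psi : local_isometry U Psi -> smooth_on U (jet Psi).
  by case=> sP _ _; exact: sm_jet.
have [c c0 cP] := conn_bounded p v (sm_hess_conn sh hpos).
pose X (t : R) := jet Phi (p + t *: v) - jet Phi' (p + t *: v).
suff : X 1 = 0 by rewrite /X scale1r => /eqP; rewrite subr_eq0 => /eqP.
apply: (@sylvester_unique _ _ _ (fun=> 0) (fun t => conn A v (p + t *: v)) c c0).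
- move=> t i j t01; have Ux := Ut t t01.
  have dl Psi (iPsi : local_isometry U Psi) : is_derive t 1 (fun s => jet Psi (p + s *: v) i j)
      ((jet Psi (p + t *: v) *m conn A v (p + t *: v)) i j).
    have sc : smooth_on U (fun y => jet Psi y i j) := sm_coord i j oU (sj Psi iPsi).
    rewrite -(gauss_formula _ oU Ux iPsi) (derive_entry _ _ _ (sm_diff (sj _ iPsi) Ux)).
    by apply: (is_derive_line (f := fun y => jet Psi y i j)); exact: sm_diff sc Ux.
  have -> : (fun s => X s i j) = (fun s => jet Phi (p + s *: v) i j - jet Phi' (p + s *: v) i j).
    by apply/funext => s; rewrite /X; move: (jet _ _) (jet _ _) => M M'; rewrite !mxE.
  have -> : (0 *m X t + X t *m conn A v (p + t *: v)) i j =
     (jet Phi (p + t *: v) *m conn A v (p + t *: v)) i j - (jet Phi' (p + t *: v) *m conn A v (p + t *: v)) i j.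
    have sub (M M' : 'M[R]_3) : (M - M') i j = M i j - M' i j by rewrite !mxE.
    by rewrite mul0mx add0r /X mulmxBl; exact: sub.
  by apply: is_deriveB; exact: dl.
- by move=> t i j t01; split; [rewrite mxE normr0|exact: cP].
- by rewrite /X scale0r addr0 jp subrr.
Qed.

Hypothesis hcurv : forall x, gauss_curvature h x = 1.

(** The Gram matrix of the solution and [ext_metric] obey the same linear equation along segments,
    so their equality at x0 persists; the map is the first column of the solution. *)
Lemma develop x0 (M0 : 'M[R]_3) : M0^T *m M0 = ext_metric x0 ->
  exists2 Phi, local_isometry setT Phi & jet Phi x0 = M0.
Proof.
move=> M0E; have [M [Mx0 sM dM]] := flat_solution (sm_hess_conn sh hpos) x0 M0
  (hess_conn_flat sh hsym hpos hcurv).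
have dfM x : differentiable M x by exact: sm_diff sM I.
have se : smooth_on setT ext_metric by apply: smooth_mx3 => //; try exact: sm_cst; exact: sm_entry.
have ME x : (M x)^T *m M x = ext_metric x.
  pose X (t : R) := (M (x0 + t *: (x - x0)))^T *m M (x0 + t *: (x - x0)) - ext_metric (x0 + t *: (x - x0)).
  suff : X 1 = 0 by rewrite /X scale1r (addrC x0) subrK => /eqP; rewrite subr_eq0 => /eqP.
  set v := x - x0 in X *.
  have [c c0 cP] := conn_bounded x0 v (sm_hess_conn sh hpos).
  apply: (@sylvester_unique _ _ _ (fun t => (conn A v (x0 + t *: v))^T) (fun t => conn A v (x0 + t *: v)) c c0).
  - move=> t i j t01; set y := x0 + t *: v.
    have dl k l : is_derive t 1 (fun s => M (x0 + s *: v) k l) ((M y *m conn A v y) k l).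
      have sc : smooth_on setT (fun z => M z k l) by exact: sm_coord.
      rewrite -dM (derive_entry _ _ _ (dfM y)).
      by apply: (is_derive_line (f := fun z => M z k l)); exact: sm_diff sc I.
    have dlT k l : is_derive t 1 (fun s => (M (x0 + s *: v))^T k l) ((M y *m conn A v y)^T k l).
      by rewrite mxE; under eq_fun do rewrite mxE.
    have dMM := is_derive_mulmx dlT dl i j.
    have dE : 'D_v ext_metric y = (conn A v y)^T *m ext_metric y + ext_metric y *m conn A v y.
      rewrite derive_coord; last exact: sm_diff se I.
      rewrite /conn linear_sum /= mulmx_suml mulmx_sumr -big_split; apply: eq_bigr => k _ /=.
      by rewrite ext_metric_compat scalerDr linearZ /= -scalemxAl -scalemxAr.
    have de : is_derive t 1 (fun s => ext_metric (x0 + s *: v) i j)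
        (((conn A v y)^T *m ext_metric y + ext_metric y *m conn A v y) i j).
      have sc : smooth_on setT (fun z => ext_metric z i j) by exact: sm_coord.
      rewrite -dE (derive_entry _ _ _ (sm_diff se I)).
      by apply: (is_derive_line (f := fun z => ext_metric z i j)); exact: sm_diff sc I.
    have -> : (fun s => X s i j) = (fun s => ((M (x0 + s *: v))^T *m M (x0 + s *: v)) i j - ext_metric (x0 + s *: v) i j).
      by apply/funext => s; rewrite /X; move: (_ *m _) (ext_metric _) => Y Z; rewrite !mxE.
    have := is_deriveB dMM de; congr is_derive.
    rewrite /X -/y trmx_mul mulmxBr mulmxBl !mulmxA.
    move: (_ *m M y) (_ *m conn A v y) (_ *m ext_metric y) (ext_metric y *m _) => a b c' d'.
    by rewrite !mxE; ring.
  - by move=> t i j t01; split; [rewrite mxE; exact: cP|exact: cP].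
  - by rewrite /X scale0r addr0 Mx0 M0E subrr.
pose Phi x := \row_a M x a 0.
have sPhi : smooth_on setT Phi.
  apply: sm_mx => // i j; under eq_fun do rewrite mxE.
  exact: sm_coord.
have dPhi i x : 'D_(e_ i) Phi x = \row_a M x a (lift ord0 i).
  apply/rowP => a; rewrite (derive_entry _ _ _ (sm_diff sPhi I)) !mxE.
  have -> : (fun y => Phi y 0 a) = (fun y => M y a 0) by apply/funext => y; rewrite mxE.
  rewrite -(derive_entry _ _ _ (dfM x)) dM conn_e mxE sum3 !mxE /= mulr0 add0r.
  by move: i; elim/ord2P => /=; rewrite !mulr1 !mulr0 ?addr0 ?add0r; congr (M x a _); exact: val_inj.
have jE x : jet Phi x = M x.
  rewrite [RHS]mx3E /jet /cols !dPhi !mxE.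
  by congr mx3; congr (M x _ _); exact: val_inj.
exists Phi; last by rewrite jE Mx0.
have g x : (jet Phi x)^T *m jet Phi x = ext_metric x by rewrite jE.
split=> //.
  by move=> x _; have := g x; rewrite cols_gram => /matrixP/(_ 0 0); rewrite !mxE.
move=> x i j _; have := g x; rewrite cols_gram => /matrixP E.
move: i j; elim/ord2P; elim/ord2P.
- by have := E 1 1; rewrite !mxE.
- by have := E 1 2; rewrite !mxE.
- by have := E 2 1; rewrite !mxE.
- by have := E 2 2; rewrite !mxE.
Qed.

End Developing.

Lemma sm_entry_id {R : realType} m n (U : set 'M[R]_(m, n)) i j : smooth_on U (fun x => x i j).
Proof. exact: sm_lin (lincont_coord i j). Qed.

Lemma sm_row2 {R : realType} (V : normedModType R) (U : set V) (a b : V -> R) : open U ->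
  smooth_on U a -> smooth_on U b -> smooth_on U (fun x => \row_(i < 2) [:: a x; b x]`_i).
Proof.
by move=> oU sa sb; apply: sm_mx => // i; elim/ord2P; under eq_fun do rewrite mxE.
Qed.

Lemma sm_row3 {R : realType} (V : normedModType R) (U : set V) (a b c : V -> R) : open U ->
  smooth_on U a -> smooth_on U b -> smooth_on U c ->
  smooth_on U (fun x => \row_(i < 3) [:: a x; b x; c x]`_i).
Proof.
by move=> oU sa sb sc; apply: sm_mx => // i; elim/ord3P; under eq_fun do rewrite mxE.
Qed.

Lemma open_pos {R : realType} (V : topologicalType) (U : set V) (f : V -> R) : open U ->
  (forall x, U x -> {for x, continuous f}) -> open (U `&` [set x | 0 < f x]).
Proof.
move=> oU cf; rewrite openE => x [Ux fx]; apply: filterI; first exact: open_nbhs_nbhs.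
by apply: (cf x Ux [set r | 0 < r]); apply: open_nbhs_nbhs; split => //; exact: open_gt.
Qed.

Ltac smooth_step := lazymatch goal with
  | |- smooth_on _ (fun x => x) => exact: sm_id
  | |- smooth_on _ (fun _ => ?c) => exact: sm_cst
  | |- smooth_on _ (fun x => @?f x + - @?g x) => apply: smB
  | |- smooth_on _ (fun x => @?f x + @?g x) => apply: smD
  | |- smooth_on _ (fun x => - @?f x) => apply: smN
  | |- smooth_on _ (fun x => @?f x * @?g x) => apply: smM
  | |- smooth_on _ (fun x => @?f x ^+ _) => apply: smX
  | |- smooth_on _ (fun x => @?f x *: @?g x) => apply: smZ
  | |- smooth_on _ (fun x => (@?f x)^-1) => apply: smV
  | |- smooth_on _ (fun x => dot (@?f x) (@?g x)) => apply: sm_dot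
  | |- smooth_on _ (fun x => Num.sqrt (@?f x)) => apply: sm_sqrt
  | |- smooth_on _ (fun x => matrix_of_fun _ (@?f x)) => first [apply: sm_row2 | apply: sm_row3]
  | |- smooth_on _ (fun x => fun_of_matrix (@?f x) _ _) => first [exact: sm_entry_id | apply: sm_coord]
  end.
Ltac smooth := repeat first [by [] | exact: openT | assumption | smooth_step].

Section Dot.
Context {R : realType}.
Implicit Types (n : nat).

Lemma dotDl n (u v w : 'rV[R]_n) : dot (u + v) w = dot u w + dot v w.
Proof. by rewrite -big_split; apply: eq_bigr => i _; rewrite /= mxE mulrDl. Qed.

Lemma dotDr n (u v w : 'rV[R]_n) : dot w (u + v) = dot w u + dot w v.
Proof. by rewrite !(dotC w) dotDl. Qed.

Lemma dotZl n a (u v : 'rV[R]_n) : dot (a *: u) v = a * dot u v.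
Proof. by rewrite /dot mulr_sumr; apply: eq_bigr => i _; rewrite mxE mulrA. Qed.

Lemma dotZr n a (u v : 'rV[R]_n) : dot u (a *: v) = a * dot u v.
Proof. by rewrite !(dotC u) dotZl. Qed.

Lemma dotNl n (u v : 'rV[R]_n) : dot (- u) v = - dot u v.
Proof. by rewrite -scaleN1r dotZl mulN1r. Qed.

Lemma dotNr n (u v : 'rV[R]_n) : dot u (- v) = - dot u v.
Proof. by rewrite !(dotC u) dotNl. Qed.

Lemma dot0l n (u : 'rV[R]_n) : dot 0 u = 0.
Proof. by rewrite -(scale0r 0) dotZl mul0r. Qed.

Lemma dot0r n (u : 'rV[R]_n) : dot u 0 = 0.
Proof. by rewrite dotC dot0l. Qed.

Lemma dot_ge0 n (u : 'rV[R]_n) : 0 <= dot u u.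
Proof. by apply: sumr_ge0 => i _; rewrite -expr2 sqr_ge0. Qed.

Lemma dot_eq0 n (u : 'rV[R]_n) : (dot u u == 0) = (u == 0).
Proof.
apply/eqP/eqP => [|->]; last exact: dot0l.
move=> /psumr_eq0P h; apply/rowP => i; rewrite mxE.
have /eqP := h (fun i _ => sqr_ge0 (u 0 i)) i isT.
by rewrite -expr2 sqrf_eq0 => /eqP.
Qed.

Lemma dot_gt0 n (u : 'rV[R]_n) : u != 0 -> 0 < dot u u.
Proof. by move=> u0; rewrite lt0r dot_eq0 u0 dot_ge0. Qed.

Lemma dot2 (u v : 'rV[R]_2) : dot u v = u 0 0 * v 0 0 + u 0 1 * v 0 1.
Proof. exact: sum2. Qed.

Definition nrm n (u : 'rV[R]_n) := Num.sqrt (dot u u).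

Lemma nrm_ge0 n (u : 'rV[R]_n) : 0 <= nrm u.
Proof. exact: sqrtr_ge0. Qed.

Lemma nrm_sqr n (u : 'rV[R]_n) : nrm u ^+ 2 = dot u u.
Proof. by rewrite sqr_sqrtr ?dot_ge0. Qed.

Lemma nrm_gt0 n (u : 'rV[R]_n) : u != 0 -> 0 < nrm u.
Proof. by move=> u0; rewrite sqrtr_gt0 dot_gt0. Qed.

Lemma nrm_eq1 n (u : 'rV[R]_n) : dot u u = 1 -> nrm u = 1.
Proof. by rewrite /nrm => ->; exact: sqrtr1. Qed.

Lemma nrmZ n a (u : 'rV[R]_n) : 0 <= a -> nrm (a *: u) = a * nrm u.
Proof. by move=> a0; rewrite /nrm dotZl dotZr mulrA -expr2 sqrtrM ?sqr_ge0 // sqrtr_sqr ger0_norm. Qed.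

Lemma sphere_neq0 (q : 'rV[R]_3) : sphere q -> q != 0.
Proof. by move=> qS; rewrite -dot_eq0 qS oner_eq0. Qed.

Lemma dot_continuous n : continuous (fun x : 'rV[R]_n => dot x x).
Proof.
move=> x; have s : smooth_on setT (fun x : 'rV[R]_n => dot x x).
  by apply: sm_dot; [exact: openT|exact: sm_id|exact: sm_id].
exact: sm_continuous s I.
Qed.

Lemma nrm_continuous n : continuous (@nrm n).
Proof. by move=> x; apply: continuous_comp; [exact: dot_continuous|exact: sqrt_continuous]. Qed.

Lemma open_nonzero n : open [set x : 'rV[R]_n | x != 0].
Proof.
rewrite (_ : [set x | _] = (fun x : 'rV[R]_n => dot x x) @^-1` [set r | r != 0]).
  by apply: open_comp; [move=> x _; exact: dot_continuous|exact: open_neq].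
by apply/seteqP; split => x /=; rewrite dot_eq0.
Qed.

Lemma sm_nrm n : smooth_on [set x : 'rV[R]_n | x != 0] (@nrm n).
Proof.
apply: sm_sqrt; [exact: open_nonzero|by move=> x; exact: dot_gt0|].
by apply: sm_dot; [exact: open_nonzero|exact: sm_id|exact: sm_id].
Qed.

Lemma entry_le_nrm n (x : 'rV[R]_n) i : `|x 0 i| <= nrm x.
Proof.
rewrite -[leLHS]sqrtr_sqr /nrm ler_sqrt ?dot_ge0 // /dot (bigD1 i) //= -expr2 lerDl.
by apply: sumr_ge0 => j _; rewrite -expr2 sqr_ge0.
Qed.

Lemma norm_le_nrm n (x : 'rV[R]_n) : `|x| <= nrm x.
Proof. by apply: mx_norm_le => [|i j]; [exact: nrm_ge0|rewrite ord1; exact: entry_le_nrm]. Qed.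

End Dot.

(** * Stereographic charts, extended along rays *)

Section Charts.
Context {R : realType}.
Local Notation E3 := 'rV[R]_3.
Local Notation E2 := 'rV[R]_2.

Definition chart_dom (c : bool) : set E3 := [set X | X != 0 /\ 0 < nrm X - (-1) ^+ c * X 0 2].

(** Constant on rays, so that it has ambient derivatives; its domain is the complement of the closed
    ray through the pole omitted by [stereo c]. *)
Definition chart (c : bool) (X : E3) : E2 :=
  (nrm X - (-1) ^+ c * X 0 2)^-1 *: \row_i [:: X 0 0; X 0 1]`_i.

Lemma open_chart_dom c : open (chart_dom c).
Proof.
apply: openI; first exact: open_nonzero.
apply: (@open_comp _ _ (fun X : E3 => nrm X - (-1) ^+ c * X 0 2) [set x | 0 < x]); last exact: open_gt.
move=> X _; apply: continuousB; first exact: nrm_continuous.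
by apply: continuousM; [exact: cst_continuous|exact: coord_continuous].
Qed.

Lemma chart_cover X : X != 0 -> chart_dom false X \/ chart_dom true X.
Proof.
move=> X0; have := nrm_gt0 X0 => N0.
rewrite /chart_dom /= expr0 expr1 !mul1r !mulN1r.
have [h|h] := ltP (X 0 2) 0; [left|right]; split => //; lra.
Qed.

Lemma stereo_sphere c (x : E2) : sphere (stereo c x).
Proof.
rewrite /sphere /stereo /= dotZl dotZr !dot3 !mxE /= dot2.
have : 0 <= dot x x := dot_ge0 x; rewrite dot2 => h.
have : 1 + (x 0 0 * x 0 0 + x 0 1 * x 0 1) != 0 by apply: lt0r_neq0; lra.
case: c => /= h'; field; lra.
Qed.

Lemma stereo_neq0 c (x : E2) : stereo c x != 0.
Proof. exact/sphere_neq0/stereo_sphere. Qed.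

Lemma chart_stereo c x : chart c (stereo c x) = x.
Proof.
have N := nrm_eq1 (stereo_sphere c x).
rewrite /chart N; apply/rowP; move: N => _.
have : 0 <= dot x x := dot_ge0 x; rewrite /stereo => h.
have d0 : 1 + dot x x != 0 by apply: lt0r_neq0; lra.
by elim/ord2P; rewrite !mxE /=; case: c; field; lra.
Qed.

Lemma stereo_dom c x : chart_dom c (stereo c x).
Proof.
split; first exact: stereo_neq0.
rewrite (nrm_eq1 (stereo_sphere c x)) !mxE /=.
have h : 0 <= dot x x := dot_ge0 x.
have d0 : 0 < 1 + dot x x by lra.
have -> : 1 - (-1) ^+ c * ((1 + dot x x)^-1 * ((-1) ^+ c * (dot x x - 1))) = 2 / (1 + dot x x).
  by case: c; field; lra.
by apply: divr_gt0.
Qed.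

Lemma stereo_chart c X : chart_dom c X -> stereo c (chart c X) = (nrm X)^-1 *: X.
Proof.
move=> [X0 d0]; have N0 := nrm_gt0 X0.
have NE : nrm X ^+ 2 = X 0 0 * X 0 0 + X 0 1 * X 0 1 + X 0 2 * X 0 2 by rewrite nrm_sqr dot3.
have D : dot (chart c X) (chart c X) = (nrm X + (-1) ^+ c * X 0 2) / (nrm X - (-1) ^+ c * X 0 2).
  rewrite /chart dotZl dotZr dot2 !mxE /=.
  have -> : X 0 0 * X 0 0 + X 0 1 * X 0 1 = (nrm X - (-1) ^+ c * X 0 2) * (nrm X + (-1) ^+ c * X 0 2).
    by move: NE; case: (c); rewrite /= => NE; nra.
  by field; lra.
rewrite /stereo D; move: d0 N0 {D NE} => /=; rewrite /chart; move: (nrm X) => N d0 N0.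
by apply/rowP; elim/ord3P; rewrite !mxE /=; move: d0; case: c => /= d0; field; lra.
Qed.

Lemma sm_chart c : smooth_on (chart_dom c) (chart c).
Proof.
have oD := @open_chart_dom c; rewrite /chart; smooth.
- by move=> X [_ /lt0r_neq0].
- by apply: (sm_subset _ (@sm_nrm R 3)) => X [].
Qed.

Lemma sm_stereo c : smooth_on setT (stereo c : E2 -> E3).
Proof.
rewrite /stereo; smooth.
by move=> x _; apply: lt0r_neq0; have := dot_ge0 x; lra.
Qed.

Lemma derive_sphere (V : normedModType R) (f : V -> E3) x v : differentiable f x ->
  (\forall y \near x, sphere (f y)) -> dot (f x) ('D_v f x) = 0.
Proof.
move=> df sf; have : 'D_v (fun y => dot (f y) (f y)) x = 0.
  by rewrite (@near_eq_derive _ _ _ _ (fun _ : V => 1 : R)) ?der_cst //.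
by rewrite (derive_dot _ df df) (dotC (f x)); lra.
Qed.

Lemma tangent_sphere (q u : E3) : sphere q -> tangent sphere q u <-> dot q u = 0.
Proof.
move=> qS; split.
  move=> [c [c0 cS dc]]; have dfc : differentiable c 0 by apply/derivable1_diffP; case: dc.
  rewrite -{1}c0 -[u](@derive_val _ _ _ _ _ _ _ dc).
  exact: derive_sphere dfc cS.
move=> qu; exists (fun t : R => (Num.sqrt (1 + t ^+ 2 * dot u u))^-1 *: (q + t *: u)); split.
- by rewrite expr0n /= mul0r addr0 sqrtr1 invr1 scale1r scale0r addr0.
- near=> t; rewrite /sphere /= dotZl dotZr dotDl !dotDr !dotZl !dotZr qS qu (dotC u) qu.
  have h : 0 < 1 + t ^+ 2 * dot u u by have := mulr_ge0 (sqr_ge0 t) (dot_ge0 u); lra.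
  have s0 : Num.sqrt (1 + t ^+ 2 * dot u u) != 0 by rewrite gt_eqF // sqrtr_gt0.
  apply: (mulfI s0); apply: (mulfI s0).
  by rewrite mulVKf // mulVKf // mulr1 -expr2 sqr_sqrtr ?ltW //; ring.
- have oT := @openT R.
  have h (t : R) : 0 < 1 + t ^+ 2 * dot u u by have := mulr_ge0 (sqr_ge0 t) (dot_ge0 u); lra.
  have sr : smooth_on setT (fun t : R => 1 + t ^+ 2 * dot u u).
    smooth.
  have sa : smooth_on setT (fun t : R => (Num.sqrt (1 + t ^+ 2 * dot u u))^-1).
    by smooth; move=> t _; rewrite gt_eqF // sqrtr_gt0.
  have sl : smooth_on setT (fun t : R => q + t *: u).
    apply: smD => //; [exact: sm_cst|apply: smZ => //; [exact: sm_id|exact: sm_cst]].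
  (* The normalising factor depends on t only through t^2, so it does not contribute to the velocity
     at 0. *)
  have dE : 'D_(1 : R) (fun t : R => (Num.sqrt (1 + t ^+ 2 * dot u u))^-1) (0 : R) = 0.
    have -> : (fun t : R => (Num.sqrt (1 + t ^+ 2 * dot u u))^-1) =
      (fun r => (Num.sqrt (1 + r * dot u u))^-1) \o (fun t : R => t ^+ 2) by [].
    rewrite derive_comp; first last.
    + rewrite expr0n /=; have oP : open [set x : R | 0 < 1 + x * dot u u].
        have cP (x : R) : setT x -> {for x, continuous (fun x : R => 1 + x * dot u u)}.
          by move=> _; apply: (sm_continuous (U := setT)) => //; smooth.
        by have := open_pos openT cP; rewrite setTI.
      have sP : smooth_on [set x : R | 0 < 1 + x * dot u u] (fun r => (Num.sqrt (1 + r * dot u u))^-1).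
        by smooth; move=> t p; rewrite gt_eqF // sqrtr_gt0.
      by apply: sm_diff sP _; rewrite /= mul0r addr0.
    + by apply: (sm_diff (U := setT)) => //; smooth.
    rewrite (_ : 'D_1 (fun t : R => t ^+ 2) 0 = 0); last first.
      by rewrite derX ?expr1 ?mulr0 ?mul0r //; exact: sm_diff (sm_id _) I.
    exact: derive0.
  apply: DeriveDef; first by apply: diff_derivable; exact: sm_diff (smZ _ oT sa sl) I.
  rewrite (derZ _ (sm_diff sa I) (sm_diff sl I)) // dE scale0r add0r.
  rewrite expr0n /= mul0r addr0 sqrtr1 invr1 scale1r.
  have := @is_derive_line _ _ _ (@idfun E3) q u 0 (sm_diff (@sm_id _ _ setT) I).
  by rewrite derive_id => -[].
Unshelve. all: by end_near.
Qed.

End Charts.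

Section Bil.
Context {R : realType}.
Local Notation E3 := 'rV[R]_3.
Implicit Types (G : 'M[R]_3) (u v w : E3).

Lemma bilDl G u v w : bil G (u + v) w = bil G u w + bil G v w.
Proof. by rewrite /bil !mulmxDl mxE. Qed.

Lemma bilDr G u v w : bil G w (u + v) = bil G w u + bil G w v.
Proof. by rewrite /bil raddfD mulmxDr mxE. Qed.

Lemma bilZl G a u w : bil G (a *: u) w = a * bil G u w.
Proof. by rewrite /bil -!scalemxAl mxE. Qed.

Lemma bilZr G a u w : bil G w (a *: u) = a * bil G w u.
Proof. by rewrite /bil linearZ /= -scalemxAr mxE. Qed.

Lemma bil_comb G u v a b c d : bil G (a *: u + b *: v) (c *: u + d *: v) =
  a * c * bil G u u + a * d * bil G u v + b * c * bil G v u + b * d * bil G v v.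
Proof. by rewrite bilDl !bilDr !bilZl !bilZr; ring. Qed.

Lemma dot_comb n (u v : 'rV[R]_n) a b c d : dot (a *: u + b *: v) (c *: u + d *: v) =
  a * c * dot u u + a * d * dot u v + b * c * dot v u + b * d * dot v v.
Proof. by rewrite dotDl !dotDr !dotZl !dotZr; ring. Qed.

Lemma congr_form (p q r t p' q' r' t' a b c d : R) : p = p' -> q = q' -> r = r' -> t = t' ->
  a * p + b * q + c * r + d * t = a * p' + b * q' + c * r' + d * t'.
Proof. by move=> -> -> -> ->. Qed.

Lemma pos_form (a b d : R) : 0 < a ->
  0 < - b * - b * a + - b * a * b + a * - b * b + a * a * d -> 0 < a * d - b * b.
Proof.
move=> a0; rewrite -(pmulr_rgt0 (a * d - b * b) a0); congr (is_true (_ < _)); ring.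
Qed.

End Bil.

Section Gluing.
Context {R : realType}.
Local Notation E3 := 'rV[R]_3.
Local Notation E2 := 'rV[R]_2.
Local Notation e_ i := (delta_mx 0 i : 'rV[R]_2).
Variable g : E3 -> 'M[R]_3.
Hypothesis gm : riemannian_metric g.

Local Notation oN := (@open_nonzero R 2).

Lemma derive_stereo c (x w : E2) : 'D_w (stereo c) x = w 0 0 *: frame c x 0 + w 0 1 *: frame c x 1.
Proof.
rewrite (derive_coord _ (sm_diff (@sm_stereo R c) I)).
exact: (sum2 (fun i => w 0 i *: frame c x i)).
Qed.

Lemma derive_stereo_perp c (x w : E2) : dot (stereo c x) ('D_w (stereo c) x) = 0.
Proof.
apply: derive_sphere (sm_diff (@sm_stereo R c) I) _.
by apply: filterS filterT => y _; exact: stereo_sphere.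
Qed.

Lemma derive_chart_stereo c (x w : E2) : 'D_('D_w (stereo c) x) (chart c) (stereo c x) = w.
Proof.
rewrite -derive_comp; first last.
- exact: sm_diff (@sm_chart R c) (stereo_dom c x).
- exact: sm_diff (@sm_stereo R c) I.
- have -> : chart c \o stereo c = @idfun E2 by apply/funext => y; exact: chart_stereo.
  by rewrite derive_id.
Qed.

Lemma tangent_stereo c (x w : E2) : tangent sphere (stereo c x) ('D_w (stereo c) x).
Proof. by apply/tangent_sphere; [exact: stereo_sphere|exact: derive_stereo_perp]. Qed.

Lemma derive_nrm (X u : E3) : X != 0 -> 'D_u (@nrm R 3) X = dot X u / nrm X.
Proof.
move=> X0; have N0 := nrm_gt0 X0; have dN := sm_diff (@sm_nrm R 3) X0.
have : 'D_u (fun Y : E3 => nrm Y ^+ 2) X = 'D_u (fun Y : E3 => dot Y Y) X.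
  by congr ('D_u _ X); apply/funext => Y; exact: nrm_sqr.
have did : differentiable (fun Y : E3 => Y) X by exact: sm_diff (@sm_id _ _ setT) I.
rewrite (derX 1 _ dN) (derive_dot _ did did) derive_id (dotC u) expr1.
move: ('D_u _ X) => D E; apply: (mulIf (lt0r_neq0 N0)); rewrite divfK ?lt0r_neq0 //.
by lra.
Qed.

Lemma derive_stereo_chart c (q u : E3) : sphere q -> chart_dom c q -> dot q u = 0 ->
  'D_('D_u (chart c) q) (stereo c) (chart c q) = u.
Proof.
move=> qS dq qu; have q0 := sphere_neq0 qS.
have oD := @open_chart_dom R c.
rewrite -derive_comp; first last.
- exact: sm_diff (@sm_stereo R c) I.
- exact: sm_diff (@sm_chart R c) dq.
rewrite (@near_eq_derive _ _ _ _ (fun X : E3 => (nrm X)^-1 *: X)); last first.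
  by apply: open_near_eq oD dq _ => X dX; exact: stereo_chart.
have dN := sm_diff (@sm_nrm R 3) q0.
have oN3 := @open_nonzero R 3.
have sV : smooth_on [set x : E3 | x != 0] (fun X : E3 => (nrm X)^-1).
  by smooth; [move=> X /nrm_gt0/lt0r_neq0|exact: sm_nrm].
have did : differentiable (fun Y : E3 => Y) q by exact: sm_diff (@sm_id _ _ setT) I.
rewrite (derZ _ (sm_diff sV q0) did) // derive_id (derV _ dN) ?lt0r_neq0 ?nrm_gt0 //.
by rewrite derive_nrm // qu !mul0r oppr0 mul0r scale0r add0r (nrm_eq1 qS) invr1 scale1r.
Qed.

Lemma frame_comb_neq0 c (x w : E2) : w != 0 -> 'D_w (stereo c) x != 0.
Proof.
apply: contra_neq => h; rewrite -(derive_chart_stereo c x w) h.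
by rewrite -(scale0r 0) (deriveZv _ _ (sm_diff (@sm_chart R c) (stereo_dom c x))) scale0r.
Qed.

Lemma metric_coord_sym c (x : E2) i j : metric_coord g c x i j = metric_coord g c x j i.
Proof.
rewrite !mxE; case: gm => _ gs _.
by apply: gs; [exact: stereo_sphere|exact: tangent_stereo|exact: tangent_stereo].
Qed.

Lemma metric_coord_form c (x a b : E2) :
  bil (g (stereo c x)) ('D_a (stereo c) x) ('D_b (stereo c) x) =
  a 0 0 * b 0 0 * metric_coord g c x 0 0 + a 0 0 * b 0 1 * metric_coord g c x 0 1
  + a 0 1 * b 0 0 * metric_coord g c x 1 0 + a 0 1 * b 0 1 * metric_coord g c x 1 1.
Proof.
have E i j : bil (g (stereo c x)) (frame c x i) (frame c x j) = metric_coord g c x i j by rewrite mxE.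
apply: (etrans (congr2 (bil (g (stereo c x))) (derive_stereo c x a) (derive_stereo c x b))).
apply: (etrans (bil_comb _ _ _ _ _ _ _)).
exact: (congr_form _ _ _ _ (E 0 0) (E 0 1) (E 1 0) (E 1 1)).
Qed.

Lemma metric_coord_pos c (x : E2) : 0 < metric_coord g c x 0 0 /\
  0 < metric_coord g c x 0 0 * metric_coord g c x 1 1 - metric_coord g c x 0 1 * metric_coord g c x 1 0.
Proof.
have P w : w != 0 -> 0 < bil (g (stereo c x)) ('D_w (stereo c) x) ('D_w (stereo c) x).
  move=> w0; case: gm => _ _ gp; apply: gp; [exact: stereo_sphere|exact: tangent_stereo|].
  exact: frame_comb_neq0.
have h0 : 0 < metric_coord g c x 0 0.
  have e0 : (e_ 0 : E2) != 0 by apply/eqP => /rowP/(_ 0); rewrite !mxE /=; apply/eqP; exact: oner_neq0.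
  by have := P _ e0; rewrite mxE.
split=> //; rewrite (metric_coord_sym c x 1 0); apply: (pos_form h0).
(* The quadratic form at this vector takes the value h_00 times its determinant. *)
pose w : E2 := \row_i [:: - metric_coord g c x 0 1; metric_coord g c x 0 0]`_i.
have w1 : w 0 0 = - metric_coord g c x 0 1 by rewrite mxE.
have w2 : w 0 1 = metric_coord g c x 0 0 by rewrite mxE.
clearbody w; have w0 : w != 0.
  by apply/eqP => w0; move: w2 h0; rewrite w0 mxE => <-; rewrite ltxx.
have := P w w0; rewrite metric_coord_form w1 w2 (metric_coord_sym c x 1 0).
by [].
Qed.

Lemma isometry_form c U Phi x a b : U x -> local_isometry (metric_coord g c) U Phi ->
  dot ('D_a Phi x) ('D_b Phi x) =
  bil (g (stereo c x)) ('D_a (stereo c) x) ('D_b (stereo c) x).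
Proof.
move=> Ux [sP _ Ph]; have dP := sm_diff sP Ux.
have E w : 'D_w Phi x = w 0 0 *: 'D_(e_ 0) Phi x + w 0 1 *: 'D_(e_ 1) Phi x.
  by rewrite (derive_coord _ dP); exact: (sum2 (fun i => w 0 i *: 'D_(e_ i) Phi x)).
rewrite metric_coord_form; apply: (etrans (congr2 (@dot R 3) (E a) (E b))).
apply: (etrans (dot_comb _ _ _ _ _ _)).
exact: (congr_form _ _ _ _ (Ph x 0 0 Ux) (Ph x 0 1 Ux) (Ph x 1 0 Ux) (Ph x 1 1 Ux)).
Qed.

Definition inversion (x : E2) : E2 := (dot x x)^-1 *: x.

Lemma sm_inversion : smooth_on [set x : E2 | x != 0] inversion.
Proof. by rewrite /inversion; smooth; try exact: oN; move=> x /dot_gt0/lt0r_neq0. Qed.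

Lemma stereo_inversion (x : E2) : x != 0 -> stereo true x = stereo false (inversion x).
Proof.
move=> /dot_gt0 d0; rewrite /stereo /inversion !dotZl !dotZr.
move: d0; move: (dot x x) => d d0.
by apply/rowP; elim/ord3P; rewrite !mxE /=; field; lra.
Qed.

Lemma isometry_inversion Phi : local_isometry (metric_coord g false) setT Phi ->
  local_isometry (metric_coord g true) [set x | x != 0] (fun x => Phi (inversion x)).
Proof.
move=> iP; have [sP P1 _] := iP; split.
- exact: (sm_comp (findim_mx _ _) (findim_mx _ _) oN openT (fun x _ => I) sm_inversion sP).
- by move=> x _; exact: P1.
move=> x i j x0; have di := sm_diff sm_inversion x0.
have dP y : differentiable Phi y by exact: sm_diff sP I.
have E a : 'D_a (fun x => Phi (inversion x)) x = 'D_('D_a inversion x) Phi (inversion x).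
  exact: (derive_comp a di (dP _)).
have F a : 'D_a (stereo true) x = 'D_('D_a inversion x) (stereo false) (inversion x).
  rewrite -(derive_comp a di (sm_diff (@sm_stereo R false) I)).
  by apply: near_eq_derive; apply: open_near_eq oN x0 _ => y y0; exact: stereo_inversion.
have e1 := isometry_form ('D_(e_ i) inversion x) ('D_(e_ j) inversion x) (I : setT (inversion x)) iP.
have e2 := congr2 (bil (g (stereo false (inversion x)))) (esym (F (e_ i))) (esym (F (e_ j))).
rewrite (E (e_ i)) (E (e_ j)) e1 e2 mxE /frame.
have G A B : bil (g (stereo false (inversion x))) A B = bil (g (stereo true x)) A B by rewrite (stereo_inversion x0).
exact: G.
Qed.

(** Supplies an initial jet: a matrix with the Gram matrix that [develop] prescribes at a point. *)
Lemma cholesky (a b d : R) : 0 < a -> 0 < a * d - b * b -> exists M : 'M[R]_3,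
  M^T *m M = mx3 1 0 0 0 a b 0 b d.
Proof.
move=> a0 D0; pose r := Num.sqrt a.
have r0 : r != 0 by rewrite lt0r_neq0 // sqrtr_gt0.
have rr : r * r = a by rewrite -expr2 sqr_sqrtr // ltW.
have p : 0 <= (a * d - b * b) / a by rewrite ltW // divr_gt0.
exists (mx3 1 0 0 0 r (b / r) 0 0 (Num.sqrt ((a * d - b * b) / a))).
rewrite mx3_tr mx3_mul -!expr2 (sqr_sqrtr p) !expr2; congr mx3; rewrite ?rr //; try by ring.
- by rewrite -rr; field.
- by field.
- by rewrite -rr; field.
Qed.

Hypothesis gcurv : constant_curvature 1 g.

Lemma segment_nonzero (p x : E2) : (forall t : R, 0 <= t <= 1 -> (1 - t) *: p + t *: x != 0) ->
  forall t : R, 0 <= t <= 1 -> [set y : E2 | y != 0] (p + t *: (x - p)).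
Proof.
move=> h t /h; congr (is_true (_ != 0)).
by rewrite scalerBl scale1r scalerBr -addrA (addrC (- _)).
Qed.

(** The developing map of the second chart is given, at one point, the jet of the first one read
    through the inversion. Uniqueness along segments then propagates the agreement over the
    punctured plane. *)
Lemma glued_developing : exists Phi0 Phi1 : E2 -> E3,
  [/\ local_isometry (metric_coord g false) setT Phi0,
      local_isometry (metric_coord g true) setT Phi1
    & forall x, x != 0 -> Phi1 x = Phi0 (inversion x)].
Proof.
have [sg _ _] := gm.
have dev c := develop (sg c) (metric_coord_sym c) (metric_coord_pos c) (gcurv c).
have [a0 d0] := metric_coord_pos false 0.
have [|M ME] := @cholesky (metric_coord g false 0 0 0) (metric_coord g false 0 0 1) (metric_coord g false 0 1 1) a0.
  by move: d0; rewrite (metric_coord_sym _ _ 1 0).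
have [|Phi0 iP0 _] := dev false 0 M.
  by rewrite ME /ext_metric (metric_coord_sym _ _ 1 0).
have iPi := isometry_inversion iP0.
pose p : E2 := e_ 0.
have p0 : p != 0 by apply/eqP => /rowP/(_ 0); rewrite !mxE /=; apply/eqP; exact: oner_neq0.
have [|Phi1 iP1 jp] := dev true p (jet (fun x => Phi0 (inversion x)) p).
  have [sPi Pi1 Pih] := iPi.
  have o1 i : dot (Phi0 (inversion p)) ('D_(e_ i) (fun x => Phi0 (inversion x)) p) = 0.
    apply: (@derive_sphere _ _ (fun x => Phi0 (inversion x)) p (e_ i) (sm_diff sPi p0)).
    by near=> y; apply: Pi1; near: y; exact: open_nbhs_nbhs (conj oN p0).
  rewrite /jet cols_gram /ext_metric.
  have o1' i : dot ('D_(e_ i) (fun x => Phi0 (inversion x)) p) (Phi0 (inversion p)) = 0 by rewrite dotC.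
  exact: (mx3_congr (Pi1 p p0) (o1 0) (o1 1) (o1' 0) (Pih p 0 0 p0) (Pih p 0 1 p0)
      (o1' 1) (Pih p 1 0 p0) (Pih p 1 1 p0)).
exists Phi0, Phi1; split=> //.
have iP1' : local_isometry (metric_coord g true) [set x | x != 0] Phi1.
  by have [s1 s2 s3] := iP1; split; [exact: sm_subset s1|move=> x _; exact: s2|move=> x i j _; exact: s3].
have step y x : jet Phi1 y = jet (fun x => Phi0 (inversion x)) y ->
    (forall t : R, 0 <= t <= 1 -> (1 - t) *: y + t *: x != 0) ->
    jet Phi1 x = jet (fun x => Phi0 (inversion x)) x.
  move=> jy yx; have := @isometry_unique _ _ (sg true) (metric_coord_pos true)
    _ _ _ y (x - y) oN iP1' iPi (segment_nonzero yx) jy.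
  by rewrite (addrC y) subrK.
(* A segment from [p] to a point of the first axis may meet the origin; such points are reached from
   [p'] instead. *)
pose p' : E2 := e_ 1.
have jp' : jet Phi1 p' = jet (fun x => Phi0 (inversion x)) p'.
  apply: (step p p' jp) => t t01; apply/eqP => /rowP E.
  by have := E 0; have := E 1; rewrite !mxE /= !mulr1 !mulr0 add0r addr0 => -> /eqP; rewrite subr0 oner_eq0.
move=> x x0; suff : jet Phi1 x = jet (fun x => Phi0 (inversion x)) x by move=> /cols_inj [].
have [x1|x1] := eqVneq (x 0 1) 0; [apply: (step p' x jp')|apply: (step p x jp)] => t t01; apply/eqP => /rowP E.
- have := E 1; have := E 0; rewrite !mxE /= x1 !mulr0 mulr1 add0r addr0 => tx t1.
  have t1' : t = 1 by lra.
  move: tx; rewrite t1' mul1r => x00; case/negP: x0; apply/eqP/rowP; elim/ord2P; rewrite !mxE //.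
- have := E 0; have := E 1; rewrite !mxE /= !mulr0 mulr1 add0r => /eqP.
  by rewrite mulf_eq0 (negbTE x1) orbF => /eqP ->; rewrite mul0r addr0 subr0 => /eqP; rewrite oner_eq0.
Unshelve. all: by end_near.
Qed.

End Gluing.

Section Global.
Context {R : realType}.
Local Notation E3 := 'rV[R]_3.
Local Notation E2 := 'rV[R]_2.
Local Notation NZ := [set X : E3 | X != 0].
Variable g : E3 -> 'M[R]_3.
Hypothesis gm : riemannian_metric g.
Hypothesis gcurv : constant_curvature 1 g.

Lemma stereo_inj c : injective (stereo c : E2 -> E3).
Proof. by move=> x y /(congr1 (chart c)); rewrite !chart_stereo. Qed.

Lemma chart_inversion (X : E3) : chart_dom false X -> chart_dom true X ->
  chart true X != 0 /\ chart false X = inversion (chart true X).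
Proof.
move=> d0 d1; have E0 := stereo_chart d0; have E1 := stereo_chart d1.
have n0 : chart true X != 0.
  apply/eqP => c0; move: E1 d0; rewrite c0 => E1 [X0]; have N0 := nrm_gt0 X0.
  have -> : X = nrm X *: stereo true 0 by rewrite E1 scalerA divff ?scale1r // lt0r_neq0.
  rewrite nrmZ ?ltW // (nrm_eq1 (stereo_sphere _ _)) /stereo dot0l mxE mxE mxE /= addr0 invr1 expr0 expr1 => h.
  by move: (nrm X) N0 h => N N0 h; clear -N0 h; lra.
split=> //; apply: (@stereo_inj false).
by rewrite -stereo_inversion // E0 E1.
Qed.

Lemma chartZ c (a : R) (X : E3) : 0 < a -> chart c (a *: X) = chart c X.
Proof.
move=> a0; rewrite /chart (nrmZ _ (ltW a0)) mxE mulrCA -mulrBr invfM.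
have -> : \row_i [:: (a *: X) 0 0; (a *: X) 0 1]`_i = a *: \row_(i < 2) [:: X 0 0; X 0 1]`_i.
  by apply/rowP; elim/ord2P; rewrite !mxE.
by rewrite scalerA mulrAC mulVf ?mul1r // lt0r_neq0.
Qed.

Lemma developing_map : exists Phi : E3 -> E3,
  [/\ smooth_on NZ Phi, forall a X, 0 < a -> Phi (a *: X) = a *: Phi X,
      forall X, dot (Phi X) (Phi X) = dot X X
    & forall q u v, sphere q -> dot q u = 0 -> dot q v = 0 ->
        dot ('D_u Phi q) ('D_v Phi q) = bil (g q) u v].
Proof.
have [Phi0 [Phi1 [iP0 iP1 P10]]] := glued_developing gm gcurv.
pose P c := if c then Phi1 else Phi0.
have iP c : local_isometry (metric_coord g c) setT (P c) by case: c; [exact: iP1|exact: iP0].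
pose Phi X := nrm X *: (if X 0 2 < 0 then Phi0 (chart false X) else Phi1 (chart true X)).
(* The case distinction in [Phi] is immaterial: on the overlap of the charts both expressions agree
   through the inversion. *)
have PhiE c X : chart_dom c X -> Phi X = nrm X *: P c (chart c X).
  rewrite /Phi; case: c => dX; case: ltP => // h.
    have d0 : chart_dom false X.
      by case: dX => X0 _; split => //; have := nrm_gt0 X0; rewrite expr0 mul1r; lra.
    by have [n0 ->] := chart_inversion d0 dX; rewrite -P10.
  have d1 : chart_dom true X.
    by case: dX => X0 _; split => //; have := nrm_gt0 X0; rewrite expr1 mulN1r; lra.
  by have [n0 ->] := chart_inversion dX d1; rewrite P10.
have oD := @open_chart_dom R.
have sPc c : smooth_on (chart_dom c) (fun X => P c (chart c X)).
  have [sP _ _] := iP c.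
  exact: (sm_comp (findim_mx _ _) (findim_mx _ _) (@oD c) openT (fun x _ => I) (@sm_chart R c) sP).
have sc c : smooth_on (chart_dom c) Phi.
  apply: (sm_eq (@oD c) (fun X dX => esym (PhiE c X dX))).
  apply: smZ => //; by apply: (sm_subset _ (@sm_nrm R 3)) => X [].
have cov (q : E3) : q != 0 -> exists c, chart_dom c q by move=> q0; case: (chart_cover q0) => h; [exists false|exists true].
exists Phi; split.
- by move=> vs X /cov[c dX]; exact: (sc c vs X dX).
- move=> a X a0; rewrite /Phi (nrmZ _ (ltW a0)) !chartZ // -scalerA mxE.
  by rewrite (pmulr_rlt0 _ a0).
- move=> X; rewrite /Phi dotZl dotZr mulrA -expr2 nrm_sqr -[RHS]mulr1; congr (_ * _).
  by case: ifP => _; [case: iP0|case: iP1] => _ h _; exact: h.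
move=> q u v qS qu qv; have [c dq] := cov q (sphere_neq0 qS).
pose x := chart c q.
have qE : stereo c x = q by rewrite stereo_chart // (nrm_eq1 qS) invr1 scale1r.
have PE : P c = Phi \o stereo c.
  apply/funext => y; rewrite /= (PhiE c _ (stereo_dom c y)) chart_stereo.
  by rewrite (nrm_eq1 (stereo_sphere _ _)) scale1r.
have key w : dot q w = 0 -> 'D_w Phi q = 'D_('D_w (chart c) q) (P c) x.
  move=> qw; have dst := sm_diff (@sm_stereo R c) (I : setT x).
  have dc := sm_diff (sc c) dq; rewrite -qE in dc.
  rewrite -{1}(derive_stereo_chart qS dq qw) -{1}qE.
  by rewrite -(derive_comp _ dst dc) -PE.
have e1 := isometry_form ('D_u (chart c) q) ('D_v (chart c) q) (I : setT x) (iP c).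
have e2 := congr2 (bil (g (stereo c x))) (derive_stereo_chart qS dq qu) (derive_stereo_chart qS dq qv).
rewrite (key u qu) (key v qv) e1 e2.
by rewrite qE.
Qed.

End Global.

(** * Bijectivity of the developing map *)

Section Radius.
Context {R : realType}.

Lemma near_radius (V : normedModType R) (x : V) (P : V -> Prop) : (\forall y \near x, P y) ->
  exists2 r, 0 < r & forall y, `|y - x| <= r -> P y.
Proof.
move=> /nbhs_normP[r /= r0 h]; exists (r / 2); first by rewrite divr_gt0.
move=> y yr; apply: h => /=; rewrite /ball_ /= distrC; apply: le_lt_trans yr _.
by rewrite ltr_pdivrMr // ltr_pMr // ltr1n.
Qed.

Lemma radius_near (V : normedModType R) (x : V) (r : R) (P : V -> Prop) : 0 < r ->
  (forall y, `|y - x| < r -> P y) -> \forall y \near x, P y.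
Proof. by move=> r0 h; apply/nbhs_normP; exists r => // y; rewrite /ball_ /= distrC; exact: h. Qed.

Lemma continuous_radius (V W : normedModType R) (f : V -> W) x (e : R) :
  {for x, continuous f} -> 0 < e ->
  exists2 r, 0 < r & forall y, `|y - x| <= r -> `|f y - f x| < e.
Proof.
move=> /cvgrPdist_lt cf e0; apply: near_radius.
by apply: filterS (cf e e0) => y; rewrite distrC.
Qed.

Lemma norm_sqr_le_dot n (u : 'rV[R]_n) : `|u| ^+ 2 <= dot u u.
Proof. by rewrite -nrm_sqr ler_sqr ?nnegrE ?nrm_ge0 ?norm_le_nrm. Qed.

Lemma dot_le_norm_sqr n (u : 'rV[R]_n) : dot u u <= n%:R * `|u| ^+ 2.
Proof.
apply: sum_le_card => i; rewrite -expr2 -[leLHS]real_normK ?num_real //.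
by rewrite ler_sqr ?nnegrE // ler_rV_norm.
Qed.

End Radius.

(** * Quantitative local inversion *)

Section LocalInverse.
Context {R : realType} {n : nat}.
Local Notation V := 'rV[R]_n.
Implicit Types (f : V -> V) (U : set V).

Definition jacobian f (x : V) : 'M[R]_n := \matrix_(i, j) ('D_(delta_mx 0 i) f x) 0 j.

Lemma jacobianE f x v : differentiable f x -> 'D_v f x = v *m jacobian f x.
Proof.
move=> df; rewrite (derive_coord _ df); apply/rowP => j; rewrite summxE mxE.
by apply: eq_bigr => i _; rewrite !mxE.
Qed.

Lemma sm_jacobian f U : open U -> smooth_on U f -> smooth_on U (jacobian f).
Proof.
move=> oU sf; apply: sm_mx => // i j; under eq_fun do rewrite mxE.
by apply: sm_coord => //; exact: sm_der.
Qed.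

Lemma jacobian_unit f x : differentiable f x -> (forall v, v != 0 -> 'D_v f x != 0) ->
  jacobian f x \in unitmx.
Proof.
move=> df h; rewrite -row_free_unit -kermx_eq0; apply/rowV0P => v /sub_kermxP vJ.
by apply/eqP/negPn/negP => /h; rewrite jacobianE // vJ eqxx.
Qed.

Lemma mulmx_norm (v : V) (A : 'M[R]_n) : `|v *m A| <= n%:R * `|A| * `|v|.
Proof.
apply: mx_norm_le => [|i j]; first by rewrite !mulr_ge0.
rewrite mxE; apply: le_trans (ler_norm_sum _ _ _) _; rewrite -mulrA.
apply: sum_le_card => k; rewrite normrM mulrC ord1; apply: ler_pM => //; last exact: ler_rV_norm.
rewrite [leRHS]/Num.norm /= mx_normrE.
exact: (le_bigmax _ (fun ij => `|A ij.1 ij.2|) (k, j)).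
Qed.

Lemma closed_ball_shift (p : V) (r : R) : compact [set x : V | `|x - p| <= r].
Proof.
have -> : [set x : V | `|x - p| <= r] = (fun x => p + x) @` [set x : V | `|x| <= r].
  apply/seteqP; split => [x /= xr|_ [x /= xr <-]]; last by rewrite /= addrC addKr.
  by exists (x - p) => //; rewrite addrC subrK.
apply: continuous_compact; last exact: compact_ball.
apply: continuous_subspaceT => x.
by apply: continuousD; [exact: cst_continuous|exact: cvg_id].
Qed.

Lemma segment_ball (p x y : V) (r t : R) : `|x - p| <= r -> `|y - p| <= r -> 0 <= t <= 1 ->
  `|x + t *: (y - x) - p| <= r.
Proof.
move=> xr yr /andP[t0 t1].
have -> : x + t *: (y - x) - p = (1 - t) *: (x - p) + t *: (y - p).
  by apply/matrixP => i j; rewrite !mxE; ring.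
apply: le_trans (ler_normD _ _) _; rewrite !normrZ !ger0_norm ?subr_ge0 //.
have -> : r = (1 - t) * r + t * r by ring.
by apply: lerD; apply: ler_wpM2l; rewrite ?subr_ge0.
Qed.

(** Near p the difference of f and its linear part J is Lipschitz with constant at most 1 / (2 C),
    while J expands by at least 1 / C. *)
Lemma local_expansion f U p : open U -> smooth_on U f -> U p ->
  (forall v, v != 0 -> 'D_v f p != 0) ->
  exists2 r, 0 < r & exists2 c, 0 < c &
    (forall x, `|x - p| <= r -> U x) /\
    forall x y, `|x - p| <= r -> `|y - p| <= r -> c * `|y - x| <= `|f y - f x|.
Proof.
move=> oU sf Up inj; have dfU x : U x -> differentiable f x by exact: sm_diff sf.
have uJ := jacobian_unit (dfU p Up) inj; set J := jacobian f p in uJ.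
pose C := n%:R * `|invmx J| + 1.
have C0 : 0 < C by rewrite ltr_wpDl // mulr_ge0.
have JC (v : V) : `|v| <= C * `|v *m J|.
  have {1}-> : v = (v *m J) *m invmx J by rewrite mulmxK.
  apply: le_trans (mulmx_norm _ _) _; apply: ler_wpM2r => //.
  by rewrite lerDl.
pose e := (2 * C * (n%:R + 1))^-1.
have e0 : 0 < e by rewrite invr_gt0 !mulr_gt0 // ltr_wpDl.
have [r1 r10 P1] := near_radius (open_nbhs_nbhs (conj oU Up)).
have [r2 r20 P2] := continuous_radius (sm_continuous (sm_jacobian oU sf) Up) e0.
pose r := Num.min r1 r2; have r0 : 0 < r by rewrite lt_min r10.
have rP x : `|x - p| <= r -> U x /\ `|jacobian f x - J| < e.
  by rewrite le_min => /andP[a b]; split; [exact: P1|exact: P2].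
exists r => //; exists (2 * C)^-1; first by rewrite invr_gt0 mulr_gt0.
split=> [x /rP[]//|x y xr yr].
set w := y - x.
have bnd j : `|(f y - f x - w *m J) 0 j| <= n%:R * e * `|w|.
  pose F (t : R) := (f (x + t *: w) - t *: (w *m J)) 0 j.
  have dF (t : R) : 0 <= t <= 1 -> is_derive t 1 F ((w *m (jacobian f (x + t *: w) - J)) 0 j).
    move=> t01; have [Ut _] := rP _ (segment_ball xr yr t01).
    have dfj : differentiable (fun z => f z 0 j) (x + t *: w).
      exact: (@differentiable_comp _ _ _ _ f (fun v : V => v 0 j)) (dfU _ Ut) (differentiable_lincont _ (lincont_coord 0 j)).
    have d1 := is_derive_line (f := fun z => f z 0 j) dfj.
    rewrite -(derive_entry _ _ _ (dfU _ Ut)) (jacobianE _ (dfU _ Ut)) in d1.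
    have d2 : is_derive t 1 (fun s : R => s * (w *m J) 0 j) ((w *m J) 0 j).
      have := @is_deriveM _ _ (@idfun R) (cst ((w *m J) 0 j)) t 1 _ _ (is_derive_id _ _) (is_derive_cst _ _ _).
      by rewrite /GRing.scale /= mulr0 add0r mulr1; congr is_derive.
    have -> : F = (fun s : R => f (x + s *: w) 0 j - s * (w *m J) 0 j).
      by apply/funext => s; rewrite /F; move: (f _) (_ *m _) => A B; rewrite !mxE.
    rewrite mulmxBr; have := is_deriveB d1 d2.
    have sub (A B : 'rV[R]_n) : (A - B) 0 j = A 0 j - B 0 j by rewrite !mxE.
    by rewrite sub.
  have [t t01 E] := MVT0 ltr01 dF.
  have {E} -> : (f y - f x - w *m J) 0 j = (w *m (jacobian f (x + t *: w) - J)) 0 j.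
    move: E; rewrite mulr1 => <-; rewrite /F scale1r scale0r addr0 scale0r subr0 scale1r /w (addrC x) subrK.
    by move: (f y) (f x) (_ *m _) => A B D; rewrite !mxE; ring.
  apply: le_trans (ler_rV_norm _ _) _; apply: le_trans (mulmx_norm _ _) _.
  apply: ler_wpM2r => //; apply: ler_wpM2l => //.
  have t01' : 0 <= t <= 1 by case/andP: t01 => a b; rewrite !ltW.
  by have [_ /ltW] := rP _ (segment_ball xr yr t01').
have B : `|f y - f x - w *m J| <= n%:R * e * `|w|.
  by apply: mx_norm_le => [|i j]; [rewrite !mulr_ge0 // ltW|rewrite ord1].
have ne : n%:R * e <= (2 * C)^-1.
  rewrite /e [(2 * C * _)^-1]invfM mulrCA -[leRHS]mulr1; apply: ler_wpM2l.
    by rewrite invr_ge0 mulr_ge0 // ltW.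
  by rewrite ler_pdivrMr ?mul1r ?lerDl // ltr_wpDl.
have B' : `|f y - f x - w *m J| <= (2 * C)^-1 * `|w| by apply: le_trans B _; exact: ler_wpM2r.
have JC' : C^-1 * `|w| <= `|w *m J| by rewrite ler_pdivrMl.
have : `|w *m J| <= `|f y - f x| + `|f y - f x - w *m J|.
  rewrite -[X in `|X| <= _](subrK (f y - f x)) -[w *m J - _]opprB addrC.
  by apply: le_trans (ler_normD _ _) _; rewrite normrN.
rewrite (_ : C^-1 = (2 * C)^-1 + (2 * C)^-1) in JC'; last by field; rewrite lt0r_neq0.
by move: JC' B'; rewrite mulrDl; lra.
Qed.

(** Difference quotients inherit the expansion. This makes the derivative injective at nearby points
    as well, as [local_surjection] requires. *)
Lemma expansion_derive f p v (c : R) : differentiable f p ->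
  (\forall y \near p, c * `|y - p| <= `|f y - f p|) -> c * `|v| <= `|'D_v f p|.
Proof.
move=> df h; have [->|v0] := eqVneq v 0.
  by rewrite normr0 mulr0.
have nv : 0 < `|v| by rewrite normr_gt0.
apply/ler_addgt0Pr => e e0; have ev : 0 < e / `|v| by rewrite divr_gt0.
have [r1 r10 P1] := near_radius (differentiable_eps df ev).
have [r2 r20 P2] := near_radius h.
pose r := Num.min r1 r2; have r0 : 0 < r by rewrite lt_min r10.
pose t := r / (2 * `|v|); have t0 : 0 < t by rewrite divr_gt0 // mulr_gt0.
have tv : `|t *: v| <= r.
  rewrite normrZ gtr0_norm // /t invfM mulrA divfK ?lt0r_neq0 //.
  by rewrite ler_pdivrMr // ler_pMr // ler1n.
have a : c * `|t *: v| <= `|f (t *: v + p) - f p|.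
  have := P2 (t *: v + p); rewrite addrK; apply; by apply: le_trans tv _; rewrite ge_min lexx orbT.
have b : `|f (t *: v + p) - f p - t *: 'D_v f p| <= e / `|v| * `|t *: v|.
  rewrite -deriveZv // deriveE //; apply: P1; rewrite subr0.
  by apply: le_trans tv _; rewrite ge_min lexx.
move: a b; rewrite normrZ gtr0_norm // => a b.
have : `|f (t *: v + p) - f p| <= `|t *: 'D_v f p| + `|f (t *: v + p) - f p - t *: 'D_v f p|.
  by rewrite -[X in `|X| <= _](subrK (t *: 'D_v f p)) addrC; apply: ler_normD.
rewrite normrZ gtr0_norm // => d; rewrite -(ler_pM2l t0).
apply: le_trans (le_trans _ d) _; first by rewrite mulrCA.
rewrite mulrDr lerD2l; apply: le_trans b _.
by rewrite mulrCA divfK ?lt0r_neq0.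
Qed.

(** The squared distance from f x to y is minimised over a closed ball. Expansion keeps the
    minimiser off the boundary, so f x - y is orthogonal there to the range of the derivative, which
    is the whole space. *)
Lemma local_surjection f U p (eps : R) : open U -> smooth_on U f -> U p ->
  (forall v, v != 0 -> 'D_v f p != 0) -> 0 < eps ->
  exists2 del, 0 < del & forall y, `|y - f p| < del -> exists2 x, `|x - p| < eps & f x = y.
Proof.
move=> oU sf Up inj eps0; have [r r0 [c c0 [rU exps]]] := local_expansion oU sf Up inj.
have dfU x : U x -> differentiable f x by exact: sm_diff sf.
pose e := Num.min r (eps / 2).
have e0 : 0 < e by rewrite lt_min r0 divr_gt0.
have er : e <= r by rewrite ge_min lexx.
have eeps : e < eps by rewrite gt_min; apply/orP; right; rewrite ltr_pdivrMr // ltr_pMr // ltr1n.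
have n1 : 0 < (n%:R + 1 : R) by rewrite ltr_wpDl.
pose del := c * e / (2 * (n%:R + 1)).
exists del; first by rewrite !(divr_gt0, mulr_gt0).
move=> y yd; pose phi x := dot (f x - y) (f x - y).
pose K := [set x : V | `|x - p| <= e].
have KU x : K x -> U x by move=> xe; apply: rU; exact: le_trans xe er.
have cphi x : K x -> {for x, continuous phi}.
  move=> Kx; apply: (@sm_continuous _ _ _ U phi x) (KU x Kx).
  by apply: sm_dot => //; apply: smB => //; exact: sm_cst.
have Kp : K p by rewrite /K /= subrr normr0 ltW.
have [|x /set_mem Kx xmin] := @compact_EVT_min _ _ phi K (ex_intro _ p Kp) (@closed_ball_shift p e).
  by apply: continuous_in_subspaceT => z /set_mem; exact: cphi.
have fxy : `|f x - y| <= (n%:R + 1) * `|f p - y|.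
  rewrite -ler_sqr ?nnegrE ?mulr_ge0 ?addr_ge0 //; apply: le_trans (norm_sqr_le_dot _) _.
  apply: le_trans (xmin p (mem_set Kp)) _; apply: le_trans (dot_le_norm_sqr _) _.
  rewrite exprMn; apply: ler_wpM2r; first exact: sqr_ge0.
  have : 0 <= n%:R :> R by []. by nra.
have del2 : (n%:R + 1) * del = c * e / 2 by rewrite /del; field; rewrite lt0r_neq0.
have pyd : `|f p - y| < del by rewrite distrC.
have fxy2 : `|f x - y| < c * e / 2 by apply: le_lt_trans fxy _; rewrite -del2 ltr_pM2l.
have fpy2 : `|f p - y| < c * e / 2.
  apply: lt_le_trans pyd _; rewrite -del2 ler_pMl ?lerDr //.
  by rewrite !(divr_gt0, mulr_gt0).
have xe : `|x - p| < e.
  rewrite lt_neqAle (_ : `|x - p| <= e) // andbT; apply/eqP => E.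
  have := exps p x; rewrite subrr normr0 E => /(_ (ltW r0) er).
  have : `|f x - f p| <= `|f x - y| + `|f p - y|.
    by rewrite (distrC (f p)); exact: ler_distD.
  by lra.
exists x; first exact: lt_trans xe eeps.
have Ux : U x := KU x Kx; have dfx := dfU x Ux.
have crit v : dot (f x - y) ('D_v f x) = 0.
  have [->|v0] := eqVneq v 0; first by rewrite deriveE // linear0 dot0r.
  have nv : 0 < `|v| by rewrite normr_gt0.
  pose a := (e - `|x - p|) / `|v|; have a0 : 0 < a by rewrite divr_gt0 // subr_gt0.
  have Kt (t : R) : - a < t < a -> K (x + t *: v).
    move=> ta; rewrite /K /= addrAC; apply: le_trans (ler_normD _ _) _.
    rewrite normrZ -lerBrDl -ler_pdivlMr // ltW // -/a; by rewrite ltr_norml.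
  have sphi : smooth_on U phi by apply: sm_dot => //; apply: smB => //; exact: sm_cst.
  have dphi (t : R) : - a < t < a -> is_derive t 1 (fun s => phi (x + s *: v)) ('D_v phi (x + t *: v)).
    by move=> ta; apply: is_derive_line; apply: sm_diff sphi _; exact: KU (Kt _ ta).
  have aa : - a < 0 < a by rewrite oppr_lt0 a0.
  have h := @derive1_at_min _ (fun s => phi (x + s *: v)) (- a) a 0.
  have : is_derive (0 : R) 1 (fun s => phi (x + s *: v)) 0.
    apply: h; first by rewrite ltW // (lt_trans (y := 0)) // oppr_lt0.
    - by move=> t; rewrite in_itv /= => /dphi[].
    - by rewrite in_itv.
    - move=> t; rewrite in_itv /= scale0r addr0 => ta; apply: xmin; apply/mem_set; exact: Kt.
  have d0 := dphi 0 aa; move=> d1.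
  have : 'D_v phi x = 0.
    have := @derive_val _ _ _ _ _ _ _ d0; rewrite (@derive_val _ _ _ _ _ _ _ d1).
    by rewrite scale0r addr0.
  have dfy : differentiable (fun z => f z - y) x by apply: differentiableB => //; exact: differentiable_cst.
  rewrite /phi (derive_dot _ dfy dfy) (derB _ dfx (differentiable_cst y x)).
  rewrite der_cst subr0 (dotC ('D_v f x)).
  by move: (dot _ _) => D; lra.
have injx v : v != 0 -> 'D_v f x != 0.
  move=> v0; rewrite -normr_gt0; apply: (@lt_le_trans _ _ (c * `|v|)); first by rewrite mulr_gt0 ?normr_gt0.
  apply: expansion_derive dfx _; apply: (@radius_near _ _ _ (r - `|x - p|)).
    by rewrite subr_gt0; exact: lt_le_trans xe er.
  move=> z; rewrite ltrBrDr => zr; apply: exps; first exact: le_trans (ltW xe) er.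
  apply: le_trans (ltW zr); rewrite -[z in `|z - p|](subrK x) -addrA; exact: ler_normD.
have uJ := jacobian_unit dfx injx.
have := crit ((f x - y) *m invmx (jacobian f x)).
rewrite jacobianE // mulmxKV // => /eqP; rewrite dot_eq0 subr_eq0 => /eqP; exact.
Qed.

End LocalInverse.

Section Uniform.
Context {R : realType}.

(** A Lebesgue number argument: the scales form the filter of right neighbourhoods of 0, to which
    the near-covering form of compactness applies. *)
Lemma unif_compact (V : normedModType R) (K : set V) (P : R -> V -> Prop) : compact K ->
  (forall r r' x, P r x -> 0 < r' -> r' <= r -> P r' x) ->
  (forall x, K x -> exists2 r, 0 < r & forall y, `|y - x| < r -> P r y) ->
  exists2 r, 0 < r & forall x, K x -> P r x.
Proof.
move=> cK mono loc.
have /compact_near_coveringP/(_ _ (0 : R)^'+ P _) := cK.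
have H x : K x -> \forall x' \near x & i \near 0^'+, P i x'.
  move=> /loc[r r0 h]; exists ([set y | `|y - x| < r], [set i | 0 < i /\ i < r]) => /=.
    split; first exact: (radius_near r0).
    by apply: filterI; [exact: nbhs_right_gt|exact: nbhs_right_lt].
  by move=> [y i] [/= yr [i0 ir]]; exact: mono (h y yr) i0 (ltW ir).
move=> /(_ H) KP; have : \forall i \near (0 : R)^'+, 0 < i /\ K `<=` P i.
  by apply: filterI => //; exact: nbhs_right_gt.
by move=> /filter_ex[r [r0 h]]; exists r.
Qed.

(* The indicator of the fibre of [f x] has zero derivative along the segment. *)
Lemma locally_constant_segment (V : normedModType R) (T : Type) (f : V -> T) x y :
  (forall t : R, 0 <= t <= 1 -> exists2 r, 0 < r &
     forall z, `|z - (x + t *: (y - x))| < r -> f z = f (x + t *: (y - x))) -> f y = f x.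
Proof.
move=> loc; pose F (t : R) : R := `[< f (x + t *: (y - x)) = f x >]%:R.
have dF (t : R) : 0 <= t <= 1 -> is_derive t 1 F ((fun=> 0) t).
  move=> /loc[r r0 h]; have nv : 0 < `|y - x| + 1 by rewrite ltr_wpDl.
  have nF : \forall s \near t, F t = F s.
    apply: (@radius_near _ _ _ (r / (`|y - x| + 1))); first exact: divr_gt0.
    move=> s; rewrite ltr_pdivlMr // => st; rewrite /F (h (x + s *: (y - x))) //.
    rewrite opprD addrACA subrr add0r -scalerBl normrZ; apply: le_lt_trans st.
    by apply: ler_wpM2l => //; rewrite lerDl.
  have dc : is_derive t 1 (fun=> F t) 0 by exact: is_derive_cst.
  split; first by apply: near_eq_derivable nF _; case: dc.
  by rewrite -(near_eq_derive _ nF); case: dc.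
have [c _] := MVT0 ltr01 dF; rewrite mul0r => /eqP; rewrite subr_eq0 /F scale1r scale0r addr0.
rewrite [`[< f x = f x >]]asboolT // (addrC x) subrK; case: asboolP => // _.
by rewrite eq_sym oner_eq0.
Qed.

End Uniform.

(** * Path lifting through a norm-preserving immersion *)

Section Covering.
Context {R : realType}.
Local Notation E3 := 'rV[R]_3.
Local Notation E2 := 'rV[R]_2.
Local Notation NZ := [set X : E3 | X != 0].
Variable Phi : E3 -> E3.
Hypothesis sPhi : smooth_on NZ Phi.
Hypothesis Phi_iso : forall X, dot (Phi X) (Phi X) = dot X X.
Hypothesis Phi_imm : forall X v, X != 0 -> v != 0 -> 'D_v Phi X != 0.

(** The paths to be lifted consist of chords between unit vectors with nonnegative inner product,
    whose points have squared norm at least 1/2. Compactness then gives radii of local injectivity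
    and surjectivity that are uniform along them. *)
Definition annulus : set E3 := [set X | 2^-1 <= dot X X <= 1].

Lemma annulus_neq0 X : annulus X -> X != 0.
Proof. by move=> /andP[h _]; apply/eqP => X0; move: h; rewrite X0 dot0l; lra. Qed.

Lemma sphere_annulus X : sphere X -> annulus X.
Proof. by rewrite /annulus /= => ->; lra. Qed.

Lemma annulus_compact : compact annulus.
Proof.
have cB := @compact_ball R 3 1.
have -> : annulus = annulus `&` [set x : E3 | `|x| <= 1].
  apply/seteqP; split => X; last by case.
  move=> h; split => //=; case/andP: h => _ h.
  by rewrite -ler_sqr ?nnegrE // expr1n; apply: le_trans h; exact: norm_sqr_le_dot.
rewrite setIC; apply: compact_closedI => //.
have -> : annulus = (fun X : E3 => dot X X) @^-1` `[2^-1, 1].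
  by apply/seteqP; split => X; rewrite /annulus /= in_itv.
apply: closed_comp; last exact: interval_closed.
by move=> x _; exact: dot_continuous.
Qed.

Let oNZ := @open_nonzero R 3.

Lemma unif_injective : exists2 r, 0 < r & forall p, annulus p -> forall x y,
  `|x - p| < r -> `|y - p| < r -> Phi x = Phi y -> x = y.
Proof.
pose P r p := forall x y, `|x - p| < r -> `|y - p| < r -> Phi x = Phi y -> x = y.
apply: (@unif_compact _ _ annulus P) => [|r r' x h r0 rr a b ha hb|p /annulus_neq0 p0].
- exact: annulus_compact.
- by apply: h; exact: lt_le_trans rr.
have [r r0 [c c0 [_ ex]]] := local_expansion oNZ sPhi p0 (fun v => Phi_imm p0).
exists (r / 2); first by rewrite divr_gt0.
move=> q qr x y xq yq E.
have tri z : `|z - q| < r / 2 -> `|z - p| <= r.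
  move=> zq; apply: le_trans (ler_distD q _ _) _; lra.
have := ex x y (tri x xq) (tri y yq); rewrite E subrr normr0 pmulr_rle0 // normr_le0 subr_eq0.
by move=> /eqP.
Qed.

Lemma unif_surjective e : 0 < e -> exists2 d, 0 < d & forall p, annulus p -> forall y,
  `|y - Phi p| < d -> exists2 x, `|x - p| < e & Phi x = y.
Proof.
move=> e0; pose P d p := forall y, `|y - Phi p| < d -> exists2 x, `|x - p| < e & Phi x = y.
apply: (@unif_compact _ _ annulus P) => [|r r' x h r0 rr y yr|p /annulus_neq0 p0].
- exact: annulus_compact.
- by apply: h; exact: lt_le_trans rr.
have e20 : 0 < e / 2 by rewrite divr_gt0.
have [d d0 ds] := local_surjection oNZ sPhi p0 (fun v => Phi_imm p0) e20.
have d20 : 0 < d / 2 by rewrite divr_gt0.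
have [r r0 rP] := continuous_radius (sm_continuous sPhi p0) d20.
exists (Num.min (d / 2) (Num.min r (e / 2))); first by rewrite !lt_min d20 r0 e20.
move=> q; rewrite !lt_min => /and3P[q1 q2 q3] y; rewrite lt_min => /andP[y1 _].
have [|x xp E] := ds y.
  by apply: le_lt_trans (ler_distD (Phi q) _ _) _; have := rP q (ltW q2); lra.
exists x => //; apply: le_lt_trans (ler_distD p _ _) _; rewrite [X in _ + X]distrC; lra.
Qed.

Section Lifting.
Variable v : E3.
Hypothesis vS : sphere v.

Definition middle (w : E3) : E3 := (nrm (w + v))^-1 *: (w + v).

(** A polygonal path of 2 N steps from w to v through the normalised midpoint: the direct chord
    would pass near 0 for w close to - v, whereas each half subtends at most a right angle. *)
Definition way (N k : nat) (w : E3) : E3 :=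
  if (k <= N)%N then w + (k%:R / N%:R) *: (middle w - w)
  else middle w + ((k - N)%:R / N%:R) *: (v - middle w).

Lemma chord_annulus a b (t : R) : sphere a -> sphere b -> 0 <= dot a b -> 0 <= t <= 1 ->
  annulus (a + t *: (b - a)).
Proof.
move=> aS bS ab /andP[t0 t1]; have E : dot (a + t *: (b - a)) (a + t *: (b - a)) =
    (1 - t) ^+ 2 + t ^+ 2 + 2 * t * (1 - t) * dot a b.
  rewrite !(dotDl, dotDr, dotZl, dotZr, dotNl, dotNr) aS bS (dotC b a); ring.
have := dot_ge0 (a - b); rewrite /annulus /= E.
rewrite !(dotDl, dotDr, dotNl, dotNr) aS bS (dotC b a).
move: (dot a b) ab => d d0 d1; have x0 : 0 <= t * (1 - t) by rewrite mulr_ge0 ?subr_ge0.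
have x1 : t * (1 - t) <= 4^-1 by have := sqr_ge0 (2 * t - 1); rewrite expr2; lra.
have -> : (1 - t) ^+ 2 + t ^+ 2 + 2 * t * (1 - t) * d = 1 - 2 * (t * (1 - t)) + 2 * (t * (1 - t)) * d by ring.
move: (t * (1 - t)) x0 x1 => x x0 x1; have xd := mulr_ge0 x0 d0.
have xd' : 0 <= x * (1 - d) by rewrite mulr_ge0 //; lra.
by rewrite mulrBr mulr1 in xd'; apply/andP; split; lra.
Qed.

Lemma middle_sphere w : sphere w -> w + v != 0 -> sphere (middle w).
Proof.
move=> wS wv; rewrite /sphere /= /middle dotZl dotZr mulrA -expr2 exprVn nrm_sqr mulVf //.
by rewrite dot_eq0.
Qed.

Lemma middle_dot w : sphere w -> w + v != 0 -> 0 <= dot w (middle w) /\ 0 <= dot (middle w) v.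
Proof.
move=> wS wv; have := dot_ge0 (w + v); have := nrm_gt0 wv.
rewrite /middle dotZl dotZr !dotDl !dotDr wS vS (dotC v w).
move: (nrm _) (dot w v) => N d N0 h; have N1 : 0 < N^-1 by rewrite invr_gt0.
by split; (apply: mulr_ge0; [exact: ltW|lra]).
Qed.

Lemma middle_id : middle v = v.
Proof.
rewrite /middle -mulr2n -scaler_nat nrmZ // (nrm_eq1 vS) mulr1 scalerA mulVf ?scale1r //.
Qed.

Lemma way0 N w : way N 0 w = w.
Proof. by rewrite /way leq0n mul0r scale0r addr0. Qed.

Lemma way_end N w : (0 < N)%N -> way N (N + N) w = v.
Proof.
move=> N0; rewrite /way leqNgt -{1}(addn0 N) ltn_add2l N0 addnK divff ?pnatr_eq0 -?lt0n //.
by rewrite /= scale1r addrC subrK.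
Qed.

Lemma way_id N k : way N k v = v.
Proof. by rewrite /way middle_id subrr !scaler0 addr0; case: ifP. Qed.

Lemma frac01 (N k : nat) : (k <= N)%N -> (0 < N)%N -> 0 <= (k%:R / N%:R : R) <= 1.
Proof.
by move=> kN N0; rewrite divr_ge0 //= ler_pdivrMr ?ltr0n // mul1r ler_nat.
Qed.

Lemma way_annulus N k w : (0 < N)%N -> (k <= N + N)%N -> sphere w -> w + v != 0 -> annulus (way N k w).
Proof.
move=> N0 kN wS wv; have mS := middle_sphere wS wv; have [d1 d2] := middle_dot wS wv.
rewrite /way; case: leqP => h; apply: chord_annulus => //; apply: frac01 => //.
by rewrite leq_subLR.
Qed.

Lemma chord_step (a b : E3) (s t : R) : sphere a -> sphere b ->
  `|a + t *: (b - a) - (a + s *: (b - a))| <= 2 * `|t - s|.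
Proof.
move=> aS bS; rewrite opprD addrACA subrr add0r -scalerBl normrZ mulrC; apply: ler_wpM2r => //.
have n1 (z : E3) : sphere z -> `|z| <= 1 by move=> zS; rewrite -(nrm_eq1 zS); exact: norm_le_nrm.
by apply: le_trans (ler_normB _ _) _; have := n1 a aS; have := n1 b bS; lra.
Qed.

Lemma way_step N k w : (0 < N)%N -> sphere w -> w + v != 0 ->
  `|way N k.+1 w - way N k w| <= 2 / N%:R.
Proof.
move=> N0 wS wv; have mS := middle_sphere wS wv.
have N0' : (N%:R : R) != 0 by rewrite pnatr_eq0 -lt0n.
have st (i : nat) : `|i.+1%:R / N%:R - i%:R / N%:R| = N%:R^-1 :> R.
  by rewrite -mulrBl -natrB // subSnn mul1r ger0_norm // invr_ge0.
rewrite /way; have [kN|kN|kN] := ltngtP k N.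
- by apply: le_trans (chord_step _ _ wS mS) _; rewrite st.
- by rewrite subSn ?(ltnW kN) //; apply: le_trans (chord_step _ _ mS vS) _; rewrite st.
- rewrite kN; have -> : w + (N%:R / N%:R) *: (middle w - w) = middle w + (0%:R / N%:R) *: (v - middle w).
    by rewrite divff // scale1r addrC subrK mul0r scale0r addr0.
  by rewrite subSn // subnn; apply: le_trans (chord_step _ _ mS vS) _; rewrite st.
Qed.

Lemma open_nonopposite : open [set w : E3 | w + v != 0].
Proof.
apply: (@open_comp _ _ (fun w : E3 => w + v) [set X | X != 0]); last exact: oNZ.
by move=> x _; apply: continuousD; [exact: cvg_id|exact: cst_continuous].
Qed.

Lemma way_continuous N k w : w + v != 0 -> {for w, continuous (way N k)}.
Proof.
move=> wv; have oU := open_nonopposite; apply: (sm_continuous (U := [set w : E3 | w + v != 0])) => //.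
have sa : smooth_on [set w : E3 | w + v != 0] (fun w => w + v) by smooth.
have sm : smooth_on [set w : E3 | w + v != 0] middle.
  rewrite /middle; smooth; first by move=> x /nrm_gt0/lt0r_neq0.
  exact: (sm_comp (findim_mx _ _) findimR oU oNZ (fun x h => h) sa (@sm_nrm R 3)).
have -> : way N k = if (k <= N)%N then fun w => w + (k%:R / N%:R) *: (middle w - w)
    else fun w => middle w + ((k - N)%:R / N%:R) *: (v - middle w).
  by apply/funext => x; rewrite /way; case: ifP.
by case: ifP => _; smooth.
Qed.

Definition good (x : E3) := sphere x /\ Phi x + v != 0.

Lemma sphere_Phi x : sphere x -> sphere (Phi x).
Proof. by rewrite /sphere /= Phi_iso. Qed.

(* Lifts the polygonal path from [Phi x] to [v] step by step; the end point is the value at x of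
   a locally constant retraction onto the fibre of v. *)
Lemma fibre_retraction : exists r : E3 -> E3,
  [/\ forall x, good x -> sphere (r x) /\ Phi (r x) = v,
      forall x, sphere x -> Phi x = v -> r x = x
    & forall x, good x -> exists2 d, 0 < d & forall y, good y -> `|y - x| < d -> r y = r x].
Proof.
have [rho rho0 inj] := unif_injective.
(* Thirds, because the continuity of the lift adds up three such displacements before injectivity at
   scale rho is used. *)
have e0 : 0 < rho / 3 by rewrite divr_gt0.
have [del del0 surj] := unif_surjective e0.
pose N := (Num.truncn (2 / del)).+1; have N0 : (0 < N)%N by [].
have Ndel : 2 / N%:R < del.
  have h : 2 / del < N%:R by rewrite truncnS_gt.
  by rewrite ltr_pdivrMr ?ltr0n // mulrC -ltr_pdivrMr.
pose L (x y : E3) := get [set z | `|z - x| < rho / 3 /\ Phi z = y].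
have LP x y : annulus x -> `|y - Phi x| < del -> `|L x y - x| < rho / 3 /\ Phi (L x y) = y.
  move=> Ax xy; have [z zx E] := surj x Ax y xy.
  by apply: (@getPex _ [set z | `|z - x| < rho / 3 /\ Phi z = y]); exists z.
pose X := fix X (k : nat) (x : E3) : E3 := if k is k'.+1 then L (X k' x) (way N k (Phi x)) else x.
have AX k x : (k <= N + N)%N -> good x -> annulus (way N k (Phi x)).
  by move=> kN [xS xv]; apply: way_annulus => //; exact: sphere_Phi.
have XE k x : (k <= N + N)%N -> good x -> Phi (X k x) = way N k (Phi x) /\ annulus (X k x).
  elim: k => [|k IH] kN gx.
    by rewrite way0; split => //; case: gx => xS _; exact: sphere_annulus.
  have [E A] := IH (ltnW kN) gx; have [xS xv] := gx.
  have [_ E'] : `|X k.+1 x - X k x| < rho / 3 /\ Phi (X k.+1 x) = way N k.+1 (Phi x).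
    apply: LP => //; rewrite E; apply: le_lt_trans Ndel.
    by apply: way_step => //; exact: sphere_Phi.
  split=> //; rewrite /annulus /= -Phi_iso E'; exact: AX.
have XS k x : (k < N + N)%N -> good x -> `|X k.+1 x - X k x| < rho / 3.
  move=> kN gx; have [E A] := XE k x (ltnW kN) gx; have [xS xv] := gx.
  have [] // : `|X k.+1 x - X k x| < rho / 3 /\ Phi (X k.+1 x) = way N k.+1 (Phi x).
  apply: LP => //; rewrite E; apply: le_lt_trans Ndel.
  by apply: way_step => //; exact: sphere_Phi.
(* Local surjectivity provides a preimage of the next way point of y close to [X k.+1 x], and
   injectivity identifies it with [X k.+1 y]; this gives the continuity of each step of the lift. *)
have XC k x : (k <= N + N)%N -> good x -> forall eta, 0 < eta -> exists2 d, 0 < d &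
    forall y, good y -> `|y - x| < d -> `|X k y - X k x| < eta.
  move=> + gx; elim: k => [|k IH] kN eta eta0; first by exists eta.
  have [d1 d10 P1] := IH (ltnW kN) (rho / 3) e0.
  have [E1 A1] := XE k.+1 x kN gx.
  pose e := Num.min eta (rho / 3); have ee : 0 < e by rewrite lt_min eta0.
  have [d2 d20 P2] := local_surjection oNZ sPhi (annulus_neq0 A1) (fun v => Phi_imm (annulus_neq0 A1)) ee.
  have [xS xv] := gx.
  have cw : {for x, continuous (way N k.+1 \o Phi)}.
    apply: continuous_comp; last exact: way_continuous.
    exact: sm_continuous sPhi (sphere_neq0 xS).
  have [d3 d30 P3] := continuous_radius cw d20.
  exists (Num.min d1 d3); first by rewrite lt_min d10.
  move=> y gy; rewrite lt_min => /andP[y1 y3].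
  have [E2 A2] := XE k.+1 y kN gy; have [E3' A3] := XE k y (ltnW kN) gy.
  have [z zx Ez] : exists2 z, `|z - X k.+1 x| < e & Phi z = way N k.+1 (Phi y).
    by apply: P2; rewrite E1; exact: P3 (ltW y3).
  have <- : z = X k.+1 y.
    apply: (inj _ A3) => //.
    - have h1 := P1 y gy y1; have h2 := XS k x kN gx.
      have h3 : `|z - X k.+1 x| < rho / 3 by apply: lt_le_trans zx _; rewrite ge_min lexx orbT.
      apply: le_lt_trans (ler_distD (X k.+1 x) _ _) _.
      apply: le_lt_trans (lerD (lexx _) (ler_distD (X k x) _ _)) _.
      rewrite [`|X k x - X k y|]distrC; lra.
    - by apply: lt_trans (XS k y kN gy) _; rewrite ltr_pdivrMr // ltr_pMr // ltr1n.
    - by rewrite Ez E2.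
  by apply: lt_le_trans zx _; rewrite ge_min lexx.
have X0 x : X 0%N x = x by [].
clearbody X; exists (X (N + N)%N); split.
- move=> x gx; have [E A] := XE _ x (leqnn _) gx; move: E; rewrite way_end // => E.
  by split => //; rewrite /sphere /= -Phi_iso E.
- move=> x xS xv; have gx : good x.
    split=> //; rewrite xv -mulr2n -scaler_nat scaler_eq0 pnatr_eq0 /=; exact: sphere_neq0.
  have : forall k, (k <= N + N)%N -> X k x = x.
    elim=> [|k IH] kN; first exact: X0.
    have := XS k x kN gx; rewrite IH ?(ltnW kN) // => h.
    apply: (inj x (sphere_annulus xS)) => //; last by have [-> _] := XE _ _ kN gx; rewrite xv way_id.
    - by apply: lt_trans h _; rewrite ltr_pdivrMr // ltr_pMr // ltr1n.
    - by rewrite subrr normr0.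
  exact.
move=> x gx; have [d d0 P] := XC (N + N)%N x (leqnn _) gx _ rho0.
exists d => // y gy yx; have [E A] := XE _ x (leqnn _) gx; have [E' _] := XE _ y (leqnn _) gy.
apply: (inj _ A); [exact: P|by rewrite subrr normr0|].
by rewrite E E' !way_end.
Qed.

End Lifting.
End Covering.

Section Punctured.
Context {R : realType}.
Local Notation E2 := 'rV[R]_2.

Lemma norm_scale_delta n (r : R) (i : 'I_n) : 0 <= r -> `|r *: (delta_mx 0 i : 'rV[R]_n)| <= r.
Proof.
move=> r0; apply: mx_norm_le => // k j; rewrite mxE mxE normrM ger0_norm // ler_piMr //.
by case: (_ && _); rewrite ?normr1 ?normr0.
Qed.

(** The punctured ball is reached along segments avoiding b from two base points, one for the points
    on the line through b parallel to the first axis and one for all others. *)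
Lemma punctured_constant (T : Type) (f : E2 -> T) (b : E2) (eta : R) : 0 < eta ->
  (forall y, 0 < `|y - b| < eta -> exists2 r, 0 < r & forall z, `|z - y| < r -> f z = f y) ->
  exists z, forall y, 0 < `|y - b| < eta -> f y = z.
Proof.
move=> eta0 loc.
have seg p y : (forall t : R, 0 <= t <= 1 -> p + t *: (y - p) != b) -> `|p - b| < eta -> `|y - b| < eta ->
    f y = f p.
  move=> nb pe ye; apply: locally_constant_segment => t t01; apply: loc.
  rewrite normr_gt0 subr_eq0 nb //=.
  apply: (@le_lt_trans _ _ (Num.max `|p - b| `|y - b|)); last by rewrite gt_max pe.
  by apply: segment_ball => //; rewrite le_max lexx ?orbT.
pose pt i : E2 := b + (eta / 2) *: delta_mx 0 i.
have h0 : 0 < eta / 2 by rewrite divr_gt0.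
have ptE i : `|pt i - b| < eta.
  rewrite /pt addrC addKr; apply: (@le_lt_trans _ _ (eta / 2)); last first.
    by rewrite ltr_pdivrMr // ltr_pMr // ltr1n.
  exact: norm_scale_delta (ltW h0).
have sE (p y : E2) (t : R) i : (p + t *: (y - p)) 0 i = (1 - t) * p 0 i + t * y 0 i by rewrite !mxE; ring.
have p01 : f (pt 1) = f (pt 0).
  apply: seg => // t t01; apply/eqP => /rowP E; have := E 0; have := E 1.
  rewrite !sE !mxE /= !mulr0 !mulr1 !addr0 => e1 e0.
  have : t * (eta / 2) = 0 by move: e1; lra.
  move=> /eqP; rewrite mulf_eq0 (gt_eqF h0) orbF => /eqP t0; move: e0; rewrite t0.
  lra.
exists (f (pt 0)) => y /andP[y0 ye]; have [y1|y1] := eqVneq ((y - b) 0 1) 0.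
  rewrite -p01; apply: seg => // t t01; apply/eqP => /rowP E; have := E 0; have := E 1.
  rewrite !sE !mxE /= !mulr0 !mulr1 !addr0 => e1 e0.
  move: y1; rewrite !mxE => y1; have y1' : y 0 1 = b 0 1 by lra.
  rewrite y1' in e1.
  have : (1 - t) * (eta / 2) = 0 by move: e1; lra.
  move=> /eqP; rewrite mulf_eq0 (gt_eqF h0) orbF subr_eq0 => /eqP t1; move: e0; rewrite -t1 => e0.
  have y0' : y 0 0 = b 0 0 by lra.
  move: y0; rewrite normr_gt0 subr_eq0 => /eqP; apply; apply/rowP; elim/ord2P => //.
apply: seg => // t t01; apply/eqP => /rowP E; have := E 0; have := E 1.
rewrite !sE !mxE /= !mulr0 !mulr1 !addr0 => e1 e0.
have : t * (y - b) 0 1 = 0 by rewrite !mxE; move: e1; lra.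
move=> /eqP; rewrite mulf_eq0 (negbTE y1) orbF => /eqP t0; move: e0; rewrite t0; lra.
Qed.

Lemma sphere_not_isolated (x : 'rV[R]_3) (eta : R) : sphere x -> 0 < eta ->
  exists2 y, sphere y & 0 < `|y - x| < eta.
Proof.
move=> xS eta0; have [c dx] : exists c, chart_dom c x.
  by case: (chart_cover (sphere_neq0 xS)) => h; [exists false|exists true].
have xE : stereo c (chart c x) = x by rewrite stereo_chart // (nrm_eq1 xS) invr1 scale1r.
have [r r0 rP] := continuous_radius (sm_continuous (@sm_stereo R c) (I : setT (chart c x))) eta0.
pose y : E2 := chart c x + r *: delta_mx 0 0.
exists (stereo c y); first exact: stereo_sphere.
rewrite -{1}xE normr_gt0 subr_eq0; apply/andP; split.
  apply/eqP => /stereo_inj/rowP/(_ 0); rewrite !mxE /= mulr1; lra.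
rewrite -[X in _ - X]xE; apply: rP; rewrite /y addrC addKr.
exact: norm_scale_delta (ltW r0).
Qed.

End Punctured.

(** * Bijectivity on the unit sphere *)

Section Bijective.
Context {R : realType}.
Local Notation E3 := 'rV[R]_3.
Local Notation E2 := 'rV[R]_2.
Local Notation NZ := [set X : E3 | X != 0].
Variable Phi : E3 -> E3.
Hypothesis sPhi : smooth_on NZ Phi.
Hypothesis Phi_iso : forall X, dot (Phi X) (Phi X) = dot X X.
Hypothesis Phi_imm : forall X v, X != 0 -> v != 0 -> 'D_v Phi X != 0.

Lemma sphere_chart (x : E3) : sphere x -> exists2 c, chart_dom c x & stereo c (chart c x) = x.
Proof.
move=> xS; have [c dx] : exists c, chart_dom c x.
  by case: (chart_cover (sphere_neq0 xS)) => h; [exists false|exists true].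
by exists c => //; rewrite stereo_chart // (nrm_eq1 xS) invr1 scale1r.
Qed.

(** The function is constant in each stereographic chart, along segments of the plane, and the
    images of the two charts meet. *)
Lemma sphere_locally_constant (T : Type) (f : E3 -> T) :
  (forall x, sphere x -> exists2 d, 0 < d & forall y, sphere y -> `|y - x| < d -> f y = f x) ->
  forall x y, sphere x -> sphere y -> f x = f y.
Proof.
move=> floc x y; have f_chart c y1 y2 : f (stereo c y1) = f (stereo c y2).
  apply: (@locally_constant_segment _ _ _ (fun y => f (stereo c y))) => t _.
  set w := _ + _; have [d d0 dP] := floc _ (stereo_sphere c w).
  have [d1 d10 d1P] := continuous_radius (sm_continuous (@sm_stereo R c) (I : setT w)) d0.
  by exists d1 => // z zw; apply: dP; [exact: stereo_sphere|exact: d1P (ltW zw)].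
move=> /sphere_chart[c _ <-] /sphere_chart[c' _ <-].
pose e : E2 := delta_mx 0 0.
have e0 : e != 0 by apply/eqP => /rowP/(_ 0); rewrite !mxE /=; apply/eqP; exact: oner_neq0.
have E y1 y2 : f (stereo false y1) = f (stereo true y2).
  by rewrite (f_chart false y1 (inversion e)) -stereo_inversion //; exact: f_chart.
move: (chart c x) (chart c' y) => a b; case: c; case: c'.
- exact: f_chart.
- exact/esym/E.
- exact: E.
- exact: f_chart.
Qed.

(** The points over - v, where the lift is undefined, are isolated by local injectivity, and the
    retraction is constant on a punctured neighbourhood of each. Its extension [rt] is locally
    constant on the whole sphere, hence constant, while it fixes every point over v. *)
Lemma fibre_connected v : sphere v -> (exists2 x, sphere x & Phi x = v) /\
  forall x y, sphere x -> sphere y -> Phi x = v -> Phi y = v -> x = y.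
Proof.
move=> vS; have [r [r1 r2 r3]] := fibre_retraction sPhi Phi_iso Phi_imm vS.
have [rho rho0 inj] := unif_injective sPhi Phi_imm.
(* Here z is the value of the retraction at all points close to x and distinct from x. *)
pose near1 x z := exists2 eta, 0 < eta & forall y, sphere y -> 0 < `|y - x| < eta -> good Phi v y /\ r y = z.
have cst0 c (y : E2) := sm_continuous (@sm_stereo R c) (I : setT y).
have claim x : sphere x -> exists z, near1 x z.
  move=> xS; have [xv|xv] := eqVneq (Phi x + v) 0; last first.
    exists (r x); have gx : good Phi v x by [].
    have [d d0 dP] := r3 x gx.
    have pv : 0 < `|Phi x + v| by rewrite normr_gt0.
    have [d' d0' dP'] := continuous_radius (sm_continuous sPhi (sphere_neq0 xS)) pv.
    exists (Num.min d d'); first by rewrite lt_min d0.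
    move=> y yS /andP[_]; rewrite lt_min => /andP[yd yd'].
    suff gy : good Phi v y by split => //; exact: dP.
    split=> //; apply/eqP => yv; have := dP' y (ltW yd').
    by rewrite -(addrK v (Phi y)) yv sub0r -opprD normrN addrC ltxx.
  have gp y : sphere y -> 0 < `|y - x| < rho -> good Phi v y.
    move=> yS /andP[y0 yr]; split => //; apply/eqP => yv; move: y0.
    suff -> : y = x by rewrite subrr normr0 ltxx.
    apply: (inj x (sphere_annulus xS)); rewrite ?subrr ?normr0 //.
    by apply/eqP; rewrite -subr_eq0 -(subrr (- v)) opprK; move: xv yv => /eqP; rewrite !addr_eq0 => /eqP -> /eqP; rewrite addr_eq0 => /eqP ->; rewrite subrr addNr.
  have [c dx xE] := sphere_chart xS.
  have [eta eta0 eP] := continuous_radius (cst0 c (chart c x)) rho0; rewrite xE in eP.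
  have ne y : 0 < `|y - chart c x| -> 0 < `|stereo c y - x|.
    rewrite !normr_gt0 !subr_eq0 => /eqP yx; apply/eqP => E; apply: yx.
    by rewrite -E chart_stereo.
  have [z zP] : exists z, forall y, 0 < `|y - chart c x| < eta -> r (stereo c y) = z.
    apply: punctured_constant => // y /andP[y0 ye].
    have gy : good Phi v (stereo c y).
      by apply: gp; [exact: stereo_sphere|rewrite ne //=; exact: eP (ltW ye)].
    have [d d0 dP] := r3 _ gy.
    have yx0 : 0 < rho - `|stereo c y - x| by rewrite subr_gt0; exact: eP (ltW ye).
    have [d1 d10 d1P] := continuous_radius (cst0 c y) d0.
    exists (Num.min d1 (Num.min `|y - chart c x| (eta - `|y - chart c x|))).
      by rewrite !lt_min d10 y0 subr_gt0.
    move=> z; rewrite !lt_min => /and3P[z1 z2 z3]; apply: dP; last exact: d1P (ltW z1).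
    apply: gp; first exact: stereo_sphere.
    have ze : `|z - chart c x| < eta.
      by apply: le_lt_trans (ler_distD y _ _) _; lra.
    rewrite ne /=; first exact: eP (ltW ze).
    rewrite normr_gt0 subr_eq0; apply/eqP => zc; move: z2; rewrite zc distrC ltxx //.
  exists z; have [d d0 dP] := continuous_radius (sm_continuous (@sm_chart R c) dx) eta0.
  have [d' d0' dP'] := near_radius (open_nbhs_nbhs (conj (@open_chart_dom R c) dx)).
  exists (Num.min rho (Num.min d d')); first by rewrite !lt_min rho0 d0.
  move=> y yS /andP[y0]; rewrite !lt_min => /and3P[yr yd yd'].
  split; first by apply: gp => //; rewrite y0.
  have yE : stereo c (chart c y) = y by rewrite stereo_chart ?(nrm_eq1 yS) ?invr1 ?scale1r //; exact: dP' (ltW yd').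
  rewrite -yE; apply: zP; rewrite dP ?ltW // andbT normr_gt0 subr_eq0.
  by apply/eqP => E; move: y0; rewrite -yE E xE subrr normr0 ltxx.
pose rt x := get (near1 x).
have rtP x : sphere x -> near1 x (rt x) by move=> /claim h; exact: getPex.
have rt_loc x : sphere x -> exists2 d, 0 < d & forall y, sphere y -> `|y - x| < d -> rt y = rt x.
  move=> xS; have [d d0 dP] := rtP x xS; exists d => // y yS yd.
  have [->//|yx] := eqVneq y x; have [e e0 eP] := rtP y yS.
  have yx0 : 0 < `|y - x| by rewrite normr_gt0 subr_eq0.
  have [|z zS /andP[z0]] := @sphere_not_isolated R y (Num.min e (Num.min `|y - x| (d - `|y - x|))) yS.
    by rewrite !lt_min e0 yx0 subr_gt0.
  rewrite !lt_min => /and3P[z1 z2 z3].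
  have := eP z zS; rewrite z0 z1 => /(_ isT)[_ <-].
  suff /(dP z zS)[] : 0 < `|z - x| < d by [].
  apply/andP; split.
    by rewrite normr_gt0 subr_eq0; apply/eqP => zx; move: z2; rewrite zx distrC ltxx.
  by apply: le_lt_trans (ler_distD y _ _) _; lra.
have rt_r x : good Phi v x -> rt x = r x.
  move=> gx; have [xS _] := gx; have [d d0 dP] := rtP x xS; have [e e0 eP] := r3 x gx.
  have [|z zS /andP[z0]] := @sphere_not_isolated R x (Num.min d e) xS; first by rewrite lt_min d0.
  rewrite lt_min => /andP[zd ze]; have := dP z zS; rewrite z0 zd => /(_ isT)[gz <-].
  exact: eP.
have rt_const := sphere_locally_constant rt_loc.
split.
  have xS := stereo_sphere false (0 : E2); have [d d0 dP] := rtP _ xS.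
  have [y yS yd] := sphere_not_isolated xS d0; have [gy _] := dP y yS yd.
  by have [h1 h2] := r1 y gy; exists (r y).
have gv x : sphere x -> Phi x = v -> good Phi v x.
  by move=> xS xv; split=> //; rewrite xv -mulr2n -scaler_nat scaler_eq0 pnatr_eq0 /=; exact: sphere_neq0.
move=> x y xS yS xv yv; rewrite -(r2 x xS xv) -(r2 y yS yv) -!rt_r; [exact: rt_const|exact: gv|exact: gv].
Qed.

End Bijective.

Section Inverse.
Context {R : realType}.

Lemma sm_prod (V : normedModType R) (U : set V) n (f : 'I_n -> V -> R) : open U ->
  (forall i, smooth_on U (f i)) -> smooth_on U (fun x => \prod_i f i x).
Proof.
move=> oU; elim: n f => [|n IH] f sf.
  by apply: (sm_eq (f := fun _ : V => 1 : R)) => // [y _|]; [rewrite big_ord0|exact: sm_cst].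
apply: (sm_eq (f := fun x => f ord0 x * \prod_i f (lift ord0 i) x)) => // [y _|].
  by rewrite big_ord_recl.
by apply: smM => //; exact: IH.
Qed.

Lemma sm_sumF (V W : normedModType R) (U : set V) (I : finType) (F : I -> V -> W) : open U ->
  (forall i, smooth_on U (F i)) -> smooth_on U (fun x => \sum_i F i x).
Proof.
move=> oU sF; apply: (sm_eq (f := fun x => \sum_(i < #|I|) F (enum_val i) x)) => // [y _|].
  by rewrite [RHS](reindex _ (onW_bij _ (@enum_val_bij I))).
exact: sm_sum.
Qed.

Lemma sm_det (V : normedModType R) (U : set V) n (A : V -> 'M[R]_n) : open U ->
  smooth_on U A -> smooth_on U (fun x => \det (A x)).
Proof.
move=> oU sA; rewrite /determinant; apply: sm_sumF => // s.
by apply: smM => //; [exact: sm_cst|apply: sm_prod => // i; exact: sm_coord].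
Qed.

Lemma sm_invmx (V : normedModType R) (U : set V) n (A : V -> 'M[R]_n) : open U ->
  (forall x, U x -> A x \in unitmx) -> smooth_on U A -> smooth_on U (fun x => invmx (A x)).
Proof.
move=> oU uA sA; apply: (sm_eq (f := fun x => (\det (A x))^-1 *: \adj (A x))) => // [y Uy|].
  by rewrite /invmx uA.
apply: smZ => //.
  by apply: smV => //; [move=> x /uA; rewrite unitmxE unitfE|exact: sm_det].
apply: sm_mx => // i j; under eq_fun do rewrite mxE.
rewrite /cofactor; apply: smM => //; first exact: sm_cst.
apply: sm_det => //; apply: sm_mx => // k l; under eq_fun do rewrite !mxE.
exact: sm_coord.
Qed.

Lemma derive_inverse n (U W : set 'rV[R]_n) (f g : 'rV[R]_n -> 'rV[R]_n) y : open U -> open W ->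
  smooth_on U f -> (forall x v, U x -> v != 0 -> 'D_v f x != 0) ->
  (forall x, U x -> W (f x) /\ g (f x) = x) -> (forall y, W y -> U (g y) /\ f (g y) = y) -> W y ->
  differentiable g y /\ forall v, 'D_v g y = v *m invmx (jacobian f (g y)).
Proof.
move=> oU oW sf inj gf fg Wy; have [Up fp] := fg y Wy; set p := g y in Up fp *.
have df := sm_diff sf Up; have uJ := jacobian_unit df (fun v => inj p v Up).
set J := jacobian f p in uJ *.
pose L := mulmxr (invmx J) : 'rV[R]_n -> 'rV[R]_n.
have LE v : L v = v *m invmx J by [].
have [r r0 [c c0 [rU ex]]] := local_expansion oU sf Up (fun v => inj p v Up).
have [d d0 ds] := local_surjection oU sf Up (fun v => inj p v Up) r0.
have gy h : `|h| < d -> `|g (h + y) - p| <= r /\ f (g (h + y)) = h + y.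
  move=> hd; have [|x xp E] := ds (h + y); first by rewrite fp addrK.
  have Ux := rU x (ltW xp); have [_ gx] := gf x Ux.
  by rewrite -E gx; split => //; exact: ltW.
have ge h : `|h| < d -> c * `|g (h + y) - p| <= `|h|.
  move=> /gy[h1 h2]; have := ex p _ _ h1; rewrite subrr normr0 h2 fp addrK; apply.
  exact: ltW.
have D : is_diff y g (mulmxr (invmx J)).
  apply: diff_eps => [v|e e0].
    apply: (@sm_continuous _ _ _ setT (fun v : 'rV[R]_n => v *m invmx J)) => //.
    by apply: sm_mulmx; [exact: openT|exact: sm_id|exact: sm_cst].
  pose C := n%:R * `|invmx J| + 1; have C0 : 0 < C by rewrite ltr_wpDl // mulr_ge0.
  have e'0 : 0 < e * c / C by rewrite divr_gt0 // mulr_gt0.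
  have [r1 r10 P1] := near_radius (differentiable_eps df e'0).
  apply: (@radius_near _ _ _ (Num.min d (c * r1))); first by rewrite lt_min d0 mulr_gt0.
  move=> h; rewrite subr0 lt_min => /andP[hd hr1].
  have [k1 k2] := gy h hd; have k3 := ge h hd; set k := g (h + y) - p in k3.
  have kr : `|k| <= r1 by rewrite -(ler_pM2l c0); apply: le_trans k3 (ltW hr1).
  have := P1 k; rewrite subr0 => /(_ kr).
  have -> : k + p = g (h + y) by rewrite subrK.
  rewrite k2 fp addrK -deriveE // jacobianE // -/J => b.
  have -> : g (h + y) - g y - mulmxr (invmx J) h = - ((h - k *m J) *m invmx J).
    by rewrite /= mulmxBl mulmxK // opprB.
  rewrite normrN; apply: le_trans (mulmx_norm _ _) _.
  apply: (@le_trans _ _ (C * (e * c / C * `|k|))).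
    by apply: ler_pM => //; rewrite lerDl.
  rewrite mulrA mulrCA divff ?lt0r_neq0 // mulr1 -mulrA; apply: ler_wpM2l => //.
  exact: ltW.
have dg : differentiable g y by case: D.
by split=> // v; rewrite deriveE // (@diff_val _ _ _ _ _ _ _ D).
Qed.

(** The derivative of the inverse is the inverse Jacobian of f at g y, a smooth function of the
    value of g, as [sm_bootstrap] asks. *)
Lemma sm_inverse n (U W : set 'rV[R]_n) (f g : 'rV[R]_n -> 'rV[R]_n) : open U -> open W ->
  smooth_on U f -> (forall x v, U x -> v != 0 -> 'D_v f x != 0) ->
  (forall x, U x -> W (f x) /\ g (f x) = x) -> (forall y, W y -> U (g y) /\ f (g y) = y) ->
  smooth_on W g.
Proof.
move=> oU oW sf inj gf fg; have D y Wy := derive_inverse oU oW sf inj gf fg (y := y) Wy.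
apply: sm_bootstrap => // [y /D[]//|v].
have oN : open [set z : 'rV[R]_n * 'rV[R]_n | U z.2].
  by apply: (@open_comp _ _ snd U) => // z _; exact: cvg_snd.
exists [set z | U z.2], (fun z => v *m invmx (jacobian f z.2)); split=> //.
- apply: sm_mulmx => //; first exact: sm_cst.
  apply: (sm_comp (U' := U) (g := fun x => invmx (jacobian f x)) (f := snd)) => //.
    by apply: sm_snd => //; exact: sm_id.
  apply: sm_invmx => //; last exact: sm_jacobian.
  by move=> x Ux; apply: jacobian_unit (sm_diff sf Ux) _ => w; exact: inj.
- by move=> y /fg[].
- by move=> y /D[_ ->].
Qed.

End Inverse.

(** * The diffeomorphism to the round sphere, with orientation *)

Section RoundModel.
Context {R : realType}.
Local Notation E3 := 'rV[R]_3.
Local Notation NZ := [set X : E3 | X != 0].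

Definition det3 (u v w : E3) : R :=
  u 0 0 * (v 0 1 * w 0 2 - v 0 2 * w 0 1) - u 0 1 * (v 0 0 * w 0 2 - v 0 2 * w 0 0)
  + u 0 2 * (v 0 0 * w 0 1 - v 0 1 * w 0 0).

Lemma det_rows (u v w : E3) : \det (\matrix_(i < 3) [:: u; v; w]`_i) = det3 u v w.
Proof.
have -> : \matrix_(i < 3) [:: u; v; w]`_i = (cols u v w)^T.
  by apply/matrixP; elim/ord3P; elim/ord3P; rewrite !mxE.
by rewrite det_tr det_mx3 /det3; ring.
Qed.

Lemma det3_mulmx (u v w : E3) (A : 'M[R]_3) :
  det3 (u *m A) (v *m A) (w *m A) = det3 u v w * \det A.
Proof.
rewrite -!det_rows -det_mulmx; congr (\det _); apply/matrixP => i j.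
by rewrite !mxE; move: i; elim/ord3P; rewrite /= !mxE; apply: eq_bigr => k _; rewrite mxE.
Qed.

Lemma det3_gram (u v w : E3) : dot u u = 1 -> dot u v = 0 -> dot u w = 0 ->
  det3 u v w ^+ 2 = dot v v * dot w w - dot v w ^+ 2.
Proof.
move=> uu uv uw; have := det_mulmx (cols u v w)^T (cols u v w).
rewrite cols_gram !det_mx3 det_tr uu uv uw (dotC v u) uv (dotC w u) uw (dotC w v) => E.
rewrite /det3; move: E; rewrite det_mx3; lra.
Qed.

(** A linear isometry of either orientation, composed with the developing map to match the
    orientation o. *)
Definition reflect (b : bool) (X : E3) : E3 := \row_i [:: X 0 0; X 0 1; (-1) ^+ b * X 0 2]`_i.

Lemma lincont_reflect b : lincont (reflect b).
Proof.
split=> [a u v|x].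
  by apply/rowP; elim/ord3P; rewrite !mxE //=; ring.
by apply: (@sm_continuous _ _ _ setT (reflect b)) => //; rewrite /reflect; smooth.
Qed.

Lemma dot_reflect b u v : dot (reflect b u) (reflect b v) = dot u v.
Proof. by rewrite !dot3 !mxE /=; case: b; rewrite /= ?expr0 ?expr1; ring. Qed.

Lemma det3_reflect b u v w : det3 (reflect b u) (reflect b v) (reflect b w) = (-1) ^+ b * det3 u v w.
Proof. by rewrite /det3 !mxE /=; case: b; rewrite /= ?expr0 ?expr1; ring. Qed.

Lemma normalize_sphere (X : E3) : X != 0 -> sphere ((nrm X)^-1 *: X).
Proof.
by move=> X0; rewrite /sphere /= dotZl dotZr mulrA -expr2 exprVn nrm_sqr mulVf // dot_eq0.
Qed.

Lemma derive_homogeneous (f : E3 -> E3) X : (forall a Y, 0 < a -> f (a *: Y) = a *: f Y) ->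
  differentiable f X -> 'D_X f X = f X.
Proof.
move=> hf df; have := @is_derive_line R E3 E3 f 0 X 1; rewrite add0r scale1r => /(_ df) h.
have : \forall t \near (1 : R), t *: f X = f (0 + t *: X).
  by near=> t; rewrite add0r hf //; near: t; exact: lt_nbhsr.
move=> /near_eq_derive; move=> /(_ 1) E.
have := @derive_val _ _ _ _ _ _ _ h; rewrite -E => <-.
rewrite (derZ _ (sm_diff (@sm_id _ _ setT) I) (sm_diff (@sm_cst _ _ _ setT _) I)) //.
by rewrite derive_id der_cst scaler0 addr0 scale1r.
Unshelve. all: by end_near.
Qed.

Variable g : E3 -> 'M[R]_3.
Hypothesis gm : riemannian_metric g.
Hypothesis gcurv : constant_curvature 1 g.

Lemma round_model o : exists Phi Psi : E3 -> E3,
  [/\ [/\ smooth_on NZ Phi, smooth_on NZ Psi, cancel Phi Psi & cancel Psi Phi],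
      forall X, dot (Phi X) (Phi X) = dot X X,
      forall a X, 0 < a -> Phi (a *: X) = a *: Phi X,
      forall q u v, sphere q -> dot q u = 0 -> dot q v = 0 ->
        bil (g q) u v = dot ('D_u Phi q) ('D_v Phi q)
    & forall q u v, sphere q -> dot q u = 0 -> dot q v = 0 ->
        area_form g o q u v = det3 (Phi q) ('D_u Phi q) ('D_v Phi q)].
Proof.
have oNZ := @open_nonzero R 3.
have [Ph [sP hP iP gP]] := developing_map gm gcurv.
have dP X : X != 0 -> differentiable Ph X by move=> X0; exact: sm_diff sP X0.
have did X : differentiable (fun Y : E3 => Y) X by exact: sm_diff (@sm_id _ _ setT) I.
have radial X u : X != 0 -> dot (Ph X) ('D_u Ph X) = dot X u.
  move=> X0; have : 'D_u (fun Y => dot (Ph Y) (Ph Y)) X = 'D_u (fun Y : E3 => dot Y Y) X.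
    by congr ('D_u _ X); apply/funext => Y; exact: iP.
  rewrite (derive_dot _ (dP X X0) (dP X X0)) (derive_dot _ (did X) (did X)) derive_id.
  by rewrite (dotC (Ph X)) (dotC X u); move: (dot _ _) (dot _ _) => A B; lra.
(* The derivative of a map homogeneous of degree one is constant along rays, which reduces its
   injectivity to points of the unit sphere. *)
have deg0 a X u : 0 < a -> X != 0 -> 'D_u Ph (a *: X) = 'D_u Ph X.
  move=> a0 X0; have aX0 : a *: X != 0 by rewrite scaler_eq0 (gt_eqF a0) (negbTE X0).
  have sZ : smooth_on setT (fun Y : E3 => a *: Y) by smooth.
  have E : 'D_u (Ph \o (fun Y => a *: Y)) X = 'D_u (fun Y => a *: Ph Y) X.
    by congr ('D_u _ X); apply/funext => Y /=; exact: hP.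
  have dca : differentiable (fun _ : E3 => a) X by exact: differentiable_cst.
  move: E; rewrite (derive_comp u (sm_diff sZ I) (dP _ aX0)) (derZ _ dca (dP _ X0)) // der_cst scale0r add0r.
  rewrite (derZ _ dca (did X)) // der_cst scale0r add0r derive_id (deriveZv _ _ (dP _ aX0)).
  by move=> /(scalerI (lt0r_neq0 a0)).
have imm X v : X != 0 -> v != 0 -> 'D_v Ph X != 0.
  move=> X0 v0; have N0 := nrm_gt0 X0; have N1 : 0 < (nrm X)^-1 by rewrite invr_gt0.
  rewrite -(deg0 _ X v N1 X0); set q := _ *: X.
  have qS : sphere q by exact: normalize_sphere.
  apply/eqP => Dv; have qv : dot q v = 0 by rewrite -radial ?Dv ?dot0r //; exact: sphere_neq0.
  have := gP q v v qS qv qv; rewrite Dv dot0l => /esym b0.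
  have [_ _ gp] := gm; have := gp q v qS; rewrite b0 ltxx => h.
  by have := h (proj2 (tangent_sphere v qS) qv) v0.
have nE X : nrm (Ph X) = nrm X by rewrite /nrm iP.
have P0 : Ph 0 = 0 by apply/eqP; rewrite -dot_eq0 iP dot0l.
have unit := normalize_sphere.
have surj Y : exists X, Ph X = Y.
  have [->|Y0] := eqVneq Y 0; first by exists 0.
  have [[x xS E] _] := fibre_connected sP iP imm (unit Y Y0).
  exists (nrm Y *: x); rewrite hP ?nrm_gt0 // E scalerA divff ?scale1r //.
  by rewrite lt0r_neq0 // nrm_gt0.
have inj X X' : Ph X = Ph X' -> X = X'.
  move=> E; have NE : nrm X = nrm X' by rewrite -(nE X) -(nE X') E.
  have [X0|X0] := eqVneq X 0.
    by apply/eqP; rewrite X0 eq_sym -dot_eq0 -nrm_sqr -NE X0 /nrm dot0l sqrtr0 expr0n.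
  have N0 := nrm_gt0 X0; have X0' : X' != 0.
    by apply/eqP => X'0; move: N0; rewrite NE X'0 /nrm dot0l sqrtr0 ltxx.
  have N1 : 0 < (nrm X)^-1 by rewrite invr_gt0.
  have PX0 : Ph X' != 0 by rewrite -dot_eq0 iP dot_eq0.
  have vS : sphere ((nrm X')^-1 *: Ph X') by rewrite -(nE X'); exact: unit.
  have [_ u] := fibre_connected sP iP imm vS.
  have xS := unit X X0; rewrite NE in xS N1.
  have := u _ _ xS (unit X' X0'); rewrite !hP // E => /(_ erefl erefl).
  by move=> /(scalerI (lt0r_neq0 N1)).
have [Ps PsK] : exists Ps, forall Y, Ph (Ps Y) = Y.
  by have [Ps h] := choice surj; exists Ps.
have PhK X : Ps (Ph X) = X by apply: inj; rewrite PsK.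
have nz X : X != 0 -> Ph X != 0 by rewrite -!dot_eq0 iP.
have nz' Y : Y != 0 -> Ps Y != 0 by rewrite -!dot_eq0 -(iP (Ps Y)) PsK.
have sPs : smooth_on NZ Ps.
  apply: (sm_inverse oNZ oNZ sP imm) => [x x0|y y0]; first by split; [exact: nz|exact: PhK].
  by split; [exact: nz'|exact: PsK].
have [del delE] : exists del, forall X, del X = \det (jacobian Ph X) by exists (fun X => \det (jacobian Ph X)).
have uJ X : X != 0 -> del X != 0.
  by move=> X0; rewrite delE -unitfE -unitmxE; exact: jacobian_unit (dP X X0) (fun v => imm X v X0).
have sJ : smooth_on NZ del.
  apply: (sm_eq oNZ (fun X _ => esym (delE X))).
  by apply: sm_det => //; exact: sm_jacobian.
(* The Jacobian determinant does not vanish, so its sign is constant on the connected sphere. *)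
pose neg q := del q < 0.
have negC q q' : sphere q -> sphere q' -> neg q = neg q'.
  apply: sphere_locally_constant => x xS; have x0 := sphere_neq0 xS.
  have d0 : 0 < `|del x| by rewrite normr_gt0 uJ.
  have [d dd dE] := continuous_radius (sm_continuous sJ x0) d0.
  exists d; first exact: dd.
  move=> y yS yd; have := dE y (ltW yd); have := uJ x x0; rewrite /neg.
  move: (del x) (del y) => a b; rewrite ltr_norml => a0 /andP[h1 h2].
  have [ap|an] := ltP 0 a.
    rewrite (gtr0_norm ap) in h1 h2; rewrite !ltNge (ltW ap) /=; apply/negbTE; rewrite negbK; lra.
  have an' : a < 0 by rewrite lt_neqAle a0.
  by rewrite (ltr0_norm an') in h1 h2; rewrite an'; lra.
pose q0 : E3 := stereo false 0; have q0S : sphere q0 := stereo_sphere _ _.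
(* A reflection is inserted exactly when the orientation induced by [Ph] differs from o. *)
pose b := o (+) neg q0.
have lr := @lincont_reflect; have dr X : differentiable (reflect b) X by exact: differentiable_lincont (lr b).
have rK X : reflect b (reflect b X) = X.
  by apply/rowP; elim/ord3P; rewrite !mxE //= signrMK.
have Dr X u : X != 0 -> 'D_u (fun Y => reflect b (Ph Y)) X = reflect b ('D_u Ph X).
  move=> X0; have := derive_comp u (dP X X0) (dr (Ph X)).
  by rewrite (derive_lincont _ _ (lr b)).
exists (fun X => reflect b (Ph X)), (fun Y => Ps (reflect b Y)); split.
- split.
  + exact: sm_lincomp oNZ (lr b) sP.
  + apply: (sm_comp (U' := NZ) (g := Ps) (f := reflect b)) => //; last exact: sm_lin.
    by move=> X /=; rewrite -!dot_eq0 dot_reflect.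
  + by move=> X; rewrite rK PhK.
  + by move=> Y; rewrite PsK rK.
- by move=> X; rewrite dot_reflect iP.
- by move=> a X a0; rewrite hP // (lincontZ _ _ (lr b)).
- by move=> q u v qS qu qv; have q1 := sphere_neq0 qS; rewrite !Dr // dot_reflect gP.
move=> q u v qS qu qv; have q1 := sphere_neq0 qS; rewrite !Dr // det3_reflect.
(* By homogeneity [Ph q] is the derivative of [Ph] at q in the direction q, so all three arguments
   are images under the Jacobian. *)
have E : det3 (Ph q) ('D_u Ph q) ('D_v Ph q) = det3 q u v * del q.
  rewrite delE -(derive_homogeneous hP (dP q q1)) !(jacobianE _ (dP q q1)); exact: det3_mulmx.
have o1 w : dot q w = 0 -> dot (Ph q) ('D_w Ph q) = 0 by move=> qw; rewrite radial.
have P1 : dot (Ph q) (Ph q) = 1 by rewrite iP.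
have G := det3_gram P1 (o1 u qu) (o1 v qv); rewrite !gP // in G.
rewrite /area_form det_rows -G E sqrtr_sqr normrM.
have : neg q = neg q0 by exact: negC.
rewrite /b /neg => <-; have := uJ q q1; move: (del q) (det3 q u v) => d e d0.
rewrite signr_addb -mulrA mulrA -(mulrA _ (Num.sg e)) -!mulrA; congr (_ * _).
rewrite mulrA -numEsg mulrCA; congr (_ * _).
by rewrite normrEsign.
Qed.

End RoundModel.

(** * Tangent vectors and forms on embedded manifolds *)

Section Manifolds.
Context {R : realType}.
Implicit Types V W : normedModType R.

Lemma derive_curve V W (f : V -> W) (c : R -> V) v (t : R) : is_derive t 1 c v ->
  differentiable f (c t) -> is_derive t 1 (f \o c) ('D_v f (c t)).
Proof.
move=> [dc <-] df; have dc' : differentiable c t by apply/derivable1_diffP.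
split; first by apply: diff_derivable; exact: differentiable_comp.
by rewrite derive_comp.
Qed.

Lemma near_is_derive V (f f' : R -> V) (t : R) v : (\forall s \near t, f s = f' s) ->
  is_derive t 1 f v -> is_derive t 1 f' v.
Proof.
move=> ff [df <-]; split; first exact: near_eq_derivable ff df.
by rewrite (near_eq_derive _ ff).
Qed.

Lemma is_derive_unique V (f : R -> V) (t : R) v w : is_derive t 1 f v -> is_derive t 1 f w -> v = w.
Proof. by move=> [_ <-] [_ <-]. Qed.

Lemma curve_continuous V (c : R -> V) (t : R) v : is_derive t 1 c v -> {for t, continuous c}.
Proof. by move=> [dc _]; apply: differentiable_continuous; apply/derivable1_diffP. Qed.

Lemma curve_near V (U : set V) (c : R -> V) (t : R) v : open U -> is_derive t 1 c v -> U (c t) ->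
  \forall s \near t, U (c s).
Proof. by move=> oU dc Ut; apply: (curve_continuous dc); exact: open_nbhs_nbhs. Qed.

(** Every admissible curve gives the same velocity, that of an ambient extension, so the choice made
    by [get] in [mdiff] is immaterial. *)
Lemma mdiff_ext V W (X U : set V) (f F : V -> W) x v : open U -> U x -> X x ->
  (forall y, U y -> X y -> F y = f y) -> differentiable F x -> tangent X x v ->
  mdiff X f x v = 'D_v F x.
Proof.
move=> oU Ux Xx fF dF tv.
have key c : curve_at X x c v -> is_derive (0 : R) 1 (f \o c) ('D_v F x).
  move=> [c0 cX dc]; have dFc : differentiable F (c 0) by rewrite c0.
  have := derive_curve dc dFc; rewrite c0; apply: near_is_derive.
  have cU : \forall s \near (0 : R), U (c s) by apply: (curve_near oU dc); rewrite c0.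
  by apply: filterS2 cX cU => t ct Ut /=; exact: fF.
have [c cc] := tv.
have : (exists2 c, curve_at X x c v & is_derive (0 : R) 1 (f \o c) (mdiff X f x v)).
  apply: (@getPex _ [set w | exists2 c, curve_at X x c v & is_derive (0 : R) 1 (f \o c) w]).
  by exists ('D_v F x); exists c => //; exact: key.
by move=> [c' cc' h]; exact: is_derive_unique h (key _ cc').
Qed.

(** A working form of the submanifold property: tangent vectors are those fixed by the derivative of
    the retraction, and two extensions of a form are compared by pulling both back along it. *)
Definition retraction_at V (X U : set V) (rho : V -> V) :=
  [/\ open U, smooth_on U rho, forall y, U y -> X (rho y) & forall y, U y -> X y -> rho y = y].

Lemma tangent_image V W (X : set V) (Y : set W) (U : set V) (F : V -> W) x v : open U -> U x ->
  (forall y, U y -> X y -> Y (F y)) -> differentiable F x -> tangent X x v -> tangent Y (F x) ('D_v F x).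
Proof.
move=> oU Ux FY dF [c [c0 cX dc]]; exists (F \o c); split; first by rewrite /= c0.
  have cU : \forall s \near (0 : R), U (c s) by apply: (curve_near oU dc); rewrite c0.
  by apply: filterS2 cX cU => t ct Ut /=; exact: FY.
by rewrite -[X in 'D_v F X]c0; apply: derive_curve dc _; rewrite c0.
Qed.

Lemma line_derive V (x v : V) : is_derive (0 : R) 1 (fun t : R => x + t *: v) v.
Proof.
have := @is_derive_line R V V id x v 0 (sm_diff (@sm_id _ _ setT) I).
by rewrite derive_id.
Qed.

Lemma tangent_open V (U : set V) x v : open U -> U x -> tangent U x v.
Proof.
move=> oU Ux; exists (fun t : R => x + t *: v); split; first by rewrite scale0r addr0.
- by apply: (curve_near oU (line_derive x v)); rewrite scale0r addr0.
- exact: line_derive.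
Qed.

Lemma tangent_fixed V (X U : set V) (rho : V -> V) x v : retraction_at X U rho -> U x -> X x ->
  tangent X x v -> 'D_v rho x = v.
Proof.
move=> [oU sr rX rid] Ux Xx [c [c0 cX dc]]; have dr := sm_diff sr Ux.
have dr' : differentiable rho (c 0) by rewrite c0.
have h := derive_curve dc dr'; rewrite c0 in h.
apply: is_derive_unique h _; apply: (near_is_derive _ dc).
have cU : \forall s \near (0 : R), U (c s) by apply: (curve_near oU dc); rewrite c0.
by apply: filterS2 cX cU => t ct Ut /=; rewrite rid.
Qed.

Lemma tangent_range V (X U : set V) (rho : V -> V) y v : retraction_at X U rho -> U y ->
  tangent X (rho y) ('D_v rho y).
Proof.
move=> [oU sr rX rid] Uy.
by apply: (tangent_image (X := U) (U := U)) => //; [move=> z Uz _; exact: rX|exact: sm_diff sr Uy|exact: tangent_open].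
Qed.

Lemma tangentP V (X U : set V) (rho : V -> V) x v : retraction_at X U rho -> U x -> X x ->
  tangent X x v <-> 'D_v rho x = v.
Proof.
move=> rX Ux Xx; split; first exact: tangent_fixed rX Ux Xx.
by move=> E; have [_ _ _ rid] := rX; have := tangent_range v rX Ux; rewrite E (rid x Ux Xx).
Qed.

Definition smooth_covector V (U : set V) (A : V -> V -> R) :=
  (forall v, smooth_on U (A ^~ v)) /\ (forall y, scalar (A y)).

Definition dform V (A : V -> V -> R) (x u v : V) : R := 'D_u (A ^~ v) x - 'D_v (A ^~ u) x.

Lemma scalarD V (l : V -> R) u v : scalar l -> l (u + v) = l u + l v.
Proof. by move=> h; have := h 1 u v; rewrite scale1r mul1r. Qed.

Lemma scalar0 V (l : V -> R) : scalar l -> l 0 = 0.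
Proof. by move=> h; have := scalarD 0 0 h; rewrite addr0 => /eqP; rewrite -subr_eq0 opprD addrA subrr add0r oppr_eq0 => /eqP. Qed.

Lemma scalarZ V (l : V -> R) a u : scalar l -> l (a *: u) = a * l u.
Proof. by move=> h; have := h a u 0; rewrite addr0 (scalar0 h) addr0. Qed.

Lemma scalar_sum V (l : V -> R) n (a : 'I_n -> R) (e : 'I_n -> V) : scalar l ->
  l (\sum_i a i *: e i) = \sum_i a i * l (e i).
Proof.
move=> h; elim: n a e => [|n IH] a e; first by rewrite !big_ord0 scalar0.
by rewrite !big_ord_recl (scalarD _ _ h) (scalarZ _ _ h) IH.
Qed.

(* The second derivatives of [F] cancel by Schwarz. *)
Lemma dform_pullback V W (U : set V) (U' : set W) (F : V -> W) (A : W -> W -> R) x u v :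
  findim W -> open U -> open U' -> U x -> smooth_on U F -> (forall y, U y -> U' (F y)) ->
  smooth_covector U' A ->
  dform (fun y w => A (F y) ('D_w F y)) x u v = dform A (F x) ('D_u F x) ('D_v F x).
Proof.
move=> fW oU oU' Ux sF FU [sA lA]; have [n [e [l [lc le]]]] := fW.
have dF := sm_diff sF Ux; have U'x := FU x Ux.
have AE y w : A y w = \sum_i l i w * A y (e i) by rewrite {1}(le w) scalar_sum.
have dA i := sm_diff (sA (e i)) U'x.
have dl i y : differentiable (l i) y by exact: differentiable_lincont.
have dAF i : differentiable (fun y => A (F y) (e i)) x.
  exact: (@differentiable_comp _ _ _ _ F (fun z => A z (e i)) x dF (dA i)).
have dDF w := sm_diff (sm_der w sF) Ux.
have dlF i w : differentiable (fun y => l i ('D_w F y)) x.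
  exact: (@differentiable_comp _ _ _ _ ('D_w F) (l i) x (dDF w) (dl i _)).
have D w w' : 'D_w (fun y => A (F y) ('D_w' F y)) x =
    'D_('D_w F x) (A ^~ ('D_w' F x)) (F x) + A (F x) ('D_w ('D_w' F) x).
  have -> : (fun y => A (F y) ('D_w' F y)) = \sum_i (fun y => l i ('D_w' F y) * A (F y) (e i)).
    by apply/funext => y; rewrite fct_sumE AE.
  have -> : A ^~ ('D_w' F x) = \sum_i (fun y => l i ('D_w' F x) * A y (e i)).
    by apply/funext => y; rewrite fct_sumE AE.
  rewrite derive_sum => [|i]; last by apply: diff_derivable; apply: differentiableM.
  rewrite derive_sum => [|i]; last by apply: diff_derivable; apply: differentiableM.
  rewrite (AE (F x) ('D_w ('D_w' F) x)) -big_split; apply: eq_bigr => i _ /=.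
  rewrite (derM _ (dlF i w') (dAF i)) (derM _ (differentiable_cst _ _) (dA i)) der_cst mul0r add0r.
  have -> : 'D_w (fun y => A (F y) (e i)) x = 'D_('D_w F x) (A ^~ (e i)) (F x).
    exact: (@derive_comp _ _ _ _ F (fun z => A z (e i)) x w dF (dA i)).
  have -> : 'D_w (fun y => l i ('D_w' F y)) x = l i ('D_w ('D_w' F) x).
    have := @derive_comp _ _ _ _ ('D_w' F) (l i) x w (dDF w') (dl i _).
    by rewrite (derive_lincont _ _ (lc i)).
  by rewrite addrC.
rewrite /dform !D (schwarz v u fW oU Ux sF).
have alg (a b t : R) : a + t - (b + t) = a - b by ring.
exact: alg.
Qed.

Lemma dform_near V (A A' : V -> V -> R) x u v :
  (\forall y \near x, forall w, A y w = A' y w) -> dform A x u v = dform A' x u v.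
Proof.
move=> h; rewrite /dform; congr (_ - _); apply: near_eq_derive; by apply: filterS h => y.
Qed.

Lemma extension_covector V (X : set V) eta x A : form_extension X eta x A ->
  exists U : set V, [/\ open U, U x, smooth_covector U A &
    forall y v, U y -> X y -> tangent X y v -> A y v = eta y v].
Proof. by move=> [U [oU Ux sA lA h]]; exists U; split. Qed.

(** Pulled back by the retraction, whose derivative takes tangent values, both extensions become the
    same form near x; on tangent vectors at x this pullback does not change the exterior
    derivative. *)
Lemma dform_unique V (X U : set V) rho eta x A A' u v : findim V -> retraction_at X U rho -> U x -> X x ->
  form_extension X eta x A -> form_extension X eta x A' -> tangent X x u -> tangent X x v ->
  dform A x u v = dform A' x u v.
Proof.
move=> fV rX Ux Xx /extension_covector[U1 [oU1 U1x cA eA]] /extension_covector[U2 [oU2 U2x cA' eA']] tu tv.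
have [oU sr rXX rid] := rX.
have cr := sm_continuous sr Ux.
pose N := U `&` rho @^-1` (U1 `&` U2).
have oN : open N.
  rewrite openE => y [Uy Ny]; apply: filterI; first exact: open_nbhs_nbhs.
  apply: (sm_continuous sr Uy); apply: open_nbhs_nbhs; split => //; exact: openI.
have Nx : N x by split => //; rewrite /= rid.
have sN : smooth_on N rho by apply: sm_subset sr => y [].
have E B (UB : set V) : open UB -> smooth_covector UB B -> (forall y, N y -> UB (rho y)) ->
    dform B x u v = dform (fun y w => B (rho y) ('D_w rho y)) x u v.
  move=> oB cB NB; rewrite (dform_pullback u v fV oN oB Nx sN NB cB).
  by rewrite rid // !(tangent_fixed rX).
rewrite (E A U1) //; last by move=> y [_ []].
rewrite (E A' U2) //; last by move=> y [_ []].
apply: dform_near; apply: (filterS (P := N)); last exact: open_nbhs_nbhs.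
move=> y [Uy [r1 r2]] w; have t := tangent_range w rX Uy.
by rewrite eA ?eA' //; exact: rXX.
Qed.

Lemma extdE V (X U : set V) rho eta x A u v : findim V -> retraction_at X U rho -> U x -> X x ->
  form_extension X eta x A -> tangent X x u -> tangent X x v ->
  extd X eta x u v = dform A x u v.
Proof.
move=> fV rX Ux Xx eA tu tv.
have : (exists2 B, form_extension X eta x B & extd X eta x u v = dform B x u v).
  apply: (@getPex _ [set r | exists2 B, form_extension X eta x B & r = 'D_u (B ^~ v) x - 'D_v (B ^~ u) x]).
  by exists (dform A x u v); exists A.
by move=> [B eB ->]; exact: (dform_unique fV rX Ux Xx eB eA tu tv).
Qed.

End Manifolds.

(** * The double cover of the cotangent bundle by quaternionic frames *)

Section Vectors.
Context {R : realType}.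
Local Notation E3 := 'rV[R]_3.
Local Notation E4 := 'rV[R]_4.
Implicit Types (u v w a b : E3) (z : E4).

Lemma ord4P (P : 'I_4 -> Prop) : P 0 -> P 1 -> P 2 -> P 3 -> forall i, P i.
Proof.
move=> P0 P1 P2 P3 [[|[|[|[|//]]]] lti].
- by rewrite (_ : Ordinal lti = 0) //; exact: val_inj.
- by rewrite (_ : Ordinal lti = 1) //; exact: val_inj.
- by rewrite (_ : Ordinal lti = 2) //; exact: val_inj.
- by rewrite (_ : Ordinal lti = 3) //; exact: val_inj.
Qed.

Lemma dot4 (u v : E4) : dot u v = u 0 0 * v 0 0 + u 0 1 * v 0 1 + u 0 2 * v 0 2 + u 0 3 * v 0 3.
Proof.
rewrite /dot !big_ord_recl big_ord0 addr0 !addrA.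
by congr (_ + _ + _ + _); congr (u _ _ * v _ _); exact: val_inj.
Qed.

Definition cross u v : E3 := \row_i [:: u 0 1 * v 0 2 - u 0 2 * v 0 1;
  u 0 2 * v 0 0 - u 0 0 * v 0 2; u 0 0 * v 0 1 - u 0 1 * v 0 0]`_i.

Lemma dot_cross u v w : dot (cross u v) w = det3 u v w.
Proof. by rewrite dot3 !mxE /= /det3; ring. Qed.

Lemma crossZl k u v : cross (k *: u) v = k *: cross u v.
Proof. by apply/rowP; elim/ord3P; rewrite !mxE /=; ring. Qed.

Lemma crossZr k u v : cross u (k *: v) = k *: cross u v.
Proof. by apply/rowP; elim/ord3P; rewrite !mxE /=; ring. Qed.

Lemma crossDl u v w : cross (u + v) w = cross u w + cross v w.
Proof. by apply/rowP; elim/ord3P; rewrite !mxE /=; ring. Qed.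

Lemma crossDr u v w : cross w (u + v) = cross w u + cross w v.
Proof. by apply/rowP; elim/ord3P; rewrite !mxE /=; ring. Qed.

Lemma cross_cross u v w : cross u (cross v w) = dot u w *: v - dot u v *: w.
Proof. by rewrite !dot3; apply/rowP; elim/ord3P; rewrite !mxE /=; ring. Qed.

Lemma dot_crossl u v : dot u (cross u v) = 0.
Proof. by rewrite dot3 !mxE /=; ring. Qed.

Lemma dot_crossr u v : dot v (cross u v) = 0.
Proof. by rewrite dot3 !mxE /=; ring. Qed.

Lemma cross_anti u v : cross v u = - cross u v.
Proof. by apply/rowP; elim/ord3P; rewrite !mxE /=; ring. Qed.

Lemma dot_cross_cross u v : dot (cross u v) (cross u v) = dot u u * dot v v - dot u v ^+ 2.
Proof. by rewrite !dot3 !mxE /=; ring. Qed.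

(* Gram determinant of the bases [Q, P, cross Q P] and [x, y, w]. *)
Lemma gram_cross (Q P x y w : E3) :
  (dot Q Q * dot P P - dot Q P ^+ 2) * det3 x y w =
  dot Q x * (dot P y * det3 Q P w - dot P w * det3 Q P y)
  - dot Q y * (dot P x * det3 Q P w - dot P w * det3 Q P x)
  + dot Q w * (dot P x * det3 Q P y - dot P y * det3 Q P x).
Proof. by rewrite !dot3 /det3; ring. Qed.

(** The structure equation of the round sphere. The left side is the exterior derivative of det(Q,
    P, dP) / |P|^2, the Levi-Civita connection form on nonzero tangent vectors; the right side is
    minus the curvature 1 times the area form. *)
Lemma solid_angle_algebra (Q P a w a' w' : E3) : dot Q Q = 1 -> dot Q P = 0 -> dot P P != 0 ->
  dot Q a = 0 -> dot Q a' = 0 -> dot a P + dot Q w = 0 -> dot a' P + dot Q w' = 0 ->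
  ((det3 a P w' + det3 Q w w') / dot P P - 2 * dot P w * det3 Q P w' / dot P P ^+ 2)
  - ((det3 a' P w + det3 Q w' w) / dot P P - 2 * dot P w' * det3 Q P w / dot P P ^+ 2)
  = - det3 Q a a'.
Proof.
move=> QQ QP PP Qa Qa' aw aw'; have G := gram_cross Q P.
have PPE : dot Q Q * dot P P - dot Q P ^+ 2 = dot P P by rewrite QQ QP expr0n /= mul1r subr0.
have dPP : det3 Q P P = 0 by rewrite /det3; ring.
have dPQ : det3 Q P Q = 0 by rewrite /det3; ring.
have dww : det3 Q w' w = - det3 Q w w' by rewrite /det3; ring.
have G1 := G Q w w'; have G2 := G a P w'; have G3 := G a' P w; have G4 := G Q a a'.
rewrite !PPE QQ QP ?dPP ?dPQ ?Qa ?Qa' (dotC P Q) QP (dotC P a) (dotC P a') in G1 G2 G3 G4.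
rewrite dww.
have e1 : dot Q w = - dot a P by lra.
have e2 : dot Q w' = - dot a' P by lra.
rewrite ?e1 ?e2 in G1 G2 G3 G4.
move: G1 G2 G3 G4; move: (det3 Q w w') (det3 a P w') (det3 a' P w) (det3 Q a a') => D1 D2 D3 D4.
move: (det3 Q P w) (det3 Q P w') (det3 Q P a) (det3 Q P a') => nw nw' na na'.
move: (dot P w) (dot P w') (dot a P) (dot a' P) => pw pw' pa pa'.
move: (dot P P) PP => r r0 G1 G2 G3 G4.
have -> : D1 = (pw * nw' - pw' * nw) / r by apply: (mulfI r0); rewrite G1; field.
have -> : D2 = pa' * na by apply: (mulfI r0); rewrite G2; ring.
have -> : D3 = pa * na' by apply: (mulfI r0); rewrite G3; ring.
have -> : D4 = (pa * na' - pa' * na) / r by apply: (mulfI r0); rewrite G4; field.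
by field.
Qed.

End Vectors.

Section Frames.
Context {R : realType}.
Local Notation E3 := 'rV[R]_3.
Local Notation E4 := 'rV[R]_4.

(* Polarized columns of |z|^2 times the rotation matrix of the quaternion z. *)
Definition F1 (z w : E4) : E3 := \row_i [:: z 0 0 * w 0 0 - z 0 1 * w 0 1 - z 0 2 * w 0 2 + z 0 3 * w 0 3;
  z 0 0 * w 0 1 + z 0 1 * w 0 0 + z 0 2 * w 0 3 + z 0 3 * w 0 2;
  z 0 1 * w 0 3 + z 0 3 * w 0 1 - z 0 0 * w 0 2 - z 0 2 * w 0 0]`_i.

Definition F2 (z w : E4) : E3 := \row_i [:: z 0 2 * w 0 3 + z 0 3 * w 0 2 - z 0 0 * w 0 1 - z 0 1 * w 0 0;
  z 0 0 * w 0 0 - z 0 1 * w 0 1 + z 0 2 * w 0 2 - z 0 3 * w 0 3;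
  z 0 0 * w 0 3 + z 0 3 * w 0 0 + z 0 1 * w 0 2 + z 0 2 * w 0 1]`_i.

Definition F3 (z w : E4) : E3 := \row_i [:: z 0 0 * w 0 2 + z 0 2 * w 0 0 + z 0 1 * w 0 3 + z 0 3 * w 0 1;
  z 0 1 * w 0 2 + z 0 2 * w 0 1 - z 0 0 * w 0 3 - z 0 3 * w 0 0;
  z 0 0 * w 0 0 + z 0 1 * w 0 1 - z 0 2 * w 0 2 - z 0 3 * w 0 3]`_i.

Lemma frame_dot z : [/\ dot (F1 z z) (F1 z z) = dot z z ^+ 2, dot (F2 z z) (F2 z z) = dot z z ^+ 2,
  dot (F3 z z) (F3 z z) = dot z z ^+ 2 &
  [/\ dot (F1 z z) (F2 z z) = 0, dot (F1 z z) (F3 z z) = 0 & dot (F2 z z) (F3 z z) = 0]].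
Proof. by rewrite !dot3 !dot4 !mxE /=; split; [ring|ring|ring|split; ring]. Qed.

Lemma frame_cross z : [/\ cross (F1 z z) (F2 z z) = dot z z *: F3 z z,
  cross (F2 z z) (F3 z z) = dot z z *: F1 z z & cross (F3 z z) (F1 z z) = dot z z *: F2 z z].
Proof. by rewrite !dot4; split; apply/rowP; elim/ord3P; rewrite !mxE /=; ring. Qed.

Lemma frame_expand z (u : E3) : dot z z ^+ 2 *: u =
  dot u (F1 z z) *: F1 z z + dot u (F2 z z) *: F2 z z + dot u (F3 z z) *: F3 z z.
Proof. by rewrite !dot4 !dot3; apply/rowP; elim/ord3P; rewrite !mxE /=; ring. Qed.

(** The angular velocity of the frame about its third vector is the Hopf connection form, that is,
    the Liouville form up to scale. *)
Lemma frame_liouville z v : dot (F2 z z) (2 *: F1 z v) = 4 * dot z z * liouville z v.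
Proof. by rewrite /liouville dot3 dot4 !mxE /=; field. Qed.

Lemma frame_skew12 z v : dot (F1 z z) (2 *: F2 z v) = - dot (F2 z z) (2 *: F1 z v).
Proof. by rewrite !dot3 !mxE /=; ring. Qed.

Lemma frame_skew23 z v : dot (F3 z z) (2 *: F2 z v) = - dot (F2 z z) (2 *: F3 z v).
Proof. by rewrite !dot3 !mxE /=; ring. Qed.

Lemma frame_line (z v : E4) (t : R) :
  [/\ F1 (z + t *: v) (z + t *: v) = F1 z z + t *: (2 *: F1 z v) + t ^+ 2 *: F1 v v,
      F2 (z + t *: v) (z + t *: v) = F2 z z + t *: (2 *: F2 z v) + t ^+ 2 *: F2 v v &
      F3 (z + t *: v) (z + t *: v) = F3 z z + t *: (2 *: F3 z v) + t ^+ 2 *: F3 v v].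
Proof. by split; apply/rowP; elim/ord3P; rewrite !mxE /=; ring. Qed.

Lemma half_angle (a b : R) : a ^+ 2 + b ^+ 2 = 1 -> exists x y : R,
  [/\ x ^+ 2 + y ^+ 2 = 1, x ^+ 2 - y ^+ 2 = a & 2 * x * y = b].
Proof.
move=> ab; have b2 := sqr_ge0 b.
have a1 : -1 <= a by nra.
have [E|a2] := eqVneq a (-1).
  exists 0, 1; rewrite E in ab *; have b0 : b ^+ 2 = 0 by move: ab; rewrite sqrrN expr1n; lra.
  by move/eqP: b0; rewrite sqrf_eq0 => /eqP ->; split; ring.
have a3 : 0 < (1 + a) / 2 by rewrite divr_gt0 // -ltrBlDl sub0r lt_neqAle eq_sym a2.
pose x := Num.sqrt ((1 + a) / 2); have xx : x ^+ 2 = (1 + a) / 2 by rewrite sqr_sqrtr // ltW.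
have x0 : x != 0 by rewrite lt0r_neq0 // sqrtr_gt0.
exists x, (b / (2 * x)).
have yy : (b / (2 * x)) ^+ 2 = (1 - a) / 2.
  have h : 1 + a != 0 by lra.
  rewrite expr_div_n exprMn xx (_ : b ^+ 2 = (1 - a) * (1 + a)); last by move: ab; rewrite !expr2; lra.
  by field.
by split; rewrite ?xx ?yy; field.
Qed.

(** The Hopf fibration is onto. The preimage is the quaternion of a rotation about a horizontal axis
    that takes the third axis to u; its half-angle formula degenerates at the south pole, which is
    treated apart. *)
Lemma frame3_onto (u : E3) : dot u u = 1 -> exists2 z : E4, dot z z = 1 & F3 z z = u.
Proof.
rewrite dot3 => uu; have u2 : -1 <= u 0 2 by nra.
have [E|n1] := eqVneq (u 0 2) (-1).
  have u0 : u 0 0 = 0 by apply/eqP; rewrite -sqrf_eq0; apply/eqP; rewrite E in uu; nra.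
  have u1 : u 0 1 = 0 by apply/eqP; rewrite -sqrf_eq0; apply/eqP; rewrite E in uu; nra.
  exists (delta_mx 0 2).
    by rewrite dot4 !mxE /=; ring.
  by apply/rowP; elim/ord3P; rewrite !mxE /= ?u0 ?u1 ?E; ring.
have h : 0 < (1 + u 0 2) / 2 by rewrite divr_gt0 // -ltrBlDl sub0r lt_neqAle eq_sym n1.
pose r := Num.sqrt ((1 + u 0 2) / 2); have rr : r ^+ 2 = (1 + u 0 2) / 2 by rewrite sqr_sqrtr // ltW.
have r0 : r != 0 by rewrite lt0r_neq0 // sqrtr_gt0.
pose z : E4 := \row_i [:: r; 0; u 0 0 / (2 * r); - u 0 1 / (2 * r)]`_i.
have u22 : u 0 2 = 2 * r ^+ 2 - 1 by rewrite rr; field.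
have sq : u 0 0 ^+ 2 + u 0 1 ^+ 2 = 4 * r ^+ 2 * (1 - r ^+ 2).
  have -> : u 0 0 ^+ 2 + u 0 1 ^+ 2 = 1 - u 0 2 * u 0 2 by move: uu; lra.
  by rewrite u22; ring.
have q : (u 0 0 / (2 * r)) ^+ 2 + (u 0 1 / (2 * r)) ^+ 2 = 1 - r ^+ 2.
  have -> : (u 0 0 / (2 * r)) ^+ 2 + (u 0 1 / (2 * r)) ^+ 2 = (u 0 0 ^+ 2 + u 0 1 ^+ 2) / (4 * r ^+ 2) by field.
  by rewrite sq; field.
exists z.
  by rewrite dot4 !mxE /= mulNr; move: q; rewrite !expr2; lra.
apply/rowP; elim/ord3P; rewrite !mxE /= ?mulNr.
- by field.
- by field.
- by rewrite u22; move: q; rewrite !expr2; lra.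
Qed.

(* Multiplication of both complex coordinates by [x + i y]. *)
Definition phase (x y : R) (z : E4) : E4 := \row_i [:: x * z 0 0 - y * z 0 1; x * z 0 1 + y * z 0 0;
  x * z 0 2 - y * z 0 3; x * z 0 3 + y * z 0 2]`_i.

Lemma frame_phase x y z : [/\ dot (phase x y z) (phase x y z) = (x ^+ 2 + y ^+ 2) * dot z z,
  F1 (phase x y z) (phase x y z) = (x ^+ 2 - y ^+ 2) *: F1 z z + (2 * x * y) *: F2 z z,
  F2 (phase x y z) (phase x y z) = (x ^+ 2 - y ^+ 2) *: F2 z z - (2 * x * y) *: F1 z z &
  F3 (phase x y z) (phase x y z) = (x ^+ 2 + y ^+ 2) *: F3 z z].
Proof.
by split; rewrite ?dot4 ?mxE /=; first (by ring); apply/rowP; elim/ord3P; rewrite !mxE /=; ring.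
Qed.

(** A quaternion with the right third vector is corrected by a phase, which turns the first two
    vectors in their plane by twice its angle. *)
Lemma frame_onto (e1 e3 : E3) : dot e1 e1 = 1 -> dot e3 e3 = 1 -> dot e1 e3 = 0 ->
  exists2 z : E4, dot z z = 1 & [/\ F1 z z = e1, F2 z z = cross e3 e1 & F3 z z = e3].
Proof.
move=> h1 h3 h13; have [z zz z3] := frame3_onto h3.
pose a := dot e1 (F1 z z); pose b := dot e1 (F2 z z).
have e1E : e1 = a *: F1 z z + b *: F2 z z.
  have := frame_expand z e1; rewrite zz expr1n scale1r z3 h13 scale0r addr0; exact.
have [d1 d2 d3 [d12 d13 d23]] := frame_dot z.
have ab : a ^+ 2 + b ^+ 2 = 1.
  have := h1; rewrite e1E dot_comb d1 d2 (dotC (F2 z z)) d12 zz expr1n; lra.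
have [x [y [xy1 xy2 xy3]]] := half_angle ab.
have [p0 p1 p2 p3] := frame_phase x y z; have [c1 c2 c3] := frame_cross z.
exists (phase x y z); first by rewrite p0 xy1 zz mul1r.
rewrite p1 p2 p3 xy1 xy2 xy3 scale1r z3 -e1E; split=> //.
rewrite e1E -z3 crossDr !crossZr c3 (cross_anti (F2 z z)) c2 zz !scale1r scalerN.
by [].
Qed.

End Frames.

Section Hopf.
Context {R : realType}.
Local Notation E3 := 'rV[R]_3.
Local Notation E4 := 'rV[R]_4.

(** Reads the derivative off an exact second-order expansion along a line, which for polynomial maps
    is a ring identity. *)
Lemma derive_quadratic (V W : normedModType R) (f : V -> W) x v a b : differentiable f x ->
  (forall t : R, f (x + t *: v) = f x + t *: a + t ^+ 2 *: b) -> 'D_v f x = a.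
Proof.
move=> df h; have dx : differentiable f (x + 0 *: v) by rewrite scale0r addr0.
have := is_derive_line dx; rewrite scale0r addr0 => d1.
have d2 : is_derive (0 : R) 1 (fun t : R => f x + t *: a + t ^+ 2 *: b) a.
  have dl := line_derive (f x) a.
  have d3 : is_derive (0 : R) 1 (fun t : R => t ^+ 2 *: b) 0.
    have ds : differentiable (fun t : R => t) (0 : R) by exact: sm_diff (@sm_id _ _ setT) I.
    have := derive_curve (f := fun r : R => r *: b) (c := fun t : R => t ^+ 2) (v := 0) (t := 0).
    have lz : lincont (fun r : R => r *: b).
      by split; [move=> k u w; rewrite /= scalerDl scalerA|exact: scalel_continuous].
    move=> H; have {H} := H _ (differentiable_lincont _ lz); rewrite (derive_lincont _ _ lz) scale0r; apply.
    split; last by rewrite derX // expr1 mulr0 mul0r.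
    by apply: diff_derivable; apply: (sm_diff (U := setT)) => //; smooth.
  by have := is_deriveD dl d3; rewrite addr0.
apply: is_derive_unique d1 _; apply: near_is_derive d2.
by apply: filterE => t; rewrite h.
Qed.

Lemma sm_F (U : set E4) : open U -> [/\ smooth_on U (fun z => F1 z z), smooth_on U (fun z => F2 z z)
  & smooth_on U (fun z => F3 z z)].
Proof. by move=> oU; split; rewrite /F1 /F2 /F3; smooth. Qed.

Lemma derive_F (z v : E4) : [/\ 'D_v (fun z => F1 z z) z = 2 *: F1 z v,
  'D_v (fun z => F2 z z) z = 2 *: F2 z v & 'D_v (fun z => F3 z z) z = 2 *: F3 z v].
Proof.
have [s1 s2 s3] := sm_F (@openT E4).
split; [apply: (derive_quadratic (b := F1 v v)); first exact: (sm_diff s1)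
 |apply: (derive_quadratic (b := F2 v v)); first exact: (sm_diff s2)
 |apply: (derive_quadratic (b := F3 v v)); first exact: (sm_diff s3)];
 by move=> t; have [h1 h2 h3] := frame_line z v t.
Qed.

Variables s c : R.
Hypothesis s0 : 0 <= s.
Hypothesis c0 : 0 < c.

Definition hopf_j (z : E4) : R := c / 2 * dot z z.
Definition hopf_m (z : E4) : R := Num.sqrt (hopf_j z ^+ 2 - s ^+ 2).
(** For |P| = m the moment cross Q P + s Q has length j with j^2 = m^2 + s^2. Requiring the moment
    to point along [F3] and P along [F2] leaves these coefficients for Q. *)
Definition hopf_Q (z : E4) : E3 :=
  (s / (hopf_j z * dot z z)) *: F3 z z + (hopf_m z / (hopf_j z * dot z z)) *: F1 z z.
Definition hopf_P (z : E4) : E3 := (hopf_m z / dot z z) *: F2 z z.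
Definition hopf_dom : set E4 := [set z | s < hopf_j z].

Lemma hopf_dom_facts z : hopf_dom z -> [/\ 0 < dot z z, 0 < hopf_j z, 0 < hopf_m z &
  hopf_m z ^+ 2 = hopf_j z ^+ 2 - s ^+ 2].
Proof.
move=> zO; have j0 : 0 < hopf_j z := le_lt_trans s0 zO.
have N0 : 0 < dot z z by move: j0; rewrite /hopf_j pmulr_rgt0 // divr_gt0.
have p : 0 < hopf_j z ^+ 2 - s ^+ 2 by rewrite subr_gt0 ltr_sqr ?nnegrE // ltW.
by split => //; [rewrite sqrtr_gt0|rewrite sqr_sqrtr // ltW].
Qed.

Lemma open_hopf_dom : open hopf_dom.
Proof.
have cj x : setT x -> {for x, continuous (fun z => hopf_j z - s)}.
  by move=> _; apply: (sm_continuous (U := setT)) => //; rewrite /hopf_j; smooth.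
have := open_pos openT cj; rewrite setTI; congr open; apply/seteqP.
by split => z; rewrite /hopf_dom /= subr_gt0.
Qed.

Let oO := open_hopf_dom.

Lemma sm_hopf_scalars : [/\ smooth_on hopf_dom hopf_j, smooth_on hopf_dom hopf_m,
  smooth_on hopf_dom (fun z : E4 => dot z z) & smooth_on hopf_dom (fun z => (hopf_j z * dot z z)^-1)].
Proof.
have sj : smooth_on hopf_dom hopf_j by rewrite /hopf_j; smooth.
have sN : smooth_on hopf_dom (fun z : E4 => dot z z) by smooth.
split=> //.
- rewrite /hopf_m; smooth; move=> z /hopf_dom_facts[_ _ m0 mm].
  by rewrite -mm exprn_gt0.
- by smooth; move=> z /hopf_dom_facts[N0 j0 _ _]; rewrite mulf_neq0 // lt0r_neq0.
Qed.

Lemma sm_hopf_Q : smooth_on hopf_dom hopf_Q.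
Proof.
have [sj sm sN si] := sm_hopf_scalars; have [s1 s2 s3] := sm_F oO.
by rewrite /hopf_Q; smooth.
Qed.

Lemma sm_hopf_P : smooth_on hopf_dom hopf_P.
Proof.
have [sj sm sN si] := sm_hopf_scalars; have [s1 s2 s3] := sm_F oO.
by rewrite /hopf_P; smooth; move=> z /hopf_dom_facts[N0 _ _ _]; exact: lt0r_neq0.
Qed.

Lemma hopf_cotangent z : hopf_dom z -> [/\ dot (hopf_Q z) (hopf_Q z) = 1,
  dot (hopf_Q z) (hopf_P z) = 0 & dot (hopf_P z) (hopf_P z) = hopf_m z ^+ 2].
Proof.
move=> zO; have [N0 j0 m0 mm] := hopf_dom_facts zO.
have [d1 d2 d3 [d12 d13 d23]] := frame_dot z.
have Nn := lt0r_neq0 N0; have jn := lt0r_neq0 j0.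
split.
- rewrite /hopf_Q dot_comb d1 d3 d13 (dotC (F3 z z)) d13.
  have -> : 1 = (s ^+ 2 + hopf_m z ^+ 2) / hopf_j z ^+ 2 by rewrite mm addrC subrK divff // sqrf_eq0.
  by move: (hopf_j z) (hopf_m z) (dot z z) Nn jn => j m N Nn jn; field; rewrite ?jn ?Nn.
- by rewrite /hopf_Q /hopf_P dotDl !dotZl !dotZr d12 (dotC (F3 z z)) d23 !mulr0 addr0.
- by rewrite /hopf_P dotZl dotZr d2; move: (hopf_m z) (dot z z) Nn => m N Nn; field.
Qed.

Lemma hopf_moment z : hopf_dom z ->
  cross (hopf_Q z) (hopf_P z) + s *: hopf_Q z = (c / 2) *: F3 z z.
Proof.
move=> zO; have [N0 j0 m0 mm] := hopf_dom_facts zO.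
have [c1 c2 c3] := frame_cross z.
have Nn := lt0r_neq0 N0; have jn := lt0r_neq0 j0.
rewrite /hopf_P /hopf_Q crossZr crossDl !crossZl (cross_anti (F2 z z) (F3 z z)) c1 c2.
rewrite -[c / 2](mulfK Nn) -/(hopf_j z).
move: (F1 z z) (F3 z z) (F2 z z) => f1 f3 f2; rewrite !scalerDr !scalerN !scalerA.
have -> : hopf_j z / dot z z = hopf_j z ^+ 2 / (hopf_j z * dot z z).
  by move: (hopf_j z) (dot z z) Nn jn => j N Nn jn; field; rewrite ?jn ?Nn.
have -> : hopf_j z ^+ 2 = hopf_m z ^+ 2 + s ^+ 2 by rewrite mm subrK.
move: (hopf_j z) (hopf_m z) (dot z z) Nn jn => j m N Nn jn.
by apply/rowP => i; rewrite !mxE; field; rewrite ?jn ?Nn.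
Qed.

Lemma hopf_liouville z v : hopf_dom z ->
  dot (hopf_P z) ('D_v hopf_Q z)
  + s * (det3 (hopf_Q z) (hopf_P z) ('D_v hopf_P z) / dot (hopf_P z) (hopf_P z)) =
  2 * c * liouville z v.
Proof.
move=> zO; have [N0 j0 m0 mm] := hopf_dom_facts zO.
have [sj sm sN si] := sm_hopf_scalars; have [s1 s2 s3] := sm_F oO.
have [D1 D2 D3] := derive_F z v; have [d1 d2 d3 [d12 d13 d23]] := frame_dot z.
have [c1 c2 c3] := frame_cross z.
have Nn := lt0r_neq0 N0; have jn := lt0r_neq0 j0.
have sa : smooth_on hopf_dom (fun z => s / (hopf_j z * dot z z)) by smooth.
have sb : smooth_on hopf_dom (fun z => hopf_m z / (hopf_j z * dot z z)) by smooth.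
have sg : smooth_on hopf_dom (fun z => hopf_m z / dot z z).
  by smooth; move=> y /hopf_dom_facts[? _ _ _]; exact: lt0r_neq0.
(* The derivatives of the scalar coefficients can stay unknown: they multiply frame vectors
   orthogonal to those with which the two derivatives are paired. *)
have [DQ DP] : (exists a b : R, 'D_v hopf_Q z = a *: F3 z z + b *: F1 z z
    + ((s / (hopf_j z * dot z z)) *: (2 *: F3 z v) + (hopf_m z / (hopf_j z * dot z z)) *: (2 *: F1 z v)))
    /\ exists a : R, 'D_v hopf_P z = a *: F2 z z + (hopf_m z / dot z z) *: (2 *: F2 z v).
  split.
    rewrite /hopf_Q (derD _ (sm_diff (smZ _ oO sa s3) zO) (sm_diff (smZ _ oO sb s1) zO)) //.
    rewrite (derZ _ (sm_diff sa zO) (sm_diff s3 zO)) // (derZ _ (sm_diff sb zO) (sm_diff s1 zO)) //.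
    by rewrite D1 D3; eexists; eexists; rewrite addrACA.
  by rewrite /hopf_P (derZ _ (sm_diff sg zO) (sm_diff s2 zO)) // D2; eexists.
case: DQ => a [b ->]; case: DP => a' ->; move: (hopf_cotangent zO) => [_ _ ->].
have L := frame_liouville z v; have k12 := frame_skew12 z v; have k23 := frame_skew23 z v.
rewrite -dot_cross /hopf_P /hopf_Q crossZr crossDl !crossZl c1 (cross_anti (F2 z z) (F3 z z)) c2.
have d32 : dot (F3 z z) (F2 z z) = 0 by rewrite dotC.
have d21 : dot (F2 z z) (F1 z z) = 0 by rewrite dotC.
move: (2 *: F1 z v) (2 *: F2 z v) (2 *: F3 z v) L k12 k23 => f1 f2 f3 L k12 k23.
rewrite !(dotDl, dotDr, dotZl, dotZr, dotNl, dotNr) d23 d21 d12 d32 k12 k23 L.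
have -> : 2 * c * liouville z v = 4 * hopf_j z ^+ 2 * liouville z v / (hopf_j z * dot z z).
  by rewrite /hopf_j; field; rewrite Nn lt0r_neq0.
have -> : hopf_j z ^+ 2 = hopf_m z ^+ 2 + s ^+ 2 by rewrite mm subrK.
move: (liouville z v) (dot (F2 z z) f3) (hopf_j z) (hopf_m z) (dot z z) Nn jn m0 => l t j m N Nn jn m0.
by field; rewrite ?jn ?Nn ?lt0r_neq0.
Qed.

Lemma hopf_onto (Q P : E3) : dot Q Q = 1 -> dot Q P = 0 -> P != 0 ->
  exists2 z, hopf_dom z & hopf_Q z = Q /\ hopf_P z = P.
Proof.
move=> QQ QP P0; have PP0 := dot_gt0 P0.
pose J := cross Q P + s *: Q; pose j := Num.sqrt (dot P P + s ^+ 2).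
have jj0 : 0 < dot P P + s ^+ 2 by rewrite ltr_wpDr // sqr_ge0.
have jj : j ^+ 2 = dot P P + s ^+ 2 by rewrite sqr_sqrtr // ltW.
have j0 : 0 < j by rewrite sqrtr_gt0.
have m0 := nrm_gt0 P0; have mm := nrm_sqr P; set m := nrm P in m0 mm.
have PQ : dot P Q = 0 by rewrite dotC.
have JJ : dot J J = j ^+ 2.
  rewrite /J !(dotDl, dotDr, dotZl, dotZr) dot_cross_cross QQ QP (dotC (cross _ _)) dot_crossl jj; ring.
have JP : dot J P = 0 by rewrite /J dotDl dotZl QP (dotC (cross _ _)) dot_crossr; ring.
have PJ : cross P J = dot P P *: Q - s *: cross Q P.
  by rewrite /J crossDr crossZr cross_cross PQ scale0r subr0 (cross_anti Q P) scalerN.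
(* The inverse construction: the third frame vector is the direction of the moment J, the first one
   that of cross P J, and |z|^2 will be read off j = c |z|^2 / 2. *)
pose e3 := j^-1 *: J; pose e1 := (m * j)^-1 *: cross P J.
have h3 : dot e3 e3 = 1 by rewrite dotZl dotZr JJ mulrA -invfM -expr2 mulVf // sqrf_eq0 lt0r_neq0.
have h1 : dot e1 e1 = 1.
  rewrite dotZl dotZr dot_cross_cross (dotC P J) JP JJ -mm.
  by field; rewrite !lt0r_neq0.
have h13 : dot e1 e3 = 0 by rewrite dotZl dotZr dotC dot_crossr !mulr0.
have [z zz [f1 f2 f3]] := frame_onto h1 h3 h13.
pose N := 2 * j / c; have N0 : 0 < N by rewrite divr_gt0 // mulr_gt0.
pose r := Num.sqrt N; have rr : r * r = N by rewrite -expr2 sqr_sqrtr // ltW.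
have Fr : [/\ F1 (r *: z) (r *: z) = N *: F1 z z, F2 (r *: z) (r *: z) = N *: F2 z z & F3 (r *: z) (r *: z) = N *: F3 z z].
  by rewrite -rr; split; apply/rowP; elim/ord3P; rewrite !mxE /=; ring.
have NN : dot (r *: z) (r *: z) = N by rewrite dotZl dotZr zz mulr1.
have hj : hopf_j (r *: z) = j by rewrite /hopf_j NN /N; field; exact: lt0r_neq0.
have hm : hopf_m (r *: z) = m by rewrite /hopf_m hj jj addrK -mm sqrtr_sqr ger0_norm // ltW.
have [F1r F2r F3r] := Fr; have Nn := lt0r_neq0 N0; have jn := lt0r_neq0 j0; have mn := lt0r_neq0 m0.
exists (r *: z).
  rewrite /hopf_dom /= hj ltNge; apply/negP => js.
  have : j ^+ 2 <= s ^+ 2 by rewrite ler_sqr ?nnegrE // ltW.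
  by rewrite jj; lra.
split.
  rewrite /hopf_Q hj hm NN F1r F3r f1 f3 /e3 /e1 PJ /J -mm !scalerA scalerBr !scalerDr !scalerA.
  have E : m ^+ 2 + s ^+ 2 = j ^+ 2 by rewrite jj mm.
  apply/rowP => i; rewrite !mxE; set k := (X in _ * X + _ + (_ - _ * X)).
  have {3}-> : Q 0 i = (m ^+ 2 + s ^+ 2) / j ^+ 2 * Q 0 i by rewrite E divff ?mul1r // sqrf_eq0.
  by field; rewrite ?jn ?mn ?Nn.
rewrite /hopf_P hm NN F2r f2 scalerA divfK // /e3 /e1 crossZl crossZr cross_cross JJ JP scale0r subr0.
rewrite !scalerA -[RHS]scale1r; congr (_ *: _).
by field; rewrite ?jn ?mn ?Nn.
Qed.

End Hopf.

(** * Local sections of the double cover *)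

Section Lift.
Context {R : realType}.
Local Notation E3 := 'rV[R]_3.
Local Notation E4 := 'rV[R]_4.
Local Notation E6 := ('rV[R]_3 * 'rV[R]_3)%type.

(* Recovers the products z_i z_j from |z|^2 and the rotation matrix of z. *)
Definition products (N : R) (f1 f2 f3 : E3) : 'M[R]_4 :=
  \matrix_(i, k) (4^-1 * (nth [::]
   [:: [:: N + f1 0 0 + f2 0 1 + f3 0 2; f1 0 1 - f2 0 0; f3 0 0 - f1 0 2; f2 0 2 - f3 0 1];
       [:: f1 0 1 - f2 0 0; N - f1 0 0 - f2 0 1 + f3 0 2; f2 0 2 + f3 0 1; f3 0 0 + f1 0 2];
       [:: f3 0 0 - f1 0 2; f2 0 2 + f3 0 1; N - f1 0 0 + f2 0 1 - f3 0 2; f1 0 1 + f2 0 0];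
       [:: f2 0 2 - f3 0 1; f3 0 0 + f1 0 2; f1 0 1 + f2 0 0; N + f1 0 0 - f2 0 1 - f3 0 2]] i)`_k).

Lemma products_frame (z : E4) : products (dot z z) (F1 z z) (F2 z z) (F3 z z) = z^T *m z.
Proof.
rewrite dot4; apply/matrixP => i k.
rewrite [RHS]mxE big_ord_recl big_ord0 addr0 [z^T _ _]mxE mxE.
by move: i k; elim/ord4P; elim/ord4P; rewrite !mxE /=; field.
Qed.

Lemma sm_products (V : normedModType R) (U : set V) N f1 f2 f3 : open U -> smooth_on U N ->
  smooth_on U f1 -> smooth_on U f2 -> smooth_on U f3 ->
  smooth_on U (fun x => products (N x) (f1 x) (f2 x) (f3 x)).
Proof.
move=> oU sN s1 s2 s3; apply: sm_mx => // i k.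
under eq_fun do rewrite mxE; apply: smM => //; first exact: sm_cst.
move: i k; elim/ord4P; elim/ord4P => /=; smooth.
Qed.

Variables s c : R.
Hypothesis s0 : 0 <= s.
Hypothesis c0 : 0 < c.

Definition momentum (y : E6) : E3 := cross y.1 y.2 + s *: y.1.
Definition momentum_norm (y : E6) : R := Num.sqrt (dot y.2 y.2 + s ^+ 2).

Definition squares (y : E6) : 'M[R]_4 :=
  products (2 / c * momentum_norm y) ((2 / (c * nrm y.2)) *: cross y.2 (momentum y))
    ((2 * momentum_norm y / (c * nrm y.2)) *: y.2) ((2 / c) *: momentum y).

Definition nonzero_momentum : set E6 := [set y | y.2 != 0].

Lemma open_nonzero_momentum : open nonzero_momentum.
Proof.
apply: (@open_comp _ _ (@snd E3 E3) [set X | X != 0]); last exact: open_nonzero.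
by move=> x _; exact: cvg_snd.
Qed.

Lemma sm_cross (V : normedModType R) (U : set V) (f g : V -> E3) : open U -> smooth_on U f ->
  smooth_on U g -> smooth_on U (fun x => cross (f x) (g x)).
Proof. by move=> oU sf sg; rewrite /cross; smooth. Qed.

Let oD := open_nonzero_momentum.

Lemma momentum_norm_gt0 y : nonzero_momentum y -> 0 < dot y.2 y.2 + s ^+ 2.
Proof. by move=> /dot_gt0 h; rewrite ltr_wpDr // sqr_ge0. Qed.

Lemma sm_momentum (U : set E6) : open U -> smooth_on U momentum.
Proof.
move=> oU; have s1 : smooth_on U (fun y : E6 => y.1) by apply: sm_fst => //; exact: sm_id.
have s2 : smooth_on U (fun y : E6 => y.2) by apply: sm_snd => //; exact: sm_id.
by rewrite /momentum; smooth; exact: sm_cross.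
Qed.

Lemma sm_squares : smooth_on nonzero_momentum squares.
Proof.
have s1 : smooth_on nonzero_momentum (fun y : E6 => y.1) by apply: sm_fst => //; exact: sm_id.
have s2 : smooth_on nonzero_momentum (fun y : E6 => y.2) by apply: sm_snd => //; exact: sm_id.
have sn : smooth_on nonzero_momentum momentum_norm.
  by rewrite /momentum_norm; smooth => y /momentum_norm_gt0.
have sm : smooth_on nonzero_momentum (fun y => nrm y.2).
  exact: (sm_comp (findim_mx _ _) findimR oD (@open_nonzero R 3) (fun y h => h) s2 (@sm_nrm R 3)).
have sJ := sm_momentum oD.
have si : smooth_on nonzero_momentum (fun y => (c * nrm y.2)^-1).
  by smooth; move=> y /nrm_gt0/lt0r_neq0 h; rewrite mulf_neq0 // lt0r_neq0.
rewrite /squares; apply: sm_products => //; smooth.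
exact: sm_cross.
Qed.

Definition hopf (z : E4) : E6 := (hopf_Q s c z, hopf_P s c z).

Local Notation Omega := (hopf_dom s c).

Lemma hopf_nonzero z : Omega z -> nonzero_momentum (hopf z).
Proof.
move=> zO; have [_ _ PP] := hopf_cotangent s0 c0 zO; have [_ _ m0 _] := hopf_dom_facts s0 c0 zO.
by rewrite /nonzero_momentum /= -dot_eq0 PP sqrf_eq0 lt0r_neq0.
Qed.

Lemma hopf_momentum_norm z : Omega z -> momentum_norm (hopf z) = hopf_j c z.
Proof.
move=> zO; have [_ _ PP] := hopf_cotangent s0 c0 zO; have [_ j0 _ mm] := hopf_dom_facts s0 c0 zO.
by rewrite /momentum_norm PP mm subrK sqrtr_sqr ger0_norm // ltW.
Qed.

Lemma hopf_momentumE z : Omega z -> momentum (hopf z) = (c / 2) *: F3 z z.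
Proof. exact: hopf_moment. Qed.

Lemma squares_hopf z : Omega z -> squares (hopf z) = z^T *m z.
Proof.
move=> zO; have [N0 j0 m0 mm] := hopf_dom_facts s0 c0 zO; have [_ _ PP] := hopf_cotangent s0 c0 zO.
have [c1 c2 c3] := frame_cross z.
rewrite -products_frame /squares hopf_momentum_norm // hopf_momentumE //.
have -> : nrm (hopf z).2 = hopf_m s c z by rewrite /nrm PP sqrtr_sqr ger0_norm // ltW.
rewrite /= /hopf_P crossZl crossZr c2 !scalerA.
have Nn := lt0r_neq0 N0; have mn := lt0r_neq0 m0; have cn := lt0r_neq0 c0.
have E0 : 2 / c * hopf_j c z = dot z z by rewrite /hopf_j; field.
have E1 : 2 / (c * hopf_m s c z) * (hopf_m s c z / dot z z * (c / 2) * dot z z) = 1.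
  by move: (hopf_m s c z) (dot z z) Nn mn => m N Nn mn; field; rewrite ?Nn ?mn ?cn.
have E2 : 2 * hopf_j c z / (c * hopf_m s c z) * (hopf_m s c z / dot z z) = 1.
  by rewrite /hopf_j; move: (hopf_m s c z) (dot z z) Nn mn => m N Nn mn; field; rewrite ?Nn ?mn ?cn.
have E3' : 2 / c * (c / 2) = 1 by field.
by rewrite E0 E1 E2 E3' !scale1r.
Qed.

Definition quad (w : E4) (y : E6) : R := (w *m squares y *m w^T) 0 0.
(** The matrix of the products z_i z_k sends w to <w, z> z, and [quad] is <w, z>^2; the quotient
    selects smoothly, off the hyperplane <w, z> = 0, the one of z and - z that has positive inner
    product with w. *)
Definition lift (w : E4) (y : E6) : E4 := (Num.sqrt (quad w y))^-1 *: (w *m squares y).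
Definition lift_dom (w : E4) : set E6 := nonzero_momentum `&` [set y | 0 < quad w y].

Lemma sm_quad w : smooth_on nonzero_momentum (quad w).
Proof.
have h := sm_squares; rewrite /quad; apply: sm_coord => //.
by apply: sm_mulmx => //; [apply: sm_mulmx => //; exact: sm_cst|exact: sm_cst].
Qed.

Lemma open_lift_dom w : open (lift_dom w).
Proof. by apply: open_pos => // y yD; exact: sm_continuous (sm_quad w) yD. Qed.

Lemma sm_lift w : smooth_on (lift_dom w) (lift w).
Proof.
have oL := @open_lift_dom w.
have sq : smooth_on (lift_dom w) (quad w) by apply: (sm_subset _ (@sm_quad w)) => y [].
have ss : smooth_on (lift_dom w) squares by apply: (sm_subset _ sm_squares) => y [].
rewrite /lift; smooth.
- by move=> y [_ yq]; rewrite lt0r_neq0 // sqrtr_gt0.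
- by move=> y [].
- by apply: sm_mulmx => //; exact: sm_cst.
Qed.

Lemma mulmx_tr_dot (w z : E4) : w *m (z^T *m z) = dot w z *: z.
Proof.
rewrite mulmxA [w *m z^T]mx11_scalar mul_scalar_mx; congr (_ *: _).
by rewrite mxE; apply: eq_bigr => i _; rewrite !mxE.
Qed.

Lemma quad_hopf w z : Omega z -> quad w (hopf z) = dot w z ^+ 2.
Proof.
move=> zO; rewrite /quad squares_hopf // mulmx_tr_dot -scalemxAl mxE expr2; congr (_ * _).
by rewrite mxE; apply: eq_bigr => i _; rewrite !mxE mulrC.
Qed.

Lemma lift_hopf w z : Omega z -> dot w z != 0 ->
  lift_dom w (hopf z) /\ lift w (hopf z) = Num.sg (dot w z) *: z.
Proof.
move=> zO wz; have q := quad_hopf w zO; split.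
  by split; [exact: hopf_nonzero|rewrite /= q exprn_even_gt0].
rewrite /lift q squares_hopf // mulmx_tr_dot sqrtr_sqr scalerA; congr (_ *: _).
by rewrite {2}[dot w z]numEsg mulrCA mulVf ?mulr1 // normr_eq0.
Qed.

Lemma hopfN z : hopf (- z) = hopf z.
Proof.
have E : [/\ F1 (- z) (- z) = F1 z z, F2 (- z) (- z) = F2 z z & F3 (- z) (- z) = F3 z z].
  by split; apply/rowP; elim/ord3P; rewrite !mxE /=; ring.
have [E1 E2 E3'] := E; have N : dot (- z) (- z) = dot z z by rewrite dotNl dotNr opprK.
have j : hopf_j c (- z) = hopf_j c z by rewrite /hopf_j N.
have m : hopf_m s c (- z) = hopf_m s c z by rewrite /hopf_m j.
by rewrite /hopf /hopf_Q /hopf_P N j m E1 E2 E3'.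
Qed.

Lemma hopf_domN z : Omega z -> Omega (- z).
Proof. by rewrite /hopf_dom /= /hopf_j dotNl dotNr opprK. Qed.

Lemma hopf_lift w y : cotangent y -> lift_dom w y ->
  [/\ Omega (lift w y), hopf (lift w y) = y & 0 < dot w (lift w y)].
Proof.
move=> [yS yP] [y0 yw]; have [z zO [zQ zP]] := hopf_onto s0 c0 yS yP y0.
have zy : hopf z = y by rewrite /hopf zQ zP -surjective_pairing.
rewrite -zy /= in yw *; rewrite quad_hopf // in yw.
have wz : dot w z != 0 by apply/eqP => h; move: yw; rewrite h expr0n ltxx.
have [_ ->] := lift_hopf zO wz.
case: (ltrgt0P (dot w z)) wz => // h _.
- by rewrite gtr0_sg // scale1r.
- rewrite ltr0_sg // scaleN1r hopfN dotNr oppr_gt0; split=> //; exact: hopf_domN.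
Qed.

End Lift.

(** * Periodic rotations *)

Section Rotation.
Context {R : realType}.

Lemma derivative0_constant (g : R -> R) (b : R) : (forall t : R, `|t| < b -> is_derive t 1 g 0) ->
  forall t, `|t| < b -> g t = g 0.
Proof.
move=> dg; have key x y : x <= y -> `|x| < b -> `|y| < b -> g x = g y.
  move=> xy; rewrite !ltr_norml => /andP[x1 x2] /andP[y1 y2].
  have db t : x <= t <= y -> is_derive t 1 g 0.
    by move=> /andP[t1 t2]; apply: dg; rewrite ltr_norml (lt_le_trans x1) //= (le_lt_trans t2).
  have [||z _] := @MVT_segment R g (fun=> 0) x y xy.
  - by move=> z; rewrite in_itv /= => /andP[h1 h2]; apply: db; rewrite !ltW.
  - apply: continuous_in_subspaceT => z; rewrite inE /= in_itv /= => zxy.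
    exact: is_derive_cont (db z zxy).
  by rewrite mul0r => /eqP; rewrite subr_eq0 => /eqP ->.
move=> t tb; have b0 : `|0 : R| < b by rewrite normr0; exact: le_lt_trans tb.
by have [h|h] := leP 0 t; [apply/esym; exact: key|apply: key => //; exact: ltW].
Qed.

(** Primitives on growing intervals, normalised to vanish at 0, agree wherever two of them are
    defined. *)
Lemma antiderivative (f : R -> R) : continuous f ->
  exists2 F : R -> R, F 0 = 0 & forall t : R, is_derive t 1 F (f t).
Proof.
move=> cf; have /choice[G hG] (n : nat) : exists F : R -> R, F 0 = 0 /\ forall t : R, `|t| < n.+1%:R -> is_derive t 1 F (f t).
  by have [F F0 dF] := antideriv (ltr0Sn R n) cf; exists F.
have G0 n : G n 0 = 0 by have [] := hG n.
have dG n (t : R) : `|t| < n.+1%:R -> is_derive t 1 (G n) (f t) by have [_] := hG n; apply.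
have agree n m t : `|t| < n.+1%:R -> `|t| < m.+1%:R -> G n t = G m t.
  move=> tn tm; have : (G n - G m) t = (G n - G m) 0.
    apply: (derivative0_constant (b := Num.min n.+1%:R m.+1%:R)); last by rewrite lt_min tn.
    move=> r; rewrite lt_min => /andP[rn rm]; rewrite -(subrr (f r)).
    by have h1 := dG n r rn; have h2 := dG m r rm; exact: is_deriveB.
  by rewrite !fctE !G0 subrr => /eqP; rewrite subr_eq0 => /eqP.
have big (t : R) : `|t| < (Num.truncn `|t|).+1%:R by exact: truncnS_gt.
exists (fun t => G (Num.truncn `|t|) t); first by rewrite G0.
move=> t; pose n := (Num.truncn `|t|).+1.
have tn : `|t| < n.+1%:R by apply: lt_le_trans (big t) _; rewrite ler_nat.
apply: near_is_derive (dG n t tn).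
have : \forall r \near t, `|r| < n.+1%:R.
  exact: (@cvgr_norm_lt _ _ _ (nbhs t) _ id t (@cvg_id _ (nbhs t)) _ tn).
by apply: filterS => r rn; exact: agree.
Qed.

Lemma is_derive_mul (f g : R -> R) (t a b : R) : is_derive t 1 f a -> is_derive t 1 g b ->
  is_derive t 1 (fun r => f r * g r) (a * g t + f t * b).
Proof. by move=> df dg; apply: is_derive_eq; rewrite /GRing.scale /= addrC mulrC; congr (_ + _); rewrite mulrC. Qed.

(** The complex number a + i b rotates with angular velocity k r; turned back by the angle k T it
    has zero derivative. *)
Lemma rotating (a b r T : R -> R) (k : R) : (forall t : R, is_derive t 1 a (- (k * r t * b t))) ->
  (forall t : R, is_derive t 1 b (k * r t * a t)) -> (forall t : R, is_derive t 1 T (r t)) -> T 0 = 0 ->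
  forall t, a t = cos (k * T t) * a 0 - sin (k * T t) * b 0 /\ b t = sin (k * T t) * a 0 + cos (k * T t) * b 0.
Proof.
move=> da db dT T0 t.
have dk (u : R) : is_derive u 1 (fun v => k * T v) (k * r u) by have h := dT u; apply: is_derive_eq.
have dc (u : R) : is_derive u 1 (fun v => cos (k * T v)) (- (k * r u * sin (k * T u))).
  by have h := dk u; apply: is_derive_eq; rewrite mulNr mulrC.
have ds (u : R) : is_derive u 1 (fun v => sin (k * T v)) (k * r u * cos (k * T u)).
  by have h := dk u; apply: is_derive_eq; rewrite mulrC.
have c1 : cos (k * T t) * a t + sin (k * T t) * b t = a 0.
  have -> : a 0 = (fun v => cos (k * T v) * a v + sin (k * T v) * b v) 0.
    by rewrite /= T0 mulr0 cos0 sin0 mul1r mul0r addr0.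
  apply: (@is_derive_0_is_cst _ (fun v => cos (k * T v) * a v + sin (k * T v) * b v)) => u.
  have h1 := is_derive_mul (dc u) (da u); have h2 := is_derive_mul (ds u) (db u).
  by apply: is_derive_eq; ring.
have c2 : cos (k * T t) * b t - sin (k * T t) * a t = b 0.
  have -> : b 0 = (fun v => cos (k * T v) * b v - sin (k * T v) * a v) 0.
    by rewrite /= T0 mulr0 cos0 sin0 mul1r mul0r subr0.
  apply: (@is_derive_0_is_cst _ (fun v => cos (k * T v) * b v - sin (k * T v) * a v)) => u.
  have h1 := is_derive_mul (dc u) (db u); have h2 := is_derive_mul (ds u) (da u).
  by apply: is_derive_eq; ring.
rewrite -c1 -c2; have := cos2Dsin2 (k * T t); rewrite !expr2.
move: (cos _) (sin _) => x y h; split.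
  by rewrite -[LHS]mul1r -h; ring.
by rewrite -[LHS]mul1r -h; ring.
Qed.

Lemma cos_eq1 (x : R) : cos x = 1 -> 0 < x -> exists2 n : nat, (0 < n)%N & x = 2 * pi * n%:R.
Proof.
move=> cx x0; have p0 : 0 < 2 * pi :> R by rewrite mulr_gt0 // pi_gt0.
have q0 : 0 <= x / (2 * pi) by rewrite divr_ge0 // ltW.
have /andP[] := truncn_itv q0; move: (Num.truncn _) => n n1 n2.
have [y yn] : exists y, y = x - (pi *+ 2) *+ n by eexists.
have yE : y = x - 2 * pi * n%:R by rewrite yn -[_ *+ n]mulr_natr -[pi *+ 2]mulr_natl.
have y1 : 0 <= y by rewrite yE subr_ge0 mulrC -ler_pdivlMr.
have y2 : y < 2 * pi by move: n2; rewrite ltr_pdivrMr // yE -addn1 natrD; lra.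
have cy : cos y = 1 by rewrite -cx -[x](subrK ((pi *+ 2) *+ n)) -yn (periodicn (@cosD2pi R)).
have y0 : y = 0.
  have [h|h] := leP y pi.
    by rewrite -(@cosK R y) ?cy ?acos1 // in_itv /= y1.
  have c2 : cos (2 * pi - y) = 1.
    by rewrite mulr_natl cosB cos2pi sin2pi mul1r mul0r addr0.
  have : 2 * pi - y = 0.
    by rewrite -(@cosK R (2 * pi - y)) ?c2 ?acos1 // in_itv /=; apply/andP; split; move: h y2; lra.
  by move: y2; lra.
have xn : x = 2 * pi * n%:R by move: yE; rewrite y0; lra.
exists n => //; rewrite lt0n; apply: contraTneq x0 => n0.
by rewrite xn n0 mulr0 ltxx.
Qed.

Lemma angle_exists (x y : R) : x ^+ 2 + y ^+ 2 = 1 ->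
  exists t, [/\ 0 <= t <= 2 * pi, cos t = x & sin t = y].
Proof.
move=> h; have x1 : -1 <= x <= 1.
  by rewrite -ler_norml -(@expr_le1 _ 2) // real_normK ?num_real // -h lerDl sqr_ge0.
have s2 : Num.sqrt (1 - x ^+ 2) = `|y| by rewrite -sqrtr_sqr; congr Num.sqrt; move: h; lra.
have /andP[a1 a2] : 0 <= acos x <= pi by rewrite acos_ge0 // acos_lepi.
have [y0|y0] := leP 0 y.
  exists (acos x); split; last by rewrite sin_acos // s2 ger0_norm.
    by rewrite a1 /=; have := pi_gt0 R; lra.
  by rewrite acosK.
exists (2 * pi - acos x); split.
- by apply/andP; split; have := pi_gt0 R; lra.
- by rewrite mulr_natl cosB cos2pi sin2pi mul1r mul0r addr0 acosK.
- by rewrite mulr_natl sinB cos2pi sin2pi mul0r mul1r sub0r sin_acos // s2 ltr0_norm // opprK.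
Qed.

(** The two angles are 2 pi n and 2 pi m with n and m positive, so that a = (n - m) / (n + m). *)
Lemma closing_angles_rational (a L : R) : 0 < a < 1 -> 0 < L -> cos (2 * (1 + a) * L) = 1 ->
  cos (2 * (1 - a) * L) = 1 -> rational a.
Proof.
move=> /andP[a0 a1] L0 c1 c2; have p0 := pi_gt0 R.
have [n n0 nE] := cos_eq1 c1 (mulr_gt0 (mulr_gt0 (ltr0Sn R 1) (addr_gt0 ltr01 a0)) L0).
have b0 : 0 < 2 * (1 - a) * L by rewrite !mulr_gt0 // subr_gt0.
have [m m0 mE] := cos_eq1 c2 b0.
apply/rationalP; exists (n%:Z - m%:Z), (n + m)%N.
have nm : (n + m)%:R != 0 :> R by rewrite pnatr_eq0 addn_eq0 -!leqn0 leqNgt n0.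
rewrite intrB -!pmulrn; apply: (mulIf nm); rewrite mulfVK // natrD.
have e1 : (1 + a) * L = pi * n%:R by move: nE; lra.
have e2 : (1 - a) * L = pi * m%:R by move: mE; lra.
have Ln : L != 0 by rewrite lt0r_neq0. 
apply: (mulfI (lt0r_neq0 p0)); rewrite mulrBr mulrCA !mulrDr -e1 -e2; ring.
Qed.

End Rotation.

Section Aux.
Context {R : realType}.
Local Notation E3 := 'rV[R]_3.

Lemma dot_mulmx_tr n (a u : 'rV[R]_n) (M : 'M[R]_n) : dot (a *m M^T) u = dot a (u *m M).
Proof.
have E (x y : 'rV[R]_n) : dot x y = (x *m y^T) 0 0 by rewrite mxE; apply: eq_bigr => i _; rewrite mxE.
by rewrite !E trmx_mul mulmxA.
Qed.

Lemma bil_outer (th u v : E3) : bil (th^T *m th) u v = dot th u * dot th v.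
Proof.
have E (x y : E3) : dot x y = (x *m y^T) 0 0 by rewrite mxE; apply: eq_bigr => i _; rewrite mxE.
rewrite /bil mulmxA -mulmxA [u *m th^T]mx11_scalar mul_scalar_mx mxE -!E (dotC th u).
by rewrite E mulrC.
Qed.

Lemma bil_add (A B : 'M[R]_3) u v : bil (A + B) u v = bil A u v + bil B u v.
Proof. by rewrite /bil mulmxDr mulmxDl mxE. Qed.

Lemma bil_scale k (A : 'M[R]_3) u v : bil (k *: A) u v = k * bil A u v.
Proof. by rewrite /bil -scalemxAr -scalemxAl mxE. Qed.

Lemma bil0l (G : 'M[R]_3) v : bil G 0 v = 0.
Proof. by rewrite /bil !mul0mx mxE. Qed.

Lemma tangent_sphere_comb (q u v : E3) a b : sphere q -> tangent sphere q u -> tangent sphere q v ->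
  tangent sphere q (a *: u + b *: v).
Proof.
move=> qS /(tangent_sphere _ qS) qu /(tangent_sphere _ qS) qv.
by apply/(tangent_sphere _ qS); rewrite dotDr !dotZr qu qv !mulr0 addr0.
Qed.

Section Conorm.
Variable g : E3 -> 'M[R]_3.
Hypothesis gm : riemannian_metric g.

Lemma metric_cauchy q u v : sphere q -> tangent sphere q u -> tangent sphere q v ->
  bil (g q) u v ^+ 2 <= bil (g q) u u * bil (g q) v v.
Proof.
move=> qS tu tv; have [_ gs gp] := gm.
have [v0|v0] := eqVneq v 0.
  have z w : bil (g q) w 0 = 0 by rewrite -(scale0r 0) bilZr mul0r.
  by rewrite v0 !z mulr0 expr0n.
have vv := gp q v qS tv v0; set b := bil (g q) v v in vv *.
set d := bil (g q) u v; set a := bil (g q) u u.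
have h : 0 <= bil (g q) (b *: u + (- d) *: v) (b *: u + (- d) *: v).
  have t := tangent_sphere_comb b (- d) qS tu tv.
  have [->|n0] := eqVneq (b *: u + (- d) *: v) 0; last exact: ltW (gp _ _ qS t n0).
  by rewrite bil0l.
move: h; rewrite bil_comb -/a -/b -/d (gs q v u qS tv tu) -/d => h.
have : 0 <= b * (a * b - d ^+ 2) by move: h; congr (is_true (_ <= _)); ring.
by rewrite pmulr_rge0 // subr_ge0.
Qed.

(** The vector w is dual to p. Cauchy-Schwarz bounds the supremum, which is attained at the
    normalisation of w, or at 0 when p vanishes on w. *)
Lemma conorm_dual q p w : sphere q -> tangent sphere q w ->
  (forall u, tangent sphere q u -> bil (g q) w u = dot p u) ->
  conorm g q p ^+ 2 = dot p w.
Proof.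
move=> qS tw wp; have [_ gs gp] := gm.
have t0 : tangent sphere q 0 by apply/(tangent_sphere _ qS); exact: dot0r.
have b0 : bil (g q) 0 0 = 0 by exact: bil0l.
pose r := Num.sqrt (dot p w).
have pw : 0 <= dot p w.
  rewrite -wp //; have [->|w0] := eqVneq w 0; [by rewrite b0|exact: ltW (gp _ _ qS tw w0)].
suff -> : conorm g q p = r by rewrite sqr_sqrtr.
pose S := [set dot p v | v in [set v | tangent sphere q v /\ bil (g q) v v <= 1]].
have ub x : S x -> x <= r.
  move=> [v [tv vv] <-]; have h := metric_cauchy qS tw tv.
  rewrite !wp // in h; have [n|n] := leP (dot p v) 0; first exact: le_trans n (sqrtr_ge0 _).
  rewrite /r -(ger0_norm (ltW n)) -sqrtr_sqr ler_sqrt //.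
  apply: le_trans h _; rewrite -[leRHS]mulr1; exact: ler_wpM2l.
have Sr : S r.
  have [w0|w0] := eqVneq (dot p w) 0.
    exists 0; first by split; rewrite ?b0.
    by rewrite dot0r /r w0 sqrtr0.
  have r0 : 0 < r by rewrite sqrtr_gt0 lt0r w0.
  have rr : r ^+ 2 = dot p w by rewrite sqr_sqrtr.
  exists (r^-1 *: w).
    split; first by apply/(tangent_sphere _ qS); rewrite dotZr (proj1 (tangent_sphere _ qS) tw) mulr0.
    by rewrite bilZl bilZr wp // -rr expr2 mulKf ?mulVf ?lt0r_neq0.
  by rewrite dotZr -rr expr2 mulrA mulVf ?lt0r_neq0 // mul1r.
apply/eqP; rewrite eq_le; apply/andP; split.
  by apply: ge_sup => //; exists r.
by apply: ub_le_sup => //; exists r.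
Qed.

End Conorm.

Lemma derive_fst (V W Z : normedModType R) (f : V -> W * Z) x v : differentiable f x ->
  ('D_v f x).1 = 'D_v (fun y => (f y).1) x.
Proof.
move=> df; have l := lincont_fst W Z.
have := derive_comp v df (differentiable_lincont (f x) l).
by rewrite (derive_lincont _ _ l).
Qed.

Lemma derive_snd (V W Z : normedModType R) (f : V -> W * Z) x v : differentiable f x ->
  ('D_v f x).2 = 'D_v (fun y => (f y).2) x.
Proof.
move=> df; have l := lincont_snd W Z.
have := derive_comp v df (differentiable_lincont (f x) l).
by rewrite (derive_lincont _ _ l).
Qed.

End Aux.

Ltac smooth_pair := repeat first [progress smooth | lazymatch goal with
  | |- smooth_on _ (@fst _ _) => exact: (sm_lin (lincont_fst _ _))
  | |- smooth_on _ (@snd _ _) => exact: (sm_lin (lincont_snd _ _))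
  | |- smooth_on _ (fun x => (@?f x).1) => apply: sm_fst
  | |- smooth_on _ (fun x => (@?f x).2) => apply: sm_snd
  | |- smooth_on _ (fun x => (@?f x) *m (@?g x)) => apply: sm_mulmx
  | |- smooth_on _ (fun x => (@?f x)^T) => apply: sm_tr
  | |- smooth_on _ (fun x => (@?f x, @?g x)) => apply: sm_pair
  end].

Lemma unit_norm (F : fieldType) (f q : F) : (2 : F) != 0 -> f != 0 -> 1 = f * q / 2 -> q = 2 / f.
Proof.
move=> n2 fn /(congr1 (fun x => x * 2)); rewrite mul1r divfK // => ->.
by rewrite mulrC mulKf.
Qed.

(** Equal squares of the complex numbers u = x + i y and u' = x' + i y' first give equal moduli, and
    then the vanishing of |u - u'|^2 |u + u'|^2. *)
Lemma sqr_pair_ext (F : realFieldType) (x y x' y' : F) : x ^+ 2 - y ^+ 2 = x' ^+ 2 - y' ^+ 2 ->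
  2 * (x * y) = 2 * (x' * y') -> (x = x' /\ y = y') \/ (x = - x' /\ y = - y').
Proof.
move=> h1 h2.
have P : (x ^+ 2 + y ^+ 2) ^+ 2 = (x' ^+ 2 + y' ^+ 2) ^+ 2.
  have E (u v : F) : (u ^+ 2 + v ^+ 2) ^+ 2 = (u ^+ 2 - v ^+ 2) ^+ 2 + (2 * (u * v)) ^+ 2 by ring.
  by rewrite !E h1 h2.
have {}P : x ^+ 2 + y ^+ 2 = x' ^+ 2 + y' ^+ 2.
  have A0 : 0 <= x ^+ 2 + y ^+ 2 := addr_ge0 (sqr_ge0 x) (sqr_ge0 y).
  have B0 : 0 <= x' ^+ 2 + y' ^+ 2 := addr_ge0 (sqr_ge0 x') (sqr_ge0 y').
  by have := eqrXn2 (ltn0Sn 1) A0 B0; rewrite P eqxx => /esym/eqP.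
have Q : ((x - x') ^+ 2 + (y - y') ^+ 2) * ((x + x') ^+ 2 + (y + y') ^+ 2) = 0.
  have e1 : x ^+ 2 = x' ^+ 2 by lra.
  have e2 : y ^+ 2 = y' ^+ 2 by lra.
  have e3 : x * y = x' * y' by lra.
  have -> : ((x - x') ^+ 2 + (y - y') ^+ 2) * ((x + x') ^+ 2 + (y + y') ^+ 2) =
    (x ^+ 2 - x' ^+ 2) ^+ 2 + (y ^+ 2 - y' ^+ 2) ^+ 2 + 2 * x ^+ 2 * y ^+ 2 + 2 * x' ^+ 2 * y' ^+ 2
    + 2 * x ^+ 2 * y' ^+ 2 + 2 * x' ^+ 2 * y ^+ 2 - 8 * (x * y) * (x' * y') by ring.
  rewrite e3 e1 e2; ring.
move/eqP: Q; rewrite mulf_eq0 !paddr_eq0 ?sqr_ge0 // !sqrf_eq0 !subr_eq0 !addr_eq0.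
by case/orP => /andP[/eqP h /eqP h']; [left|right].
Qed.

Lemma card_pair (T : Type) (x y : T) : x <> y -> ([set x; y] #= `I_2)%card.
Proof.
move=> xy; apply/pcard_eqP.
suff /Pbij[f] : set_bij [set x; y] `I_2 (fun z => if pselect (z = x) is left _ then 0%N else 1%N) by squash f.
split.
- by move=> _ [|] -> /=; case: pselect.
- move=> u v; rewrite !inE => -[|] -> [|] ->; case: pselect => // h1; case: pselect => // h2 *; congruence.
- case=> [|[|//]] _ /=; first by exists x; [left|case: pselect].
  by exists y; [right|case: pselect => // h; case: xy].
Qed.

(** * The magnetic system and its level *)

Section Model.
Context {R : realType}.
Local Notation E3 := 'rV[R]_3.
Local Notation E4 := 'rV[R]_4.
Local Notation E6 := ('rV[R]_3 * 'rV[R]_3)%type.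
Local Notation NZ := [set X : E3 | X != 0].
Variables (gbar : E3 -> 'M[R]_3) (o : bool).
Hypothesis gbm : riemannian_metric gbar.
Variables Phi Psi : E3 -> E3.
Hypothesis sPhi : smooth_on NZ Phi.
Hypothesis sPsi : smooth_on NZ Psi.
Hypothesis PhiK : cancel Phi Psi.
Hypothesis PsiK : cancel Psi Phi.
Hypothesis Phi_iso : forall X, dot (Phi X) (Phi X) = dot X X.
Hypothesis Phi_hom : forall a X, 0 < a -> Phi (a *: X) = a *: Phi X.
Hypothesis Phi_metric : forall q u v, sphere q -> dot q u = 0 -> dot q v = 0 ->
  bil (gbar q) u v = dot ('D_u Phi q) ('D_v Phi q).
Hypothesis Phi_area : forall q u v, sphere q -> dot q u = 0 -> dot q v = 0 ->
  area_form gbar o q u v = det3 (Phi q) ('D_u Phi q) ('D_v Phi q).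
Variables s c alpha : R.
Hypothesis s0 : 0 <= s.
Hypothesis a0 : 0 < alpha.
Hypothesis a1 : alpha < 1.
(** At a zero covector j + alpha J_3 equals s (1 + alpha q_3) with q_3 <= 1. The inequality
    therefore keeps the level j + alpha J_3 = c off the zero section; it also makes [lam]
    positive. *)
Hypothesis sc : s * (1 + alpha) < c.

Let oNZ := @open_nonzero R 3.

Lemma c_gt0 : 0 < c.
Proof. by apply: le_lt_trans sc; rewrite mulr_ge0 // addr_ge0 // ltW. Qed.
Let c0 := c_gt0.

Lemma s_lt_c : s < c.
Proof. by apply: le_lt_trans sc; rewrite mulrDr mulr1 lerDl mulr_ge0 // ltW. Qed.

Lemma dPhi X : X != 0 -> differentiable Phi X.
Proof. by move=> X0; exact: sm_diff sPhi X0. Qed.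

Local Notation J := (jacobian Phi).

Lemma Phi_nz X : (Phi X != 0) = (X != 0).
Proof. by rewrite -!dot_eq0 Phi_iso. Qed.

Lemma Psi_nz X : (Psi X != 0) = (X != 0).
Proof. by rewrite -Phi_nz PsiK. Qed.

Lemma Psi_iso X : dot (Psi X) (Psi X) = dot X X.
Proof. by rewrite -Phi_iso PsiK. Qed.

Lemma PhiE q : q != 0 -> Phi q = q *m J q.
Proof. by move=> q0; rewrite -(jacobianE _ (dPhi q0)) derive_homogeneous //; exact: dPhi. Qed.

Lemma J_unit q : q != 0 -> J q \in unitmx.
Proof.
move=> q0; apply: jacobian_unit (dPhi q0) _ => v v0.
have sid : 'D_v (Psi \o Phi) q = v.
  have -> : Psi \o Phi = id by apply/funext.
  exact: derive_id.
have Pq0 : Phi q != 0 by rewrite Phi_nz.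
move: sid; rewrite (derive_comp _ (dPhi q0) (sm_diff sPsi Pq0)) => E.
apply/eqP => D0; move: v0; rewrite -E D0 deriveE; last exact: sm_diff sPsi Pq0.
by rewrite linear0 eqxx.
Qed.

Lemma Phi_radial q u : q != 0 -> dot (Phi q) ('D_u Phi q) = dot q u.
Proof.
move=> q0; have did : differentiable (fun Y : E3 => Y) q by exact: sm_diff (@sm_id _ _ setT) I.
have : 'D_u (fun Y => dot (Phi Y) (Phi Y)) q = 'D_u (fun Y : E3 => dot Y Y) q.
  by congr ('D_u _ q); apply/funext => Y; exact: Phi_iso.
rewrite (derive_dot _ (dPhi q0) (dPhi q0)) (derive_dot _ did did) derive_id.
by rewrite (dotC (Phi q)) (dotC q u); move: (dot _ _) (dot _ _) => A B; lra.
Qed.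

Lemma sm_J : smooth_on NZ J.
Proof. exact: sm_jacobian. Qed.

Lemma sm_invJ : smooth_on NZ (fun q => invmx (J q)).
Proof. by apply: sm_invmx => //; [move=> q; exact: J_unit|exact: sm_J]. Qed.

(** * The perturbed metric and 1-form *)

Definition axis (Q : E3) : E3 := \row_i [:: - Q 0 1; Q 0 0; 0]`_i.
(** Let V be the rotation field [axis] and C = [shift_coef]. As J_3 = <p, V> + s q_3, squaring j = c
    - alpha J_3 gives |p|^2 - alpha^2 <p, V>^2 + 2 alpha C <p, V> = C^2 - s^2. The quadratic part
    multiplies V by [den] = 1 - alpha^2 |V|^2 on the sphere, so replacing p by p - [shift] removes
    the linear term and leaves C^2 / [den] - s^2 on the right; [lam] is the quotient of this by c^2
    - s^2, which makes the right side constant. The metric contains the inverse of the quadratic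
    part, 1 + (alpha^2 / [den]) V V^T. *)
Definition den (Q : E3) : R := 1 - alpha ^+ 2 + alpha ^+ 2 * Q 0 2 ^+ 2.
Definition shift_coef (Q : E3) : R := c - alpha * s * Q 0 2.
Definition shift (Q : E3) : E3 := (alpha * shift_coef Q / den Q) *: axis Q.
Definition lam (Q : E3) : R := (shift_coef Q ^+ 2 / den Q - s ^+ 2) / (c ^+ 2 - s ^+ 2).
(** The transposed Jacobian pulls a covector at Phi q back to q, here and in [form]. *)
Definition theta (q : E3) : E3 := axis (Phi q) *m (J q)^T.
Definition metric (q : E3) : 'M[R]_3 :=
  lam (Phi q) *: (gbar q + (alpha ^+ 2 / den (Phi q)) *: ((theta q)^T *m theta q)).
Definition form (q : E3) : E3 := shift (Phi q) *m (J q)^T.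
Definition energy : R := (c ^+ 2 - s ^+ 2) / 2.

Lemma den_gt0 Q : 0 < den Q.
Proof.
have h : alpha ^+ 2 < 1 by rewrite expr_lt1 // ltW.
by rewrite /den; have := mulr_ge0 (sqr_ge0 alpha) (sqr_ge0 (Q 0 2)); lra.
Qed.

Lemma den_sphere Q : sphere Q -> den Q = 1 - alpha ^+ 2 * dot (axis Q) (axis Q).
Proof. by rewrite /sphere /= !dot3 /den !mxE /= => h; rewrite -[1 in LHS]h; move: h; rewrite !expr2 => h; nra. Qed.

Lemma sphere_entry (Q : E3) i : sphere Q -> -1 <= Q 0 i <= 1.
Proof. by move=> QS; rewrite -ler_norml -(nrm_eq1 QS); exact: entry_le_nrm. Qed.

Lemma energy_gt0 : 0 < c ^+ 2 - s ^+ 2.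
Proof. by rewrite subr_gt0 ltr_sqr ?nnegrE ?s_lt_c // ltW. Qed.

Lemma lam_gt0 Q : sphere Q -> 0 < lam Q.
Proof.
move=> QS; have /andP[q1 q2] := sphere_entry 2 QS; have D0 := den_gt0 Q.
have as0 : 0 <= alpha * s by rewrite mulr_ge0 // ltW.
have C1 : s < shift_coef Q.
  rewrite /shift_coef; have : alpha * s * Q 0 2 <= alpha * s by rewrite -[leRHS]mulr1 ler_wpM2l.
  by move: sc; rewrite mulrDr mulr1 (mulrC s); lra.
have D1 : den Q <= 1.
  have : alpha ^+ 2 * Q 0 2 ^+ 2 <= alpha ^+ 2.
    by rewrite -[leRHS]mulr1 ler_wpM2l ?sqr_ge0 // expr2; nra.
  by rewrite /den; lra.
rewrite divr_gt0 ?energy_gt0 // subr_gt0 ltr_pdivlMr //.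
apply: le_lt_trans (_ : s ^+ 2 * den Q <= s ^+ 2) _; last by rewrite ltr_sqr ?nnegrE // (le_trans s0) // ltW.
by rewrite -[leRHS]mulr1 ler_wpM2l // sqr_ge0.
Qed.

Lemma theta_dot q u : q != 0 -> dot (theta q) u = dot (axis (Phi q)) ('D_u Phi q).
Proof. by move=> q0; rewrite dot_mulmx_tr (jacobianE _ (dPhi q0)). Qed.

Lemma form_dot q u : q != 0 -> dot (form q) u = dot (shift (Phi q)) ('D_u Phi q).
Proof. by move=> q0; rewrite dot_mulmx_tr (jacobianE _ (dPhi q0)). Qed.

Lemma Phi_sphere q : sphere q -> sphere (Phi q).
Proof. by rewrite /sphere /= Phi_iso. Qed.

Lemma Psi_sphere q : sphere q -> sphere (Psi q).
Proof. by rewrite /sphere /= Psi_iso. Qed.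

Lemma metricE q u v : q != 0 -> bil (metric q) u v = lam (Phi q) *
  (bil (gbar q) u v + alpha ^+ 2 / den (Phi q) * (dot (axis (Phi q)) ('D_u Phi q) * dot (axis (Phi q)) ('D_v Phi q))).
Proof. by move=> q0; rewrite bil_scale bil_add bil_scale bil_outer !theta_dot. Qed.

Lemma axis_perp Q : dot Q (axis Q) = 0.
Proof. by rewrite dot3 !mxE /=; ring. Qed.

Lemma sm_axis (V : normedModType R) (U : set V) f : open U -> smooth_on U f -> smooth_on U (fun x => axis (f x)).
Proof. by move=> oU sf; rewrite /axis; smooth. Qed.

Lemma sm_den (V : normedModType R) (U : set V) f : open U -> smooth_on U f ->
  smooth_on U (fun x => (den (f x))^-1).
Proof. by move=> oU sf; rewrite /den; smooth; move=> x _; exact: lt0r_neq0 (den_gt0 (f x)). Qed.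

Lemma sm_shift (V : normedModType R) (U : set V) f : open U -> smooth_on U f ->
  smooth_on U (fun x => shift (f x)).
Proof.
move=> oU sf; have := sm_den oU sf; have := sm_axis oU sf.
by rewrite /shift /shift_coef => h1 h2; smooth.
Qed.

Lemma sm_lam (V : normedModType R) (U : set V) f : open U -> smooth_on U f ->
  smooth_on U (fun x => lam (f x)).
Proof. by move=> oU sf; have h := sm_den oU sf; rewrite /lam /shift_coef; smooth. Qed.

(** * Passage to the round model *)

Definition base : set E6 := [set y | y.1 != 0].

Lemma open_base : open base.
Proof.
apply: (@open_comp _ _ (@fst E3 E3) [set X | X != 0]); last exact: open_nonzero.
by move=> x _; exact: cvg_fst.
Qed.
Let oB := open_base.

Lemma sm_base (W : normedModType R) (f : E3 -> W) : findim W -> smooth_on NZ f ->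
  smooth_on base (fun y => f y.1).
Proof.
move=> fW sf; apply: (sm_comp (U' := NZ) (g := f) (f := fun y : E6 => y.1)) => //.
by smooth_pair.
Qed.

(** The cotangent lift of Phi followed by the translation by minus [shift], extended to all nonzero
    base points in order to have ambient derivatives. *)
Definition untwist (y : E6) : E6 := (Phi y.1, y.2 *m (invmx (J y.1))^T - shift (Phi y.1)).
Definition twist (x : E6) : E6 := (Psi x.1, (x.2 + shift x.1) *m (J (Psi x.1))^T).

Lemma sm_untwist : smooth_on base untwist.
Proof.
have s1 := sm_base (findim_mx _ _) sPhi; have s2 := sm_base (findim_mx _ _) sm_invJ.
have s3 := sm_shift oB s1; rewrite /untwist; smooth_pair.
Qed.

Lemma sm_twist : smooth_on base twist.
Proof.
have s1 := sm_base (findim_mx _ _) sPsi.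
have sJP : smooth_on NZ (fun Q => J (Psi Q)).
  apply: (sm_comp (U' := NZ) (g := J) (f := Psi)) => //; last exact: sm_J.
  by move=> x; rewrite /= Psi_nz.
have s2 := sm_base (findim_mx _ _) sJP.
have s3 : smooth_on base (fun y => shift y.1) by apply: sm_shift => //; smooth_pair.
rewrite /twist; smooth_pair.
Qed.

Lemma untwistK y : base y -> twist (untwist y) = y.
Proof.
move=> yB; rewrite /twist /untwist /= PhiK subrK -mulmxA -trmx_mul mulmxV ?J_unit //.
by rewrite trmx1 mulmx1 -surjective_pairing.
Qed.

Lemma twistK x : base x -> untwist (twist x) = x.
Proof.
move=> xB; have PB : Psi x.1 != 0 by rewrite Psi_nz.
rewrite /twist /untwist /= PsiK -mulmxA -trmx_mul mulVmx ?J_unit //.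
by rewrite trmx1 mulmx1 addrK -surjective_pairing.
Qed.

Lemma shift_perp Q : dot Q (shift Q) = 0.
Proof. by rewrite dotZr axis_perp mulr0. Qed.

Lemma cotangent_base y : cotangent y -> base y.
Proof. by move=> [yS _]; exact: sphere_neq0. Qed.

Lemma untwist_cotangent y : cotangent y -> cotangent (untwist y).
Proof.
move=> [yS yP]; have q0 := sphere_neq0 yS; split; first exact: Phi_sphere.
rewrite /untwist /= dotDr dotNr shift_perp subr0 dotC dot_mulmx_tr PhiE // mulmxK ?J_unit //.
by rewrite dotC.
Qed.

Lemma twist_cotangent x : cotangent x -> cotangent (twist x).
Proof.
move=> [xS xP]; have q0 := sphere_neq0 (Psi_sphere xS); split; first exact: Psi_sphere.
by rewrite /twist /= dotC dot_mulmx_tr -PhiE // PsiK dotDl dotC xP dotC shift_perp addr0.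
Qed.

(** Off the zero section the pulled-back area form is minus the differential of the connection form;
    this is therefore a primitive of the canonical 2-form minus s times the area. *)
Definition model_form (x v : E6) : R :=
  dot x.2 v.1 + s * (det3 x.1 x.2 v.2 / dot x.2 x.2).

Let oM := @open_nonzero_momentum R.

Lemma det3D (u v w w' : E3) k : det3 u v (k *: w + w') = k * det3 u v w + det3 u v w'.
Proof. by rewrite /det3 !mxE; ring. Qed.

Lemma model_form_covector : smooth_covector (@nonzero_momentum R) model_form.
Proof.
split=> [v|y k u v].
  rewrite /model_form /det3; smooth_pair.
  by move=> x x0; rewrite dot_eq0.
by rewrite /model_form /= dotDr dotZr det3D; ring.
Qed.

Lemma derive_model_form x U U' : nonzero_momentum x -> 'D_U (model_form ^~ U') x =
  dot U.2 U'.1 + s * ((det3 U.1 x.2 U'.2 + det3 x.1 U.2 U'.2) / dot x.2 x.2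
    - 2 * dot x.2 U.2 * det3 x.1 x.2 U'.2 / dot x.2 x.2 ^+ 2).
Proof.
move=> x0; have n0 : dot x.2 x.2 != 0 by rewrite dot_eq0.
have s1 : smooth_on setT (fun y : E6 => dot y.2 U'.1) by smooth_pair.
have s2 : smooth_on setT (fun y : E6 => det3 y.1 y.2 U'.2) by rewrite /det3; smooth_pair.
have s3 : smooth_on setT (fun y : E6 => dot y.2 y.2) by smooth_pair.
have s4 : smooth_on (@nonzero_momentum R) (fun y : E6 => (dot y.2 y.2)^-1).
  by smooth_pair; move=> y y0; rewrite dot_eq0.
have d1 := sm_diff s1 (I : setT x); have d2 := sm_diff s2 (I : setT x).
have d3 := sm_diff s3 (I : setT x); have d4 := sm_diff s4 x0.
have e1 : 'D_U (fun y : E6 => dot y.2 U'.1) x = dot U.2 U'.1.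
  apply: (derive_quadratic (b := 0) d1) => t.
  by rewrite /= dotDl dotZl scaler0 addr0.
have e2 : 'D_U (fun y : E6 => det3 y.1 y.2 U'.2) x = det3 U.1 x.2 U'.2 + det3 x.1 U.2 U'.2.
  apply: (derive_quadratic (b := det3 U.1 U.2 U'.2) d2) => t.
  by rewrite /det3 /= !mxE /GRing.scale /=; ring.
have e3 : 'D_U (fun y : E6 => dot y.2 y.2) x = 2 * dot x.2 U.2.
  apply: (derive_quadratic (b := dot U.2 U.2) d3) => t.
  by rewrite /= !(dotDl, dotDr, dotZl, dotZr) (dotC U.2 x.2) /GRing.scale /=; ring.
have d24 : differentiable (fun y : E6 => det3 y.1 y.2 U'.2 / dot y.2 y.2) x by exact: differentiableM.
have dsc : differentiable (fun y : E6 => s * (det3 y.1 y.2 U'.2 / dot y.2 y.2)) x.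
  by apply: differentiableM => //; exact: differentiable_cst.
rewrite /model_form (derD _ d1 dsc) e1 (derM _ (differentiable_cst s x) d24) der_cst mul0r add0r.
rewrite (derM _ d2 d4) e2 (derV _ d3 n0) e3.
by move: (dot x.2 x.2) n0 => r r0; congr (_ + s * _); field.
Qed.

Lemma dform_model x U U' : cotangent x -> nonzero_momentum x ->
  dot x.1 U.1 = 0 -> dot x.1 U'.1 = 0 -> dot U.1 x.2 + dot x.1 U.2 = 0 ->
  dot U'.1 x.2 + dot x.1 U'.2 = 0 ->
  dform model_form x U U' = dot U.2 U'.1 - dot U'.2 U.1 - s * det3 x.1 U.1 U'.1.
Proof.
move=> [xS xP] x0 h1 h2 h3 h4; have n0 : dot x.2 x.2 != 0 by rewrite dot_eq0.
have := solid_angle_algebra xS xP n0 h1 h2 h3 h4; rewrite /dform !derive_model_form //.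
by move=> E; rewrite -[det3 x.1 U.1 U'.1]opprK -E; ring.
Qed.

Lemma dform_canonical (x U U' : E6) : dform canonical_form x U U' = dot U.2 U'.1 - dot U'.2 U.1.
Proof.
have e (W W' : E6) : 'D_W (canonical_form ^~ W') x = dot W.2 W'.1.
  have s1 : smooth_on setT (fun y : E6 => dot y.2 W'.1) by smooth_pair.
  apply: (derive_quadratic (b := 0) (sm_diff s1 (I : setT x))) => t.
  by rewrite /canonical_form /= dotDl dotZl scaler0 addr0.
by rewrite /dform !e.
Qed.

Lemma canonical_covector (U : set E6) : open U -> smooth_covector U (@canonical_form R).
Proof.
move=> oU; split=> [v|y k u v]; first by rewrite /canonical_form; smooth_pair.
by rewrite /canonical_form /= dotDr dotZr.
Qed.

Lemma tangent_cotangent (x U : E6) : cotangent x -> tangent cotangent x U ->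
  dot x.1 U.1 = 0 /\ dot U.1 x.2 + dot x.1 U.2 = 0.
Proof.
move=> xC [cc [cc0 cX dcc]].
have key (f : E6 -> R) a : (forall y, cotangent y -> f y = a) -> differentiable f x -> 'D_U f x = 0.
  move=> fa df; have df' : differentiable f (cc 0) by rewrite cc0.
  have h := derive_curve dcc df'; rewrite cc0 in h; apply: is_derive_unique h _.
  have hc : is_derive (0 : R) 1 (fun _ : R => a) 0 by exact: is_derive_cst.
  apply: (near_is_derive _ hc).
  by apply: filterS cX => t /fa /= ->.
have s1 : smooth_on setT (fun y : E6 => dot y.1 y.1) by smooth_pair.
have s2 : smooth_on setT (fun y : E6 => dot y.1 y.2) by smooth_pair.
have d1 := sm_diff s1 (I : setT x); have d2 := sm_diff s2 (I : setT x).
have e1 : 'D_U (fun y : E6 => dot y.1 y.1) x = 2 * dot x.1 U.1.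
  apply: (derive_quadratic (b := dot U.1 U.1) d1) => t.
  by rewrite /= !(dotDl, dotDr, dotZl, dotZr) (dotC U.1 x.1) /GRing.scale /=; ring.
have e2 : 'D_U (fun y : E6 => dot y.1 y.2) x = dot U.1 x.2 + dot x.1 U.2.
  apply: (derive_quadratic (b := dot U.1 U.2) d2) => t.
  by rewrite /= !(dotDl, dotDr, dotZl, dotZr) /GRing.scale /=; ring.
split; last by rewrite -e2; apply: (key _ 0) => // y [].
have := key _ 1 _ d1; rewrite e1 => H; have := H (fun y yC => proj1 yC); lra.
Qed.

Definition regular : set E6 := [set y | base y /\ nonzero_momentum (untwist y)].

Lemma open_preimage_untwist (U : set E6) : open U -> open [set y | base y /\ U (untwist y)].
Proof.
move=> oU; rewrite openE => y [yB yU]; apply: filterI; first exact: open_nbhs_nbhs.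
by apply: (sm_continuous sm_untwist yB); exact: open_nbhs_nbhs.
Qed.

Lemma open_regular : open regular.
Proof. exact: open_preimage_untwist. Qed.
Let oR := open_regular.

(** Written with the differential, which is linear in v at every y: a smooth covector must be linear
    even at points where [untwist] is not differentiable. *)
Definition contact (y v : E6) : R := model_form (untwist y) ('d untwist y v).

Lemma contactE y v : base y -> contact y v = model_form (untwist y) ('D_v untwist y).
Proof. by move=> yB; rewrite /contact deriveE //; exact: sm_diff sm_untwist yB. Qed.

Lemma contact_covector : smooth_covector regular contact.
Proof.
split=> [v|y k u v]; last by rewrite /contact linearP; case: model_form_covector => _; exact.
have su : smooth_on regular untwist by apply: (sm_subset _ sm_untwist) => y [].
have sv : smooth_on regular (fun y => 'D_v untwist y) by exact: sm_derx.
apply: (sm_eq oR (f := fun y => model_form (untwist y) ('D_v untwist y))) => [y [yB _]|].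
  by rewrite contactE.
rewrite /model_form /det3; smooth_pair.
by move=> y [_ y0]; rewrite dot_eq0.
Qed.

Lemma derive_untwist_fst y v : base y -> ('D_v untwist y).1 = 'D_(v.1) Phi y.1.
Proof.
move=> yB; rewrite (derive_fst _ (sm_diff sm_untwist yB)).
have d1 : differentiable (@fst E3 E3) y by exact: differentiable_lincont (lincont_fst _ _).
have := @derive_comp _ _ _ _ (@fst E3 E3) Phi y v d1 (dPhi yB).
by rewrite (derive_lincont _ _ (lincont_fst _ _)).
Qed.

(* The Liouville form of the round sphere pulls back to [p dq - beta]. *)
Lemma untwist_canonical y v : base y ->
  canonical_form (untwist y) ('D_v untwist y) = canonical_form y v - dot (form y.1) v.1.
Proof.
move=> yB; rewrite /canonical_form derive_untwist_fst // (form_dot _ yB) /untwist /= dotDl dotNl.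
congr (_ - _); rewrite dot_mulmx_tr (jacobianE _ (dPhi yB)) mulmxK //; exact: J_unit.
Qed.

Lemma sphere_retraction : retraction_at sphere NZ (fun q : E3 => (nrm q)^-1 *: q).
Proof.
split=> //.
- smooth; first by move=> x /nrm_gt0/lt0r_neq0.
  exact: sm_nrm.
- exact: normalize_sphere.
- by move=> q _ /nrm_eq1 ->; rewrite invr1 scale1r.
Qed.

Lemma sm_form_dot v : smooth_on NZ (fun q => dot (form q) v).
Proof. by have h := sm_shift oNZ sPhi; have h' := sm_J; rewrite /form; smooth_pair. Qed.

Lemma form_covector : smooth_covector NZ (fun q a => dot (form q) a).
Proof. by split=> [v|q k u v]; [exact: sm_form_dot|rewrite /= dotDr dotZr]. Qed.

Lemma extd_form q u v : sphere q -> tangent sphere q u -> tangent sphere q v ->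
  extd sphere (fun q a => dot (form q) a) q u v = dform (fun q a => dot (form q) a) q u v.
Proof.
move=> qS tu tv; apply: (extdE (findim_mx _ _) sphere_retraction (sphere_neq0 qS) qS _ tu tv).
have [f1 f2] := form_covector.
by exists NZ; split => //; exact: sphere_neq0.
Qed.

Definition magnetic := magnetic_form s (area_form gbar o) form.

(** [contact] is the pullback of [model_form]. Its area term yields s times [area_form] because Phi
    preserves oriented area, and its canonical term differs from p dq by [form]. *)
Lemma dform_contact y u v : cotangent y -> regular y -> tangent cotangent y u -> tangent cotangent y v ->
  dform contact y u v = dform canonical_form y u v - magnetic y.1 u.1 v.1.
Proof.
move=> yC [yB y0] tu tv; have xC := untwist_cotangent yC.
have [yS _] := yC; have [uq _] := tangent_cotangent yC tu; have [vq _] := tangent_cotangent yC tv.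
have tC w : tangent cotangent y w -> tangent cotangent (untwist y) ('D_w untwist y).
  by apply: (tangent_image oB yB) => [z _ zC|]; [exact: untwist_cotangent|exact: sm_diff sm_untwist yB].
have [h1 h3] := tangent_cotangent xC (tC u tu); have [h2 h4] := tangent_cotangent xC (tC v tv).
have fE6 : findim E6 by [].
have -> : dform contact y u v = dform model_form (untwist y) ('D_u untwist y) ('D_v untwist y).
  have su : smooth_on regular untwist by apply: (sm_subset _ sm_untwist) => z [].
  have h : forall z, regular z -> nonzero_momentum (untwist z) by move=> z [].
  have rg : regular y by [].
  rewrite -(dform_pullback u v fE6 oR oM rg su h model_form_covector).
  by apply: dform_near; apply: filterS (open_nbhs_nbhs (conj oR rg)) => z [zB _] w; rewrite contactE.
have hs : det3 (untwist y).1 ('D_u untwist y).1 ('D_v untwist y).1 = area_form gbar o y.1 u.1 v.1.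
  have e1 := derive_untwist_fst u yB; have e2 := derive_untwist_fst v yB.
  exact: (etrans (congr2 (det3 (Phi y.1)) e1 e2) (esym (Phi_area yS uq vq))).
have -> : dform model_form (untwist y) ('D_u untwist y) ('D_v untwist y) =
    dform canonical_form (untwist y) ('D_u untwist y) ('D_v untwist y) - s * area_form gbar o y.1 u.1 v.1.
  rewrite (dform_model xC y0 h1 h2 h3 h4) hs; congr (_ - _); exact/esym/dform_canonical.
have -> : dform canonical_form (untwist y) ('D_u untwist y) ('D_v untwist y) =
    dform canonical_form y u v - dform (fun q a => dot (form q) a) y.1 u.1 v.1.
  rewrite -(dform_pullback u v fE6 oB openT yB sm_untwist (fun _ _ => I) (canonical_covector openT)).
  have -> : dform (fun y w => canonical_form (untwist y) ('D_w untwist y)) y u v =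
      dform (fun y w => canonical_form y w - dot (form y.1) w.1) y u v.
    by apply: dform_near; apply: filterS (open_nbhs_nbhs (conj oB yB)) => z zB w; exact: untwist_canonical.
  have s1 : smooth_on base (@fst E3 E3) by exact: (sm_lin (lincont_fst _ _)).
  have := dform_pullback u v (findim_mx _ _) oB oNZ yB s1 (fun z h => h) form_covector.
  rewrite !(derive_lincont _ _ (lincont_fst _ _)) => <-.
  have E (A B C D : R) : (A - B) - (C - D) = (A - C) - (B - D) by ring.
  have db w w' : 'D_w' (fun z : E6 => canonical_form z w - dot (form z.1) w.1) y =
     'D_w' (canonical_form ^~ w) y - 'D_w' (fun z : E6 => dot (form z.1) ('D_w fst z)) y.
    have -> : (fun z : E6 => dot (form z.1) ('D_w fst z)) = (fun z : E6 => dot (form z.1) w.1).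
      by apply/funext => z; rewrite (derive_lincont _ _ (lincont_fst _ _)).
    apply: derB; first by have [h _] := canonical_covector openT; exact: sm_diff (h w) (I : setT y).
    exact: sm_diff (sm_base findimR (sm_form_dot w.1)) yB.
  by rewrite /dform !db E.
rewrite /magnetic /magnetic_form extd_form //; [|exact/tangent_sphere|exact/tangent_sphere].
by ring.
Qed.

(** * The double cover and its local inverses *)

Definition cover (z : E4) : E6 := twist (hopf s c z).
Local Notation Omega := (hopf_dom s c : set E4).
Let oO : open Omega := @open_hopf_dom R s c.

Lemma hopf_cot z : Omega z -> cotangent (hopf s c z).
Proof. by move=> zO; have [h1 h2 _] := hopf_cotangent s0 c0 zO. Qed.

Lemma cover_cotangent z : Omega z -> cotangent (cover z).
Proof. by move=> /hopf_cot; exact: twist_cotangent. Qed.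

Lemma untwist_cover z : Omega z -> untwist (cover z) = hopf s c z.
Proof. by move=> /hopf_cot/cotangent_base; exact: twistK. Qed.

Lemma cover_regular z : Omega z -> regular (cover z).
Proof.
move=> zO; split; first exact: cotangent_base (cover_cotangent zO).
by rewrite untwist_cover //; exact: hopf_nonzero.
Qed.

Lemma sm_hopf : smooth_on Omega (hopf s c).
Proof. by apply: sm_pair => //; [exact: sm_hopf_Q|exact: sm_hopf_P]. Qed.

Lemma sm_cover : smooth_on Omega cover.
Proof.
apply: (sm_comp (U' := base) (g := twist) (f := hopf s c)) => //.
- by move=> z /hopf_cot/cotangent_base.
- exact: sm_hopf.
- exact: sm_twist.
Qed.

Lemma coverN z : cover (- z) = cover z.
Proof. by rewrite /cover hopfN. Qed.

Lemma contact_cover z v : Omega z -> contact (cover z) ('D_v cover z) = 2 * c * liouville z v.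
Proof.
move=> zO; have cB := cotangent_base (cover_cotangent zO).
rewrite contactE // untwist_cover // -(derive_comp _ (sm_diff sm_cover zO) (sm_diff sm_untwist cB)).
rewrite (@near_eq_derive _ _ _ _ (hopf s c)); last first.
  by apply: open_near_eq oO zO _ => y yO; exact: untwist_cover.
rewrite -(hopf_liouville s0 c0 v zO) /model_form.
have dh := sm_diff sm_hopf zO.
by rewrite (derive_fst _ dh) (derive_snd _ dh).
Qed.

Definition cut_dom (w : E4) : set E6 := [set y | base y /\ lift_dom s c w (untwist y)].
Definition section (w : E4) (y : E6) : E4 := lift s c w (untwist y).

Lemma open_cut_dom w : open (cut_dom w).
Proof. by apply: open_preimage_untwist; exact: open_lift_dom. Qed.

Lemma sm_section w : smooth_on (cut_dom w) (section w).
Proof.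
have su : smooth_on (cut_dom w) untwist by apply: (sm_subset _ sm_untwist) => y [].
apply: (sm_comp (U' := lift_dom s c w) (g := lift s c w) (f := untwist)) => //.
- exact: open_cut_dom.
- exact: open_lift_dom.
- by move=> y [].
- exact: sm_lift.
Qed.

Lemma section_cover w z : Omega z -> dot w z != 0 ->
  cut_dom w (cover z) /\ section w (cover z) = Num.sg (dot w z) *: z.
Proof.
move=> zO wz; have [h1 h2] := lift_hopf s0 c0 zO wz.
split; last by rewrite /section untwist_cover.
split; first exact: cotangent_base (cover_cotangent zO).
by rewrite untwist_cover.
Qed.

Lemma cover_section w y : cotangent y -> cut_dom w y ->
  [/\ Omega (section w y), cover (section w y) = y & 0 < dot w (section w y)].
Proof.
move=> yC [yB yw]; have [h1 h2 h3] := hopf_lift s0 c0 (untwist_cotangent yC) yw.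
by split => //; rewrite /cover h2 untwistK.
Qed.

Lemma cover_onto y : cotangent y -> regular y -> exists2 z, Omega z & cover z = y.
Proof.
move=> yC [yB y0]; have [xS xP] := untwist_cotangent yC.
have [z zO [zQ zP]] := hopf_onto s0 c0 xS xP y0; exists z => //.
by rewrite /cover /hopf zQ zP -surjective_pairing untwistK.
Qed.

(** Off T^*S^2 the section may leave the domain of [cover]. On this open set the composite of the
    two is a retraction onto T^*S^2 and, with a radial projection to the ellipsoid in between, onto
    the level. *)
Definition local_dom (w : E4) : set E6 := [set y | cut_dom w y /\ Omega (section w y)].

Lemma open_local_dom w : open (local_dom w).
Proof.
rewrite openE => y [yB yU]; apply: filterI; first exact: open_nbhs_nbhs (conj (@open_cut_dom w) yB).
by apply: (sm_continuous (@sm_section w) yB); exact: open_nbhs_nbhs.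
Qed.

Lemma cotangent_retraction w : retraction_at cotangent (local_dom w) (fun y => cover (section w y)).
Proof.
split; first exact: open_local_dom.
- apply: (sm_comp (U' := Omega) (g := cover) (f := section w)) => //.
  + exact: open_local_dom.
  + by move=> y [].
  + by apply: (sm_subset _ (@sm_section w)) => y [].
  + exact: sm_cover.
- by move=> y [_ yO]; exact: cover_cotangent.
- by move=> y [yL yO] yC; have [_ h _] := cover_section yC yL.
Qed.

Lemma local_dom_cover z : Omega z -> local_dom z (cover z) /\ section z (cover z) = z.
Proof.
move=> zO; have [N0 _ _ _] := hopf_dom_facts s0 c0 zO.
have [h1 h2] := section_cover zO (lt0r_neq0 N0).
have E : section z (cover z) = z by rewrite h2 gtr0_sg // scale1r.
by split=> //; split => //; rewrite E.
Qed.

Lemma sm_stereo_comp (W : normedModType R) (f : E3 -> W) cc : findim W -> smooth_on NZ f ->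
  smooth_on setT (fun x => f (stereo cc x)).
Proof.
move=> fW sf; apply: (sm_comp (U' := NZ) (g := f) (f := stereo cc)) => //.
- exact: openT.
- by move=> x _; exact: stereo_neq0.
- exact: sm_stereo.
Qed.

Lemma sm_frame cc i : smooth_on setT (fun x => frame cc x i : E3).
Proof. exact: sm_derx (@sm_stereo R cc). Qed.

Lemma sm_theta : smooth_on NZ theta.
Proof. by have h := sm_axis oNZ sPhi; have h' := sm_J; rewrite /theta; smooth_pair. Qed.

Lemma sm_form : smooth_on NZ form.
Proof. by have h := sm_shift oNZ sPhi; have h' := sm_J; rewrite /form; smooth_pair. Qed.

Lemma metric_coordE cc x i k : metric_coord metric cc x i k = lam (Phi (stereo cc x)) *
  (metric_coord gbar cc x i k + alpha ^+ 2 / den (Phi (stereo cc x)) *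
    (dot (theta (stereo cc x)) (frame cc x i) * dot (theta (stereo cc x)) (frame cc x k))).
Proof. by rewrite !mxE bil_scale bil_add bil_scale bil_outer. Qed.

Lemma form_coordE cc x i : form_coord form cc x 0 i = dot (form (stereo cc x)) (frame cc x i).
Proof. by rewrite mxE. Qed.

Lemma form_one_form : one_form form.
Proof.
move=> cc; have oT := @openT 'rV[R]_2; apply: sm_mx => // i k; under eq_fun do rewrite mxE.
have h := sm_stereo_comp cc (findim_mx _ _) sm_form; have h' := @sm_frame cc k.
exact: (sm_dot oT h h').
Qed.

Lemma metric_riemannian : riemannian_metric metric.
Proof.
have [gs1 gs2 gs3] := gbm; split.
- move=> cc; have oT := @openT 'rV[R]_2; apply: sm_mx => // i k.
  have h1 := sm_lam oNZ sPhi; have h2 := sm_den oNZ sPhi.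
  have t1 := sm_stereo_comp cc findimR h1; have t2 := sm_stereo_comp cc findimR h2.
  have t3 := sm_stereo_comp cc (findim_mx _ _) sm_theta.
  have f1 := @sm_frame cc i; have f2 := @sm_frame cc k; have g1 := gs1 cc.
  apply: (sm_eq oT (fun x _ => esym (metric_coordE cc x i k))).
  have gik : smooth_on setT (fun x => metric_coord gbar cc x i k) by exact: sm_coord.
  have ca : smooth_on setT (fun _ : 'rV[R]_2 => alpha ^+ 2) by exact: sm_cst.
  exact: (smM oT t1 (smD oT gik (smM oT (smM oT ca t2) (smM oT (sm_dot oT t3 f1) (sm_dot oT t3 f2))))).
- move=> q u v qS tu tv; have q0 := sphere_neq0 qS; rewrite (metricE u v q0) (metricE v u q0) (gs2 q u v qS tu tv).
  have sym (l b k x y : R) : l * (b + k * (x * y)) = l * (b + k * (y * x)) by rewrite (mulrC x).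
  exact: sym.
- move=> q v qS tv v0; have q0 := sphere_neq0 qS; rewrite metricE //.
  have l0 := lam_gt0 (Phi_sphere qS); have g0 := gs3 q v qS tv v0.
  apply: mulr_gt0 => //; apply: ltr_wpDr => //; rewrite -expr2; apply: mulr_ge0; last exact: sqr_ge0.
  by rewrite divr_ge0 ?sqr_ge0 // ltW // den_gt0.
Qed.

(** * The energy level as an ellipsoid *)

Definition model_energy (x : E6) : R :=
  (dot (x.2 + shift x.1) (x.2 + shift x.1) - alpha ^+ 2 * dot (x.2 + shift x.1) (axis x.1) ^+ 2)
  / (2 * lam x.1).

Lemma kineticE y : cotangent y -> kinetic metric y = model_energy (untwist y).
Proof.
move=> yC; have [yS yP] := yC; have q0 := sphere_neq0 yS; have QS := Phi_sphere yS.
have [xS xP] := untwist_cotangent yC.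
pose Q := Phi y.1; pose P := y.2 *m (invmx (J y.1))^T; pose V := axis Q.
have PE : (untwist y).2 + shift (untwist y).1 = P by rewrite /untwist /= subrK.
have l0 := lam_gt0 QS; have D0 := den_gt0 Q; have ln := lt0r_neq0 l0; have Dn := lt0r_neq0 D0.
(* The image under Phi of the vector dual to the covector: the inverse of 1 + (alpha^2 / den) V V^T
   is 1 - alpha^2 V V^T. *)
pose w0 := (lam Q)^-1 *: (P - (alpha ^+ 2 * dot P V) *: V).
pose w := w0 *m invmx (J y.1).
have Dw : 'D_w Phi y.1 = w0 by rewrite (jacobianE _ (dPhi q0)) mulmxKV // J_unit.
have QV : dot Q V = 0 by exact: axis_perp.
have QP : dot Q P = 0.
  by have := xP; rewrite /untwist /= -/P -/Q dotDr dotNr shift_perp subr0.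
have qw : dot y.1 w = 0.
  by rewrite -Phi_radial // Dw dotZr dotDr dotNr dotZr QP QV mulr0 subr0 mulr0.
have tw : tangent sphere y.1 w by exact/tangent_sphere.
have dP u : dot P ('D_u Phi y.1) = dot y.2 u.
  by rewrite (jacobianE _ (dPhi q0)) dot_mulmx_tr mulmxK // J_unit.
have VV : den Q = 1 - alpha ^+ 2 * dot V V by exact: den_sphere.
have key u : tangent sphere y.1 u -> bil (metric y.1) w u = dot y.2 u.
  move=> /(tangent_sphere _ yS) yu; rewrite metricE // Phi_metric // Dw -dP.
  rewrite -/Q -/V /w0 !(dotZl, dotDl, dotNl, dotZr, dotDr, dotNr) (dotC V P).
  move: VV Dn ln; move: (den Q) (lam Q) (dot P _) (dot P V) (dot V V) (dot V _) => D l pu pv vv vu -> Dn ln.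
  by field; rewrite ln Dn.
rewrite /kinetic (conorm_dual metric_riemannian yS tw key) /model_energy PE /= -/Q -/V.
rewrite -dP Dw /w0 dotZr dotDr dotNr dotZr.
by move: ln; move: (lam Q) (dot P P) (dot P V) => l pp pv ln; field.
Qed.

Lemma momentum_sqr x : cotangent x -> dot (momentum s x) (momentum s x) = momentum_norm s x ^+ 2.
Proof.
move=> [xS xP]; rewrite sqr_sqrtr; last by rewrite addr_ge0 ?dot_ge0 ?sqr_ge0.
rewrite /momentum !(dotDl, dotDr, dotZl, dotZr) dot_cross_cross xS xP (dotC (cross _ _)) dot_crossl.
by ring.
Qed.

(** The excess of energy has numerator j^2 - (c - alpha J_3)^2, here factored; the level is the zero
    set of the first factor because the second one is positive. *)
Lemma model_energyE x : cotangent x -> model_energy x = energy +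
  (momentum_norm s x + alpha * momentum s x 0 2 - c) * (momentum_norm s x - alpha * momentum s x 0 2 + c)
  / (2 * lam x.1).
Proof.
move=> xC; have [xS xP] := xC; have l0 := lt0r_neq0 (lam_gt0 xS); have e0 := lt0r_neq0 energy_gt0.
have D0 := lt0r_neq0 (den_gt0 x.1).
have jj : momentum_norm s x ^+ 2 = dot x.2 x.2 + s ^+ 2.
  by rewrite sqr_sqrtr // addr_ge0 ?dot_ge0 ?sqr_ge0.
have Jz : momentum s x 0 2 = dot x.2 (axis x.1) + s * x.1 0 2.
  by rewrite /momentum dot3 !mxE /=; ring.
have eE : energy = (shift_coef x.1 ^+ 2 / den x.1 - s ^+ 2) / (2 * lam x.1).
  have := l0; rewrite /energy /lam mulf_eq0 negb_or => /andP[h _].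
  by move: h; move: (_ / den x.1 - _) => B h; field; rewrite h e0.
rewrite eE -mulrDl; congr (_ / _); rewrite /model_energy.
have -> : (momentum_norm s x + alpha * momentum s x 0 2 - c) * (momentum_norm s x - alpha * momentum s x 0 2 + c) =
   momentum_norm s x ^+ 2 - (alpha * momentum s x 0 2 - c) ^+ 2 by ring.
rewrite jj Jz /shift !(dotDl, dotDr, dotZl, dotZr) (dotC (axis x.1) x.2).
have VV := den_sphere xS; have Ce : alpha * (dot x.2 (axis x.1) + s * x.1 0 2) - c = alpha * dot x.2 (axis x.1) - shift_coef x.1.
  by rewrite /shift_coef; ring.
rewrite Ce; move: VV D0; move: (den _) (shift_coef _) (dot x.2 x.2) (dot x.2 _) (dot (axis _) _) => D C pp pv vv VV D0.
have -> : vv = (1 - D) / alpha ^+ 2 by rewrite VV; field; rewrite lt0r_neq0.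
by field; rewrite D0 lt0r_neq0.
Qed.

Lemma momentum_z_bound x : cotangent x -> `|momentum s x 0 2| <= momentum_norm s x.
Proof.
move=> xC; have j0 : 0 <= momentum_norm s x by exact: sqrtr_ge0.
by apply: le_trans (entry_le_nrm _ _) _; rewrite /nrm momentum_sqr // sqrtr_sqr ger0_norm.
Qed.

(** The moment has length j, so |J_3| <= j, and alpha < 1. *)
Lemma level_factor_gt0 x : cotangent x -> 0 < momentum_norm s x - alpha * momentum s x 0 2 + c.
Proof.
move=> xC; have := momentum_z_bound xC; rewrite ler_norml => /andP[h1 h2].
have j0 : 0 <= momentum_norm s x by exact: sqrtr_ge0.
have : alpha * momentum s x 0 2 <= alpha * momentum_norm s x by rewrite ler_pM2l.
have : alpha * momentum_norm s x <= momentum_norm s x by rewrite ler_piMl // ltW.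
by have := c0; lra.
Qed.

Notation Level := (level (kinetic metric) energy).

Lemma levelP y : cotangent y -> Level y <->
  momentum_norm s (untwist y) + alpha * momentum s (untwist y) 0 2 = c.
Proof.
move=> yC; have xC := untwist_cotangent yC; have f0 := level_factor_gt0 xC.
have l0 := lam_gt0 (proj1 xC); rewrite /level /= kineticE // model_energyE //.
split=> [[_] | ->]; last by rewrite subrr !mul0r addr0.
move=> /eqP; rewrite -subr_eq0 addrAC subrr add0r !mulf_eq0 (gt_eqF f0) orbF invr_eq0 mulf_eq0.
by rewrite pnatr_eq0 (gt_eqF l0) !orbF subr_eq0 => /eqP.
Qed.

Lemma level_cotangent y : Level y -> cotangent y. Proof. by case. Qed.

Lemma level_regular y : Level y -> regular y.
Proof.
move=> yL; have yC := level_cotangent yL; split; first exact: cotangent_base.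
apply/eqP => P0; have /(levelP yC) := yL; have [xS _] := untwist_cotangent yC.
have /andP[_ q2] := sphere_entry 2 xS.
have -> : momentum_norm s (untwist y) = s by rewrite /momentum_norm P0 dot0l add0r sqrtr_sqr ger0_norm.
have -> : momentum s (untwist y) 0 2 = s * (untwist y).1 0 2.
  by rewrite /momentum P0; move: (untwist y).1 => Q; rewrite !mxE /=; ring.
move=> E; have : alpha * (s * (untwist y).1 0 2) <= alpha * s by rewrite ler_pM2l // -[leRHS]mulr1 ler_wpM2l.
by move: sc; rewrite mulrDr mulr1 (mulrC s); lra.
Qed.

Definition quadratic (z : E4) : R := (1 + alpha) * ((z 0 0 ^+ 2 + z 0 1 ^+ 2) / 2)
           + (1 - alpha) * ((z 0 2 ^+ 2 + z 0 3 ^+ 2) / 2).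

(** Along the cover j + alpha J_3 is c times [quadratic]. *)
Lemma cover_level z : Omega z -> Level (cover z) <-> quadratic z = 1.
Proof.
move=> zO; have E : momentum_norm s (untwist (cover z)) + alpha * momentum s (untwist (cover z)) 0 2 = c * quadratic z.
  rewrite untwist_cover // hopf_momentum_norm // hopf_momentumE // /hopf_j dot4 !mxE /= /quadratic.
  by field.
rewrite (levelP (cover_cotangent zO)) E; split=> [|->]; last by rewrite mulr1.
by rewrite -{2}[c]mulr1 => /(mulfI (lt0r_neq0 c0)).
Qed.

Lemma ellipsoid_dom z : quadratic z = 1 -> Omega z.
Proof.
move=> q1; rewrite /hopf_dom /= /hopf_j; have h : 2 <= (1 + alpha) * dot z z.
  have : 0 <= alpha * (z 0 2 ^+ 2 + z 0 3 ^+ 2) by rewrite mulr_ge0 ?addr_ge0 ?sqr_ge0 // ltW.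
  by move: q1; rewrite /quadratic dot4 !expr2; lra.
rewrite -(ltr_pM2r (_ : 0 < 1 + alpha)); last by rewrite addr_gt0.
apply: lt_le_trans sc _; have -> : c / 2 * dot z z * (1 + alpha) = c / 2 * ((1 + alpha) * dot z z) by ring.
have : 0 <= c / 2 * ((1 + alpha) * dot z z - 2) by rewrite mulr_ge0 ?subr_ge0 // divr_ge0 // ltW.
by lra.
Qed.

Definition gradient (z : E4) : E4 := \row_i [:: (1 + alpha) * z 0 0; (1 + alpha) * z 0 1;
  (1 - alpha) * z 0 2; (1 - alpha) * z 0 3]`_i.
Definition normalize4 (z : E4) : E4 := (Num.sqrt (quadratic z))^-1 *: z.
Local Notation NZ4 := [set z : E4 | z != 0].
Local Notation Ell := (ellipsoid alpha : set E4).

Lemma quadratic_gt0 z : z != 0 -> 0 < quadratic z.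
Proof.
move=> /dot_gt0; rewrite dot4 /quadratic => N0.
have b0 : 0 < 1 - alpha by rewrite subr_gt0.
have h : (1 - alpha) * dot z z / 2 <= quadratic z.
  rewrite /quadratic dot4; have := mulr_ge0 (ltW a0) (sqr_ge0 (z 0 0)); have := mulr_ge0 (ltW a0) (sqr_ge0 (z 0 1)).
  by rewrite !expr2; lra.
by apply: lt_le_trans h; rewrite dot4 divr_gt0 // mulr_gt0.
Qed.

Lemma quadraticZ k z : quadratic (k *: z) = k ^+ 2 * quadratic z.
Proof. by rewrite /quadratic !mxE; ring. Qed.

Lemma normalize4_level z : z != 0 -> quadratic (normalize4 z) = 1.
Proof.
move=> z0; have q0 := quadratic_gt0 z0.
by rewrite quadraticZ exprVn sqr_sqrtr ?ltW // mulVf // lt0r_neq0.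
Qed.

Lemma normalize4_id z : quadratic z = 1 -> normalize4 z = z.
Proof. by move=> q1; rewrite /normalize4 q1 sqrtr1 invr1 scale1r. Qed.

Lemma sm_quadratic (U : set E4) : open U -> smooth_on U quadratic.
Proof. by move=> oU; rewrite /quadratic; smooth. Qed.

Let oNZ4 := @open_nonzero R 4.

Lemma sm_normalize4 : smooth_on NZ4 normalize4.
Proof.
have sq := sm_quadratic oNZ4; rewrite /normalize4; smooth.
- by move=> z /quadratic_gt0 h; rewrite lt0r_neq0 // sqrtr_gt0.
- by move=> z; exact: quadratic_gt0.
Qed.

Lemma dom_nz z : Omega z -> z != 0.
Proof. by move=> /(hopf_dom_facts s0 c0)[N0 _ _ _]; apply: contraTneq N0 => ->; rewrite dot0l ltxx. Qed.

Lemma ellipsoid_retraction : retraction_at Ell NZ4 normalize4.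
Proof.
split=> //; first exact: sm_normalize4.
- by move=> z; exact: normalize4_level.
- by move=> z _; exact: normalize4_id.
Qed.

Lemma ellipsoid_nz z : Ell z -> z != 0.
Proof. by move=> /ellipsoid_dom; exact: dom_nz. Qed.

Lemma derive_quadratic_form z v : 'D_v quadratic z = dot (gradient z) v.
Proof.
apply: (derive_quadratic (b := quadratic v)).
  exact: sm_diff (sm_quadratic (@openT E4)) I.
by move=> t; rewrite dot4 /quadratic !mxE /GRing.scale /=; field.
Qed.

Lemma tangent_ellipsoid z v : Ell z -> tangent Ell z v <-> dot (gradient z) v = 0.
Proof.
move=> zE; have z0 := ellipsoid_nz zE; have dq := sm_diff (sm_quadratic (@openT E4)) (I : setT z).
split.
  move=> [cc [cc0 cX dcc]]; have df' : differentiable quadratic (cc 0) by rewrite cc0.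
  have h := derive_curve dcc df'; rewrite cc0 derive_quadratic_form in h.
  apply: is_derive_unique h _.
  have hc : is_derive (0 : R) 1 (fun _ : R => 1 : R) 0 by exact: is_derive_cst.
  by apply: (near_is_derive _ hc); apply: filterS cX => t /= <-.
move=> gv; apply/(tangentP v ellipsoid_retraction z0 zE).
have oP : open [set r : R | 0 < r] by exact: open_gt.
have sh : smooth_on [set r : R | 0 < r] (fun r => (Num.sqrt r)^-1).
  smooth; first by move=> r r0; rewrite lt0r_neq0 // sqrtr_gt0.
  exact: (sm_sqrt oP (fun _ h => h) (@sm_id _ _ _)).
have q0 := quadratic_gt0 z0.
have dh := sm_diff sh q0.
have Dh : 'D_v ((fun r => (Num.sqrt r)^-1) \o quadratic) z = 0.
  by rewrite (derive_comp v dq dh) derive_quadratic_form gv deriveE // linear0.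
have dhq : differentiable ((fun r => (Num.sqrt r)^-1) \o quadratic) z by exact: differentiable_comp.
have did : differentiable (fun y : E4 => y) z by exact: sm_diff (@sm_id _ _ setT) I.
rewrite /normalize4 (derZ _ dhq did) // Dh scale0r add0r derive_id.
by rewrite /= (zE : quadratic z = 1) sqrtr1 invr1 scale1r.
Qed.

Lemma level_retraction w : retraction_at Level (local_dom w) (fun y => cover (normalize4 (section w y))).
Proof.
have nO z : Omega z -> Omega (normalize4 z) /\ quadratic (normalize4 z) = 1.
  by move=> /dom_nz/normalize4_level h; split => //; exact: ellipsoid_dom.
have sn : smooth_on (local_dom w) (fun y => normalize4 (section w y)).
  apply: (sm_comp (U' := NZ4) (g := normalize4) (f := section w)) => //.
  + exact: open_local_dom.
  + by move=> y [_ /dom_nz].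
  + by apply: (sm_subset _ (@sm_section w)) => y [].
  + exact: sm_normalize4.
split; first exact: open_local_dom.
- apply: (sm_comp (U' := Omega) (g := cover) (f := fun y => normalize4 (section w y))) => //.
  + exact: open_local_dom.
  + by move=> y [_ /nO[]].
  + exact: sm_cover.
- by move=> y [_ /nO[nyO nyq]]; apply/cover_level.
- move=> y [yL yO] yY; have yC := level_cotangent yY; have [_ h _] := cover_section yC yL.
  by rewrite normalize4_id // -(cover_level yO) h.
Qed.

Lemma level_onto y : Level y -> exists z, [/\ Omega z, cover z = y & Ell z].
Proof.
move=> yY; have [z zO zy] := cover_onto (level_cotangent yY) (level_regular yY).
by exists z; split => //; apply/(cover_level zO); rewrite zy.
Qed.

Lemma tangent_sub (V : normedModType R) (X Y : set V) x v : X `<=` Y -> tangent X x v -> tangent Y x v.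
Proof. by move=> XY [cc [c1 c2 c3]]; exists cc; split => //; apply: filterS c2 => t /XY. Qed.

Lemma extd_contact y u v : Level y -> tangent Level y u -> tangent Level y v ->
  extd Level contact y u v = dform contact y u v.
Proof.
move=> yY tu tv; have [z [zO zy zE]] := level_onto yY; have [zL _] := local_dom_cover zO.
rewrite zy in zL; apply: (extdE _ (level_retraction z) zL yY _ tu tv) => //.
have [f1 f2] := contact_covector; exists regular; split => //; exact: level_regular.
Qed.

Lemma contact_primitive : primitive_on Level (twisted_form magnetic) contact.
Proof.
move=> y u v yY tu tv; have yC := level_cotangent yY; have yR := level_regular yY.
have sub : Level `<=` cotangent by move=> x [].
have tu' := tangent_sub sub tu; have tv' := tangent_sub sub tv.
rewrite extd_contact // dform_contact // /twisted_form; congr (_ - _).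
have [z [zO zy zE]] := level_onto yY; have [zL _] := local_dom_cover zO; rewrite zy in zL.
apply/esym; apply: (extdE _ (cotangent_retraction z) zL yC _ tu' tv') => //.
have [f1 f2] := canonical_covector (@openT E6); by exists setT; split => //; exact: openT.
Qed.

Definition area4 (u v : E4) : R := u 0 0 * v 0 1 - u 0 1 * v 0 0 + u 0 2 * v 0 3 - u 0 3 * v 0 2.

Lemma dform_liouville z u v : dform (fun z v => 2 * c * liouville z v) z u v = 2 * c * area4 u v.
Proof.
have e u' v' : 'D_u' (fun z => 2 * c * liouville z v') z = 2 * c * liouville u' v'.
  have sl : smooth_on setT (fun z => 2 * c * liouville z v') by rewrite /liouville; smooth.
  apply: (derive_quadratic (b := 0) (sm_diff sl (I : setT z))) => t.
  by rewrite /liouville !mxE scaler0 addr0 /GRing.scale /=; ring.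
by rewrite /dform !e /liouville /area4; field.
Qed.

Lemma dform_contact_cover z u v : Omega z ->
  dform contact (cover z) ('D_u cover z) ('D_v cover z) = 2 * c * area4 u v.
Proof.
move=> zO; have fE6 : findim E6 by [].
have cr y : Omega y -> regular (cover y) by exact: cover_regular.
rewrite -(dform_pullback u v fE6 oO oR zO sm_cover cr contact_covector) -(dform_liouville z u v).
by apply: dform_near; apply: filterS (open_nbhs_nbhs (conj oO zO)) => y yO w; exact: contact_cover.
Qed.

Lemma tangent_cover z v : Omega z -> Ell z -> tangent Ell z v -> tangent Level (cover z) ('D_v cover z).
Proof.
move=> zO zE; apply: (tangent_image oO zO) => [y yO yE|]; first exact/cover_level.
exact: sm_diff sm_cover zO.
Qed.

(** The gradient multiplied by i, hence the Hamiltonian field of [quadratic] for [area4]; on the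
    ellipsoid it is the Reeb field of the Liouville form. *)
Definition reeb (z : E4) : E4 := \row_i [:: - (1 + alpha) * z 0 1; (1 + alpha) * z 0 0;
  - (1 - alpha) * z 0 3; (1 - alpha) * z 0 2]`_i.

Lemma contact_contact : contact_form Level contact.
Proof.
split=> [y yY|y yY].
  have [f1 f2] := contact_covector; exists contact, regular; split => //; exact: level_regular.
have [z [zO zy zE]] := level_onto yY; have z0 := ellipsoid_nz zE.
pose g := gradient z.
have g0 : g != 0.
  apply: contra_neq z0 => /rowP E; apply/rowP => i; rewrite mxE.
  have p1 : 1 + alpha != 0 by rewrite lt0r_neq0 // addr_gt0.
  have p2 : 1 - alpha != 0 by rewrite lt0r_neq0 // subr_gt0.
  by move: i; elim/ord4P; [have := E 0|have := E 1|have := E 2|have := E 3]; rewrite !mxE /= => /eqP;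
    rewrite mulf_eq0 ?(negbTE p1) ?(negbTE p2) => /eqP.
(* With g read as a quaternion, [reeb z], v and w are i g, j g and k g. In this tangent frame only
   the product of the form on the first vector with its differential on the other two survives. *)
pose v : E4 := \row_i [:: - g 0 2; g 0 3; g 0 0; - g 0 1]`_i.
pose w : E4 := \row_i [:: - g 0 3; - g 0 2; g 0 1; g 0 0]`_i.
have tr : tangent Ell z (reeb z) by apply/(tangent_ellipsoid _ zE); rewrite dot4 !mxE /=; ring.
have tv : tangent Ell z v by apply/(tangent_ellipsoid _ zE); rewrite -/g; clearbody g; rewrite dot4 !mxE /=; ring.
have tw : tangent Ell z w by apply/(tangent_ellipsoid _ zE); rewrite -/g; clearbody g; rewrite dot4 !mxE /=; ring.
have gv : dot g v = 0 by exact/tangent_ellipsoid.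
have gw : dot g w = 0 by exact/tangent_ellipsoid.
have rv u : area4 (reeb z) u = - dot g u by rewrite /area4 dot4 !mxE /=; ring.
have vr u : area4 u (reeb z) = dot g u by rewrite /area4 dot4 !mxE /=; ring.
have lr : liouville z (reeb z) = 1.
  by rewrite -(zE : quadratic z = 1) /liouville /quadratic !mxE /=; field.
have vw : area4 v w = dot g g by rewrite /v /w; clearbody g; rewrite /area4 dot4 !mxE /=; ring.
exists ('D_(reeb z) cover z), ('D_v cover z), ('D_w cover z); rewrite -zy.
have t1 := tangent_cover zO zE tr; have t2 := tangent_cover zO zE tv; have t3 := tangent_cover zO zE tw.
split=> //; have yL : Level (cover z) by rewrite zy.
have e1 := etrans (extd_contact yL t2 t3) (dform_contact_cover v w zO).
have e2 := etrans (extd_contact yL t3 t1) (dform_contact_cover w (reeb z) zO).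
have e3 := etrans (extd_contact yL t1 t2) (dform_contact_cover (reeb z) v zO).
have e4 := etrans (contact_cover (reeb z) zO) (etrans (congr1 (fun t => 2 * c * t) lr) (mulr1 _)).
have e5 := etrans e1 (congr1 (fun t => 2 * c * t) vw).
have e6 := etrans e2 (congr1 (fun t => 2 * c * t) (etrans (vr w) gw)).
have e7 := etrans e3 (congr1 (fun t => 2 * c * t) (etrans (rv v) (congr1 -%R gv))).
have alg (A B D E1 E2 E3 : R) : A = 2 * c -> E1 = 2 * c * dot g g -> E2 = 2 * c * 0 -> E3 = 2 * c * - 0 ->
    A * E1 + B * E2 + D * E3 != 0.
  move=> -> -> -> ->; rewrite oppr0 !mulr0 !addr0 !mulf_neq0 ?pnatr_eq0 ?dot_eq0 //; exact: lt0r_neq0.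
exact: alg e4 e5 e6 e7.
Qed.

(** The indicator of a relatively open and closed part, extended along rays to nonzero vectors, is
    locally constant, hence constant on segments avoiding 0. Such a segment joins two nonzero
    vectors with nonnegative inner product, and x reaches - x through i x. *)
Lemma ellipsoid_connected : connected Ell.
Proof.
move=> B [b Bb] [C1 oC1 E1] [C2 cC2 E2].
pose f (x : E4) := `[< C1 (normalize4 x) >].
have floc x : x != 0 -> exists2 d, 0 < d & forall y, `|y - x| < d -> f y = f x.
  move=> x0; have cn := sm_continuous sm_normalize4 x0; have En : Ell (normalize4 x) by exact: normalize4_level.
  have [d0 d00 P0] := near_radius (open_nbhs_nbhs (conj oNZ4 x0)).
  case: (pselect (C1 (normalize4 x))) => h.
    have [d dd P] := near_radius (cn _ (open_nbhs_nbhs (conj oC1 h))).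
    by exists d => // y yd; rewrite /f !asboolT //; exact: P (ltW yd).
  have h2 : (~` C2) (normalize4 x).
    move=> c2; apply: h; have : B (normalize4 x) by rewrite E2; split.
    by rewrite E1 => -[].
  have oC2 : open (~` C2) by rewrite openC.
  have [d dd P] := near_radius (cn _ (open_nbhs_nbhs (conj oC2 h2))).
  exists (Num.min d0 d); first by rewrite lt_min d00.
  move=> y; rewrite lt_min => /andP[y1 y2]; rewrite /f !asboolF // => c1.
  apply: (P y (ltW y2)); have : B (normalize4 y) by rewrite E1; split => //; apply: normalize4_level; exact: P0 (ltW y1).
  by rewrite E2 => -[].
have seg x y : x != 0 -> y != 0 -> 0 <= dot x y -> f y = f x.
  move=> x0 y0 xy; apply: locally_constant_segment => t /andP[t0 t1]; apply: floc.
  have -> : x + t *: (y - x) = (1 - t) *: x + t *: y by apply/rowP => i; rewrite !mxE; ring.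
  rewrite -dot_eq0 dot_comb (dotC y x); have := dot_gt0 x0; have := dot_gt0 y0.
  move: (dot x y) (dot x x) (dot y y) xy => p q r xy r0 q0; apply/eqP => E.
  have e1 := mulr_ge0 (mulr_ge0 t0 (_ : 0 <= 1 - t)) xy; rewrite subr_ge0 in e1; have {e1} e1 := e1 t1.
  have e2 : 0 <= (1 - t) * (1 - t) * q by rewrite mulr_ge0 ?(ltW q0) // -expr2 sqr_ge0.
  have e3 : 0 <= t * t * r by rewrite mulr_ge0 ?(ltW r0) // -expr2 sqr_ge0.
  have /eqP : (1 - t) * (1 - t) * q = 0 by move: E e1 e2 e3; lra.
  rewrite !mulf_eq0 orbb (gt_eqF q0) orbF subr_eq0 => /eqP t1'.
  by move: E; rewrite -t1' subrr; lra.
have rot x : x != 0 -> f (- x) = f x.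
  pose ix (x : E4) : E4 := \row_i [:: - x 0 1; x 0 0; - x 0 3; x 0 2]`_i.
  have iN y : dot (ix y) (ix y) = dot y y by rewrite !dot4 !mxE /=; ring.
  have i0 y : dot y (ix y) = 0 by rewrite !dot4 !mxE /=; ring.
  have ii : ix (ix x) = - x by apply/rowP; elim/ord4P; rewrite !mxE //=.
  move=> x0; have ix0 : ix x != 0 by rewrite -dot_eq0 iN dot_eq0.
  rewrite -ii (seg (ix x)) ?i0 //; last by rewrite -dot_eq0 iN dot_eq0.
  by apply: seg => //; rewrite i0.
have fb : f b by apply/asboolP; move: Bb; rewrite {1}E1 => -[bE bC]; rewrite normalize4_id.
have b0 : b != 0 by apply: ellipsoid_nz; move: Bb; rewrite E1 => -[].
apply/seteqP; split=> [x|x xE]; first by rewrite E1 => -[].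
have x0 := ellipsoid_nz xE; rewrite E1; split => //.
have : f x.
  have [h|h] := leP 0 (dot b x); first by rewrite (seg b).
  rewrite (seg (- b)) ?oppr_eq0 // ?rot // dotNl; lra.
by move=> /asboolP; rewrite normalize4_id.
Qed.

Lemma cut_dom_cover w z : Omega z -> cut_dom w (cover z) <-> dot w z != 0.
Proof.
move=> zO; split=> [[_ [_]]|wz]; last by have [] := section_cover zO wz.
by rewrite untwist_cover //= quad_hopf // => h; apply: contraTneq h => ->; rewrite expr0n /= ltxx.
Qed.

(** Near the image of z the two sheets are the half-spaces where the inner product with z is
    positive and negative; [section z] inverts the cover on the first one, and its opposite on the
    second. *)
Lemma cover_double : double_cover Ell Level cover.
Proof.
split; first exact: ellipsoid_connected.
- move=> z zE; exists Omega, cover; split => //; [exact: ellipsoid_dom|exact: sm_cover].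
- by move=> _ [z zE <-]; apply/cover_level => //; exact: ellipsoid_dom.
move=> y yY; have [z [zO zy zE]] := level_onto yY.
pose O1 := [set w : E4 | 0 < dot z w]; pose O2 := [set w : E4 | 0 < - dot z w].
have odot (k : R) : open [set w : E4 | 0 < k * dot z w].
  have ck (x : E4) : setT x -> {for x, continuous (fun w : E4 => k * dot z w)}.
    have oT := @openT E4; have h : smooth_on setT (fun w : E4 => k * dot z w).
      apply: smM => //; first exact: sm_cst.
      apply: sm_dot => //; [exact: sm_cst|exact: sm_id].
    exact: sm_continuous h.
  by have := open_pos openT ck; rewrite setTI.
have oO1 : open O1 by have := odot 1; congr open; apply/seteqP; split => w; rewrite /O1 /= mul1r.
have oO2 : open O2 by have := odot (-1); congr open; apply/seteqP; split => w; rewrite /O2 /= mulN1r.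
have smc X : X `<=` Ell -> smooth_in X cover.
  by move=> XE w /XE wE; exists Omega, cover; split => //; [exact: ellipsoid_dom|exact: sm_cover].
have N0 : dot z z != 0 by rewrite lt0r_neq0 // dot_gt0 // ellipsoid_nz.
have lift y' : Level y' -> cut_dom z y' -> [/\ Ell (section z y'), cover (section z y') = y' & 0 < dot z (section z y')].
  move=> yY' yc; have [h1 h2 h3] := cover_section (level_cotangent yY') yc.
  by split => //; apply/(cover_level h1); rewrite h2.
exists (cut_dom z), O1, O2; split.
- split=> //; first exact: open_cut_dom.
  by rewrite -zy; apply/cut_dom_cover.
- apply/seteqP; split=> w [wE].
    move=> /(cut_dom_cover _ (ellipsoid_dom wE)) wz; split => //; move: wz; rewrite neq_lt => /orP[h|h].
      by right; rewrite /O2 /= oppr_gt0.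
    by left.
  move=> h; split => //; apply/(cut_dom_cover _ (ellipsoid_dom wE)).
  by case: h; rewrite /O1 /O2 /= ?oppr_gt0 => h; [exact: lt0r_neq0|exact: ltr0_neq0].
- by apply/seteqP; split => // w [_ [h1 h2]]; move: h1 h2; rewrite /O1 /O2 /=; lra.
- split.
  + by apply: smc => w [].
  + apply/seteqP; split=> [_ [w [wE wz] <-]|y' [yY' yc]].
      split; first by apply/cover_level => //; exact: ellipsoid_dom.
      by apply/(cut_dom_cover _ (ellipsoid_dom wE)); exact: lt0r_neq0.
    by have [h1 h2 h3] := lift y' yY' yc; exists (section z y').
  + exists (section z).
      move=> y' [yY' yc]; exists (cut_dom z), (section z); split => //; [exact: open_cut_dom|exact: sm_section].
    move=> w [wE wz]; have [_ ->] := section_cover (ellipsoid_dom wE) (lt0r_neq0 wz).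
    by rewrite gtr0_sg // scale1r.
- split.
  + by apply: smc => w [].
  + apply/seteqP; split=> [_ [w [wE wz] <-]|y' [yY' yc]].
      split; first by apply/cover_level => //; exact: ellipsoid_dom.
      by apply/(cut_dom_cover _ (ellipsoid_dom wE)); rewrite ltr0_neq0 // -oppr_gt0.
    have [h1 h2 h3] := lift y' yY' yc; exists (- section z y'); last by rewrite coverN.
    split; first by have := quadraticZ (-1) (section z y'); rewrite scaleN1r sqrrN expr1n mul1r => E; exact: etrans E h1.
    by rewrite /O2 /= dotNr opprK.
  + exists (fun y => - section z y).
      move=> y' [yY' yc]; exists (cut_dom z), (fun y => - section z y); split => //; first exact: open_cut_dom.
      by apply: smN; [exact: open_cut_dom|exact: sm_section].
    move=> w [wE]; rewrite /O2 /= oppr_gt0 => wz.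
    have [_ ->] := section_cover (ellipsoid_dom wE) (ltr0_neq0 wz).
    by rewrite ltr0_sg // scaleN1r opprK.
Qed.

(** The covering space is the ellipsoid itself, so the contactomorphism is the identity, and the
    homothety factor is the 2 c of [contact_cover]. *)
Lemma level_double_cover : double_cover_is_ellipsoid Level (twisted_form magnetic) alpha.
Proof.
exists contact; split; [exact: contact_contact|exact: contact_primitive|].
exists 4%N, Ell, cover, (2 * c); split; [exact: cover_double|by rewrite mulr_gt0|].
have sid (X : set E4) : smooth_in X (@idfun E4).
  by move=> x _; exists setT, (@idfun E4); split => //; [exact: openT|exact: sm_id].
exists (@idfun E4).
  split=> //; first by rewrite image_id.
  by exists (@idfun E4).
move=> z v zE tv; have zO := ellipsoid_dom zE.
rewrite /pullback (@mdiff_ext _ _ _ Ell Omega cover cover) //; last exact: sm_diff sm_cover zO.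
have -> : mdiff Ell idfun z v = v.
  have := @mdiff_ext _ _ _ Ell setT idfun idfun z v (@openT E4) I zE (fun _ _ _ => erefl) (sm_diff (@sm_id _ _ setT) I) tv.
  by rewrite derive_id.
by rewrite contact_cover.
Qed.

(** * Dynamics on the level and periodic orbits *)

Definition re (b : bool) (z : E4) : R := z 0 (if b then 2 else 0 : 'I_4).
Definition im (b : bool) (z : E4) : R := z 0 (if b then 3 else 1 : 'I_4).
Definition freq (b : bool) : R := if b then 1 - alpha else 1 + alpha.

Lemma freq_gt0 b : 0 < freq b.
Proof. by case: b; rewrite /freq ?subr_gt0 // addr_gt0. Qed.

Lemma quadratic_re_im b z : quadratic z =
  freq b * (re b z ^+ 2 + im b z ^+ 2) / 2 + freq (~~ b) * (re (~~ b) z ^+ 2 + im (~~ b) z ^+ 2) / 2.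
Proof. by rewrite /quadratic /freq /re /im; case: b => /=; ring. Qed.

(* The real and imaginary parts of the square of z_1 ([b = false]) or z_2 ([b = true]), which descend
   to T^*S^2, unlike z itself. *)
Definition wre (b : bool) (y : E6) : R := let S := squares s c (untwist y) in
  S (if b then 2 else 0) (if b then 2 else 0) - S (if b then 3 else 1) (if b then 3 else 1).
Definition wim (b : bool) (y : E6) : R := let S := squares s c (untwist y) in
  2 * S (if b then 2 else 0) (if b then 3 else 1).

Lemma sm_w b : smooth_on regular (wre b) /\ smooth_on regular (wim b).
Proof.
have su : smooth_on regular untwist by apply: (sm_subset _ sm_untwist) => y [].
have sS : smooth_on regular (fun y => squares s c (untwist y)).
  apply: (sm_comp (U' := @nonzero_momentum R) (g := squares s c) (f := untwist)) => //.
  - by move=> y [].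
  - exact: sm_squares.
have h i k : smooth_on regular (fun y => squares s c (untwist y) i k) by exact: sm_coord.
split; rewrite /wre /wim; [exact: smB|].
by apply: smM => //; exact: sm_cst.
Qed.

Lemma w_cover b z : Omega z ->
  wre b (cover z) = re b z ^+ 2 - im b z ^+ 2 /\ wim b (cover z) = 2 * (re b z * im b z).
Proof.
move=> zO; have E i k : squares s c (untwist (cover z)) i k = z 0 i * z 0 k.
  by rewrite untwist_cover // squares_hopf // mxE big_ord_recl big_ord0 addr0 mxE.
by rewrite /wre /wim !E -!expr2.
Qed.

(** Along [reeb] the coordinate z_1 or z_2 rotates with velocity [freq b], and its square twice as
    fast. *)
Lemma derive_w_cover b z : Omega z ->
  'D_('D_(reeb z) cover z) (wre b) (cover z) = - (2 * freq b * wim b (cover z)) /\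
  'D_('D_(reeb z) cover z) (wim b) (cover z) = 2 * freq b * wre b (cover z).
Proof.
move=> zO; have [s1 s2] := sm_w b; have zR := cover_regular zO; have dc := sm_diff sm_cover zO.
have [e1 e2] := w_cover b zO; rewrite e1 e2.
have oT := @openT E4.
have sr (k : 'I_4) : smooth_on setT (fun y : E4 => y 0 k) by apply: sm_coord => //; exact: sm_id.
have srr : smooth_on setT (re b) by exact: sr.
have sri : smooth_on setT (im b) by exact: sr.
have near_w (f : E6 -> R) (h : E4 -> R) : (forall z', Omega z' -> f (cover z') = h z') ->
    differentiable f (cover z) -> 'D_('D_(reeb z) cover z) f (cover z) = 'D_(reeb z) h z.
  move=> fh df; rewrite -(derive_comp _ dc df); apply: near_eq_derive.
  by apply: (open_near_eq oO zO).
split.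
- rewrite (near_w _ (fun z => re b z ^+ 2 - im b z ^+ 2) _ (sm_diff s1 zR)); last by move=> z' /(w_cover b)[].
  have sd : smooth_on setT (fun z => re b z ^+ 2 - im b z ^+ 2).
    by apply: smB => //; apply: smM.
  apply: (derive_quadratic (b := re b (reeb z) ^+ 2 - im b (reeb z) ^+ 2) (sm_diff sd (I : setT z))) => t.
  by rewrite /re /im /freq; case: b {e1 e2 s1 s2 srr sri sd}; rewrite !mxE /GRing.scale /=; ring.
- rewrite (near_w _ (fun z => 2 * (re b z * im b z)) _ (sm_diff s2 zR)); last by move=> z' /(w_cover b)[].
  have sd : smooth_on setT (fun z => 2 * (re b z * im b z)).
    by apply: smM => //; [exact: sm_cst|apply: smM].
  apply: (derive_quadratic (b := 2 * (re b (reeb z) * im b (reeb z))) (sm_diff sd (I : setT z))) => t.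
  by rewrite /re /im /freq; case: b {e1 e2 s1 s2 srr sri sd}; rewrite !mxE /GRing.scale /=; ring.
Qed.

Lemma tangent_cover_cotangent z v : Omega z -> tangent cotangent (cover z) ('D_v cover z).
Proof.
move=> zO; apply: (tangent_image (X := Omega) oO zO) => [y yO _||]; first exact: cover_cotangent.
- exact: sm_diff sm_cover zO.
- exact: tangent_open.
Qed.

Lemma tangent_coverP z w : Omega z -> tangent cotangent (cover z) w -> exists v, w = 'D_v cover z.
Proof.
move=> zO tw; have yC := cover_cotangent zO; have [yL sz] := local_dom_cover zO.
have ds := sm_diff (@sm_section z) (proj1 yL).
have dc : differentiable cover (section z (cover z)) by rewrite sz; exact: sm_diff sm_cover zO.
have h := derive_comp w ds dc; have := proj1 (tangentP w (cotangent_retraction z) yL yC) tw.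
rewrite -/(cover \o section z) h sz => E.
exists ('D_w (section z) (cover z)); exact: esym E.
Qed.

Lemma twisted_form_cover z u v : Omega z ->
  twisted_form magnetic (cover z) ('D_u cover z) ('D_v cover z) = 2 * c * area4 u v.
Proof.
move=> zO; have yC := cover_cotangent zO; have yR := cover_regular zO.
have tu := tangent_cover_cotangent u zO; have tv := tangent_cover_cotangent v zO.
have [zL _] := local_dom_cover zO.
rewrite -(dform_contact_cover u v zO) dform_contact // /twisted_form; congr (_ - _).
apply: (extdE _ (cotangent_retraction z) zL yC _ tu tv) => //.
have [f1 f2] := canonical_covector (@openT E6); by exists setT; split => //; exact: openT.
Qed.

(** The time change between the two flows: on the level the pullback of the differential of the
    energy is 2 c [rate] times that of [quadratic], while the twisted form pulls back to 2 c
    [area4]. *)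
Definition rate (y : E6) : R := momentum_norm s (untwist y) / (2 * lam (untwist y).1).

Lemma rate_cover z : Omega z -> rate (cover z) = hopf_j c z / (2 * lam (hopf_Q s c z)).
Proof. by move=> zO; rewrite /rate untwist_cover // hopf_momentum_norm. Qed.

Lemma hopf_Q_sphere z : Omega z -> sphere (hopf_Q s c z).
Proof. by move=> /hopf_cot[]. Qed.

Lemma kinetic_cover z : Omega z -> kinetic metric (cover z) = energy + (c * quadratic z - c) *
  ((hopf_j c z - alpha * (c / 2 * F3 z z 0 2) + c) / (2 * lam (hopf_Q s c z))).
Proof.
move=> zO; rewrite (kineticE (cover_cotangent zO)) untwist_cover // (model_energyE (hopf_cot zO)).
rewrite hopf_momentum_norm // hopf_momentumE // mulrA [((c / 2) *: F3 z z) 0 2]mxE.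
congr (_ + _ * _ / _); congr (_ - c).
by rewrite /hopf_j dot4 !mxE /= /quadratic; field.
Qed.

Lemma mdiff_kinetic_cover z v : Ell z -> mdiff cotangent (kinetic metric) (cover z) ('D_v cover z) =
  2 * c * rate (cover z) * dot (gradient z) v.
Proof.
move=> zE; have zO := ellipsoid_dom zE; have [zL sz] := local_dom_cover zO.
pose K z := (hopf_j c z - alpha * (c / 2 * F3 z z 0 2) + c) / (2 * lam (hopf_Q s c z)).
pose E z := energy + (c * quadratic z - c) * K z.
have [sj _ _ _] := sm_hopf_scalars s0 c0; have sl := sm_lam oO (sm_hopf_Q s0 c0).
have sq := sm_quadratic oO.
have sF : smooth_on Omega (fun z => F3 z z 0 2).
  have -> : (fun z : E4 => F3 z z 0 2) = fun z : E4 => z 0 0 * z 0 0 + z 0 1 * z 0 1 - z 0 2 * z 0 2 - z 0 3 * z 0 3.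
    by apply/funext => y; rewrite mxE.
  by smooth.
have sK : smooth_on Omega K.
  rewrite /K; smooth; move=> y yO; rewrite mulf_neq0 // lt0r_neq0 //; exact: lam_gt0 (hopf_Q_sphere yO).
have sE : smooth_on Omega E by rewrite /E; smooth.
have sES : smooth_on (local_dom z) (fun y => E (section z y)).
  apply: (sm_comp (U' := Omega) (g := E) (f := section z)) => //.
  - exact: open_local_dom.
  - by move=> y [].
  - by apply: (sm_subset _ (@sm_section z)) => y [].
have dES := sm_diff sES zL.
have ext y : local_dom z y -> cotangent y -> E (section z y) = kinetic metric y.
  move=> [yL yO] yC; have [_ h _] := cover_section yC yL.
  by rewrite -{2}h kinetic_cover.
have tv := tangent_cover_cotangent v zO.
rewrite (mdiff_ext (@open_local_dom z) zL (cover_cotangent zO) ext dES tv).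
rewrite -(derive_comp v (sm_diff sm_cover zO) dES).
have nE : \forall z' \near z, ((fun y => E (section z y)) \o cover) z' = E z'.
  have od : \forall z' \near z, 0 < dot z z'.
    have sd : smooth_on setT (fun w : E4 => dot z w).
      by apply: sm_dot; [exact: openT|exact: sm_cst|exact: sm_id].
    have /cvgr_gt := sm_continuous sd (I : setT z); apply; exact: dot_gt0 (dom_nz zO).
  apply: filterS2 od (open_nbhs_nbhs (conj oO zO)) => z' h z'O /=.
  by have [_ ->] := section_cover z'O (lt0r_neq0 h); rewrite gtr0_sg // scale1r.
rewrite (near_eq_derive _ nE).
have dq : differentiable (fun z => c * quadratic z - c) z.
  have sm : smooth_on Omega (fun z => c * quadratic z - c) by smooth.
  exact: sm_diff sm zO.
have dqE : 'D_v (fun z => c * quadratic z - c) z = c * dot (gradient z) v.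
  apply: (derive_quadratic (b := c * quadratic v) dq) => t.
  by rewrite dot4 /quadratic !mxE /GRing.scale /=; field.
have dK := sm_diff sK zO; have dp := differentiableM dq dK.
rewrite /E (derD _ (differentiable_cst energy z) dp) der_cst add0r (derM _ dq dK) dqE.
have q1 : quadratic z = 1 by exact: zE.
rewrite q1 mulr1 subrr mul0r addr0 rate_cover // /K.
(* The derivative of [K] has dropped out, its cofactor being zero on the ellipsoid, where moreover
   alpha J_3 = c - j. *)
have -> : hopf_j c z - alpha * (c / 2 * F3 z z 0 2) + c = 2 * hopf_j c z.
  have : c * quadratic z = hopf_j c z + alpha * (c / 2 * F3 z z 0 2).
    by rewrite /hopf_j dot4 !mxE /= /quadratic; field.
  by rewrite q1 mulr1; move: (hopf_j _ _) (F3 _ _ _ _) => x y h; rewrite [X in _ + X = _]h; ring.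
by have := lt0r_neq0 (lam_gt0 (hopf_Q_sphere zO)); move: (lam _) (dot _ _) (hopf_j _ _) => l d j l0; field.
Qed.

Lemma area4_nondegenerate u : (forall v, area4 u v = 0) -> u = 0.
Proof.
move=> h; pose e a b d f : E4 := \row_i [:: a; b; d; f]`_i.
have E a b d f : u 0 0 * b - u 0 1 * a + u 0 2 * f - u 0 3 * d = 0.
  by rewrite -(h (e a b d f)) /area4 !mxE.
have E1 := E 0 1 0 0; have E2 := E 1 0 0 0; have E3 := E 0 0 0 1; have E4 := E 0 0 1 0.
by apply/rowP; elim/ord4P; rewrite mxE; lra.
Qed.

(** The vector is unique because [area4] is nondegenerate and every tangent vector to T^*S^2 comes
    from the cover. *)
Lemma hamiltonian_reeb z X : Ell z ->
  hamiltonian_vector (kinetic metric) magnetic (cover z) X <-> X = rate (cover z) *: 'D_(reeb z) cover z.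
Proof.
move=> zE; have zO := ellipsoid_dom zE; have dc := sm_diff sm_cover zO.
have rv k u : area4 (k *: reeb z) u = - (k * dot (gradient z) u) by rewrite /area4 dot4 !mxE /=; ring.
have Dk k : 'D_(k *: reeb z) cover z = k *: 'D_(reeb z) cover z by rewrite !deriveE // linearZ.
split=> [[tX hX]|->]; last first.
  rewrite -Dk; split=> [|w tw]; first exact: tangent_cover_cotangent.
  have [v ->] := tangent_coverP zO tw.
  by rewrite (twisted_form_cover _ v zO) (mdiff_kinetic_cover v zE) rv; ring.
have [u uE] := tangent_coverP zO tX; rewrite uE in hX *.
suff -> : u = rate (cover z) *: reeb z by exact: Dk.
apply/eqP; rewrite -subr_eq0; apply/eqP/area4_nondegenerate => v.
have := hX _ (tangent_cover_cotangent v zO).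
rewrite (twisted_form_cover _ v zO) (mdiff_kinetic_cover v zE).
have -> : area4 (u - rate (cover z) *: reeb z) v = area4 u v - area4 (rate (cover z) *: reeb z) v.
  by rewrite /area4 !mxE; ring.
rewrite rv; move: (area4 _ _) (rate _) (dot _ _) => a r d h; apply: (mulfI (lt0r_neq0 c0)).
by move: h; lra.
Qed.

Lemma rate_gt0 y : Level y -> 0 < rate y.
Proof.
move=> yY; have [z [zO <- _]] := level_onto yY; rewrite rate_cover //.
have [_ j0 _ _] := hopf_dom_facts s0 c0 zO.
by rewrite divr_gt0 // mulr_gt0 //; exact: lam_gt0 (hopf_Q_sphere zO).
Qed.

Lemma rate_continuous y : Level y -> {for y, continuous rate}.
Proof.
move=> yY; have yR := level_regular yY; have [yB y0] := yR.
have su : smooth_on regular untwist by apply: (sm_subset _ sm_untwist) => x [].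
have s1 : smooth_on regular (fun y => (untwist y).1) by apply: sm_fst.
have s2 : smooth_on regular (fun y => (untwist y).2) by apply: sm_snd.
have sl := sm_lam oR s1.
have sn : smooth_on regular (fun y => momentum_norm s (untwist y)).
  rewrite /momentum_norm; smooth => x [_ x0]; exact: momentum_norm_gt0.
have ln : 2 * lam (untwist y).1 != 0.
  by rewrite mulf_neq0 // lt0r_neq0 // lam_gt0 //; have [] := untwist_cotangent (level_cotangent yY).
have sl2 : smooth_on regular (fun y => 2 * lam (untwist y).1) by apply: smM => //; exact: sm_cst.
exact: (cvgM (sm_continuous sn yR) (cvgV ln (sm_continuous sl2 yR))).
Qed.

Lemma flow_squares cc b : (forall t, Level (cc t)) -> flow_line (kinetic metric) magnetic cc ->
  forall t : R, is_derive t 1 (wre b \o cc) (- (2 * freq b * rate (cc t) * wim b (cc t))) /\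
    is_derive t 1 (wim b \o cc) (2 * freq b * rate (cc t) * wre b (cc t)).
Proof.
move=> cL fl t; have [_ [X hX dc]] := fl t; have [z [zO zy zE]] := level_onto (cL t).
have [s1 s2] := sm_w b; have cR := level_regular (cL t).
have d1 := sm_diff s1 cR; have d2 := sm_diff s2 cR.
have h1 := derive_curve dc d1; have h2 := derive_curve dc d2.
have [e1 e2] := derive_w_cover b zO.
rewrite -zy in hX; have XE := proj1 (hamiltonian_reeb X zE) hX; rewrite zy in e1 e2 XE.
have f1 : 'D_X (wre b) (cc t) = - (2 * freq b * rate (cc t) * wim b (cc t)).
  rewrite XE deriveE // linearZ -deriveE // e1.
  have alg (x y w : R) : x *: - (2 * y * w) = - (2 * y * x * w) by rewrite /GRing.scale /=; ring.
  exact: alg.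
have f2 : 'D_X (wim b) (cc t) = 2 * freq b * rate (cc t) * wre b (cc t).
  rewrite XE deriveE // linearZ -deriveE // e2.
  have alg (x y w : R) : x *: (2 * y * w) = 2 * y * x * w by rewrite /GRing.scale /=; ring.
  exact: alg.
by rewrite -f1 -f2.
Qed.

Definition circle (b : bool) : set E6 :=
  [set cover z | z in [set z | Ell z /\ re (~~ b) z = 0 /\ im (~~ b) z = 0]].

Lemma w_eq0 b z : Omega z -> wre b (cover z) = 0 -> wim b (cover z) = 0 -> re b z = 0 /\ im b z = 0.
Proof.
move=> zO; have [-> ->] := w_cover b zO; move: (re b z) (im b z) => x y h1 h2.
have h : (x ^+ 2 + y ^+ 2) ^+ 2 = 0.
  have -> : (x ^+ 2 + y ^+ 2) ^+ 2 = (x ^+ 2 - y ^+ 2) ^+ 2 + (2 * (x * y)) ^+ 2 by ring.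
  by rewrite h1 h2 expr0n addr0.
have /eqP : x ^+ 2 + y ^+ 2 = 0 by apply/eqP; rewrite -sqrf_eq0 h.
by rewrite paddr_eq0 ?sqr_ge0 // !sqrf_eq0 => /andP[/eqP -> /eqP ->].
Qed.

Lemma circle_w b z : Ell z -> re (~~ b) z = 0 -> im (~~ b) z = 0 ->
  wre b (cover z) ^+ 2 + wim b (cover z) ^+ 2 = (2 / freq b) ^+ 2.
Proof.
move=> zE r0 i0; have [-> ->] := w_cover b (ellipsoid_dom zE).
have := quadratic_re_im b z; rewrite (zE : quadratic z = 1) r0 i0 expr0n addr0 mulr0 mul0r addr0.
have fn := lt0r_neq0 (freq_gt0 b); move: (re b z) (im b z) (freq b) fn => x y f fn h.
have <- := unit_norm (lt0r_neq0 (ltr0Sn R 1)) fn h; ring.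
Qed.

Lemma re_im_ext b z z' : re b z = re b z' -> im b z = im b z' -> re (~~ b) z = re (~~ b) z' ->
  im (~~ b) z = im (~~ b) z' -> z = z'.
Proof. by rewrite /re /im; case: b => /= h1 h2 h3 h4; apply/rowP; elim/ord4P. Qed.

(** Equal squares leave z = z' or z = - z', and these two points have the same image. *)
Lemma circle_w_inj b z z' : Omega z -> Omega z' -> re (~~ b) z = 0 -> im (~~ b) z = 0 ->
  re (~~ b) z' = 0 -> im (~~ b) z' = 0 -> wre b (cover z) = wre b (cover z') ->
  wim b (cover z) = wim b (cover z') -> cover z = cover z'.
Proof.
move=> zO zO' r0 i0 r0' i0'; have [e1 e2] := w_cover b zO; have [e1' e2'] := w_cover b zO' => H1 H2.
have h1 := etrans (etrans (esym e1) H1) e1'; have h2 := etrans (etrans (esym e2) H2) e2'.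
have reN x : re b (- x) = - re b x by rewrite /re mxE.
have imN x : im b (- x) = - im b x by rewrite /im mxE.
have reN' x : re (~~ b) (- x) = - re (~~ b) x by rewrite /re mxE.
have imN' x : im (~~ b) (- x) = - im (~~ b) x by rewrite /im mxE.
suff : (re b z = re b z' /\ im b z = im b z') \/ (re b z = - re b z' /\ im b z = - im b z').
  case=> [[u1 u2]|[u1 u2]].
    exact: congr1 (re_im_ext u1 u2 (etrans r0 (esym r0')) (etrans i0 (esym i0'))).
  rewrite -(coverN z'); apply: (congr1 cover).
  by apply: (@re_im_ext b); rewrite ?reN ?imN ?reN' ?imN' ?r0' ?i0' ?oppr0.
exact: sqr_pair_ext.
Qed.

(** In the time T, a primitive of [rate] along the orbit, z_1^2 and z_2^2 rotate with velocities 2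
    (1 + alpha) and 2 (1 - alpha). If neither vanishes, periodicity closes both angles and alpha is
    rational. Otherwise the orbit stays on one circle, and it remains to see that it fills it. *)
Lemma periodic_orbit_circle O : irrational alpha -> periodic_orbit metric magnetic energy O ->
  exists b, O = circle b.
Proof.
move=> airr [sub [cc [P [P0 fl per rg]]]].
have cL t : Level (cc t) by apply: sub; rewrite -rg; exists t.
have cr : continuous (rate \o cc).
  move=> t; have [_ [X _ dc]] := fl t.
  exact: continuous_comp (curve_continuous dc) (rate_continuous (cL t)).
have [T T0 dT] := antiderivative cr.
have rot b := rotating (fun t => proj1 (flow_squares b cL fl t)) (fun t => proj2 (flow_squares b cL fl t)) dT T0.
have cT : continuous T by move=> t; exact: is_derive_cont (dT t).
have TP : 0 < T P.
  have [t _] := MVT_segment (ltW P0) (fun t _ => dT t) (continuous_subspaceT cT).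
  by rewrite T0 !subr0 => ->; rewrite mulr_gt0 //; exact: rate_gt0.
have cP : cc P = cc 0 by rewrite -(per 0) add0r.
have closes b : wre b (cc 0) ^+ 2 + wim b (cc 0) ^+ 2 != 0 -> cos (2 * freq b * T P) = 1.
  have [h1 h2] := rot b P; move: h1 h2; rewrite /= cP.
  move: (wre b _) (wim b _) (cos _) (sin _) => x y C S h1 h2 n0.
  apply: (mulIf n0); rewrite mul1r !expr2.
  transitivity (x * (C * x - S * y) + y * (S * x + C * y)); first by ring.
  by rewrite -h1 -h2.
case: (pselect (exists b, wre b (cc 0) = 0 /\ wim b (cc 0) = 0)) => [[b' [z1 z2]]|nz]; last first.
  case: airr; have n0 b : wre b (cc 0) ^+ 2 + wim b (cc 0) ^+ 2 != 0.
    apply/eqP => h; apply: nz; exists b; move/eqP: h.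
    by rewrite paddr_eq0 ?sqr_ge0 // !sqrf_eq0 => /andP[/eqP -> /eqP ->].
  by apply: (closing_angles_rational _ TP (closes false (n0 false)) (closes true (n0 true))); rewrite a0.
pose b := ~~ b'; have bb : ~~ b = b' by rewrite negbK.
have inC t : exists z, [/\ Ell z, cover z = cc t, re (~~ b) z = 0 & im (~~ b) z = 0].
  have [z [zO zy zE]] := level_onto (cL t); exists z; rewrite bb.
  have [h1 h2] := rot b' t; move: h1 h2; rewrite /= z1 z2 !mulr0 subr0 addr0 -zy => h1 h2.
  by have [] := w_eq0 zO h1 h2.
exists b; apply/seteqP; split=> [y|y [z [zE [r0 i0]] zy]].
  by rewrite -rg => -[t _ <-]; have [z [zE zy r0 i0]] := inC t; exists z.
have [u [uE uy ur ui]] := inC 0.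
have W0 := circle_w uE ur ui; have W1 := circle_w zE r0 i0; rewrite uy in W0.
have f0 := freq_gt0 b; have rho0 : (2 / freq b) ^+ 2 != 0 by rewrite sqrf_eq0 mulf_neq0 ?invr_eq0 ?pnatr_eq0 ?lt0r_neq0.
have cl : cos (2 * freq b * T P) = 1 by apply: closes; rewrite W0.
have k0 : 0 < 2 * freq b * T P by rewrite !mulr_gt0.
have [n n0 nE] := cos_eq1 cl k0.
(* During one period the angle of the nonzero square advances by at least a full turn, so the
   intermediate value theorem reaches every point of the circle. *)
have big : 2 * pi <= 2 * freq b * T P.
  by rewrite nE -[leLHS]mulr1 ler_wpM2l ?ler1n // mulr_ge0 // pi_ge0.
have rotb := rot b; rewrite /= in rotb; move: rotb.
case: (w_cover b (ellipsoid_dom zE)) => _ _.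
have alg (x0 y0 x1 y1 r : R) : r != 0 -> x0 ^+ 2 + y0 ^+ 2 = r -> x1 ^+ 2 + y1 ^+ 2 = r ->
    [/\ ((x0 * x1 + y0 * y1) / r) ^+ 2 + ((x0 * y1 - y0 * x1) / r) ^+ 2 = 1,
        (x0 * x1 + y0 * y1) / r * x0 - (x0 * y1 - y0 * x1) / r * y0 = x1
      & (x0 * y1 - y0 * x1) / r * x0 + (x0 * x1 + y0 * y1) / r * y0 = y1].
  move=> r00 e0 e1; split.
  - have -> : ((x0 * x1 + y0 * y1) / r) ^+ 2 + ((x0 * y1 - y0 * x1) / r) ^+ 2 =
      (x0 ^+ 2 + y0 ^+ 2) * (x1 ^+ 2 + y1 ^+ 2) / r ^+ 2 by field.
    by rewrite e0 e1; field.
  - by transitivity ((x0 ^+ 2 + y0 ^+ 2) * x1 / r); [field|rewrite e0; field].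
  - by transitivity ((x0 ^+ 2 + y0 ^+ 2) * y1 / r); [field|rewrite e0; field].
have [h1 h2 h3] := alg _ _ _ _ _ rho0 W0 W1.
have [phi [/andP[p1 p2] pc ps]] := angle_exists h1.
have [||t _ tE] := @IVT R (fun t => 2 * freq b * T t) 0 P phi (ltW P0).
- apply: continuous_subspaceT => t; apply: cvgM; [exact: cvg_cst|exact: cT].
- rewrite T0 mulr0 min_l ?(ltW k0) // max_r ?(ltW k0) // p1 /=; exact: le_trans big.
move=> rotb; have [r1 r2] := rotb t; rewrite tE pc ps h2 in r1; rewrite tE pc ps h3 in r2.
have [v [vE vy vr vi]] := inC t; rewrite -vy in r1 r2.
have Oc : O (cc t) by rewrite -rg; exists t.
have E := circle_w_inj (ellipsoid_dom vE) (ellipsoid_dom zE) vr vi r0 i0 r1 r2.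
by rewrite -(etrans (etrans (esym vy) E) zy).
Qed.

Definition ray (b : bool) (x y : R) : E4 :=
  \row_i (if b then [:: 0; 0; x; y] else [:: x; y; 0; 0])`_i.

Lemma ray_re_im b x y :
  [/\ re b (ray b x y) = x, im b (ray b x y) = y, re (~~ b) (ray b x y) = 0 & im (~~ b) (ray b x y) = 0].
Proof. by rewrite /re /im; case: b; rewrite !mxE. Qed.

Lemma ray_ellipsoid b x y : x ^+ 2 + y ^+ 2 = 2 / freq b -> Ell (ray b x y).
Proof.
move=> h; have [e1 e2 e3 e4] := ray_re_im b x y; have fn := lt0r_neq0 (freq_gt0 b).
by have := quadratic_re_im b (ray b x y); rewrite e1 e2 e3 e4 h => E; apply: etrans E _; field.
Qed.

(** [rate] depends on z only through |z| and the height of the base point, both constant on the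
    circle; this is why the circles are traversed by uniform rotations. *)
Lemma rate_circle b z : Ell z -> re (~~ b) z = 0 -> im (~~ b) z = 0 ->
  rate (cover z) = rate (cover (ray b (Num.sqrt (2 / freq b)) 0)).
Proof.
move=> zE r0 i0; set w := ray b _ _; have fn := lt0r_neq0 (freq_gt0 b).
have [e1 e2 e3 e4] : [/\ re b w = Num.sqrt (2 / freq b), im b w = 0, re (~~ b) w = 0 & im (~~ b) w = 0] by exact: ray_re_im.
have wE : Ell w.
  by apply: ray_ellipsoid; rewrite expr0n addr0 sqr_sqrtr // divr_ge0 // ltW // freq_gt0.
have key y : Ell y -> re (~~ b) y = 0 -> im (~~ b) y = 0 ->
   [/\ dot y y = 2 / freq b, F3 y y 0 2 = (if b then -1 else 1) * (2 / freq b) & F1 y y 0 2 = 0].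
  move=> yE; have := quadratic_re_im b y; rewrite (yE : quadratic y = 1) => h r i.
  move: h; rewrite r i expr0n addr0 mulr0 mul0r addr0 => h.
  have h' : re b y ^+ 2 + im b y ^+ 2 = 2 / freq b.
    exact: unit_norm (lt0r_neq0 (ltr0Sn R 1)) fn h.
  rewrite -h' dot4 !mxE /=; move: r i; rewrite /re /im; clear.
  by case: b => /= -> ->; split; ring.
have [d1 f1 g1] := key z zE r0 i0; have [d2 f2 g2] := key w wE e3 e4.
have j : hopf_j c z = hopf_j c w by rewrite /hopf_j d1 d2.
have m : hopf_m s c z = hopf_m s c w by rewrite /hopf_m j.
have Q2 : hopf_Q s c z 0 2 = hopf_Q s c w 0 2.
  rewrite /hopf_Q !mxE; have l3 y : F3 y y 0 2 = (\row_i _) 0 2 := erefl.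
  by move: f1 f2 g1 g2; rewrite !mxE /= j m d1 d2 => -> -> -> ->.
have l : lam (hopf_Q s c z) = lam (hopf_Q s c w) by rewrite /lam /shift_coef /den Q2.
have e := rate_cover (ellipsoid_dom zE); have e' := rate_cover (ellipsoid_dom wE).
exact: etrans e (etrans (congr2 (fun j l => j / (2 * l)) j l) (esym e')).
Qed.

Lemma circle_periodic b : periodic_orbit metric magnetic energy (circle b).
Proof.
split; first by move=> y [z [zE _] <-]; apply/cover_level => //; exact: ellipsoid_dom.
have f0 := freq_gt0 b; pose rho := Num.sqrt (2 / freq b).
have rr : rho ^+ 2 = 2 / freq b by rewrite sqr_sqrtr // divr_ge0 // ltW.
have rho0 : 0 < rho by rewrite sqrtr_gt0 divr_gt0.
have wE : Ell (ray b rho 0) by apply: ray_ellipsoid; rewrite expr0n addr0.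
pose r0 := rate (cover (ray b rho 0)).
have rp : 0 < r0 by apply: rate_gt0; apply/cover_level => //; exact: ellipsoid_dom.
pose nu := freq b * r0; have nu0 : 0 < nu by exact: mulr_gt0.
have nun := lt0r_neq0 nu0.
pose zeta (t : R) := ray b (rho * cos (nu * t)) (rho * sin (nu * t)).
have zE t : Ell (zeta t).
  by apply: ray_ellipsoid; rewrite !exprMn -mulrDr cos2Dsin2 mulr1.
have dz (t : R) : is_derive t 1 zeta (r0 *: reeb (zeta t)).
  pose L (v : E4) (x : R) := x *: v.
  have dk : is_derive t 1 (fun v : R => nu * v) nu by apply: is_derive_eq; rewrite /GRing.scale /= mulr1.
  have d1 : is_derive t 1 (fun t : R => cos (nu * t)) (- (nu * sin (nu * t))).
    by apply: is_derive_eq; rewrite mulNr mulrC.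
  have d2 : is_derive t 1 (fun t : R => sin (nu * t)) (nu * cos (nu * t)).
    by apply: is_derive_eq; rewrite mulrC.
  have scl (f : R -> R) (v : E4) a : is_derive t 1 f a -> is_derive t 1 (fun u : R => f u *: v) (a *: v).
    move=> df; have sL : smooth_on setT (fun x : R => x *: v).
      by apply: smZ; [exact: findim_mx|exact: openT|exact: sm_id|exact: sm_cst].
    have := derive_curve df (sm_diff sL (I : setT (f t))).
    have -> // : 'D_a (fun x : R => x *: v) (f t) = a *: v.
    apply: (derive_quadratic (b := 0) (sm_diff sL (I : setT (f t)))) => u.
    by rewrite scaler0 addr0 scalerDl scalerA.
  have h1 := scl _ (ray b rho 0) _ d1; have h2 := scl _ (ray b 0 rho) _ d2.
  have h := is_deriveD h1 h2.
  have -> : zeta = (fun u : R => cos (nu * u) *: ray b rho 0) + (fun u : R => sin (nu * u) *: ray b 0 rho).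
    apply/funext => u; rewrite fctE /zeta /ray; case: (b); apply/rowP; elim/ord4P; rewrite !mxE /=; ring.
  apply: is_derive_eq h _.
  have alg (q r x y : R) : - (freq b * q * y) *: ray b r 0 + (freq b * q * x) *: ray b 0 r =
      q *: reeb (x *: ray b r 0 + y *: ray b 0 r).
    by rewrite /freq /ray; case: (b); apply/rowP; elim/ord4P; rewrite !mxE /=; ring.
  exact: alg.
(* This is the period of the lift; the orbit below already closes after half of it, when [zeta] has
   changed sign. *)
exists (cover \o zeta), (2 * pi / nu); split.
- by rewrite divr_gt0 // mulr_gt0 // pi_gt0.
- move=> t; have zO := ellipsoid_dom (zE t); split; first exact: cover_cotangent.
  exists (rate (cover (zeta t)) *: 'D_(reeb (zeta t)) cover (zeta t)).
    exact/hamiltonian_reeb.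
  have dc := sm_diff sm_cover zO; have := derive_curve (dz t) dc.
  have [_ _ e3 e4] := ray_re_im b (rho * cos (nu * t)) (rho * sin (nu * t)).
  have -> : rate (cover (zeta t)) = r0 by exact: rate_circle.
  by rewrite !deriveE // linearZ.
- move=> t; congr cover; rewrite /zeta mulrDr; have -> : nu * (2 * pi / nu) = 2 * pi by field.
  by rewrite mulr_natl (@cosD2pi R) (@sinD2pi R).
- apply/seteqP; split=> [_ [t _ <-]|_ [z [zL [r i]] <-]].
    have [_ _ e3 e4] := ray_re_im b (rho * cos (nu * t)) (rho * sin (nu * t)).
    by exists (zeta t).
  have := quadratic_re_im b z; rewrite (zL : quadratic z = 1) r i expr0n addr0 mulr0 mul0r addr0 => h.
  have h' : (re b z / rho) ^+ 2 + (im b z / rho) ^+ 2 = 1.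
    rewrite !exprMn !exprVn -mulrDl rr; have fn := lt0r_neq0 f0.
    by move: h fn; move: (freq b) (_ ^+ 2 + _) => f q h fn; rewrite [RHS]h invf_div; field.
  have [phi [_ pc ps]] := angle_exists h'.
  have rn := lt0r_neq0 rho0.
  suff zz : zeta (phi / nu) = z by exists (phi / nu); [by []|exact: congr1 zz].
  rewrite /zeta mulrCA mulfV // mulr1 pc ps.
  have -> : rho * (re b z / rho) = re b z by field.
  have -> : rho * (im b z / rho) = im b z by field.
  have [e1 e2 e3 e4] := ray_re_im b (re b z) (im b z).
  by apply: (@re_im_ext b); rewrite ?e1 ?e2 ?e3 ?e4 ?r ?i.
Qed.

(** The square of z_1 has nonzero modulus on [circle false] and vanishes on [circle true]. *)
Lemma circle_neq : circle false <> circle true.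
Proof.
move=> E; have f0 := freq_gt0 false; pose w := ray false (Num.sqrt (2 / freq false)) 0.
have [e1 e2 e3 e4] := ray_re_im false (Num.sqrt (2 / freq false)) 0.
have wE : Ell w.
  by apply: ray_ellipsoid; rewrite expr0n addr0 sqr_sqrtr // divr_ge0 // ltW.
have : circle false (cover w) by exists w.
rewrite E => -[z [zE [/= r i]] zw].
have W := circle_w wE e3 e4; have [h1 h2] := w_cover false (ellipsoid_dom zE).
move: W; rewrite -zw h1 h2 r i.
have -> : (0 ^+ 2 - 0 ^+ 2) ^+ 2 + (2 * (0 * 0)) ^+ 2 = 0 :> R by ring.
move=> /esym/eqP.
by rewrite sqrf_eq0 mulf_eq0 pnatr_eq0 invr_eq0 (gt_eqF f0).
Qed.

Lemma two_periodic_orbits : irrational alpha ->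
  ([set O | periodic_orbit metric magnetic energy O] #= `I_2)%card.
Proof.
move=> airr; have -> : [set O | periodic_orbit metric magnetic energy O] = [set circle false; circle true].
  apply/seteqP; split=> O /=.
    by move=> /(periodic_orbit_circle airr) [b ->]; case: b; [right|left].
  by case=> ->; exact: circle_periodic.
exact: card_pair circle_neq.
Qed.

End Model.

(** * Convergence of the metrics and forms *)

Section JointSmoothness.
Context {R : realType}.

(** Differentiation at a fixed parameter is joint differentiation in the directions (0, v), as the
    difference quotients coincide. *)
Lemma iter_derive_param (P V W : normedModType R) (F : P * V -> W) vs (p : P) (x : V) :
  iter_derive vs (fun x => F (p, x)) x = iter_derive [seq (0 : P, v) | v <- vs] F (p, x).
Proof.
elim: vs F => [//|v vs IH] F /=.
have -> : (fun x => 'D_v (fun x => F (p, x)) x) = fun x => (fun y => 'D_(0 : P, v) F y) (p, x).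
  apply/funext => x'; with_strategy transparent [derive] rewrite /derive; apply: (congr1 (fun f : R -> W => lim (f @ 0^'))); apply/funext => h /=.
  congr (_ *: (F _ - _)).
  by apply/pair_equal_spec; split => //=; rewrite scaler0 add0r.
exact: IH.
Qed.

(* A family that is jointly smooth in the point and a parameter converges with the parameter, by
   compactness and continuity of its iterated derivatives. *)
Lemma cvg_Cinfty_param (P V W : normedModType R) (N : set P) (F : P * V -> W) (p : nat -> P) (p0 : P) :
  N p0 -> smooth_on (N `*` setT) F -> p @ \oo --> p0 ->
  cvg_Cinfty (fun n x => F (p n, x)) (fun x => F (p0, x)).
Proof.
move=> Np0 sF pp K vs e Kc e0; pose G := iter_derive [seq (0 : P, v) | v <- vs] F.
have GE q x : iter_derive vs (fun x => F (q, x)) x = G (q, x) by exact: iter_derive_param.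
have cG x : {for (p0, x), continuous G}.
  by apply: differentiable_continuous; apply: sF; split.
have e2 : 0 < e / 2 by exact: divr_gt0.
suff : \forall n \near \oo, K `<=` [set x | `|G (p n, x) - G (p0, x)| < e].
  by apply: filterS => n h x Kx; rewrite !GE; exact: h.
apply: (proj1 (compact_near_coveringP K) Kc _ _ (fun n => [set x | `|G (p n, x) - G (p0, x)| < e])) => x Kx.
have /cvgrPdist_lt/(_ _ e2) [[A B] /= [Ap Bx] AB] := cG x.
have pA : \forall n \near \oo, A (p n) by exact: pp.
exists (B, [set n | A (p n)]) => //= -[x' n] /= [Bx' An].
have h1 := AB (p n, x') (conj An Bx'); have h2 := AB (p0, x') (conj (nbhs_singleton Ap) Bx').
have -> : G (p n, x') - G (p0, x') = (G (p0, x) - G (p0, x')) - (G (p0, x) - G (p n, x')).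
  by rewrite opprB [RHS]addrC subrKA.
apply: le_lt_trans (ler_normB _ _) _; rewrite [e]splitr; exact: ltrD.
Qed.

Lemma cvg0_harmonic (V : normedModType R) (u : nat -> V) (C : R) :
  (forall n, `|u n| <= C * harmonic n) -> u @ \oo --> (0 : V).
Proof.
move=> h; apply/cvgr0Pnorm_le => e e0.
have ch : (fun n => C * harmonic n) @ \oo --> (0 : R).
  by rewrite -(mulr0 C); apply: cvgM; [exact: cvg_cst|exact: cvg_harmonic].
have /cvgr0Pnorm_le/(_ _ e0) := ch.
by apply: filterS => n; apply: le_trans; apply: le_trans (h n) (ler_norm _).
Qed.

Lemma rational_inv (x : R) : 0 < x -> rational x^-1 -> rational x.
Proof.
move=> x0 /rationalP[a [b E]]; apply/rationalP; have i0 : 0 < x^-1 by rewrite invr_gt0.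
have a0 : (0 < a)%R.
  rewrite -(ltr0z R); move: i0; rewrite E; case: b {E} => [|b]; first by rewrite invr0 mulr0 ltxx.
  by rewrite pmulr_lgt0 // invr_gt0 ltr0n.
exists b%:Z, `|a|%N; rewrite natr_absz gtr0_norm // -[x]invrK E invf_div.
by rewrite pmulrn.
Qed.

Lemma irrational_inv_mul_pi (m : nat) : (0 < m)%N -> irrational (m%:R * pi : R)^-1.
Proof.
move=> m0 /rational_inv h; apply: (@pi_irrationnal R).
have mp : 0 < m%:R * pi :> R by rewrite mulr_gt0 ?ltr0n // pi_gt0.
have /rationalP[a [b E]] := h mp; apply/rationalP; exists a, (m * b)%N.
have mn : m%:R != 0 :> R by rewrite pnatr_eq0 -lt0n.
by apply: (mulfI mn); rewrite E natrM invfM mulrCA [m%:R * _]mulrA mulfV // mul1r.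
Qed.

End JointSmoothness.

Section Convergence.
Context {R : realType}.
Local Notation E3 := 'rV[R]_3.
Local Notation NZ := [set X : E3 | X != 0].
Local Notation E2 := 'rV[R]_2.
Variables (gbar : E3 -> 'M[R]_3) (Phi : E3 -> E3).
Hypothesis gbm : riemannian_metric gbar.
Hypothesis sPhi : smooth_on NZ Phi.
Hypothesis Phi_iso : forall X, dot (Phi X) (Phi X) = dot X X.
Variable s : R.

(* The metric and the form depend on c and alpha through these five numbers, which vanish for the
   round metric. *)
Definition small (c alpha : R) : 'rV[R]_5 := \row_i [:: alpha ^+ 2; alpha ^+ 2 * s ^+ 2 / (c ^+ 2 - s ^+ 2);
  2 * c * alpha * s / (c ^+ 2 - s ^+ 2); alpha * c; alpha ^+ 2 * s]`_i.

Local Notation P5 := ('rV[R]_5).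
Local Notation Dom := ([set e : P5 | e 0 0 < 1] `*` [set: E2] : set (P5 * E2)).

Definition height (cc : bool) (x : E2) : R := Phi (stereo cc x) 0 2.
(** This function and the next two write the data in the charts as functions jointly smooth in the
    five parameters and the point, with [gbar] and the zero form at parameter 0. *)
Definition den_of (cc : bool) (y : P5 * E2) : R := 1 - y.1 0 0 + y.1 0 0 * height cc y.2 ^+ 2.
Definition metric_of (cc : bool) (y : P5 * E2) : 'M[R]_2 := \matrix_(i, k)
  ((1 + y.1 0 1 - y.1 0 2 * height cc y.2) / den_of cc y *
   (metric_coord gbar cc y.2 i k + y.1 0 0 / den_of cc y *
     (dot (theta Phi (stereo cc y.2)) (frame cc y.2 i) * dot (theta Phi (stereo cc y.2)) (frame cc y.2 k)))).
Definition form_of (cc : bool) (y : P5 * E2) : 'rV[R]_2 := \row_i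
  ((y.1 0 3 - y.1 0 4 * height cc y.2) / den_of cc y * dot (theta Phi (stereo cc y.2)) (frame cc y.2 i)).

Lemma open_Dom : open Dom.
Proof.
have -> : Dom = setT `&` [set y : P5 * E2 | 0 < 1 - y.1 0 0].
  by apply/seteqP; split=> y /=; rewrite subr_gt0 => -[].
apply: open_pos => [|y yT]; first exact: openT.
have h : smooth_on setT (fun y : P5 * E2 => 1 - y.1 0 0).
  apply: smB; [exact: openT|exact: sm_cst|].
  by apply: sm_coord; [exact: openT|exact: (sm_lin (lincont_fst _ _))].
exact: sm_continuous h yT.
Qed.
Let oD := open_Dom.

Lemma sm_height cc : smooth_on setT (height cc).
Proof. by apply: sm_coord; [exact: openT|exact: sm_stereo_comp]. Qed.

Lemma sm_point (W : normedModType R) (f : E2 -> W) : findim W -> smooth_on setT f ->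
  smooth_on Dom (fun y => f y.2).
Proof.
move=> fW sf; apply: (sm_comp (U' := setT) (g := f) (f := fun y : P5 * E2 => y.2)) => //.
- exact: openT.
- exact: (sm_lin (lincont_snd _ _)).
Qed.

Lemma sm_par i : smooth_on Dom (fun y : P5 * E2 => y.1 0 i).
Proof. by apply: sm_coord => //; exact: (sm_lin (lincont_fst _ _)). Qed.

(** For a height of square at most 1 the denominator is a convex combination of 1 - e and 1, hence
    positive as long as the parameter e is below 1. *)
Lemma sm_den_of cc : smooth_on Dom (fun y => (den_of cc y)^-1).
Proof.
have hh := sm_point findimR (@sm_height cc); have hp := @sm_par 0.
rewrite /den_of; smooth; move=> [e x] /= [e1 _].
have Q : -1 <= height cc x <= 1 by exact: sphere_entry (Phi_sphere Phi_iso (stereo_sphere cc x)).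
have q1 : height cc x ^+ 2 <= 1 by move/andP: Q => [h1 h2]; rewrite expr2; nra.
have q0 := sqr_ge0 (height cc x); move: (_ ^+ 2) (e 0 0) q0 q1 e1 => q a q0 q1 e1.
have [a0|a0] := leP a 0; apply: lt0r_neq0.
  by have := mulr_ge0_le0 (_ : 0 <= 1 - q) a0; rewrite subr_ge0 => /(_ q1); lra.
by have := mulr_ge0 (ltW a0) q0; lra.
Qed.

Lemma metric_of_entry cc y i k : metric_of cc y i k =
  (1 + y.1 0 1 - y.1 0 2 * height cc y.2) / den_of cc y *
   (metric_coord gbar cc y.2 i k + y.1 0 0 / den_of cc y *
     (dot (theta Phi (stereo cc y.2)) (frame cc y.2 i) * dot (theta Phi (stereo cc y.2)) (frame cc y.2 k))).
Proof. by rewrite mxE. Qed.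

Lemma form_of_entry cc y i k : form_of cc y i k =
  (y.1 0 3 - y.1 0 4 * height cc y.2) / den_of cc y * dot (theta Phi (stereo cc y.2)) (frame cc y.2 k).
Proof. by rewrite mxE. Qed.

Lemma sm_metric_of cc : smooth_on Dom (metric_of cc).
Proof.
have [gs _ _] := gbm; apply: sm_mx => // i k; apply: (sm_eq oD (fun y _ => esym (metric_of_entry cc y i k))).
have hh := sm_point findimR (@sm_height cc); have hd := @sm_den_of cc.
have hi := sm_point (findim_mx _ _) (@sm_frame R cc i); have hk := sm_point (findim_mx _ _) (@sm_frame R cc k).
have ht := sm_point (findim_mx _ _) (sm_stereo_comp cc (findim_mx _ _) (sm_theta sPhi)).
have hg : smooth_on Dom (fun y => metric_coord gbar cc y.2 i k).
  by apply: (sm_point (f := fun x => metric_coord gbar cc x i k)) => //; apply: sm_coord; [exact: openT|exact: gs].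
have p0 := @sm_par 0; have p1 := @sm_par 1; have p2 := @sm_par 2.
have p_1 : smooth_on Dom (fun _ => 1 : R) by exact: sm_cst.
have h1 := smM oD (smB oD (smD oD p_1 p1) (smM oD p2 hh)) hd.
exact: (smM oD h1 (smD oD hg (smM oD (smM oD p0 hd) (smM oD (sm_dot oD ht hi) (sm_dot oD ht hk))))).
Qed.

Lemma sm_form_of cc : smooth_on Dom (form_of cc).
Proof.
apply: sm_mx => // i k; apply: (sm_eq oD (fun y _ => esym (form_of_entry cc y i k))).
have hh := sm_point findimR (@sm_height cc); have hd := @sm_den_of cc.
have hk := sm_point (findim_mx _ _) (@sm_frame R cc k).
have ht := sm_point (findim_mx _ _) (sm_stereo_comp cc (findim_mx _ _) (sm_theta sPhi)).
have p3 := @sm_par 3; have p4 := @sm_par 4.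
exact: (smM oD (smM oD (smB oD p3 (smM oD p4 hh)) hd) (sm_dot oD ht hk)).
Qed.

Lemma den_ofE c alpha cc x : den_of cc (small c alpha, x) = den alpha (Phi (stereo cc x)).
Proof. by rewrite /den_of /den /height mxE. Qed.

Lemma metric_ofE c alpha cc : 0 < alpha -> alpha < 1 -> 0 < c ^+ 2 - s ^+ 2 ->
  metric_coord (metric gbar Phi s c alpha) cc = fun x => metric_of cc (small c alpha, x).
Proof.
move=> a0 a1 e0; apply/funext => x; apply/matrixP => i k.
rewrite metric_coordE [RHS]mxE !den_ofE /= -/(height cc x).
have -> : (small c alpha) 0 0 = alpha ^+ 2 by rewrite mxE.
congr (_ * _); rewrite /lam /shift_coef /= !mxE /= -/(height cc x).
have := lt0r_neq0 (den_gt0 a0 a1 (Phi (stereo cc x))); have := lt0r_neq0 e0.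
rewrite {2 3}/den -/(height cc x).
have -> : den alpha (Phi (stereo cc x)) = 1 - alpha ^+ 2 + alpha ^+ 2 * height cc x ^+ 2 by [].
(* In C^2 - s^2 [den] the squares of the height cancel, so [lam] times [den] is affine in the
   height, with coefficients given by two of the five parameters. *)
have alg (A X Y D K q : R) : D != 0 -> K != 0 -> A - s ^+ 2 * D = K + X - Y * q ->
    (A / D - s ^+ 2) / K = (1 + X / K - Y / K * q) / D.
  move=> D0 K0 h; have -> : A = s ^+ 2 * D + (K + X - Y * q) by rewrite -h addrC subrK.
  by field; rewrite D0 K0.
by move: (height cc x) => q n1 n2; apply: alg => //; ring.
Qed.

Lemma form_ofE c alpha cc : form_coord (form Phi s c alpha) cc = fun x => form_of cc (small c alpha, x).
Proof.
apply/funext => x; apply/rowP => i; rewrite form_coordE [RHS]mxE den_ofE /=.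
have -> : form Phi s c alpha (stereo cc x) =
   (alpha * shift_coef s c alpha (Phi (stereo cc x)) / den alpha (Phi (stereo cc x))) *: theta Phi (stereo cc x).
  by rewrite /form /shift -scalemxAl.
rewrite dotZl !mxE /= /shift_coef -/(height cc x); congr (_ / _ * _); ring.
Qed.

Lemma metric_of0 cc : metric_coord gbar cc = fun x => metric_of cc (0, x).
Proof.
apply/funext => x; apply/matrixP => i k; rewrite [RHS]mxE /den_of /= !mxE.
by rewrite !(mul0r, addr0, subr0, invr1, mul1r).
Qed.

Lemma form_of0 cc : form_coord (fun=> 0) cc = fun x => form_of cc (0, x).
Proof.
apply/funext => x; apply/rowP => i; rewrite [RHS]mxE [LHS]mxE /den_of /= !mxE.
by rewrite !mul0r !subr0 !mul0r dot0l.
Qed.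

Variables c alpha : nat -> R.
Hypothesis alpha_gt0 : forall n, 0 < alpha n.
Hypothesis alpha_lt1 : forall n, alpha n < 1.
Hypothesis e_gt0 : forall n, 0 < c n ^+ 2 - s ^+ 2.
Hypothesis cvg_small : (fun n => small (c n) (alpha n)) @ \oo --> (0 : P5).

Lemma metric_cvg : cvg_metric (fun n => metric gbar Phi s (c n) (alpha n)) gbar.
Proof.
move=> cc; rewrite metric_of0.
have -> : (fun n => metric_coord (metric gbar Phi s (c n) (alpha n)) cc) =
    fun n x => metric_of cc (small (c n) (alpha n), x).
  by apply/funext => n; exact: metric_ofE.
apply: (cvg_Cinfty_param _ (@sm_metric_of cc) cvg_small).
by rewrite /= mxE ltr01.
Qed.

Lemma form_cvg : cvg_one_form (fun n => form Phi s (c n) (alpha n)) (fun=> 0).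
Proof.
move=> cc; rewrite form_of0.
have -> : (fun n => form_coord (form Phi s (c n) (alpha n)) cc) =
    fun n x => form_of cc (small (c n) (alpha n), x).
  by apply/funext => n; exact: form_ofE.
apply: (cvg_Cinfty_param _ (@sm_form_of cc) cvg_small).
by rewrite /= mxE ltr01.
Qed.

End Convergence.

(** * Choice of the parameters *)

Section Sequences.
Context {R : realType}.
Variable s : R.
Hypothesis s0 : 0 <= s.

(** Two more than the integer part of s, so that [step] is at most 1/2 and at most 1 / (s + 1) from
    the first term on. *)
Definition offset : nat := (Num.truncn s).+2.
Definition step (n : nat) : R := (n + offset)%:R^-1.
(** With t = [step] and c = s + t one has c^2 - s^2 = t (2 s + t), so the parameter 2 c alpha s /
    (c^2 - s^2) is of order alpha / t when s > 0. The cube ensures alpha <= t^2, which makes every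
    parameter at most a constant times t; division by pi makes alpha the inverse of an integer
    multiple of pi, hence irrational. *)
Definition alpha_of (n : nat) : R := step n ^+ 3 / pi.
Definition c_of (n : nat) : R := s + step n.

Lemma offset_gt1 : (1 < offset)%N. Proof. by []. Qed.

Lemma offset_gt_s : s + 1 <= offset%:R.
Proof. by have /andP[_ h] := truncn_itv s0; rewrite /offset -[_.+2]addn1 natrD lerD2r ltW. Qed.

Lemma step_den n : (0 < n + offset)%N.
Proof. by rewrite addn_gt0 (ltnW offset_gt1) orbT. Qed.

Lemma step_gt0 n : 0 < step n.
Proof. by rewrite invr_gt0 ltr0n step_den. Qed.

Lemma step_s n : step n * (s + 1) <= 1.
Proof.
rewrite /step mulrC ler_pdivrMr ?ltr0n ?step_den // mul1r.
by apply: le_trans offset_gt_s _; rewrite ler_nat leq_addl.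
Qed.

Lemma step_harmonic n : step n <= harmonic n.
Proof.
rewrite /step /harmonic lef_pV2 ?posrE ?ltr0n ?step_den // ler_nat.
by rewrite -addn1 leq_add2l; exact: ltnW offset_gt1.
Qed.

Lemma step_lt1 n : step n <= 2^-1.
Proof.
rewrite /step lef_pV2 ?posrE ?ltr0n ?step_den // ler_nat.
exact: leq_trans offset_gt1 (leq_addl _ _).
Qed.

Lemma alpha_gt0 n : 0 < alpha_of n.
Proof. by rewrite divr_gt0 ?pi_gt0 // exprn_gt0 // step_gt0. Qed.

Lemma alpha_le n : alpha_of n <= step n ^+ 3 / 2.
Proof.
rewrite ler_pM2l ?exprn_gt0 ?step_gt0 // lef_pV2 ?posrE ?pi_gt0 //; exact: pi_ge2.
Qed.

Lemma alpha_lt1 n : alpha_of n < 1.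
Proof.
apply: le_lt_trans (alpha_le n) _; have := step_gt0 n; have := step_lt1 n.
move: (step n) => t t1 t0; have : t ^+ 3 <= 1 by rewrite exprn_ile1 ?ltW //; lra.
by lra.
Qed.

Lemma s_step n : s * step n <= 1.
Proof. by have := step_s n; have := step_gt0 n; rewrite mulrDr mulr1 mulrC; lra. Qed.

Lemma s_alpha_lt_c n : s * (1 + alpha_of n) < c_of n.
Proof.
rewrite /c_of mulrDr mulr1 ltrD2l; have := alpha_le n; have := step_gt0 n; have := step_lt1 n; have := s_step n.
move: (step n) (alpha_of n) => t a st t1 t0 aE.
have h : s * a <= s * (t ^+ 3 / 2) by exact: ler_wpM2l.
apply: le_lt_trans h _.
have -> : s * (t ^+ 3 / 2) = (s * t) * (t * t / 2) by ring.
have h2 : (s * t) * (t * t / 2) <= 1 * (t * t / 2) by rewrite ler_wpM2r // divr_ge0 // mulr_ge0 // ltW.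
by apply: le_lt_trans h2 _; nra.
Qed.

Lemma energy_denominator n : c_of n ^+ 2 - s ^+ 2 = step n * (2 * s + step n).
Proof. by rewrite /c_of; ring. Qed.

Lemma energy_denominator_gt0 n : 0 < c_of n ^+ 2 - s ^+ 2.
Proof. by rewrite energy_denominator mulr_gt0 ?step_gt0 // ltr_wpDl ?mulr_ge0 // step_gt0. Qed.

Lemma alpha_irrational n : irrational (alpha_of n).
Proof.
have -> : alpha_of n = (((n + offset) ^ 3)%:R * pi)^-1 by rewrite /alpha_of /step natrX invfM exprVn.
by apply: irrational_inv_mul_pi; rewrite expn_gt0 step_den.
Qed.

Lemma alpha_cvg : alpha_of @ \oo --> (0 : R).
Proof.
apply: (cvg0_harmonic (C := 1)) => n; rewrite mul1r (ger0_norm (ltW (alpha_gt0 n))).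
apply: (le_trans _ (step_harmonic n)); apply: le_trans (alpha_le n) _.
have := step_gt0 n; have := step_lt1 n; move: (step n) => t t1 t0.
have : t ^+ 2 <= 1 by rewrite exprn_ile1 ?ltW //; lra.
by rewrite exprS => h; have := ler_wpM2l (ltW t0) h; lra.
Qed.

Lemma energy_cvg : (fun n => energy s (c_of n)) @ \oo --> (0 : R).
Proof.
apply: (cvg0_harmonic (C := s + 1)) => n; rewrite /energy energy_denominator.
have t0 := step_gt0 n; have t1 := step_lt1 n.
rewrite ger0_norm; last by rewrite divr_ge0 // mulr_ge0 ?addr_ge0 ?mulr_ge0 // ltW.
apply: le_trans (_ : (s + 1) * step n <= _); last first.
  by rewrite ler_wpM2l ?addr_ge0 //; exact: step_harmonic.
by move: (step n) t0 t1 => t t0 t1; nra.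
Qed.

Lemma small_cvg : (fun n => small s (c_of n) (alpha_of n)) @ \oo --> (0 : 'rV[R]_5).
Proof.
apply: (cvg0_harmonic (C := 2 * s + 1)) => n.
have t0 := step_gt0 n; have t1 := step_lt1 n; have st := s_step n.
have aE := alpha_le n; have a0 := alpha_gt0 n; have eE := energy_denominator n; have e0 := energy_denominator_gt0 n.
have C0 : 0 <= 2 * s + 1 by rewrite addr_ge0 ?mulr_ge0.
apply: le_trans (_ : (2 * s + 1) * step n <= _); last by rewrite ler_wpM2l //; exact: step_harmonic.
apply: mx_norm_le => [|i j]; first by rewrite mulr_ge0 // ltW.
move: C0 t0 t1 aE a0 eE e0; rewrite ord1 mxE /c_of; move: (step n) (alpha_of n) => t a C0 t0 t1 aE a0 eE e0.
have at2 : a <= t * t by apply: le_trans aE _; rewrite !exprS expr0; nra.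
have tt : t * t <= t by nra.
have aa : a ^+ 2 <= t * t by rewrite expr2; nra.
have h1 := mulr_ge0 s0 (ltW t0).
have K0 : 0 < t * (2 * s + t) by rewrite -eE.
case: j => -[|[|[|[|[|//]]]]] _ /=; rewrite ?eE ger0_norm.
- by nra.
- exact: sqr_ge0.
- rewrite ler_pdivrMr //; have := ler_wpM2r (sqr_ge0 s) aa.
  have := mulr_ge0 h1 h1; have := mulr_ge0 (mulr_ge0 h1 (ltW t0)) (ltW t0); rewrite !expr2; nra.
- exact: divr_ge0 (mulr_ge0 (sqr_ge0 a) (sqr_ge0 s)) (ltW K0).
- rewrite ler_pdivrMr //; have h2 : (s + t) * (a * s) <= (2 * s + t) * (t * t * s).
    apply: ler_pM; rewrite ?lerD2r; [|by rewrite mulr_ge0 // ltW| |exact: ler_wpM2r].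
      by rewrite addr_ge0 // ltW.
    by rewrite ler_peMl // ler1n.
  have h3 : 0 <= (2 * s + t) * (t * t) by rewrite mulr_ge0 // ?mulr_ge0 ?addr_ge0 ?mulr_ge0 // ltW.
  by move: h2 h3; lra.
- by rewrite divr_ge0 ?(ltW K0) // !mulr_ge0 ?addr_ge0 // ltW.
- apply: le_trans (_ : t * (s + t) <= _); last by nra.
  by rewrite ler_wpM2r ?addr_ge0 ?(ltW t0) //; lra.
- by rewrite mulr_ge0 ?addr_ge0 // ltW.
- by have := ler_wpM2r s0 aa; have := ler_wpM2r s0 tt; nra.
- by rewrite mulr_ge0 ?sqr_ge0.
Qed.

End Sequences.

Theorem theorem1p2 (R : realType) (gbar : 'rV[R]_3 -> 'M[R]_3) (o : bool)
    (gbar_metric : riemannian_metric gbar)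
    (gbar_curvature : constant_curvature 1 gbar)
    (s : R) (s_ge0 : 0 <= s) :
  exists (g : nat -> 'rV[R]_3 -> 'M[R]_3) (beta : nat -> 'rV[R]_3 -> 'rV[R]_3)
         (k : nat -> R) (alpha : nat -> R),
    [/\ forall n, riemannian_metric (g n),
        forall n, one_form (beta n) &
        forall n, 0 < k n] /\
    [/\ cvg_metric g gbar,
        cvg_one_form beta (fun=> 0) &
        k @ \oo --> (0 : R)] /\
    [/\ forall n, 0 < alpha n < 1,
        forall n, irrational (alpha n) &
        alpha @ \oo --> (0 : R)] /\
    forall n,
      let sigma := magnetic_form s (area_form gbar o) (beta n) in
      double_cover_is_ellipsoid (level (kinetic (g n)) (k n))
        (twisted_form sigma) (alpha n) /\
      ([set O | periodic_orbit (g n) sigma (k n) O] #= `I_2)%card.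
Proof.
have [Phi [Psi [[sPhi sPsi PhiK PsiK] Phi_iso Phi_hom Phi_metric Phi_area]]] := round_model gbar_metric gbar_curvature o.
exists (fun n => metric gbar Phi s (c_of s n) (alpha_of s n)), (fun n => form Phi s (c_of s n) (alpha_of s n)).
exists (fun n => energy s (c_of s n)), (alpha_of s).
have a0 n := alpha_gt0 s n.
have a1 n := alpha_lt1 s n.
have sc n := s_alpha_lt_c s_ge0 n.
split; [split|split; [split|split; [split|]]].
- by move=> n; apply: metric_riemannian.
- by move=> n; apply: form_one_form.
- by move=> n; rewrite divr_gt0 // energy_denominator_gt0.
- apply: metric_cvg => //; [exact: energy_denominator_gt0|exact: small_cvg].
- apply: form_cvg => //; exact: small_cvg.
- exact: energy_cvg.
- by move=> n; rewrite a0 a1.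
- exact: alpha_irrational.
- exact: alpha_cvg.
- move=> n; split.
    exact: (level_double_cover gbar_metric sPhi sPsi PhiK PsiK Phi_iso Phi_hom Phi_metric Phi_area
      s_ge0 (a0 n) (a1 n) (sc n)).
  have h := two_periodic_orbits gbar_metric sPhi sPsi PhiK PsiK Phi_iso Phi_hom Phi_metric Phi_area
    s_ge0 (a0 n) (a1 n) (sc n) (@alpha_irrational R s n).
  exact: h.
Qed.
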